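(* Assume the following. (Boundedness) There exist constants $C,C'>0$ such that for every $\theta\in\Theta$: the $\mathcal G_t^\theta$-intensity $\boldsymbol\lambda^\theta$ of $N^\theta$ is càglàd with $\sup_{0\le t\le 1}\boldsymbol\lambda_t^\theta\le C$ almost surely; the residual process $G^\theta$ is càglàd with $\sup_{0\le t\le 1}|G_t^\theta|\le C'$ almost surely; and the estimators satisfy the same bounds, $\sup_t|\hat\lambda_t^{(n),\theta}|\le C$ and $\sup_t|\hat G_t^{(n),\theta}|\le C'$ almost surely. (Rates) $|J_n|\to\infty$ as $n\to\infty$, and with $g^\theta(n)=\||G^\theta-\hat G^{(n),\theta}\||_2$ and $h^\theta(n)=\||\lambda^\theta-\hat\lambda^{(n),\theta}\||_2$, $$\lim_{n\to\infty}\sup_{\theta\in\Theta}\max\{g^\theta(n),\,h^\theta(n),\,\sqrt{|J_n|}\,g^\theta(n)h^\theta(n)\}=0 .$$ (Variance) There exists $\delta_1>0$ such that $\mathcal V^\theta(1)\ge\delta_1$ for all $\theta\in\Theta$. Then the Local Covariance Test statistic satisfies $\hat T_n^\theta\xrightarrow{\mathcal D/\Theta_0}S$ as $n\to\infty$. As a consequence, for every $\alpha\in(0,1)$, the Local Covariance Test $\Psi_n^{\alpha}$ has uniform asymptotic level $\alpha$: $$\limsup_{n\to\infty}\sup_{\theta\in\Theta_0}\mathbb P(\Psi_n^{\alpha,\theta}=1)\le\alpha .$$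
   Context: Setting. $\Theta$ is an arbitrary set indexing sampling distributions; every object below depends on $\theta\in\Theta$, with the superscript $\theta$ often suppressed. Time is $[0,1]$. $N$ is a counting process adapted to a right-continuous complete filtration $\mathcal F_t$; $X$ is a real-valued càglàd process; $\mathcal G_t$ is the right-continuous complete filtration generated by $\mathcal F_t$ and $X_t$. $N$ has an $\mathcal F_t$-intensity $\lambda$ (i.e. $\lambda$ is $\mathcal F_t$-predictable and $M_t=N_t-\int_0^t\lambda_s\,ds$ is a local $\mathcal F_t$-martingale) and a $\mathcal G_t$-intensity $\boldsymbol\lambda$. The hypothesis $H_0$ (conditional local independence of $N$ from $X$ given $\mathcal F_t$) is: $M$ is also a local $\mathcal G_t$-martingale. $\Theta_0=\{\theta\in\Theta: H_0\text{ is valid}\}$. A residual process $G$ of $X$ given $\mathcal F_t$ is a càglàd $\mathcal G_t$-adapted process with $E(G_t\mid\mathcal F_{t-})=0$ for all $t\in[0,1]$. A residual process $G$ is fixed for each $\theta$. The variance function is $\mathcal V(t)=E\int_0^tG_s^2\,dN_s$. Data and estimators. $(N_j,X_j,\mathcal F_j)$, $j=1,\dots,n$, are i.i.d. replications of $(N,X,\mathcal F)$. $J_n\cup J_n^c=\{1,\dots,n\}$ is a partition into two disjoint sets. The estimates $\hat\lambda^{(n)}$ and $\hat G^{(n)}$ are fitted on data indexed by $J_n^c$ only; given those data they are fixed maps, evaluated on the $\mathcal F$-history resp. $\mathcal G$-history of a new observation, yielding (conditionally on the training data) an $\mathcal F_t$-predictable process resp. a $\mathcal G_t$-predictable process. $\hat\lambda_j^{(n)},\hat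 G_j^{(n)}$ are their evaluations on observation $j\in J_n$; $\hat\lambda_t^{(n)},\hat G_t^{(n)}$ are their evaluations on one additional copy $(N,X,\mathcal F)$ independent of the data. With $\hat M_{j,t}^{(n)}=N_{j,t}-\int_0^t\hat\lambda_{j,s}^{(n)}ds$, set $$\hat\gamma_t^{(n)}=\frac1{|J_n|}\sum_{j\in J_n}\int_0^t\hat G_{j,s}^{(n)}\,d\hat M_{j,s}^{(n)},\qquad \hat{\mathcal V}_n(t)=\frac1{|J_n|}\sum_{j\in J_n}\int_0^t(\hat G_{j,s}^{(n)})^2\,dN_{j,s}.$$ For a process $W$ on $[0,1]$, $\||W\||_2^2=E\int_0^1W_s^2\,ds$. Test. $\hat T_n=\dfrac{\sqrt{|J_n|}}{\sqrt{\hat{\mathcal V}_n(1)}}\sup_{0\le t\le1}|\hat\gamma_t^{(n)}|$ (set to $0$ if $\hat{\mathcal V}_n(1)=0$). $S$ is a random variable distributed as $\sup_{0\le t\le1}|B_t|$ for a standard Brownian motion $B$; its distribution function is $F_S(x)=\frac4\pi\sum_{k=0}^\infty\frac{(-1)^k}{2k+1}\exp\left(-\frac{\pi^2(2k+1)^2}{8x^2}\right)$, $x>0$, and $z_{1-\alpha}$ is its $(1-\alpha)$-quantile. The test is $\Psi_n^\alpha=1$ if $\hat T_n>z_{1-\alpha}$ and $\Psi_n^\alpha=0$ otherwise. Uniform convergence. For real random variables, $Y_n^\theta\xrightarrow{\mathcal D/\Theta_0}Y$ means $\sup_{\theta\in\Theta_0}\sup_f|E f(Y_n^\theta)-E f(Y)|\to0$,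 the inner supremum over $f:\mathbb R\to\mathbb R$ with $\|f\|_\infty\le1$ and Lipschitz constant at most $1$. *)

(* Defs.v *)
From HB Require Import structures.
From mathcomp Require Import all_boot all_order all_algebra finmap.
From mathcomp Require Import all_classical all_reals all_analysis.

Set Implicit Arguments.
Unset Strict Implicit.
Unset Printing Implicit Defensive.

Import Order.TTheory GRing.Theory Num.Theory.
Import numFieldNormedType.Exports.

Local Open Scope classical_set_scope.
Local Open Scope ring_scope.

(* A process is a function [W : R -> Om -> T]; only its values at times in
   [0, 1] matter.  A filtration is a family [F : R -> set (set Om)] of
   sigma-algebras. *)

Definition measurable_wrt (Om : Type) (d' : measure_display)
    (T : measurableType d') (H : set (set Om)) (U : Om -> T) : Prop :=
  preimage_set_system setT U measurable `<=` H.

Definition adapted (R : realType) (Om : Type) (d' : measure_display)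
    (T : measurableType d') (F : R -> set (set Om)) (W : R -> Om -> T) : Prop :=
  forall t, 0 <= t <= 1 -> measurable_wrt (F t) (W t).

Definition usual_filtration (R : realType) (d : measure_display)
    (Om : measurableType d) (P : probability Om R) (F : R -> set (set Om)) :
    Prop :=
  [/\ forall t, 0 <= t <= 1 -> sigma_algebra setT (F t) /\ F t `<=` measurable,
      forall s t, 0 <= s -> s <= t -> t <= 1 -> F s `<=` F t,
      forall t, 0 <= t < 1 -> F t = \bigcap_(s in [set s | t < s <= 1]) F s
    & forall t, 0 <= t <= 1 -> forall A, P.-negligible A -> F t A].

(* At [t = 1] the intersection reduces to the single index [s = 1]. *)
Definition usual_augmentation (R : realType) (d : measure_display)
    (Om : measurableType d) (P : probability Om R) (H : R -> set (set Om))
    (t : R) : set (set Om) :=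
  \bigcap_(s in [set s | t < s <= 1 \/ s = 1])
    <<s H s `|` [set A | P.-negligible A] >>.

Definition enlarged_filtration (R : realType) (d : measure_display)
    (Om : measurableType d) (P : probability Om R) (F : R -> set (set Om))
    (X : R -> Om -> R) : R -> set (set Om) :=
  usual_augmentation P (fun t => F t `|`
    \bigcup_(u in [set u | 0 <= u <= t]) preimage_set_system setT (X u) measurable).

(* Convention at the origin: [F_{0-} = F_0]. *)
Definition left_filtration (R : realType) (Om : Type) (F : R -> set (set Om))
    (t : R) : set (set Om) :=
  if t == 0 then F 0 else <<s \bigcup_(s in [set s | 0 <= s < t]) F s >>.

Definition predictable_rectangles (R : realType) (Om : Type)
    (F : R -> set (set Om)) : set (set (R * Om)) :=
  [set E | (exists2 A, F 0 A & E = [set 0] `*` A) \/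
           (exists s t A, [/\ 0 <= s, s < t, t <= 1, F s A &
                              E = `]s, t]%classic `*` A])].

Definition predictable (R : realType) (Om : Type) (F : R -> set (set Om))
    (W : R -> Om -> R) : Prop :=
  let D := [set p : R * Om | 0 <= p.1 <= 1] in
  preimage_set_system D (fun p => W p.1 p.2) measurable
    `<=` <<s D, predictable_rectangles F >>.

Definition caglad_path (R : realType) (f : R -> R) : Prop :=
  (forall t, 0 < t <= 1 -> f s @[s --> t^'-] --> f t) /\
  (forall t, 0 <= t < 1 -> cvg (f s @[s --> t^'+])).

Definition caglad (R : realType) (Om : Type) (W : R -> Om -> R) : Prop :=
  forall w, caglad_path (W ^~ w).

(* [V] is a version of E(U | H). *)
Definition is_cond_exp (R : realType) (d : measure_display)
    (Om : measurableType d) (P : probability Om R) (H : set (set Om))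
    (U V : Om -> R) : Prop :=
  [/\ P.-integrable setT (EFin \o U), P.-integrable setT (EFin \o V),
      measurable_wrt H V &
      forall A, H A -> \int[P]_(w in A) U w = \int[P]_(w in A) V w].

Definition martingale (R : realType) (d : measure_display)
    (Om : measurableType d) (P : probability Om R) (F : R -> set (set Om))
    (M : R -> Om -> R) : Prop :=
  forall s t, 0 <= s -> s <= t -> t <= 1 -> is_cond_exp P (F s) (M t) (M s).

Definition stopping_time (R : realType) (Om : Type) (F : R -> set (set Om))
    (tau : Om -> R) : Prop :=
  (forall w, 0 <= tau w <= 1) /\
  (forall t, 0 <= t <= 1 -> F t [set w | tau w <= t]).

(* The horizon being the closed interval [0, 1], a localizing sequence has to
   reach 1; a stopping time with value 1 does not stop the process.  The
   definition is only used for processes started at 0. *)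
Definition local_martingale (R : realType) (d : measure_display)
    (Om : measurableType d) (P : probability Om R) (F : R -> set (set Om))
    (M : R -> Om -> R) : Prop :=
  exists tau : nat -> Om -> R,
    [/\ forall k, stopping_time F (tau k),
        forall k w, tau k w <= tau k.+1 w,
        \forall w \ae P, exists k, tau k w = 1 &
        forall k, martingale P F (fun t w => M (Num.min t (tau k w)) w)].

Definition jump_time (R : realType) (N : R -> nat) (s : R) : Prop :=
  ~ (\forall u \near s^'-, N u = N s).

Definition counting_path (R : realType) (N : R -> nat) : Prop :=
  [/\ N 0 = 0%N,
      forall s t, 0 <= s -> s <= t -> t <= 1 -> (N s <= N t)%N,
      forall t, 0 <= t < 1 -> \forall u \near t^'+, N u = N t
    & forall t, 0 < t <= 1 -> \forall u \near t^'-, (N t <= (N u).+1)%N].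

Definition counting_process (R : realType) (Om : Type)
    (F : R -> set (set Om)) (N : R -> Om -> nat) : Prop :=
  adapted F N /\ forall w, counting_path (N ^~ w).

(* The integral of [g] over ]0, t] with respect to the counting path [N]: the
   (finite) sum of [g] over the jump times of [N], all jumps having size 1. *)
Definition int_dN (R : realType) (g : R -> R) (N : R -> nat) (t : R) : R :=
  \sum_(s \in [set s | 0 < s <= t /\ jump_time N s]) g s.

(* The integral over ]0, t] of [g] with respect to N_s - int_0^s l_u du. *)
Definition int_dM (R : realType) (g : R -> R) (N : R -> nat) (l : R -> R)
    (t : R) : R :=
  int_dN g N t - \int[lebesgue_measure]_(s in `[0, t]) (g s * l s).

Definition compensated (R : realType) (Om : Type) (N : R -> Om -> nat)
    (l : R -> Om -> R) (t : R) (w : Om) : R :=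
  (N t w)%:R - \int[lebesgue_measure]_(s in `[0, t]) l s w.

Definition is_intensity (R : realType) (d : measure_display)
    (Om : measurableType d) (P : probability Om R) (F : R -> set (set Om))
    (N : R -> Om -> nat) (l : R -> Om -> R) : Prop :=
  [/\ predictable F l,
      \forall w \ae P,
        lebesgue_measure.-integrable `[0, 1] (fun s => (l s w)%:E)
    & local_martingale P F (compensated N l)].

Definition residual_process (R : realType) (d : measure_display)
    (Om : measurableType d) (P : probability Om R)
    (F : R -> set (set Om)) (X : R -> Om -> R) (G : R -> Om -> R) : Prop :=
  [/\ caglad G, adapted (enlarged_filtration P F X) G &
      forall t, 0 <= t <= 1 ->
        is_cond_exp P (left_filtration F t) (G t) (cst 0)].

Definition variance_function (R : realType) (d : measure_display)
    (Om : measurableType d) (P : probability Om R) (N : R -> Om -> nat)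
    (G : R -> Om -> R) (t : R) : \bar R :=
  (\int[P]_w (int_dN (fun s => G s w ^+ 2)%R (N ^~ w) t)%:E)%E.

(* |||W|||_2, with value +oo allowed. *)
Definition norm2 (R : realType) (d : measure_display)
    (Om : measurableType d) (P : probability Om R) (W : R -> Om -> R) :
    \bar R :=
  sqrte (\int[P]_w
    (\int[lebesgue_measure]_(s in `[0%R, 1%R]) (W s w ^+ 2)%:E)%E)%E.

Definition mutually_independent (R : realType) (d : measure_display)
    (Om : measurableType d) (P : probability Om R) (I : choiceType)
    (d' : measure_display) (T : measurableType d') (U : I -> Om -> T) : Prop :=
  forall (K : {fset I}) (A : I -> set T), (forall i, measurable (A i)) ->
    P (\bigcap_(i in [set` K]) U i @^-1` A i) =
    (\prod_(i <- K) P (U i @^-1` A i))%E.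

(* I.i.d. replications of the filtered experiment (Om, F, P) carrying (N, X):
   [Z j : Sm -> Om] selects the outcome of replication [j], so that
   (N_j, X_j, F_j) = (N o Z j, X o Z j, (Z j)^-1 F).  Replication 0 is the
   additional copy, replications 1, ..., n are the data.  As the replicated
   filtrations are complete, so is the sample space. *)
Definition iid_replications (R : realType) (d d' : measure_display)
    (Om : measurableType d) (P : probability Om R)
    (Sm : measurableType d') (Q : probability Sm R) (Z : nat -> Sm -> Om) :
    Prop :=
  [/\ measure_is_complete Q,
      forall j, measurable_fun setT (Z j),
      forall j (A : set Om), measurable A -> Q (Z j @^-1` A) = P A
    & mutually_independent Q Z].

(* Index [j : 'I_n] stands for observation [j + 1]. *)
Definition sample (Om Sm : Type) (n : nat) (Z : nat -> Sm -> Om) (w : Sm) :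
    n.-tuple Om :=
  [tuple Z j.+1 w | j < n].

(* [e x t w]: the estimate fitted on the sample [x], of which it only uses the
   observations outside [J], evaluated at time [t] on a new observation [w];
   [H] is the filtration with respect to which it is predictable. *)
Definition sample_split_estimator (R : realType) (d : measure_display)
    (Om : measurableType d) (H : R -> set (set Om)) (n : nat) (J : {set 'I_n})
    (e : n.-tuple Om -> R -> Om -> R) : Prop :=
  [/\ measurable_fun [set p : n.-tuple Om * R * Om | 0 <= p.1.2 <= 1]
        (fun p => e p.1.1 p.1.2 p.2),
      forall x y : n.-tuple Om,
        (forall j, j \notin J -> tnth x j = tnth y j) -> e x = e y
    & forall x, predictable H (e x)].

Definition gamma_hat (R : realType) (n : nat) (J : {set 'I_n})
    (N : 'I_n -> R -> nat) (g l : 'I_n -> R -> R) (t : R) : R :=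
  #|J|%:R^-1 * \sum_(j in J) int_dM (g j) (N j) (l j) t.

Definition variance_hat (R : realType) (n : nat) (J : {set 'I_n})
    (N : 'I_n -> R -> nat) (g : 'I_n -> R -> R) (t : R) : R :=
  #|J|%:R^-1 * \sum_(j in J) int_dN (fun s => g j s ^+ 2) (N j) t.

Definition sup_abs (R : realType) (f : R -> R) : R :=
  sup [set `|f t| | t in `[0, 1]].

Definition lct_statistic (R : realType) (n : nat) (J : {set 'I_n})
    (N : 'I_n -> R -> nat) (g l : 'I_n -> R -> R) : R :=
  if variance_hat J N g 1 == 0 then 0
  else Num.sqrt #|J|%:R / Num.sqrt (variance_hat J N g 1) *
       sup_abs (gamma_hat J N g l).

Definition T_hat (R : realType) (Om Sm : Type) (N : R -> Om -> nat)
    (Z : nat -> Sm -> Om) (n : nat) (J : {set 'I_n})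
    (lamhat Ghat : n.-tuple Om -> R -> Om -> R) (w : Sm) : R :=
  lct_statistic J (fun j t => N t (Z j.+1 w))
    (fun j t => Ghat (sample n Z w) t (Z j.+1 w))
    (fun j t => lamhat (sample n Z w) t (Z j.+1 w)).

Definition lct (R : realType) (z T : R) : nat := if z < T then 1%N else 0%N.

Definition brownian_motion (R : realType) (d : measure_display)
    (Om : measurableType d) (P : probability Om R) (B : R -> Om -> R) : Prop :=
  [/\ forall t, 0 <= t <= 1 -> measurable_fun setT (B t),
      forall w, B 0 w = 0,
      forall w, {within `[0, 1], continuous (B ^~ w)},
      forall s t, 0 <= s -> s < t -> t <= 1 -> forall A : set R, measurable A ->
        P ((fun w => B t w - B s w) @^-1` A) =
        normal_prob 0 (Num.sqrt (t - s)) A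
    & forall t : nat -> R,
        (forall i, 0 <= t i <= 1) -> (forall i, t i <= t i.+1) ->
        mutually_independent P (fun i w => B (t i.+1) w - B (t i) w)].

Definition same_law (R : realType) (d d' : measure_display)
    (Om : measurableType d) (P : probability Om R)
    (Om' : measurableType d') (P' : probability Om' R)
    (U : Om -> R) (U' : Om' -> R) : Prop :=
  forall A : set R, measurable A -> P (U @^-1` A) = P' (U' @^-1` A).

Definition quantile (R : realType) (d : measure_display)
    (Om : measurableType d) (P : probability Om R) (S : {RV P >-> R}) (p : R) :
    R :=
  inf [set x | (p%:E <= cdf S x)%E].

Definition bounded_lipschitz1 (R : realType) : set (R -> R) :=
  [set f | (forall x, `|f x| <= 1) /\ (forall x y, `|f x - f y| <= `|x - y|)].

(* Both suprema are over sets of reals bounded by 2; the real supremum of the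
   empty set, which occurs when [Theta0] is empty, is 0. *)
Definition cvg_dist_unif (R : realType) (Theta : Type) (Theta0 : set Theta)
    (d d' : measure_display) (Sm : Theta -> measurableType d)
    (Q : forall th, probability (Sm th) R) (Y : forall th, nat -> Sm th -> R)
    (OS : measurableType d') (PS : probability OS R) (S : OS -> R) : Prop :=
  (fun n => sup [set sup [set `|\int[Q th]_w f (Y th n w) - \int[PS]_w f (S w)|
                         | f in @bounded_lipschitz1 R]
                | th in Theta0]) @ \oo --> (0 : R).

(* Main.v *)
Require Import Defs.
From HB Require Import structures.
From mathcomp Require Import all_boot all_order all_algebra finmap.
From mathcomp Require Import all_classical all_reals all_analysis.
From mathcomp Require Import measurable_realfun ring lra.

Set Implicit Arguments.
Unset Strict Implicit.
Unset Printing Implicit Defensive.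

Import Order.TTheory GRing.Theory Num.Theory.
Import numFieldNormedType.Exports.

Local Open Scope classical_set_scope.
Local Open Scope ring_scope.

(* Condition on the training sample, so that the estimates become fixed: [H] is
   predictable for the large filtration and bounded by [C'], [l] is predictable
   for the small one.  On [Theta0] the process [lam] is also the intensity for
   the large filtration, hence [int H dM] is a martingale with variance
   [V = E int H^2 lam], and with [m] evaluation observations the statistic is
   governed by
     m^(-1/2) sum_j int H_j dM_j + m^(-1/2) sum_j int H_j (lam_j - l_j) ds.
   The first sum is compared with Brownian motion on a grid of [m^3] points, by
   Lindeberg replacement in a smoothed indicator of [max_k |a_k| <= x]; between
   grid points it hardly moves, since with high probability no cell contains two
   jumps of the pooled sample.  In the second sum write [H = G + (H - G)].  As
   [E(G_s | F_{s-}) = 0] and [lam - l] is predictable for the small filtration,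
   the [G] part is at each time [s] a sum of centred i.i.d. variables, of size
   [C' |||lam - l|||]; the rest is at most [m^(1/2) |||G - H||| |||lam - l|||].
   The variance estimate is handled by Chebyshev's inequality, and the training
   samples for which these errors are not small by Markov's inequality.  The level
   follows because [sup |B|] has no atoms. *)

(** * Real-valued integrals *)

(** The martingale hypotheses enter once. They are turned into an equality of measures on the
    predictable sigma-algebra, [E int h dN = E int h L ds] for nonnegative predictable [h], checked
    on rectangles. Moments of [N], orthogonality and the isometry are computed from this identity.
    It also replaces [lam], on which no bound is assumed, by a version [L] with values in [[0, C]].

    The obstacle is uniformity in [th]: no error bound may come from a limit under a fixed law, so
    each one is explicit in [C], [C'] and a lower bound of the variance, and thresholds are chosen
    before the probability spaces. Hence a replacement argument with constants; Brownian motion read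
    at the clock [V(t) / V(1)], which makes the covariances on the grid agree exactly; and an
    approximation of [sup |B|] valid for all grids of small mesh at once.

    The bounds on the estimates are almost sure and concern the additional copy. The estimates are
    therefore clipped, and the clipped statistic is shown to equal the given one almost surely. *)

Section real_integral.
Context d (T : measurableType d) (R : realType).
Variable m : {measure set T -> \bar R}.
Implicit Types f g : T -> R.

Definition Rintegrable f := m.-integrable setT (EFin \o f).

Lemma RintegrableM f : Rintegrable f -> measurable_fun setT f.
Proof. by move=> /measurable_int /measurable_EFinP. Qed.

Lemma RintegrableD f g : Rintegrable f -> Rintegrable g ->
  Rintegrable (fun x => f x + g x).
Proof.
by move=> If Ig; have := integrableD measurableT If Ig; apply: eq_integrable.
Qed.

Lemma RintegrableZ (k : R) f : Rintegrable f -> Rintegrable (fun x => k * f x).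
Proof.
by move=> If; have := integrableZl measurableT k If; apply: eq_integrable.
Qed.

Lemma RintegrableN f : Rintegrable f -> Rintegrable (fun x => - f x).
Proof.
by move=> If; have := integrableN If; apply: eq_integrable.
Qed.

Lemma RintegrableB f g : Rintegrable f -> Rintegrable g ->
  Rintegrable (fun x => f x - g x).
Proof. by move=> If Ig; apply: RintegrableD => //; exact: RintegrableN. Qed.

Lemma Rintegrable0 : Rintegrable (fun=> 0).
Proof. exact: integrable0. Qed.

Lemma Rintegrable_sum (I : Type) (s : seq I) (p : pred I) (f : I -> T -> R) :
  (forall i, p i -> Rintegrable (f i)) ->
  Rintegrable (fun x => \sum_(i <- s | p i) f i x).
Proof.
move=> h; elim: s => [|i s ih].
  by under [X in Rintegrable X]eq_fun do rewrite big_nil; exact: Rintegrable0.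
under [X in Rintegrable X]eq_fun do rewrite big_cons.
have [pi|npi] := boolP (p i); last exact: ih.
by apply: RintegrableD => //; exact: h.
Qed.

Lemma Rintegrable_le f g : measurable_fun setT f -> (forall x, `|f x| <= g x) ->
  Rintegrable g -> Rintegrable f.
Proof.
move=> mf fg; apply: le_integrable => //; first exact/measurable_EFinP.
by move=> x _ /=; rewrite lee_fin (le_trans (fg x))// ler_norm.
Qed.

Lemma Rintegrable_abs f : Rintegrable f -> Rintegrable (fun x => `|f x|).
Proof.
move=> If; have mf := RintegrableM If; have := If.
apply: le_integrable => //.
  by apply/measurable_EFinP; exact: measurableT_comp.
by move=> x _ /=; rewrite normr_id.
Qed.

Lemma RintD f g : Rintegrable f -> Rintegrable g ->
  \int[m]_x (f x + g x) = \int[m]_x f x + \int[m]_x g x.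
Proof. by move=> *; rewrite RintegralD. Qed.

Lemma RintB f g : Rintegrable f -> Rintegrable g ->
  \int[m]_x (f x - g x) = \int[m]_x f x - \int[m]_x g x.
Proof. by move=> *; rewrite RintegralB. Qed.

Lemma RintZ (k : R) f : Rintegrable f ->
  \int[m]_x (k * f x) = k * \int[m]_x f x.
Proof. by move=> *; rewrite RintegralZl. Qed.

Lemma Rint0 : \int[m]_x (fun=> 0 : R) x = 0.
Proof. by rewrite /Rintegral integral0. Qed.

Lemma Rint_sum (I : Type) (s : seq I) (p : pred I) (f : I -> T -> R) :
  (forall i, p i -> Rintegrable (f i)) ->
  \int[m]_x (\sum_(i <- s | p i) f i x) = \sum_(i <- s | p i) \int[m]_x f i x.
Proof.
move=> h; elim: s => [|i s ih].
  rewrite big_nil -[RHS]Rint0; apply: eq_Rintegral => x _.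
  by rewrite big_nil.
rewrite big_cons -ih.
have [pi|npi] := boolP (p i).
  rewrite -RintD//; [|exact: h|exact: Rintegrable_sum].
  by apply: eq_Rintegral => x _; rewrite big_cons pi.
by apply: eq_Rintegral => x _; rewrite big_cons (negbTE npi).
Qed.

Lemma Rint_le f g : Rintegrable f -> Rintegrable g -> (forall x, f x <= g x) ->
  \int[m]_x f x <= \int[m]_x g x.
Proof. by move=> If Ig fg; apply: le_Rintegral. Qed.

Lemma Rint_abs f : Rintegrable f -> `|\int[m]_x f x| <= \int[m]_x `|f x|.
Proof. by move=> If; exact: le_normr_Rintegral. Qed.

Lemma Rint_ge0 f : (forall x, 0 <= f x) -> 0 <= \int[m]_x f x.
Proof. by move=> f0; apply: Rintegral_ge0. Qed.

Lemma RintE f : Rintegrable f -> (\int[m]_x f x)%:E = (\int[m]_x (f x)%:E)%E.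
Proof. by move=> If; rewrite /Rintegral fineK//; exact: integrable_fin_num. Qed.

Lemma Rintegrable_ge0 f : measurable_fun setT f -> (forall x, 0 <= f x) ->
  (\int[m]_x (f x)%:E < +oo)%E -> Rintegrable f.
Proof.
move=> mf f0 oo; apply/integrableP; split; first exact/measurable_EFinP.
by under eq_integral => x _ do rewrite /= (ger0_norm (f0 x)).
Qed.

Lemma Rint_ae f g : measurable_fun setT f -> measurable_fun setT g ->
  {ae m, forall x, f x = g x} -> \int[m]_x f x = \int[m]_x g x.
Proof.
move=> mf mg fg; rewrite /Rintegral; congr fine.
apply: ae_eq_integral => //; try exact/measurable_EFinP.
by apply: filterS fg => x /= ->.
Qed.

Lemma Rintegrable_ae f g : measurable_fun setT g ->
  {ae m, forall x, f x = g x} -> Rintegrable f -> Rintegrable g.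
Proof.
move=> mg fg If; apply/integrableP; split; first exact/measurable_EFinP.
have/integrableP[mf] := If; apply: le_lt_trans; rewrite le_eqVlt.
apply/orP; left; apply/eqP/ge0_ae_eq_integral => //.
- by do 2 apply: measurableT_comp => //.
- by do 1 apply: measurableT_comp => //.
- by apply: filterS fg => x /= ->.
Qed.

Lemma Rintegrable_indicM (A : set T) f : measurable A -> Rintegrable f ->
  Rintegrable (fun x => \1_A x * f x).
Proof.
move=> mA If; have mf := RintegrableM If.
apply: Rintegrable_le (Rintegrable_abs If).
  by apply: measurable_funM => //; exact: measurable_indic.
by move=> x; rewrite indicE normrM; case: (x \in A) => /=;
  rewrite ?normr1 ?mul1r ?normr0 ?mul0r.
Qed.

Lemma Rintegral_indic (A : set T) f :
  \int[m]_(x in A) f x = \int[m]_x (\1_A x * f x).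
Proof.
rewrite Rintegral_mkcond; apply: eq_Rintegral => x _.
by rewrite patch_indic/= mulrC.
Qed.

(* From [0 <= \int (f - t g)^2] at the optimal [t]. *)
Lemma Rint_CauchySchwarz f g : measurable_fun setT f -> measurable_fun setT g ->
  Rintegrable (fun x => f x ^+ 2) -> Rintegrable (fun x => g x ^+ 2) ->
  Rintegrable (fun x => f x * g x) /\
  (\int[m]_x (f x * g x)) ^+ 2 <=
    \int[m]_x (f x ^+ 2) * \int[m]_x (g x ^+ 2).
Proof.
move=> mf mg If Ig.
have Ifg : Rintegrable (fun x => f x * g x).
  apply: Rintegrable_le (RintegrableD If Ig); first exact: measurable_funM.
  move=> x; rewrite ler_norml; apply/andP; split; nra.
split => //.
set a := \int[m]_x _; set b := \int[m]_x _; set c := \int[m]_x (g x ^+ 2).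
have b0 : 0 <= b by apply: Rint_ge0 => x; exact: sqr_ge0.
have c0 : 0 <= c by apply: Rint_ge0 => x; exact: sqr_ge0.
have key t : 0 <= b - 2 * t * a + t ^+ 2 * c.
  rewrite (_ : _ + _ = \int[m]_x ((f x - t * g x) ^+ 2)); last first.
    rewrite /a /b /c -RintZ// -RintB//; last exact: RintegrableZ.
    rewrite -RintZ// -RintD//; last exact: RintegrableZ.
      by apply: eq_Rintegral => x _; ring.
    by apply: RintegrableB => //; exact: RintegrableZ.
  by apply: Rint_ge0 => x; exact: sqr_ge0.
have [c00|cn0] := eqVneq c 0.
  have h t : 0 <= b - 2 * t * a by have := key t; rewrite c00; lra.
  have [->|an0] := eqVneq a 0; first by rewrite expr0n/= mulr_ge0.
  (* For [c = 0] the quadratic in [t] is affine, and at [t = (b + 1) / a] it equals [- b - 2], which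
     is negative. *)
  have := h ((b + 1) / a); rewrite -mulrA mulfVK//; nra.
have := key (a / c).
have -> : b - 2 * (a / c) * a + (a / c) ^+ 2 * c = b - a ^+ 2 / c by field.
by rewrite subr_ge0 ler_pdivrMr// lt0r cn0.
Qed.

End real_integral.
Arguments Rintegrable {d T R}.

Section probability_integral.
Context d (T : measurableType d) (R : realType) (P : probability T R).
Implicit Types f g : T -> R.

Lemma Rint_cst (k : R) : \int[P]_x (fun=> k) x = k.
Proof. rewrite Rintegral_cst//=; have -> : P setT = 1%E by exact: probability_setT.
by rewrite mulr1. Qed.

Lemma Rintegrable_bounded f (M : R) : measurable_fun setT f ->
  (forall x, `|f x| <= M) -> Rintegrable P f.
Proof.
move=> mf fM; apply: (@Rintegrable_le _ _ _ _ _ (fun=> M)) => //.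
by apply: finite_measure_integrable_cst.
Qed.

Lemma Rintegrable_cst k : Rintegrable P (fun=> k).
Proof. exact: finite_measure_integrable_cst. Qed.

Lemma Rint_le_cst f (M : R) : Rintegrable P f -> (forall x, f x <= M) ->
  \int[P]_x f x <= M.
Proof.
by move=> If fM; rewrite -[leRHS]Rint_cst; apply: Rint_le => //;
  exact: Rintegrable_cst.
Qed.

Lemma Rint_indic (A : set T) : measurable A -> \int[P]_x \1_A x = fine (P A).
Proof. by move=> mA; rewrite /Rintegral integral_indic// setIT. Qed.

Lemma Rintegrable_indic (A : set T) : measurable A -> Rintegrable P \1_A.
Proof.
by move=> mA; apply: (@Rintegrable_bounded _ 1) => // x; rewrite ger0_norm// indicE lern1 leq_b1.
Qed.

(** Cauchy-Schwarz for [|f|] against the constant 1. *)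
Lemma Rint_sqr f : measurable_fun setT f -> Rintegrable P (fun x => f x ^+ 2) ->
  Rintegrable P f /\ (\int[P]_x `|f x|) ^+ 2 <= \int[P]_x (f x ^+ 2).
Proof.
move=> mf If.
have mn : measurable_fun setT (fun x => `|f x|) by exact: measurableT_comp.
have [] := @Rint_CauchySchwarz _ _ _ P (fun x => `|f x|) (fun=> 1) mn.
- exact: measurable_cst.
- by under [X in Rintegrable _ X]eq_fun do rewrite real_normK ?num_real//.
- exact: Rintegrable_cst.
under [X in Rintegrable _ X]eq_fun do rewrite mulr1.
move=> I1 h; split.
  by apply: Rintegrable_le I1 => // x.
move: h; under eq_Rintegral do rewrite mulr1.
under [X in _ <= X * _]eq_Rintegral do rewrite real_normK ?num_real//.
by rewrite expr1n Rint_cst mulr1.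
Qed.

End probability_integral.

(** * Jump times of counting paths *)

Lemma near_right_ex (R : realType) (t : R) (p : set R) :
  (\forall u \near t^'+, p u) ->
  exists2 e, 0 < e & forall u, t < u -> u < t + e -> p u.
Proof.
move=> /nbhs_ballP[e /= e0 h]; exists e => // u tu ut.
by apply: h => //; rewrite /ball/= ltr_norml; apply/andP; split; lra.
Qed.

Lemma near_left_ex (R : realType) (t : R) (p : set R) :
  (\forall u \near t^'-, p u) ->
  exists2 e, 0 < e & forall u, u < t -> t - e < u -> p u.
Proof.
move=> /nbhs_ballP[e /= e0 h]; exists e => // u tu ut.
by apply: h => //; rewrite /ball/= ltr_norml; apply/andP; split; lra.
Qed.

Lemma near_leftP (R : realType) (t e : R) (p : set R) : 0 < e ->
  (forall u, u < t -> t - e < u -> p u) -> \forall u \near t^'-, p u.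
Proof.
move=> e0 h; apply/nbhs_ballP; exists e => //= u.
by rewrite /ball/= ltr_norml => /andP[? ?] ?; apply: h => //; lra.
Qed.

Lemma measurable_fun_of_le d (T : measurableType d) (R : realType) (f : T -> R) :
  (forall r, measurable [set x | f x <= r]) -> measurable_fun setT f.
Proof.
move=> h; apply: (measurability _ (RGenOInfty.measurableE R)).
move=> _ [_ [r ->] <-]; rewrite setTI.
rewrite (_ : _ @^-1` _ = ~` [set x | f x <= r]); first exact: measurableC.
by apply/seteqP; split=> x /=; rewrite in_itv/= andbT ltNge => /negP.
Qed.

Section arrival_times.
Context (R : realType).
Implicit Types (f : R -> nat) (s t : R) (i : nat).

(* The value is 2 when there are fewer than [i] jumps. *)
Definition arrival f i : R :=
  inf ([set t | 0 <= t <= 1 /\ (i <= f t)%N] `|` [set 2]).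

Let arrival_has_inf f i :
  has_inf ([set t : R | 0 <= t <= 1 /\ (i <= f t)%N] `|` [set 2]).
Proof.
split; first by exists 2; right.
by exists 0 => x [[/andP[]]|->].
Qed.

Lemma arrival_ge0 f i : 0 <= arrival f i.
Proof.
apply: lb_le_inf; first by exists 2; right.
by move=> x [[/andP[]]|->].
Qed.

(** The infimum is attained because a counting path is locally constant on the right; monotonicity
    then carries its value to any later [t]. *)
Lemma arrival_le f i t : counting_path f -> 0 <= t <= 1 ->
  (arrival f i <= t) = (i <= f t)%N.
Proof.
move=> [f0 ndf rcf ucf] t01; have hi := arrival_has_inf f i.
apply/idP/idP => [at1|ift]; last first.
  by apply: ge_inf; [case: hi|left].
have a0 := arrival_ge0 f i.
suff ifa : (i <= f (arrival f i))%N.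
  by rewrite (leq_trans ifa)// ndf//; case/andP: t01.
have a1 : arrival f i <= 1 by case/andP: t01 => _; exact: le_trans.
set a := arrival f i in a0 a1 *.
(* Right-continuity is given only before time 1. At 1, a point of the set below [a + 1 = 2] is not
   the default value 2, so it is a time of [[0, 1]], and monotonicity carries its value to 1. *)
have [a11|an1] := eqVneq a 1.
  have [x] := inf_adherent (ltr01 : 0 < 1 :> R) hi.
  rewrite -/(arrival f i) -/a a11 => -[[/andP[x0 x1] ix] _|->]; last lra.
  by rewrite (leq_trans ix)// ndf.
have {an1}a1' : a < 1 by rewrite lt_neqAle an1.
have [e e0 ha] := near_right_ex (rcf a (introT andP (conj a0 a1'))).
have m0 : 0 < Num.min e (1 - a) by rewrite lt_min e0 subr_gt0.
have [x xA] := inf_adherent m0 hi; rewrite -/(arrival f i) -/a => xa.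
have xe : x < a + e by rewrite (lt_le_trans xa)// lerD2l ge_min lexx.
have x1 : x < 1 by rewrite (lt_le_trans xa)// -lerBrDl ge_min lexx orbT.
have ax : a <= x by apply: ge_inf => //; case: hi.
case: xA => [[_ ix]|x2]; last by move: x1; rewrite x2; lra.
move: ax; rewrite le_eqVlt => /orP[/eqP ->//|ax].
by rewrite -(ha x).
Qed.

(** Before its [i]-th arrival the path is below [i]; since jumps have size at most 1 it is exactly
    [i] there, and the drop on the left makes the arrival a jump time. *)
Lemma arrivalP f i : counting_path f -> (0 < i)%N -> (i <= f 1%R)%N ->
  [/\ 0 < arrival f i, arrival f i <= 1, f (arrival f i) = i
    & jump_time f (arrival f i)].
Proof.
move=> cf i0 if1; have [f0 ndf rcf ucf] := cf.
have a1 : arrival f i <= 1 by rewrite arrival_le// lexx ler01.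
have a0 : 0 < arrival f i.
  rewrite lt_neqAle arrival_ge0 andbT; apply/negP => /eqP a0.
  have : arrival f i <= 0 by rewrite -a0.
  by rewrite arrival_le ?lexx ?ler01// f0 leqNgt i0.
have lta u : 0 <= u -> u < arrival f i -> (f u < i)%N.
  move=> u0 ua; rewrite ltnNge -arrival_le ?u0 ?(le_trans (ltW ua))//.
  by rewrite -ltNge.
have [e e0 h] := near_left_ex (ucf (arrival f i) (introT andP (conj a0 a1))).
set a := arrival f i in a1 a0 lta h *.
pose u := Num.max 0 (a - e / 2).
have ua : u < a by rewrite gt_max a0/=; lra.
have u0 : 0 <= u by rewrite le_max lexx.
have fai : f a = i.
  apply/eqP; rewrite eqn_leq; apply/andP; split.
    apply: leq_trans (lta _ u0 ua); apply: (h u) => //.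
    by rewrite lt_max; apply/orP; right; lra.
  by rewrite -arrival_le// (ltW a0).
split => // /near_left_ex[e' e'0 h'].
pose v := Num.max 0 (a - e' / 2).
have va : v < a by rewrite gt_max a0/=; lra.
have v0 : 0 <= v by rewrite le_max lexx.
have := lta _ v0 va; rewrite (h' v)//; first by rewrite fai ltnn.
by rewrite lt_max; apply/orP; right; lra.
Qed.

(** Were the value [f s] already reached at some [a < s], monotonicity would freeze the path on
    [[a, s]] and [s] would not be a jump time. *)
Lemma jump_arrival f s : counting_path f -> 0 < s <= 1 -> jump_time f s ->
  (0 < f s)%N /\ s = arrival f (f s).
Proof.
move=> cf /andP[s0 s1] js; have [f0 ndf rcf ucf] := cf.
have as_ : arrival f (f s) <= s by rewrite arrival_le ?s1 ?ltW.
have h (a : R) : 0 <= a -> a < s -> (f s <= f a)%N -> False.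
  move=> a0 as1 fas; apply: js; apply: (@near_leftP _ _ (s - a)) => [|u us au].
    by rewrite subr_gt0.
  have au' : a < u by lra.
  apply/eqP.
  rewrite eqn_leq (ndf _ _ (le_trans a0 (ltW au')) (ltW us) s1)/=.
  by rewrite (leq_trans fas)// (ndf _ _ a0 (ltW au') (le_trans (ltW us) s1)).
split.
  by rewrite lt0n; apply/negP => /eqP fs0; apply: (h 0) => //; rewrite fs0.
apply/eqP; rewrite eq_le as_ andbT leNgt; apply/negP => as2.
apply: (h (arrival f (f s)) (arrival_ge0 _ _) as2).
by rewrite -arrival_le ?lexx ?arrival_ge0// (le_trans as_).
Qed.

(** Replaces a sum over a path-dependent set of times by one over indices. Distinct indices have
    distinct arrival times because the path takes the value [i] at the [i]-th one. All later
    computations with [dN] use this form. *)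
Lemma int_dNE f (g : R -> R) t : counting_path f -> 0 <= t <= 1 ->
  int_dN g f t = \sum_(i < f t) g (arrival f i.+1).
Proof.
move=> cf t01; have /andP[t0 t1] := t01; have [f0 ndf rcf ucf] := cf.
have le1 i : (i < f t)%N -> (i.+1 <= f 1%R)%N.
  by move=> /leq_trans; apply; rewrite ndf.
rewrite /int_dN.
rewrite (_ : mkset _ = [set arrival f i.+1 | i in `I_(f t)]); last first.
  apply/seteqP; split => [s /= [/andP[s0 st] js]|_ [i /= it] <-].
    have s01 : 0 < s <= 1 by rewrite s0 (le_trans st).
    have [fs0 sE] := jump_arrival cf s01 js.
    by exists (f s).-1; rewrite /= prednK// ndf// ltW.
  have [a0 a1 fa ja] := arrivalP cf (ltn0Sn i) (le1 _ it).
  by rewrite a0 arrival_le.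
rewrite fsbig_image; first by rewrite (fsbig_ord _ _ (fun i => g (arrival f i.+1))).
move=> i j /set_mem/= it /set_mem/= jt aij.
have [_ _ fi _] := arrivalP cf (ltn0Sn i) (le1 _ it).
have [_ _ fj _] := arrivalP cf (ltn0Sn j) (le1 _ jt).
by apply: succn_inj; rewrite -fi -fj aij.
Qed.

End arrival_times.

Section measurable_path_integrals.
Context d (U : measurableType d) (R : realType).
Variables (N : R -> U -> nat) (t : R).
Hypotheses (cN : forall u, counting_path (N ^~ u)) (t01 : 0 <= t <= 1).
Hypothesis mN : forall s, 0 <= s <= t -> measurable_fun setT (N s).

Lemma measurable_nat_ge s i : 0 <= s <= t -> measurable [set u | (i <= N s u)%N].
Proof.
move=> st; rewrite (_ : mkset _ = N s @^-1` [set n | (i <= n)%N])//.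
by rewrite -[X in measurable X]setTI; apply: mN.
Qed.

(** Capping at [t] makes the events [arrival <= r] with [r < t] depend on [N r] only. This is what
    later yields adaptedness, when [U] carries the sigma-algebra at time [t]. *)
Lemma measurable_arrival i :
  measurable_fun setT (fun u => Num.min (arrival (N ^~ u) i) t).
Proof.
have /andP[t0 t1] := t01; apply: measurable_fun_of_le => r.
have [tr|rt] := leP t r.
  rewrite (_ : mkset _ = setT)//; apply/seteqP; split=> u //= _.
  by rewrite ge_min tr orbT.
have [r0|r0] := ltP r 0.
  rewrite (_ : mkset _ = set0)//; apply/seteqP; split=> u //=.
  rewrite ge_min => /orP[|]; last by lra.
  by have := arrival_ge0 (N ^~ u) i; lra.
rewrite (_ : mkset _ = [set u | (i <= N r u)%N]).
  by apply: measurable_nat_ge; rewrite r0 ltW.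
apply/seteqP; split=> u /=; rewrite ge_min arrival_le ?r0 ?(le_trans (ltW rt))//.
  by move=> /orP[//|]; lra.
by move=> ->.
Qed.

Lemma measurable_int_dN (g : R * U -> R) :
  measurable_fun [set p | 0 <= p.1 <= t] g ->
  measurable_fun setT (fun u => int_dN (fun s => g (s, u)) (N ^~ u) t).
Proof.
have /andP[t0 t1] := t01.
set D := [set p | _] => mg.
have mD : measurable D.
  rewrite (_ : D = fst @^-1` `[0, t]).
    by rewrite -[X in measurable X]setTI; exact: measurable_fst.
  by apply/seteqP; split=> p /=; rewrite in_itv.
have mg' : measurable_fun setT (g \_ D) by apply/(measurable_restrictT _ _).1.
(* The number of jumps is random. Sums cut at [K] terms are measurable, and they become stationary
   as soon as [K >= N t u]. *)
pose h K u := \sum_(i < K) (if (i < N t u)%N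
  then (g \_ D) (Num.min (arrival (N ^~ u) i.+1) t, u) else 0).
apply: (@measurable_fun_cvg _ _ _ _ h).
  move=> K; apply: measurable_sum => i.
  apply: measurable_fun_ifT.
  - have := @measurable_nat_ge t i.+1; rewrite lexx t0 => /(_ isT) mA.
    by apply: (measurable_fun_bool true); rewrite setTI.
  - apply: measurableT_comp => //; apply: measurable_fun_pair => //.
    exact: measurable_arrival.
  - exact: measurable_cst.
move=> u _; rewrite int_dNE//.
apply: cvg_near_cst.
exists (N t u) => // K /= NK; rewrite /h.
rewrite [RHS](_ : _ = \sum_(i < K | (i < N t u)%N) g (arrival (N ^~ u) i.+1, u)); last first.
  by rewrite (big_ord_widen _ (fun i => g (arrival (N ^~ u) i.+1, u)) NK).
rewrite [RHS]big_mkcond/=; apply: eq_bigr => i _; case: ifPn => // iN.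
rewrite patchT; last first.
  rewrite inE /D/= ge_min lexx orbT andbT le_min t0 andbT.
  exact: arrival_ge0.
by rewrite min_l// arrival_le.
Qed.

End measurable_path_integrals.

(** * Measures with a density and the Doleans measure of the jumps *)

Section density.
Context d (T : measurableType d) (R : realType).
Variables (m nu : {measure set T -> \bar R}) (f : T -> R).
Hypotheses (mf : measurable_fun setT f) (f0 : forall x, 0 <= f x).
Hypothesis nuE : forall A, measurable A -> nu A = (\int[m]_(x in A) (f x)%:E)%E.
Import HBNNSimple.

Let integral_density_nnsfun (g : {nnsfun T >-> R}) :
  (\int[nu]_x (g x)%:E = \int[m]_x (g x * f x)%:E)%E.
Proof.
rewrite integralT_nnsfun sintegralE.
transitivity (\int[m]_x (\sum_(y \in range g)
    (y * \1_(g @^-1` [set y]) x * f x)%:E)%E)%E; last first.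
  apply: eq_integral => x _; rewrite fsumEFin//; congr EFin.
  by rewrite [in RHS](fimfunE g) mulr_fsuml.
rewrite ge0_integral_fsum//; last 2 first.
- move=> y; apply/measurable_EFinP; apply: measurable_funM => //.
  by apply: measurable_funM => //; exact: measurable_indic.
- move=> y x _; rewrite lee_fin mulr_ge0//.
  rewrite indicE; case: (boolP (x \in _)) => [/set_mem/= <-|_].
    by rewrite mulr1; exact: fun_ge0.
  by rewrite mulr0.
apply: eq_fsbigr => y /set_mem[x0 _ <-].
have gx0 : 0 <= g x0 by exact: fun_ge0.
under eq_integral => x _ do rewrite -mulrA EFinM.
rewrite ge0_integralZl_EFin//; last 2 first.
- by move=> x _; rewrite lee_fin mulr_ge0.
- by apply/measurable_EFinP/measurable_funM => //; exact: measurable_indic.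
rewrite nuE// integral_mkcond; congr (_ * _)%E; apply: eq_integral => x _.
by rewrite epatch_indic/= muleC.
Qed.

Lemma integral_density (g : T -> R) : measurable_fun setT g ->
  (forall x, 0 <= g x) ->
  (\int[nu]_x (g x)%:E = \int[m]_x (g x * f x)%:E)%E.
Proof.
move=> mg g0; have mg' : measurable_fun setT (EFin \o g) by exact/measurable_EFinP.
pose g_ := nnsfun_approx measurableT mg'.
have cg x : (g_ n x)%:E @[n --> \oo] --> (g x)%:E.
  by apply: cvg_nnsfun_approx => // y _; rewrite lee_fin.
have ndg x : {homo (fun n => g_ n x) : a b / (a <= b)%N >-> a <= b}.
  by move=> a b ab; exact/lefP/nd_nnsfun_approx.
have c1 : (\int[nu]_x (g_ n x)%:E)%E @[n --> \oo] --> (\int[nu]_x (g x)%:E)%E.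
  rewrite [X in _ --> X](_ : _ = (\int[nu]_x (limn (fun n => (g_ n x)%:E)))%E).
    apply: cvg_monotone_convergence => //.
    - by move=> n; exact/measurable_EFinP.
    - by move=> n x _; rewrite lee_fin; exact: fun_ge0.
    - by move=> x _ a b ab; rewrite lee_fin; exact: ndg.
  by apply: eq_integral => x _; apply/esym/cvg_lim.
have c2 : (\int[m]_x (g_ n x * f x)%:E)%E @[n --> \oo] -->
    (\int[m]_x (g x * f x)%:E)%E.
  rewrite [X in _ --> X](_ : _ =
      (\int[m]_x (limn (fun n => (g_ n x * f x)%:E)))%E).
    apply: cvg_monotone_convergence => //.
    - by move=> n; apply/measurable_EFinP/measurable_funM.
    - by move=> n x _; rewrite lee_fin mulr_ge0//; exact: fun_ge0.
    - by move=> x _ a b ab; rewrite lee_fin ler_wpM2r//; exact: ndg.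
  apply: eq_integral => x _; apply/esym/cvg_lim => //.
  under eq_fun do rewrite EFinM.
  rewrite EFinM; apply: cvgeZr => //; exact: cg.
rewrite -(cvg_lim _ c1)// -(cvg_lim _ c2)//.
by congr (limn _); apply/funext => n; exact: integral_density_nnsfun.
Qed.

End density.

Section with_density.
Context d (T : measurableType d) (R : realType).
Variables (m : {measure set T -> \bar R}) (f : T -> R).

(** The facts on [f] are arguments so that the measure structure, whose axioms rest on them, can be
    attached to the term itself. *)
Definition with_density (mf : measurable_fun setT f)
  (f0 : forall x, 0 <= f x) (A : set T) := (\int[m]_(x in A) (f x)%:E)%E.

Hypotheses (mf : measurable_fun setT f) (f0 : forall x, 0 <= f x).

Let with_density0 : with_density mf f0 set0 = 0%E.
Proof. by rewrite /with_density integral_set0. Qed.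

Let with_density_ge0 A : (0 <= with_density mf f0 A)%E.
Proof. by apply: integral_ge0 => x _; rewrite lee_fin. Qed.

Let with_density_additive : semi_sigma_additive (with_density mf f0).
Proof.
move=> A mA tA mUA; rewrite /with_density ge0_integral_bigcup//; last 2 first.
- by apply/measurable_EFinP; exact: measurable_funTS.
- by move=> x _; rewrite lee_fin.
apply: is_cvg_nneseries => n _ _.
by apply: integral_ge0 => x _; rewrite lee_fin.
Qed.

HB.instance Definition _ := isMeasure.Build _ _ _ (with_density mf f0)
  with_density0 with_density_ge0 with_density_additive.

Lemma integral_with_density (g : T -> R) : measurable_fun setT g ->
  (forall x, 0 <= g x) ->
  (\int[with_density mf f0]_x (g x)%:E = \int[m]_x (g x * f x)%:E)%E.
Proof. by move=> mg g0; exact: (integral_density (m := m) mf f0). Qed.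

End with_density.

Section jump_measure.
Context d (Om : measurableType d) (R : realType) (P : probability Om R).
Variables (N : R -> Om -> nat).

(** The Doleans measure of [N]: a compensator of [N] is a density of this measure on the predictable
    sets. *)
Definition jump_measure (cN : forall w, counting_path (N ^~ w))
    (mN : forall t, 0 <= t <= 1 -> measurable_fun setT (N t))
    (A : set (R * Om)) : \bar R :=
  (\int[P]_w (int_dN (fun s => \1_A (s, w)) (N ^~ w) 1)%:E)%E.

Hypothesis cN : forall w, counting_path (N ^~ w).
Hypothesis mN : forall t, 0 <= t <= 1 -> measurable_fun setT (N t).
Let one01 : 0 <= (1 : R) <= 1. Proof. by rewrite ler01 lexx. Qed.

Lemma int_dN_ge0 (g : R -> R) w : (forall s, 0 <= g s) ->
  0 <= int_dN g (N ^~ w) 1.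
Proof. by move=> g0; rewrite int_dNE//; apply: sumr_ge0 => i _; exact: g0. Qed.

Lemma measurable_int_dN1 (h : R * Om -> R) : measurable_fun setT h ->
  measurable_fun setT (fun w => int_dN (fun s => h (s, w)) (N ^~ w) 1).
Proof.
by move=> mh; apply: measurable_int_dN => //; exact: measurable_funTS.
Qed.

Let jump_measure0 : jump_measure cN mN set0 = 0%E.
Proof.
rewrite /jump_measure; apply: integral0_eq => w _; rewrite int_dNE//.
by rewrite big1// => i _; rewrite indic0.
Qed.

Let jump_measure_ge0 A : (0 <= jump_measure cN mN A)%E.
Proof. by apply: integral_ge0 => w _; rewrite lee_fin int_dN_ge0. Qed.

Let jump_measure_additive : semi_sigma_additive (jump_measure cN mN).
Proof.
move=> A mA tA mUA.
have m_ n : measurable_fun setT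
    (fun w => (int_dN (fun s => \1_(A n) (s, w)) (N ^~ w) 1)%:E).
  by apply/measurable_EFinP/measurable_int_dN1; exact: measurable_indic.
have -> : jump_measure cN mN (\bigcup_n A n) =
    (\sum_(n <oo) jump_measure cN mN (A n))%E.
  rewrite /jump_measure -integral_nneseries//; last first.
    by move=> n w _; rewrite lee_fin int_dN_ge0.
  apply: eq_integral => w _; rewrite int_dNE// -sumEFin.
  under eq_bigr do rewrite indic_bigcup//.
  rewrite -nneseries_sum; last by move=> i j _; rewrite lee_fin.
  by apply: eq_eseriesr => n _; rewrite int_dNE// sumEFin.
by apply: is_cvg_nneseries => n _ _.
Qed.

HB.instance Definition _ := isMeasure.Build _ _ _ (jump_measure cN mN)
  jump_measure0 jump_measure_ge0 jump_measure_additive.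

Import HBNNSimple.

Lemma integral_jump_measure (h : R * Om -> R) : measurable_fun setT h ->
  (forall x, 0 <= h x) ->
  (\int[jump_measure cN mN]_x (h x)%:E =
   \int[P]_w (int_dN (fun s => h (s, w)) (N ^~ w) 1)%:E)%E.
Proof.
move=> mh h0; have mh' : measurable_fun setT (EFin \o h) by exact/measurable_EFinP.
pose g_ := nnsfun_approx measurableT mh'.
have cg x : (g_ n x)%:E @[n --> \oo] --> (h x)%:E.
  by apply: cvg_nnsfun_approx => // y _; rewrite lee_fin.
have ndg x : {homo (fun n => g_ n x) : a b / (a <= b)%N >-> a <= b}.
  by move=> a b ab; exact/lefP/nd_nnsfun_approx.
have c1 : (\int[jump_measure cN mN]_x (g_ n x)%:E)%E @[n --> \oo] -->
    (\int[jump_measure cN mN]_x (h x)%:E)%E.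
  rewrite [X in _ --> X](_ : _ =
      (\int[jump_measure cN mN]_x (limn (fun n => (g_ n x)%:E)))%E).
    apply: cvg_monotone_convergence => //.
    - by move=> n; exact/measurable_EFinP.
    - by move=> n x _; rewrite lee_fin; exact: fun_ge0.
    - by move=> x _ a b ab; rewrite lee_fin; exact: ndg.
  by apply: eq_integral => x _; apply/esym/cvg_lim.
have c2 : (\int[P]_w (int_dN (fun s => g_ n (s, w)) (N ^~ w) 1)%:E)%E
    @[n --> \oo] --> (\int[P]_w (int_dN (fun s => h (s, w)) (N ^~ w) 1)%:E)%E.
  rewrite [X in _ --> X](_ : _ = (\int[P]_w (limn (fun n =>
      (int_dN (fun s => g_ n (s, w)) (N ^~ w) 1)%:E)))%E).
    apply: cvg_monotone_convergence => //.
    - by move=> n; apply/measurable_EFinP/measurable_int_dN1.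
    - by move=> n w _; rewrite lee_fin int_dN_ge0// => s; exact: fun_ge0.
    - move=> w _ a b ab; rewrite lee_fin !int_dNE//.
      by apply: ler_sum => i _; exact: ndg.
  apply: eq_integral => w _; apply/esym/cvg_lim => //.
  rewrite int_dNE// -sumEFin.
  under eq_fun do rewrite int_dNE// -sumEFin.
  by apply: cvg_nnesum => [i _|i _]; [near=> n; rewrite lee_fin; exact: fun_ge0|exact: cg].
rewrite -(cvg_lim _ c1)// -(cvg_lim _ c2)//.
congr (limn _); apply/funext => n; rewrite integralT_nnsfun sintegralE.
transitivity (\sum_(y \in range (g_ n)) \int[P]_w
    (y * int_dN (fun s => \1_(g_ n @^-1` [set y]) (s, w)) (N ^~ w) 1)%:E)%E.
  apply: eq_fsbigr => y /set_mem[x0 _ <-].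
  have gx0 : 0 <= g_ n x0 by exact: fun_ge0.
  under eq_integral do rewrite EFinM.
  rewrite ge0_integralZl_EFin//; first by move=> w _; rewrite lee_fin int_dN_ge0.
  by apply/measurable_EFinP/measurable_int_dN1; exact: measurable_indic.
rewrite -ge0_integral_fsum//.
- apply: eq_integral => w _; rewrite fsumEFin//; congr EFin.
  rewrite int_dNE//.
  under [RHS]eq_bigr do rewrite (fimfunE (g_ n)).
  rewrite fsbig_finite//= [RHS](eq_bigr (fun i : 'I__ => \sum_(y <- fset_set (range (g_ n))) y * \1_(g_ n @^-1` [set y]) (arrival (N ^~ w) i.+1, w))); last first.
    by move=> i _; rewrite fsbig_finite.
  rewrite exchange_big/=; apply: eq_bigr => y _.
  by rewrite int_dNE// mulr_sumr.
- move=> y; apply/measurable_EFinP/measurable_funM => //.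
  by apply: measurable_int_dN1; exact: measurable_indic.
- move=> y w _; rewrite lee_fin int_dNE// mulr_sumr; apply: sumr_ge0 => i _.
  rewrite indicE; case: (boolP (_ \in _)) => [/set_mem/= <-|_].
    by rewrite mulr1; exact: fun_ge0.
  by rewrite mulr0.
Unshelve. all: end_near.
Qed.

End jump_measure.

(** * Predictable functions *)

Definition filtration (R : realType) d (Om : measurableType d)
    (H : R -> set (set Om)) : Prop :=
  (forall t, 0 <= t <= 1 -> sigma_algebra setT (H t) /\ H t `<=` measurable) /\
  (forall s t, 0 <= s -> s <= t -> t <= 1 -> H s `<=` H t).

Section predictable_sets.
Context (R : realType) d (Om : measurableType d) (H : R -> set (set Om)).
Hypothesis fH : filtration H.
Local Notation rects := (predictable_rectangles H).

(** The sigma-algebra lives on all of [R * Om], whereas [predictable] speaks of the trace on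
    [[0, 1]]. A predictable process becomes a measurable function here once it is extended by 0
    outside [[0, 1]], as done by [uncurry01]. *)
Definition predictable_type := g_sigma_algebraType rects.
HB.instance Definition _ := Measurable.on predictable_type.

Definition pred_fun d' (T : measurableType d') (h : R * Om -> T) :=
  measurable_fun setT (h : predictable_type -> T).

Lemma filtration_I t (A B : set Om) : 0 <= t <= 1 ->
  H t A -> H t B -> H t (A `&` B).
Proof.
move=> t01; have [sH _] := fH.1 t t01; rewrite -(sigma_algebra_id sH).
exact: (@measurableI _ (g_sigma_algebraType (H t))).
Qed.

Lemma filtration_T t : 0 <= t <= 1 -> H t setT.
Proof.
move=> t01; have [sH _] := fH.1 t t01; rewrite -(sigma_algebra_id sH).
exact: (@measurableT _ (g_sigma_algebraType (H t))).
Qed.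

Lemma filtration_0 t : 0 <= t <= 1 -> H t set0.
Proof.
move=> t01; have [sH _] := fH.1 t t01; rewrite -(sigma_algebra_id sH).
exact: (@measurable0 _ (g_sigma_algebraType (H t))).
Qed.

Let zero01 : 0 <= (0 : R) <= 1. Proof. by rewrite ler01 lexx. Qed.

(** Makes the rectangles a pi-system, as the uniqueness of measures requires. Two rectangles meet in
    one that starts at [Num.max s s'], and both bases are known at that time since the filtration
    increases. *)
Lemma rects_setI : setI_closed rects.
Proof.
have r0 : rects set0.
  left; exists set0; first exact: filtration_0.
  by apply/seteqP; split=> x // -[].
have aux (A : set Om) s t (B : set Om) : 0 <= s ->
    rects (([set 0] `*` A) `&` (`]s, t]%classic `*` B)).
  move=> s0; rewrite (_ : _ `&` _ = set0)//; apply/seteqP; split=> // x [[/= ->] _].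
  by rewrite in_itv/= => -[/andP[]]; lra.
move=> _ _ [[A HA ->]|[s [t [A [s0 st t1 HA ->]]]]]
  [[B HB ->]|[s' [t' [B [s0' st' t1' HB ->]]]]].
- left; exists (A `&` B); first exact: filtration_I.
  by apply/seteqP; split=> x /= => [[[? ?] [? ?]]|[? [? ?]]].
- exact: aux.
- by rewrite setIC; exact: aux.
- pose a := Num.max s s'; pose b := Num.min t t'.
  have [ab|ba] := ltP a b; last first.
    rewrite (_ : _ `&` _ = set0)//; apply/seteqP; split=> // x [[/=]].
    rewrite !in_itv/= => /andP[sx xt] _ [/andP[s'x xt'] _].
    move: ba; rewrite leNgt => /negP; apply.
    by apply: (@lt_le_trans _ _ x.1); rewrite ?gt_max ?sx ?s'x ?le_min ?xt.
  have b1 : b <= 1 by rewrite ge_min t1.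
  have a1 : a <= 1 by rewrite (le_trans (ltW ab)).
  right; exists a, b, (A `&` B); split => //.
  + by rewrite le_max s0.
  + apply: filtration_I; first by rewrite a1 le_max s0.
      by apply: fH.2 HA => //; rewrite le_max lexx.
    by apply: fH.2 HB => //; rewrite le_max lexx orbT.
  + apply/seteqP; split=> x /=; rewrite !in_itv/= gt_max le_min.
      by move=> [[/andP[-> ->] ?] [/andP[-> ->] ?]].
    by move=> [/andP[/andP[-> ->] /andP[-> ->]] [? ?]].
Qed.

Lemma rects_measurable : rects `<=` measurable.
Proof.
move=> _ [[A HA ->]|[s [t [A [s0 st t1 HA ->]]]]]; apply: measurableX => //.
  by apply: (fH.1 0 _).2.
by apply: (fH.1 s _).2 => //; rewrite s0 ltW// (lt_le_trans st).
Qed.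

Lemma pred_measurable (A : set predictable_type) : measurable A ->
  measurable (A : set (R * Om)).
Proof.
apply: smallest_sub; last exact: rects_measurable.
exact: sigma_algebra_measurable.
Qed.

Lemma pred_fun_measurable d' (T : measurableType d') (h : R * Om -> T) :
  pred_fun h -> measurable_fun setT h.
Proof.
move=> mh _ Y mY; apply: pred_measurable.
exact: (mh (@measurableT _ predictable_type) Y mY).
Qed.

Lemma pred_D : measurable ([set p | 0 <= p.1 <= 1] : set predictable_type).
Proof.
rewrite (_ : mkset _ = ([set 0] `*` setT) `|` (`]0, 1]%classic `*` setT)).
  apply: measurableU; apply: sub_sigma_algebra.
    by left; exists setT => //; exact: filtration_T.
  by right; exists 0, 1, setT; split => //; exact: filtration_T.
apply/seteqP; split=> x /=.
  move=> /andP[]; rewrite le_eqVlt => /orP[/eqP <- _|x0 x1]; first by left.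
  by right; rewrite in_itv/= x0 x1.
move=> [[-> _]|[]]; rewrite ?lexx ?ler01//.
by rewrite in_itv/= => /andP[/ltW -> ->].
Qed.

Lemma predictable_pred_fun (W : R -> Om -> R) : predictable H W ->
  pred_fun ((fun p : R * Om => W p.1 p.2) \_ [set p | 0 <= p.1 <= 1]).
Proof.
move=> pW; apply/(measurable_restrictT _ _).1; first exact: pred_D.
move=> mD Y mY.
have : preimage_set_system [set p | 0 <= p.1 <= 1] (fun p => W p.1 p.2)
  measurable ([set p | 0 <= p.1 <= 1] `&` (fun p => W p.1 p.2) @^-1` Y).
  by exists Y.
move=> /pW; move: (_ `&` _); apply: smallest_sub; last exact: sub_sigma_algebra.
split.
- exact: (@measurable0 _ predictable_type).
- by move=> A mA; apply: (@measurableD _ predictable_type).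
- by move=> A mA; apply: (@bigcupT_measurable _ predictable_type).
Qed.

Lemma measure_D0 (m : {measure set (R * Om) -> \bar R}) :
  m (~` (`]0, 1]%classic `*` [set: Om])) = 0%E ->
  m setT = m (`]0, 1]%classic `*` [set: Om]).
Proof.
have mD0 : measurable (`]0, 1]%classic `*` [set: Om] : set (R * Om)).
  exact: measurableX.
move=> m0; rewrite -(setvU (`]0, 1]%classic `*` [set: Om] : set (R * Om))).
rewrite measureU//; [|exact: measurableC|exact: setICl].
rewrite [X in (X + _)%E](_ : _ = 0%E) ?add0e//; exact: m0.
Qed.

Section extension.
Variables (m1 m2 : {measure set (R * Om) -> \bar R}).
Local Notation D0 := (`]0, 1]%classic `*` [set: Om]).
Hypothesis m1oo : (m1 setT < +oo)%E.
Hypotheses (m10 : m1 (~` D0) = 0%E) (m20 : m2 (~` D0) = 0%E).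
Hypothesis m12 : forall s t A, 0 <= s -> s < t -> t <= 1 -> H s A ->
  m1 (`]s, t]%classic `*` A) = m2 (`]s, t]%classic `*` A).

Let mD0 : measurable (D0 : set (R * Om)). Proof. exact: measurableX. Qed.

(** Uniqueness on a pi-system. The rectangles over time 0 are null for both measures, as neither
    charges the complement of [D0]; the whole space is added to the system because it serves as the
    exhausting set of finite mass. *)
Lemma pred_measure_eq (E : set predictable_type) : measurable E ->
  m1 (E : set (R * Om)) = m2 (E : set (R * Om)).
Proof.
have m12T : m1 setT = m2 setT.
  rewrite (measure_D0 m10) (measure_D0 m20); apply: m12 => //; exact: filtration_T.
have null0 (m : {measure set (R * Om) -> \bar R}) A : measurable A ->
    m (~` D0) = 0%E -> m ([set 0] `*` A) = 0%E.
  move=> mA m0; apply/eqP; rewrite -measure_le0 -m0; apply: le_measure.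
  - by rewrite inE; apply: measurableX.
  - by rewrite inE; exact: measurableC.
  - by move=> x [/= -> _] []/=; rewrite in_itv/= ltxx.
pose G : set (set (R * Om)) := rects `|` [set setT].
have GI : setI_closed G.
  move=> A B [rA|->] [rB|->]; rewrite ?setTI ?setIT; [|by left..|by right].
  by left; exact: rects_setI.
have GE : forall A, G A -> m1 A = m2 A.
  move=> _ [[[A HA ->]|[s [t [A [s0 st t1 HA ->]]]]]|->] //.
    by rewrite !null0//; apply: (fH.1 0 _).2.
  exact: m12.
move=> mE; apply: (@g_sigma_algebra_measure_unique _ _ _ G _ (fun=> setT)) => //.
- by move=> A [/rects_measurable//|->].
- by move=> _; right.
- by apply/seteqP; split=> // x _; exists 0%N.
- by apply: sub_sigma_algebra2 mE => A; left.
Qed.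

Lemma pred_integral_eq (h : R * Om -> R) : pred_fun h ->
  (forall p, 0 <= h p) ->
  (\int[m1]_p (h p)%:E = \int[m2]_p (h p)%:E)%E.
Proof.
move=> mh h0.
(* The identity, seen as a map into the predictable sigma-algebra: the push-forwards of both
   measures are equal there, although the measures may differ on the full product sigma-algebra. *)
pose phi : R * Om -> predictable_type := id.
have mphi : measurable_fun setT phi.
  by move=> _ Y mY; rewrite setTI; exact: pred_measurable.
have key (m : {measure set (R * Om) -> \bar R}) :
    (\int[m]_p (h p)%:E = \int[pushforward m phi]_p (h p)%:E)%E.
  rewrite (ge0_integral_pushforward mphi m (D := setT) (f := EFin \o h))//.
    exact/measurable_EFinP.
  by move=> x _; rewrite lee_fin.
rewrite (key m1) (key m2).
by apply: eq_measure_integral => A mA _; exact: pred_measure_eq.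
Qed.

End extension.

End predictable_sets.

(** * Compensators and bounded intensities *)

Section uniform01.
Context (R : realType).

Let R_of : measurableTypeR R -> R := id.

Let measurable_R_of : measurable_fun setT R_of.
Proof. by move=> _ Y mY; rewrite setTI; exact: mY. Qed.

(* [uniform_prob] is a measure on [measurableTypeR R]; this is its copy on [R]. *)
Definition U01 : set R -> \bar R := pushforward (uniform_prob (@ltr01 R)) R_of.

Let U01_0 : U01 set0 = 0%E.
Proof. exact: (measure0 (uniform_prob (@ltr01 R))). Qed.

Let U01_ge0 A : (0 <= U01 A)%E.
Proof. exact: (measure_ge0 (uniform_prob (@ltr01 R))). Qed.

Let U01_additive : semi_sigma_additive U01.
Proof.
move=> F mF tF mUF.
exact: (@measure_semi_sigma_additive _ _ _ (uniform_prob (@ltr01 R)) F).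
Qed.

HB.instance Definition _ := isMeasure.Build _ _ _ U01
  U01_0 U01_ge0 U01_additive.

Let U01T : U01 setT = 1%E.
Proof. exact: (probability_setT (uniform_prob (@ltr01 R))). Qed.

HB.instance Definition _ := Measure_isProbability.Build _ _ _ U01 U01T.

Lemma ge0_integral_U01 (f : R -> \bar R) : measurable_fun setT f ->
  (forall x, 0 <= f x)%E ->
  (\int[U01]_s f s = \int[lebesgue_measure]_(s in `[0%R, 1%R]) f s)%E.
Proof.
move=> mf f0; rewrite (ge0_integral_pushforward measurable_R_of)//.
by rewrite preimage_setT integral_uniform// subr0 invr1 mul1e.
Qed.

Lemma integral_U01 (f : R -> \bar R) : measurable_fun setT f ->
  (\int[U01]_s f s = \int[lebesgue_measure]_(s in `[0%R, 1%R]) f s)%E.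
Proof.
move=> mf; rewrite integralE [in RHS]integralE.
rewrite !ge0_integral_U01//.
- exact: measurable_funeneg.
- exact: measurable_funepos.
Qed.

Lemma integrable_U01 (f : R -> \bar R) : measurable_fun setT f ->
  lebesgue_measure.-integrable `[0, 1] f <-> U01.-integrable setT f.
Proof.
move=> mf; split => /integrableP[_ fi]; apply/integrableP; split => //.
- rewrite integral_U01//; exact: measurableT_comp.
- exact: measurable_funTS.
- by rewrite -integral_U01//; exact: measurableT_comp.
Qed.

Lemma U01_itv : U01 (~` `]0, 1]%classic) = 0%E.
Proof.
have mI : measurable (`]0, 1]%classic : set R) by exact: measurable_itv.
have h : U01 `]0, 1]%classic = 1%E.
  rewrite -[X in U01 X]setIT -integral_indic//.
  rewrite integral_U01; last exact/measurable_EFinP/measurable_indic.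
  rewrite integral_indic// setIidl ?lebesgue_measure_itv/= ?lte01 ?oppr0 ?adde0//.
    by rewrite lebesgue_measure_itv/= lte01 oppr0 adde0.
  by move=> x /=; rewrite !in_itv/= => /andP[/ltW -> ->].
pose I1 : set R := `]0, 1]%classic.
transitivity (1 - U01 I1)%E; first exact: probability_setC.
by rewrite h subee.
Qed.

End uniform01.

Lemma int_dN_itv (R : realType) (f : R -> nat) (a b : R) :
  counting_path f -> 0 <= a -> a <= b -> b <= 1 ->
  int_dN (\1_(`]a, b]%classic)) f 1 = (f b)%:R - (f a)%:R.
Proof.
move=> cf a0 ab b1; have [f0 ndf _ _] := cf.
have a1 : a <= 1 by exact: le_trans b1.
have b0 : 0 <= b by exact: le_trans ab.
have sumE (k : nat) : (k <= f 1%R)%N ->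
    \sum_(i < f 1%R) ((i < k)%N%:R : R) = k%:R.
  move=> kf; rewrite -natr_sum; congr (_%:R).
  under eq_bigr do rewrite -[nat_of_bool _]mul1n mulnbr.
  by rewrite -big_mkcond/= -(big_ord_widen _ (fun=> 1%N) kf) sum1_card card_ord.
rewrite int_dNE ?ler01 ?lexx// -(sumE (f b)) ?ndf// -(sumE (f a)) ?ndf//.
rewrite -sumrB; apply: eq_bigr => i _.
rewrite indicE mem_setE in_itv/= ltNge !arrival_le ?a0 ?b0//.
have fab : (f a <= f b)%N by exact: ndf.
have [ia|ia] /= := ltnP i (f a); first by rewrite (leq_trans ia fab) subrr.
by rewrite subr0.
Qed.
Arguments U01 {R}.

Section compensator.
Context (R : realType) d (Om : measurableType d) (P : probability Om R).
Variables (H : R -> set (set Om)) (N : R -> Om -> nat).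
Hypothesis fH : filtration H.
Hypothesis cN : forall w, counting_path (N ^~ w).
Hypothesis mN : forall t, 0 <= t <= 1 -> measurable_fun setT (N t).

Local Notation M := (@U01 R \x P)%E.
Local Notation D0 := (`]0, 1]%classic `*` [set: Om]).

Lemma jump_measureC : jump_measure P cN mN (~` D0) = 0%E.
Proof.
apply: integral0_eq => w _; rewrite int_dNE ?ler01 ?lexx// big1// => i _.
have [a0 a1 _ _] := arrivalP (cN w) (ltn0Sn i) (ltn_ord i).
rewrite indicE memNset//= => -[]; split => //=.
by rewrite in_itv/= a0 a1.
Qed.

Lemma product_U01C : M (~` D0) = 0%E.
Proof.
rewrite (_ : ~` D0 = (~` `]0, 1]%classic) `*` setT).
  by rewrite product_measure1E//= ?U01_itv ?mul0e//; apply: measurableC.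
apply/seteqP; split => [x /= nx|x [/= nx _] [//]].
by split => // x1; apply: nx.
Qed.

Lemma with_density_null (f : R * Om -> R) (mf : measurable_fun setT f)
  (f0 : forall x, 0 <= f x) (A : set (R * Om)) : measurable A -> M A = 0%E ->
  with_density M mf f0 A = 0%E.
Proof.
move=> mA MA0; apply: null_set_integral => //.
by apply/measurable_EFinP; exact: measurable_funTS.
Qed.

Section stopped.
Variables (tau : Om -> R) (l : R -> Om -> R) (q p : R * Om -> R).
Hypothesis stau : stopping_time H tau.
Hypothesis mart :
  martingale P H (fun t w => compensated N l (Num.min t (tau w)) w).
Hypothesis il : \forall w \ae P,
  lebesgue_measure.-integrable `[0, 1] (fun s => (l s w)%:E).
Hypotheses (mq : measurable_fun setT q) (mp : measurable_fun setT p).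
Hypotheses (q0 : forall x, 0 <= q x) (p0 : forall x, 0 <= p x).
Hypothesis lqp : \forall w \ae P, forall s, 0 <= s <= 1 ->
  l s w = q (s, w) - p (s, w).
Hypothesis iq : Rintegrable M q.

Lemma measurable_stopping_time : measurable_fun setT tau.
Proof.
have [t01 st] := stau; apply (@measurable_fun_of_le _ _ R) => r.
have [r0|r0] := ltP r 0.
  rewrite (_ : mkset _ = set0)//; apply/seteqP; split=> // w /= tr.
  by have := t01 w; lra.
have [r1|r1] := leP r 1.
  by apply: (fH.1 r _).2; [rewrite r0|apply: st; rewrite r0].
rewrite (_ : mkset _ = setT)//; apply/seteqP; split=> // w _ /=.
by have := t01 w; lra.
Qed.

Definition before_tau := [set x : R * Om | x.1 <= tau x.2].

Lemma measurable_before_tau : measurable before_tau.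
Proof.
have mt := measurable_stopping_time.
have h : measurable_fun setT (fun x : R * Om => x.1 <= tau x.2).
  by apply: measurable_fun_ler => //; apply: measurableT_comp.
have := h measurableT [set true] I; rewrite setTI.
by congr measurable; apply/seteqP; split => x.
Qed.

Section rectangle.
Variables (s t : R) (A : set Om).
Hypotheses (s0 : 0 <= s) (st : s < t) (t1 : t <= 1) (HA : H s A).
Let E := (`]s, t]%classic `*` A) `&` before_tau.
Let a w := Num.min s (tau w).
Let b w := Num.min t (tau w).

Let mA : measurable A.
Proof. by apply: (fH.1 s _).2 => //; rewrite s0 ltW// (lt_le_trans st). Qed.

Let mE : measurable E.
Proof. by apply: measurableI; [exact: measurableX|exact: measurable_before_tau]. Qed.

Let ab w : 0 <= a w /\ a w <= b w /\ b w <= 1.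
Proof.
have [/(_ w)/andP[t0' t1'] _] := stau.
rewrite /a /b; split; first by rewrite le_min s0 t0'.
split; last by rewrite ge_min t1' orbT.
by rewrite le_min !ge_min lexx (ltW st) orbT.
Qed.

Let EE u w : \1_E (u, w) = \1_A w * \1_(`]a w, b w]%classic) u :> R.
Proof.
rewrite !indicE -natrM mulnb; congr (nat_of_bool _)%:R.
apply/idP/andP => [/set_mem[[/=]]|[/set_mem Aw /set_mem/=]].
  rewrite /before_tau/= !in_itv/= => /andP[su ut] Aw utau.
  by split; apply/mem_set => //=; rewrite in_itv/= gt_min su/= le_min ut.
rewrite in_itv/= gt_min le_min => /andP[+ /andP[ut utau]] => su.
apply/mem_set; split => //=; split => //=; rewrite in_itv/= ut andbT.
by case/orP: su => //; lra.
Qed.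

Let dens_E (f : R * Om -> R) (mf : measurable_fun setT f) (f0 : forall x, 0 <= f x) :
  with_density M mf f0 E =
  (\int[P]_w \int[U01]_u (\1_E (u, w) * f (u, w))%:E)%E.
Proof.
transitivity (\int[M]_x (\1_E x * f x)%:E)%E; last first.
  rewrite (@fubini_tonelli2 _ _ _ _ _ _ _ (fun x => (\1_E x * f x)%:E))//.
  - by apply/measurable_EFinP/measurable_funM => //; exact: measurable_indic.
  - by move=> x; rewrite lee_fin mulr_ge0.
rewrite /with_density integral_mkcond.
by apply: eq_integral => x _; rewrite epatch_indic/= muleC.
Qed.

Let dens_path (f : R * Om -> R) (mf : measurable_fun setT f) w :
  lebesgue_measure.-integrable `[0, 1] (fun s => (f (s, w))%:E) ->
  (\int[U01]_u (\1_E (u, w) * f (u, w))%:E =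
  (\1_A w * \int[lebesgue_measure]_(u in `](a w), (b w)]) f (u, w))%:E)%E.
Proof.
move=> fi; have [a0 [ab' b1]] := ab w.
have sub : `]a w, b w]%classic `<=` (`[0, 1]%classic : set R).
  move=> u /=; rewrite !in_itv/= => /andP[au ub].
  by rewrite (le_trans ub b1) andbT ltW// (le_lt_trans a0).
have fi' : lebesgue_measure.-integrable `]a w, b w] (fun s => (f (s, w))%:E).
  by apply: integrableS fi.
under eq_integral => u _ do rewrite EE -mulrA EFinM.
rewrite EFinM; have [Aw|nAw] := boolP (w \in A); last first.
  rewrite indicE (negbTE nAw) mul0e; apply: integral0_eq => u _.
  by rewrite mul0e.
rewrite indicE Aw mul1e; under eq_integral do rewrite mul1e.
rewrite integral_U01; last first.
  apply/measurable_EFinP/measurable_funM; first exact: measurable_indic.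
  exact: measurableT_comp.
rewrite /Rintegral fineK; last exact: integrable_fin_num.
rewrite -[in RHS](setIidr sub) [in RHS]integral_mkcondr.
by apply: eq_integral => u _; rewrite epatch_indic EFinM muleC.
Qed.

Let dM w := \1_A w *
  (compensated N l (b w) w - compensated N l (a w) w).

Let mean_dM : Rintegrable P dM /\ \int[P]_w dM w = 0.
Proof.
have [it is_ _ eA] := mart s0 (ltW st) t1.
have ia := Rintegrable_indicM mA is_; have ib := Rintegrable_indicM mA it.
have dME : dM = fun w => \1_A w * compensated N l (b w) w -
    \1_A w * compensated N l (a w) w.
  by apply/funext => w; rewrite /dM mulrBr.
split; first by rewrite dME; exact: RintegrableB.
by rewrite dME RintB// -!Rintegral_indic (eA _ HA) subrr.
Qed.

Let ae_path : \forall w \ae P,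
  ((int_dN (fun s => \1_E (s, w)) (N ^~ w) 1)%:E +
   \int[U01]_u (\1_E (u, w) * p (u, w))%:E =
  (\int[U01]_u (\1_E (u, w) * q (u, w))%:E) + (dM w)%:E)%E.
Proof.
have aeq := ae_integrable2 iq.
apply: filterS3 il lqp aeq => w ilw lqpw iqw.
have [a0 [ab' b1]] := ab w.
have {}iqw : lebesgue_measure.-integrable `[0, 1] (fun s => (q (s, w))%:E).
  apply/integrable_U01 => //.
  by apply/measurable_EFinP; exact: measurableT_comp.
(* On almost every path [p = q - l] is a difference of integrable functions, although the mean of
   its integral is not known to be finite. *)
have ipw : lebesgue_measure.-integrable `[0, 1] (fun s => (p (s, w))%:E).
  have mI : measurable (`[0, 1]%classic : set (measurableTypeR R)) by exact: measurable_itv.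
  have := integrableB mI iqw ilw; apply: eq_integrable => //.
  move=> u /set_mem/=; rewrite in_itv/= => u01.
  by rewrite lqpw// -EFinB; congr EFin; ring.
rewrite !dens_path// -!EFinD; congr EFin; rewrite /dM -mulrDr.
have -> : int_dN (fun s1 => \1_E (s1, w)) (N ^~ w) 1 =
    \1_A w * ((N (b w) w)%:R - (N (a w) w)%:R).
  rewrite -(int_dN_itv (cN w) a0 ab' b1) !int_dNE ?lexx ?ler01//.
  by rewrite mulr_sumr; apply: eq_bigr => i _; rewrite EE.
rewrite -mulrDr; congr (_ * _).
have sub0b : `[0, b w]%classic `<=` (`[0, 1]%classic : set R).
  by move=> u /=; rewrite !in_itv/= => /andP[-> /le_trans ->].
have subab : `]a w, b w]%classic `<=` (`[0, 1]%classic : set R).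
  move=> u /=; rewrite !in_itv/= => /andP[au /le_trans -> //].
  by rewrite andbT ltW// (le_lt_trans a0).
have := @Rintegral_itvB R (fun s => l s w) (BLeft 0) (BRight (b w)) (a w).
have i0b : lebesgue_measure.-integrable `[0, b w] (fun s => (l s w)%:E).
  by apply: integrableS ilw.
move=> /(_ i0b) /= h.
have {}h : \int[lebesgue_measure]_(u in `[0, b w]) l u w -
  \int[lebesgue_measure]_(u in `[0, a w]) l u w =
  \int[lebesgue_measure]_(u in `](a w), (b w)]) l u w.
  by apply: h => //; rewrite bnd_simp.
have hl : \int[lebesgue_measure]_(u in `](a w), (b w)]) l u w =
  \int[lebesgue_measure]_(u in `](a w), (b w)]) q (u, w) -
  \int[lebesgue_measure]_(u in `](a w), (b w)]) p (u, w).
  rewrite -RintegralB//; [|exact: integrableS iqw|exact: integrableS ipw].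
  by apply: eq_Rintegral => u /set_mem /subab; rewrite /= in_itv/= => /lqpw.
rewrite /compensated; move: h; rewrite hl; lra.
Qed.

(** The increment of the stopped martingale between [s] and [t] has mean 0 on [A]. The part [p] is
    moved to the side of the jumps so that all three terms are nonnegative and the identity makes
    sense even if the middle one were infinite. *)
Lemma rectangle_compensator :
  (jump_measure P cN mN E + with_density M mp p0 E = with_density M mq q0 E)%E.
Proof.
have [idM mean0] := mean_dM.
have mIE (f : R * Om -> R) : measurable_fun setT f ->
    measurable_fun setT (fun x => \1_E x * f x).
  by move=> mf; apply: measurable_funM => //; exact: measurable_indic.
have mInt (f : R * Om -> R) : measurable_fun setT f -> (forall x, 0 <= f x) ->
    measurable_fun setT (fun w => \int[U01]_u (\1_E (u, w) * f (u, w))%:E)%E.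
  move=> mf f0; apply: (@measurable_fun_fubini_tonelli_G _ _ _ _ _ U01 (fun x => (\1_E x * f x)%:E)).
    by apply/measurable_EFinP; exact: mIE.
  by move=> x; rewrite lee_fin mulr_ge0.
have int0 (f : R * Om -> R) w : (forall x, 0 <= f x) ->
    (0 <= \int[U01]_u (\1_E (u, w) * f (u, w))%:E)%E.
  by move=> f0; apply: integral_ge0 => u _; rewrite lee_fin mulr_ge0.
have mJ : measurable_fun setT
    (fun w => (int_dN (fun s => \1_E (s, w)) (N ^~ w) 1)%:E).
  by apply/measurable_EFinP/measurable_int_dN1 => //; exact: measurable_indic.
have iQ : P.-integrable setT (fun w => \int[U01]_u (\1_E (u, w) * q (u, w))%:E)%E.
  apply/integrableP; split; first exact: mInt.
  under eq_integral => w _ do rewrite gee0_abs ?int0//.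
  rewrite -(dens_E mq q0) /with_density.
  have /integrableP[_] := iq; apply: le_lt_trans.
  under [leRHS]eq_integral => w _ do rewrite /= ger0_norm//.
  apply: ge0_subset_integral => //; first exact/measurable_EFinP.
  by move=> x _; rewrite lee_fin.
rewrite (dens_E mp p0) (dens_E mq q0) /jump_measure -ge0_integralD//; last 3 first.
- by move=> w _; rewrite lee_fin int_dN_ge0.
- by move=> w _; exact: int0.
- exact: mInt.
rewrite (ae_eq_integral
   (fun w => (\int[U01]_u (\1_E (u, w) * q (u, w))%:E) + (dM w)%:E)%E)//.
- rewrite integralD// -(RintE idM) mean0 adde0//.
- by apply: emeasurable_funD => //; exact: mInt.
- apply: emeasurable_funD => //; [exact: mInt|].
  by apply/measurable_EFinP; exact: RintegrableM idM.
- by apply: filterS ae_path => w.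
Qed.

End rectangle.

(** Each side, restricted to the times before [tau], is a measure of the set. They agree on
    rectangles, and the right-hand one is finite because [q] is integrable. *)
Lemma stopped_compensator (A : set (predictable_type H)) : measurable A ->
  (jump_measure P cN mN (A `&` before_tau) +
   with_density M mp p0 (A `&` before_tau) =
   with_density M mq q0 (A `&` before_tau))%E.
Proof.
have mS := measurable_before_tau.
pose m1 := mrestr (measure_add (jump_measure P cN mN) (with_density M mp p0)) mS.
pose m2 := mrestr (with_density M mq q0) mS.
have m1E B : m1 B = (jump_measure P cN mN (B `&` before_tau) +
   with_density M mp p0 (B `&` before_tau))%E.
  by rewrite /m1 /mrestr measure_addE.
have mDC : measurable (~` D0 : set (R * Om)).
  by apply: measurableC; exact: measurableX.
have null (m : {measure set (R * Om) -> \bar R}) : m (~` D0) = 0%E ->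
    m (~` D0 `&` before_tau) = 0%E.
  move=> m0; apply/eqP; rewrite -measure_le0 -m0; apply: le_measure.
  - by rewrite inE; apply: measurableI.
  - by rewrite inE.
  - exact: subIsetl.
have m10 : m1 (~` D0) = 0%E.
  rewrite m1E (null (jump_measure P cN mN))//; last exact: jump_measureC.
  rewrite add0e (null (with_density M mp p0))//.
  exact: (with_density_null mp p0 mDC product_U01C).
have m20 : m2 (~` D0) = 0%E.
  rewrite /m2 /mrestr (null (with_density M mq q0))//.
  exact: (with_density_null mq q0 mDC product_U01C).
have m12 s t B : 0 <= s -> s < t -> t <= 1 -> H s B ->
    m1 (`]s, t]%classic `*` B) = m2 (`]s, t]%classic `*` B).
  by move=> s0 st t1 HB; rewrite m1E (rectangle_compensator s0 st t1 HB).
have m1oo : (m1 setT < +oo)%E.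
  have -> : m1 setT = m1 D0 by exact: measure_D0 m10.
  rewrite [X in (X < _)%E](_ : _ = m2 D0); last first.
    by apply: m12 => //; apply: (filtration_T fH); rewrite lexx ler01.
  have /integrableP[_] := iq; apply: le_lt_trans.
  under [leRHS]eq_integral => w _ do rewrite /= ger0_norm//.
  apply: ge0_subset_integral => //.
  - by apply: measurableI => //; exact: measurableX.
  - exact/measurable_EFinP.
  - by move=> x _; rewrite lee_fin.
by move=> mA; rewrite -m1E; apply: (pred_measure_eq fH m1oo m10 m20 m12 mA).
Qed.

End stopped.

Section local.
Variables (l : R -> Om -> R) (q p : R * Om -> R).
Hypothesis lmart : local_martingale P H (compensated N l).
Hypothesis il : \forall w \ae P,
  lebesgue_measure.-integrable `[0, 1] (fun s => (l s w)%:E).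
Hypotheses (mq : measurable_fun setT q) (mp : measurable_fun setT p).
Hypotheses (q0 : forall x, 0 <= q x) (p0 : forall x, 0 <= p x).
Hypothesis lqp : \forall w \ae P, forall s, 0 <= s <= 1 ->
  l s w = q (s, w) - p (s, w).
Hypothesis iq : Rintegrable M q.

(** The sets [before_tau (tau k)] increase and, since the localizing times reach 1 almost surely,
    exhaust []0, 1]] up to a set that is null for all three measures. Continuity from below removes
    the stopping. *)
Lemma compensator_measure (A : set (predictable_type H)) : measurable A ->
  (jump_measure P cN mN A + with_density M mp p0 A = with_density M mq q0 A)%E.
Proof.
move=> mA; have mA' : measurable (A : set (R * Om)) by exact: pred_measurable mA.
have [tau [stau ndtau aetau mart]] := lmart.
have mS k := measurable_before_tau (stau k).
have mDC : measurable (~` D0 : set (R * Om)).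
  by apply: measurableC; exact: measurableX.
have [N1 [mN1 PN1 N1P]] := aetau.
have lim (m : {measure set (R * Om) -> \bar R}) : m (~` D0) = 0%E ->
    m (setT `*` N1) = 0%E ->
    m (A `&` before_tau (tau k)) @[k --> \oo] --> m A.
  move=> m0 m0'.
  have mU : measurable (\bigcup_k ((A : set (R * Om)) `&` before_tau (tau k))).
    by apply: bigcup_measurable => k _; exact: measurableI.
  have -> : m A = m (\bigcup_k (A `&` before_tau (tau k))).
    apply/eqP; rewrite eq_le; apply/andP; split; last first.
      apply: le_measure; rewrite ?inE//.
      by move=> x [k _] [].
    apply: (@le_trans _ _ (m (\bigcup_k (A `&` before_tau (tau k)) `|`
       (~` D0 `|` (setT `*` N1))))).
      apply: le_measure; rewrite ?inE//.
        apply: measurableU => //; apply: measurableU => //.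
        exact: measurableX.
      move=> x Ax; have [xD|nxD] := pselect (D0 x); last by right; left.
      have [xN|nxN] := pselect (N1 x.2); first by right; right.
      left; have [k tk] : exists k, tau k x.2 = 1.
        by apply: contrapT => nk; apply/nxN/N1P.
      exists k => //; split => //; rewrite /before_tau/= tk.
      by case: xD => /=; rewrite in_itv/= => /andP[].
    apply: (le_trans (measureU2 _ _ _)) => //.
      by apply: measurableU => //; exact: measurableX.
    rewrite -[leRHS]adde0 leeD2l//.
    apply: (le_trans (measureU2 _ _ _)) => //; first exact: measurableX.
    rewrite [X in (X + _)%E](_ : _ = 0%E); last exact: m0.
    by rewrite add0e [X in (X <= _)%E](_ : _ = 0%E)//; exact: m0'.
  apply: nondecreasing_cvg_mu => //.
    by move=> k; exact: measurableI.
  apply/nondecreasing_seqP => k; apply/subsetPset => x [Ax].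
  rewrite /before_tau/= => xk; split => //; exact: le_trans (ndtau _ _).
have mTN : measurable ([set: R] `*` N1) by exact: measurableX.
have M0 : M (setT `*` N1) = 0%E by rewrite product_measure1E//= PN1 mule0.
have j0 : jump_measure P cN mN (setT `*` N1) = 0%E.
  rewrite /jump_measure (ae_eq_integral (cst 0%E)) ?integral0//.
    apply/measurable_EFinP/measurable_int_dN1 => //; exact: measurable_indic.
  exists N1; split => // w /= nw; apply: contrapT => nN; apply: nw => _ /=.
  rewrite int_dNE ?lexx ?ler01// big1// => i _.
  by rewrite indicE memNset// => -[].
have cj := lim (jump_measure P cN mN) jump_measureC j0.
have cp := lim (with_density M mp p0)
  (with_density_null mp p0 mDC product_U01C) (with_density_null mp p0 mTN M0).
have cq := lim (with_density M mq q0)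
  (with_density_null mq q0 mDC product_U01C) (with_density_null mq q0 mTN M0).
have cjp := cvgeD (ge0_adde_def (measure_ge0 _ _) (measure_ge0 _ _)) cj cp.
rewrite -(cvg_lim _ (cjp _))// -(cvg_lim _ cq)//; congr (limn _).
apply/funext => k /=.
exact: (stopped_compensator (stau k) (mart k) il mq mp q0 p0 lqp iq mA).
Qed.

Lemma compensator_integral (h : R * Om -> R) : pred_fun H h ->
  (forall x, 0 <= h x) ->
  (\int[P]_w (int_dN (fun s => h (s, w)) (N ^~ w) 1)%:E +
   \int[M]_x (h x * p x)%:E = \int[M]_x (h x * q x)%:E)%E.
Proof.
move=> ph h0; have mh := pred_fun_measurable fH ph.
have mDC : measurable (~` D0 : set (R * Om)).
  by apply: measurableC; exact: measurableX.
pose m1 := measure_add (jump_measure P cN mN) (with_density M mp p0).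
have m1E B : m1 B = (jump_measure P cN mN B + with_density M mp p0 B)%E.
  by rewrite /m1 measure_addE.
have m12 s t B : 0 <= s -> s < t -> t <= 1 -> H s B ->
    m1 (`]s, t]%classic `*` B) = with_density M mq q0 (`]s, t]%classic `*` B).
  move=> s0 st t1 HB; rewrite m1E; apply: compensator_measure.
  by apply: sub_sigma_algebra; right; exists s, t, B.
have m1oo : (m1 setT < +oo)%E.
  rewrite m1E (compensator_measure (@measurableT _ (predictable_type H))).
  have /integrableP[_] := iq.
  by under eq_integral => w _ do rewrite /= ger0_norm//.
have m10 : m1 (~` D0) = 0%E.
  rewrite m1E jump_measureC add0e.
  exact: (with_density_null mp p0 mDC product_U01C).
have := pred_integral_eq fH m1oo m10
  (with_density_null mq q0 mDC product_U01C) m12 ph h0.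
rewrite /m1 ge0_integral_measure_add//; last 2 first.
- by move=> x _; rewrite lee_fin.
- exact/measurable_EFinP.
rewrite integral_jump_measure// integral_with_density//.
by rewrite integral_with_density.
Qed.

End local.
End compensator.

Definition uncurry01 (R : realType) (Om : Type) (W : R -> Om -> R) : R * Om -> R :=
  (fun p => W p.1 p.2) \_ [set p | 0 <= p.1 <= 1].

Lemma uncurry01E (R : realType) (Om : Type) (W : R -> Om -> R) s w :
  0 <= s <= 1 -> uncurry01 W (s, w) = W s w.
Proof. by move=> s01; rewrite /uncurry01 patchT// inE. Qed.

(** The compensator property of [N], tested on nonnegative predictable functions. From here on the
    martingale hypotheses are used only through this identity. *)
Definition bounded_intensity (R : realType) d (Om : measurableType d)
    (P : probability Om R) (H : R -> set (set Om)) (N : R -> Om -> nat) (C : R)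
    (L : R * Om -> R) : Prop :=
  [/\ pred_fun H L, forall x, 0 <= L x <= C & forall h : R * Om -> R, pred_fun H h ->
    (forall x, 0 <= h x) ->
    (\int[P]_w (int_dN (fun s => h (s, w)) (N ^~ w) 1)%:E =
     \int[U01 \x P]_x (h x * L x)%:E)%E].

Lemma Rint_eq0_ae d (T : measurableType d) (R : realType)
    (m : {measure set T -> \bar R}) (f : T -> R) :
  measurable_fun setT f -> (forall x, 0 <= f x) ->
  (\int[m]_x (f x)%:E = 0)%E -> \forall x \ae m, f x = 0.
Proof.
move=> mf f0 If; have mf' : measurable_fun setT (EFin \o f) by exact/measurable_EFinP.
have : ae_eq m setT (EFin \o f) (cst 0%E).
  apply/(ae_eq_integral_abs m measurableT mf').
  by rewrite -[RHS]If; apply: eq_integral => x _ /=; rewrite ger0_norm.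
by apply: filterS => x /(_ I) /= [].
Qed.

Section bounded_intensity_exists.
Context (R : realType) d (Om : measurableType d) (P : probability Om R).
Variables (H : R -> set (set Om)) (N : R -> Om -> nat).
Hypothesis fH : filtration H.
Hypothesis cN : forall w, counting_path (N ^~ w).
Hypothesis mN : forall t, 0 <= t <= 1 -> measurable_fun setT (N t).
Variables (C : R) (lam blam : R -> Om -> R).
Hypothesis C0 : 0 < C.
Hypothesis pblam : predictable H blam.
Hypothesis iblam : \forall w \ae P,
  lebesgue_measure.-integrable `[0, 1] (fun s => (blam s w)%:E).
Hypothesis mblam : local_martingale P H (compensated N blam).
Hypothesis blamC : \forall w \ae P, forall t, 0 <= t <= 1 -> blam t w <= C.
Hypothesis plam : predictable H lam.
Hypothesis ilam : \forall w \ae P,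
  lebesgue_measure.-integrable `[0, 1] (fun s => (lam s w)%:E).
Hypothesis mlam : local_martingale P H (compensated N lam).
Local Notation M := (@U01 R \x P)%E.
Hypothesis lamM : Rintegrable M (uncurry01 lam).

(** The compensator identity for [blam], written as [C - p] with [p] the positive part of
    [C - blam]; the nonnegative term with [p] is dropped. *)
Let dN_le (h : R * Om -> R) : pred_fun H h -> (forall x, 0 <= h x) ->
  (\int[P]_w (int_dN (fun s => h (s, w)) (N ^~ w) 1)%:E <=
   \int[M]_x (h x * C)%:E)%E.
Proof.
move=> ph h0; pose p (x : R * Om) := Num.max 0 (C - uncurry01 blam x).
have mb : measurable_fun setT (uncurry01 blam).
  exact: (pred_fun_measurable fH (predictable_pred_fun fH pblam)).
have mp : measurable_fun setT p.
  by apply: measurable_maxr => //; exact: measurable_funB.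
have p0 x : 0 <= p x by rewrite le_max lexx.
have q0 (x : R * Om) : 0 <= cst C x by exact: ltW.
have := @compensator_integral R d Om P H N fH cN mN blam (cst C) p mblam iblam.
move=> /(_ (measurable_cst _) mp q0 p0) cm.
rewrite -(cm _ _ h ph h0).
- rewrite leeDl//; apply: integral_ge0 => x _; rewrite lee_fin mulr_ge0//.
- apply: filterS blamC => w hw s s01; rewrite /p uncurry01E//= max_r.
    by ring.
  by rewrite subr_ge0; exact: hw.
- exact: Rintegrable_cst.
Qed.

(** The identity is tested on two predictable sets. On the set where [lam] is negative the side of
    the positive part vanishes, hence so does the negative part. On the set where [lam > C] the jump
    mass is the integral of [lam], but by [dN_le] it is at most [C] times the measure of the set, so
    the set is null. Clipping [lam] to [[0, C]] therefore changes it on a null set only, and keeps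
    it measurable for any sigma-algebra for which [lam] is. *)
Lemma bounded_intensityP : exists L, [/\ bounded_intensity P H N C L,
  forall x, L x = Num.max 0 (Num.min C (uncurry01 lam x)) &
  \forall x \ae M, uncurry01 lam x = L x].
Proof.
have pl : pred_fun H (uncurry01 lam) := predictable_pred_fun fH plam.
have ml := pred_fun_measurable fH pl.
pose q x := Num.max 0 (uncurry01 lam x).
pose p x := Num.max 0 (- uncurry01 lam x).
pose L x := Num.max 0 (Num.min C (uncurry01 lam x)).
have pL : pred_fun H L.
  by apply: measurable_maxr => //; exact: measurable_minr.
have mq : measurable_fun setT q by exact: measurable_maxr.
have mp : measurable_fun setT p.
  by apply: measurable_maxr => //; exact: measurable_funN.
have mL := pred_fun_measurable fH pL.
have q0 x : 0 <= q x by rewrite le_max lexx.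
have p0 x : 0 <= p x by rewrite le_max lexx.
have L0 x : 0 <= L x by rewrite le_max lexx.
have iq : Rintegrable M q.
  apply: Rintegrable_le (Rintegrable_abs lamM) => // x.
  by rewrite ger0_norm// ge_max normr_ge0 ler_norm.
have cm h ph h0 := @compensator_integral R d Om P H N fH cN mN lam q p mlam ilam
  mq mp q0 p0 _ iq h ph h0.
have {}cm (h : R * Om -> R) : pred_fun H h -> (forall x, 0 <= h x) ->
  (\int[P]_w (int_dN (fun s => h (s, w)) (N ^~ w) 1)%:E +
   \int[M]_x (h x * p x)%:E = \int[M]_x (h x * q x)%:E)%E.
  move=> ph h0; apply: cm => //.
  apply: filterS ilam => w _ s s01; rewrite /q /p uncurry01E//.
  have [l0|l0] := leP 0 (lam s w).
    by rewrite max_l ?subr0// oppr_le0.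
  by rewrite max_r ?sub0r ?opprK// oppr_ge0 ltW.
have mset (A : set (R * Om)) (D : set R) : measurable D -> A = uncurry01 lam @^-1` D ->
    pred_fun H (\1_A : _ -> R).
  move=> mD ->; apply: measurable_indic.
  rewrite -[X in measurable X](setTI (uncurry01 lam @^-1` D)).
  exact: (pl (@measurableT _ (predictable_type H)) D mD).
have indic0 (A : set (R * Om)) x : 0 <= (\1_A x : R) by [].
have indic_lt (A : set (R * Om)) (D : set R) := mset A D.
pose Am := [set x | uncurry01 lam x < 0]; pose Ap := [set x | C < uncurry01 lam x].
have pAm : pred_fun H (\1_Am : _ -> R).
  apply: (mset _ `]-oo, 0[%classic); first exact: measurable_itv.
  by apply/seteqP; split => x /=; rewrite in_itv.
have pAp : pred_fun H (\1_Ap : _ -> R).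
  apply: (mset _ `]C, +oo[%classic); first exact: measurable_itv.
  by apply/seteqP; split => x /=; rewrite in_itv/= andbT.
have Am0 : \forall x \ae M, \1_Am x * p x = 0.
  apply: Rint_eq0_ae.
  - apply: measurable_funM => //; exact: pred_fun_measurable pAm.
  - by move=> x; rewrite mulr_ge0.
  - have := cm _ pAm (indic0 Am).
    rewrite [X in _ = X -> _]integral0_eq => [|x _].
      move=> /eqP; rewrite padde_eq0//.
      + by move=> /andP[_ /eqP].
      + by apply: integral_ge0 => w _; rewrite lee_fin int_dN_ge0.
      + by apply: integral_ge0 => x _; rewrite lee_fin mulr_ge0.
    rewrite indicE; case: (boolP (x \in Am)) => [/set_mem/= lx|_]; last by rewrite mul0r.
    by rewrite mul1r /q max_l// ltW.
have p_ae0 : \forall x \ae M, p x = 0.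
  apply: filterS Am0 => x; rewrite indicE.
  case: (boolP (x \in Am)) => [_|nx _]; first by rewrite mul1r.
  rewrite /p max_l// oppr_le0 leNgt; apply/negP => lx.
  by move/negP: nx; apply; apply/mem_set.
have hp0 (h : R * Om -> R) : measurable_fun setT h -> (forall x, 0 <= h x) ->
    (\int[M]_x (h x * p x)%:E = 0)%E.
  move=> mh h0; rewrite (ae_eq_integral (cst 0%E)) ?integral0//.
    by apply/measurable_EFinP; exact: measurable_funM.
  by apply: filterS p_ae0 => x px _ /=; rewrite px mulr0.
have Ap0 : \forall x \ae M, \1_Ap x * (q x - C) = 0.
  have mAp := pred_fun_measurable fH pAp.
  have iA : Rintegrable M (\1_Ap : _ -> R).
    by apply: (@Rintegrable_bounded _ _ _ _ _ 1) => // x; rewrite ger0_norm// indicE lern1 leq_b1.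
  have iAq : Rintegrable M (fun x => \1_Ap x * q x).
    apply: Rintegrable_le iq; first exact: measurable_funM.
    move=> x; rewrite ger0_norm ?mulr_ge0// indicE.
    by case: (x \in Ap); rewrite ?mul1r ?mul0r.
  have iAC : Rintegrable M (fun x => \1_Ap x * C).
    by under [X in Rintegrable _ X]eq_fun do rewrite mulrC; exact: RintegrableZ.
  have nn x : 0 <= \1_Ap x * (q x - C).
    rewrite indicE; case: (boolP (x \in Ap)) => [/set_mem/= lx|_]; last by rewrite mul0r.
    by rewrite mul1r subr_ge0 /q le_max (ltW lx) orbT.
  have iB : Rintegrable M (fun x => \1_Ap x * (q x - C)).
    by under [X in Rintegrable _ X]eq_fun do rewrite mulrBr; exact: RintegrableB.
  apply: Rint_eq0_ae => //; first exact: RintegrableM iB.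
  rewrite -(RintE iB); congr EFin; apply/eqP; rewrite eq_le; apply/andP; split.
    under eq_Rintegral do rewrite mulrBr.
    rewrite RintB// subr_le0 -lee_fin !RintE//.
    by rewrite -(cm _ pAp (indic0 Ap)) hp0// adde0 dN_le.
  exact: Rint_ge0.
have LE : \forall x \ae M, uncurry01 lam x = L x.
  apply: filterS2 p_ae0 Ap0 => x px; rewrite /L indicE.
  have l0 : 0 <= uncurry01 lam x.
    move: px; rewrite /p => px; rewrite -oppr_le0 -px le_max lexx orbT//.
  have qx : q x = uncurry01 lam x by rewrite /q max_r.
  case: (boolP (x \in Ap)) => [/set_mem/= lx|nx _].
    rewrite mul1r qx => /eqP; rewrite subr_eq0 => /eqP lC.
    by rewrite lC minxx max_r// ltW.
  have lC : uncurry01 lam x <= C.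
    by rewrite leNgt; apply/negP => lx; move/negP: nx; apply; apply/mem_set.
  by rewrite min_r// max_r.
exists L; split => //; split => //.
  move=> x; rewrite L0 ge_max (ltW C0) ge_min lexx//.
move=> h ph h0; have mh := pred_fun_measurable fH ph.
have := cm _ ph h0; rewrite hp0// adde0 => ->.
apply: ae_eq_integral => //.
- by apply/measurable_EFinP; exact: measurable_funM.
- by apply/measurable_EFinP; exact: measurable_funM.
- apply: filterS LE => x lx _ /=; rewrite -lx /q max_r// lx//.
Qed.

End bounded_intensity_exists.

(** * Integrals against the compensated counting process *)

Section real_fubini.
Context d1 d2 (T1 : measurableType d1) (T2 : measurableType d2) (R : realType).
Variables (P1 : probability T1 R) (P2 : probability T2 R).

(** Holds also across sections that are not integrable: the real integral is [fine] of a difference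
    of two Tonelli integrals, default value included. *)
Lemma measurable_Rint2 (f : T1 * T2 -> R) : measurable_fun setT f ->
  measurable_fun setT (fun y => \int[P1]_x f (x, y)).
Proof.
move=> mf; rewrite (_ : (fun y => _) = fun y => fine
   (\int[P1]_s ((EFin \o f)^\+ (s, y)) -
    \int[P1]_s ((EFin \o f)^\- (s, y)))%E).
  have mf' : measurable_fun setT (EFin \o f) by exact/measurable_EFinP.
  apply: measurableT_comp => //; apply: emeasurable_funB.
    by apply: measurable_fun_fubini_tonelli_G => //; exact: measurable_funepos.
  by apply: measurable_fun_fubini_tonelli_G => //; exact: measurable_funeneg.
apply/funext => y; rewrite /Rintegral integralE; congr (fine (_ - _)%E).
  by apply: eq_integral => s _; rewrite !funeposE.
by apply: eq_integral => s _; rewrite !funenegE.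
Qed.

Lemma Rfubini2 (f : T1 * T2 -> R) : Rintegrable (P1 \x P2)%E f ->
  Rintegrable P2 (fun y => \int[P1]_x f (x, y)) /\
  \int[P2]_y (\int[P1]_x f (x, y)) = \int[(P1 \x P2)%E]_z f z.
Proof.
move=> If; have mf := RintegrableM If.
have e : {ae P2, forall y, fubini_G P1 (EFin \o f) y =
    (EFin \o (fun y => \int[P1]_x f (x, y))) y}.
  apply: filterS (ae_integrable2 If) => y iy.
  by rewrite /fubini_G /= RintE.
have mG : measurable_fun setT (EFin \o (fun y => \int[P1]_x f (x, y))).
  by apply/measurable_EFinP; exact: measurable_Rint2.
have mf' : measurable_fun setT (EFin \o f) by exact/measurable_EFinP.
have iG : P2.-integrable setT (fubini_G P1 (EFin \o f)).
  apply/integrableP; split; first exact: (measurable_fubini_G If).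
  apply: le_lt_trans ((integrable21ltyP _ _ mf').1 If).
  apply: ge0_le_integral => //.
  - by apply: measurableT_comp => //; exact: (measurable_fubini_G If).
  - apply: (@measurable_fun_fubini_tonelli_G _ _ _ _ _ P1 (abse \o (EFin \o f))).
      exact: measurableT_comp.
    by move=> x; exact: abse_ge0.
  - move=> y _; apply: le_abse_integral => //.
    exact: measurableT_comp.
have iI : Rintegrable P2 (fun y => \int[P1]_x f (x, y)).
  apply/integrableP; split => //; have /integrableP[_] := iG.
  rewrite (_ : (\int[P2]_x `|fubini_G P1 (EFin \o f) x| =
      \int[P2]_x `|(EFin \o (fun y => (\int[P1]_x f (x, y))%R)) x|)%E)//.
  apply: ae_eq_integral => //.
  - by apply: measurableT_comp => //; exact: (measurable_fubini_G If).
  - by apply: measurableT_comp.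
  - by apply: filterS e => y /= ->.
split => //; apply: EFin_inj; rewrite !RintE// -integral21_prod_meas1//.
apply: ae_eq_integral => //; first exact: (measurable_fubini_G If).
by apply: filterS e => y /= ->.
Qed.

End real_fubini.

Section point_process_integrals.
Context (R : realType) d (Om : measurableType d) (P : probability Om R).
Variables (H : R -> set (set Om)) (N : R -> Om -> nat) (C : R) (L : R * Om -> R).
Hypothesis fH : filtration H.
Hypothesis cN : forall w, counting_path (N ^~ w).
Hypothesis aN : adapted H N.
Hypothesis C0 : 0 < C.
Hypothesis bL : bounded_intensity P H N C L.
Local Notation M := (@U01 R \x P)%E.
Implicit Types (h k : R * Om -> R) (s t : R) (w : Om).

Lemma adapted_measurable t : 0 <= t <= 1 -> measurable_fun setT (N t).
Proof.
move=> t01 _ Y mY; apply: (fH.1 t t01).2; apply: (aN t01).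
by exists Y.
Qed.

Let mN := adapted_measurable.
Let one01 : 0 <= (1 : R) <= 1. Proof. by rewrite ler01 lexx. Qed.

(** The three integrals always run up to time 1; a smaller horizon or an increment is encoded in the
    integrand by [on_itv], which preserves predictability. The time integral is taken under the
    uniform law [U01], so that product measures are probabilities. *)
Definition intN h w := int_dN (fun s => h (s, w)) (N ^~ w) 1.
Definition intL h w := \int[U01]_s (h (s, w) * L (s, w)).
Definition intM h w := intN h w - intL h w.
Definition on_itv s t h : R * Om -> R := fun x => h x * \1_(`]s, t]%classic) x.1.

Lemma intME h w : intM h w = intN h w - intL h w. Proof. by []. Qed.

Lemma intLE h w : intL h w = \int[U01]_s (h (s, w) * L (s, w)). Proof. by []. Qed.

Lemma intNE h w : intN h w = \sum_(i < N 1 w) h (arrival (N ^~ w) i.+1, w).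
Proof. by rewrite /intN int_dNE. Qed.

Lemma arrival01 w i : (i < N 1 w)%N ->
  0 < arrival (N ^~ w) i.+1 /\ arrival (N ^~ w) i.+1 <= 1.
Proof. by move=> iN; have [] := arrivalP (cN w) (ltn0Sn i) iN. Qed.

Lemma eq_intN h k w : (forall s, 0 < s <= 1 -> h (s, w) = k (s, w)) ->
  intN h w = intN k w.
Proof.
move=> hk; rewrite !intNE; apply: eq_bigr => i _; apply: hk.
by have [-> ->] := arrival01 (ltn_ord i).
Qed.

Lemma intND h k w : intN (fun x => h x + k x) w = intN h w + intN k w.
Proof. by rewrite !intNE big_split. Qed.

Lemma intNZ (c : R) h w : intN (fun x => c * h x) w = c * intN h w.
Proof. by rewrite !intNE mulr_sumr. Qed.

Lemma intN_cst (c : R) w : intN (fun=> c) w = c * (N 1 w)%:R.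
Proof. by rewrite intNE sumr_const card_ord mulr_natr. Qed.

Lemma le_intN h k w : (forall x, h x <= k x) -> intN h w <= intN k w.
Proof. by move=> hk; rewrite !intNE; apply: ler_sum => i _. Qed.

Lemma abs_intN h w : `|intN h w| <= intN (fun x => `|h x|) w.
Proof. by rewrite !intNE; exact: ler_norm_sum. Qed.

Lemma intN_on_itv s t w : 0 <= s -> s <= t -> t <= 1 ->
  intN (on_itv s t (fun=> 1)) w = (N t w)%:R - (N s w)%:R.
Proof.
move=> s0 st t1; rewrite -(int_dN_itv (cN w) s0 st t1) intNE int_dNE//.
by apply: eq_bigr => i _; rewrite /on_itv mul1r.
Qed.

Lemma measurable_intN h : measurable_fun setT h -> measurable_fun setT (intN h).
Proof. by move=> mh; exact: measurable_int_dN1. Qed.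

Lemma measurable_intensity : measurable_fun setT L.
Proof. by have [pL _ _] := bL; exact: pred_fun_measurable pL. Qed.

Lemma intensity_bounds x : 0 <= L x <= C. Proof. by have [_ /(_ x)] := bL. Qed.

Lemma measurable_intL h : measurable_fun setT h -> measurable_fun setT (intL h).
Proof.
move=> mh; apply: (@measurable_Rint2 _ _ _ _ _ U01 (fun x => h x * L x)).
by apply: measurable_funM => //; exact: measurable_intensity.
Qed.

Lemma measurable_intM h : measurable_fun setT h -> measurable_fun setT (intM h).
Proof.
by move=> mh; apply: measurable_funB; [exact: measurable_intN|exact: measurable_intL].
Qed.

Lemma Rintegrable_ML h : Rintegrable M h -> Rintegrable M (fun x => h x * L x).
Proof.
move=> ih; apply: Rintegrable_le (RintegrableZ C (Rintegrable_abs ih)).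
  by apply: measurable_funM; [exact: RintegrableM ih|exact: measurable_intensity].
move=> x; rewrite normrM mulrC; have /andP[L0 LC] := intensity_bounds x.
by apply: ler_wpM2r => //; rewrite ger0_norm.
Qed.

Lemma mean_intL h : Rintegrable M h ->
  Rintegrable P (intL h) /\ \int[P]_w intL h w = \int[M]_x (h x * L x).
Proof. by move=> /Rintegrable_ML; exact: Rfubini2. Qed.

Let mean_intN_ge0 h : pred_fun H h -> (forall x, 0 <= h x) ->
  Rintegrable M h ->
  Rintegrable P (intN h) /\ \int[P]_w intN h w = \int[M]_x (h x * L x).
Proof.
move=> ph h0 ih; have [_ _ /(_ h ph h0)] := bL => e.
have mh := pred_fun_measurable fH ph.
have iN : Rintegrable P (intN h).
  apply: Rintegrable_ge0; first exact: measurable_intN.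
    by move=> w; exact: int_dN_ge0.
  rewrite e -(RintE (Rintegrable_ML ih)); exact: ltry.
split => //; apply: EFin_inj; rewrite !RintE//; exact: Rintegrable_ML.
Qed.

Lemma mean_intN h : pred_fun H h -> Rintegrable M h ->
  Rintegrable P (intN h) /\ \int[P]_w intN h w = \int[M]_x (h x * L x).
Proof.
move=> ph ih.
pose hp x := Num.max 0 (h x); pose hm x := Num.max 0 (- h x).
have hE x : h x = hp x + -1 * hm x.
  rewrite /hp /hm; have [h0|h0] := leP 0 (h x).
    by rewrite max_l ?mulr0 ?addr0// oppr_le0.
  by rewrite max_r ?oppr_ge0 ?ltW// add0r mulN1r opprK.
have php : pred_fun H hp by exact: measurable_maxr.
have phm : pred_fun H hm.
  by apply: measurable_maxr => //; exact: measurable_funN.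
have ihp : Rintegrable M hp.
  apply: Rintegrable_le (Rintegrable_abs ih); first exact: pred_fun_measurable php.
  by move=> x; rewrite ger0_norm ?le_max ?lexx// ge_max normr_ge0 ler_norm.
have ihm : Rintegrable M hm.
  apply: Rintegrable_le (Rintegrable_abs ih); first exact: pred_fun_measurable phm.
  by move=> x; rewrite ger0_norm ?le_max ?lexx// ge_max normr_ge0 -normrN ler_norm.
have hp0 x : 0 <= hp x by rewrite le_max lexx.
have hm0 x : 0 <= hm x by rewrite le_max lexx.
have [ip ep] := mean_intN_ge0 php hp0 ihp.
have [im em] := mean_intN_ge0 phm hm0 ihm.
have NE : intN h = fun w => intN hp w + -1 * intN hm w.
  apply/funext => w; rewrite -intNZ -intND; apply: eq_intN => s _; exact: hE.
have im' := RintegrableZ (-1) im.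
split; first by rewrite NE; exact: RintegrableD.
rewrite NE RintD// RintZ// ep em -RintZ//; last exact: Rintegrable_ML.
rewrite -RintD//; first by apply: eq_Rintegral => x _; rewrite hE mulrDl mulrA.
  exact: Rintegrable_ML.
by apply: RintegrableZ; exact: Rintegrable_ML.
Qed.

Lemma mean_intM h : pred_fun H h -> Rintegrable M h ->
  Rintegrable P (intM h) /\ \int[P]_w intM h w = 0.
Proof.
move=> ph ih; have [i1 e1] := mean_intN ph ih; have [i2 e2] := mean_intL ih.
by split; [exact: RintegrableB|rewrite RintB// e1 e2 subrr].
Qed.

Lemma pred_itv s t : 0 <= s -> s <= t -> t <= 1 ->
  pred_fun H (fun x : R * Om => (\1_(`]s, t]%classic) x.1 : R)).
Proof.
move=> s0 st t1; rewrite (_ : (fun x => _) = \1_(`]s, t]%classic `*` [set: Om])).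
  apply: measurable_indic.
  move: st; rewrite le_eqVlt => /orP[/eqP st|st].
    rewrite (_ : _ `*` _ = set0); first exact: (@measurable0 _ (predictable_type H)).
    by apply/seteqP; split => // x [] /=; rewrite in_itv/= st => /andP[]; lra.
  apply: sub_sigma_algebra; right; exists s, t, setT; split => //.
  by apply: (filtration_T fH); rewrite s0 (le_trans (ltW st)).
apply/funext => x; rewrite !indicE; congr (nat_of_bool _)%:R.
by apply/idP/idP => /set_mem h; apply/mem_set => //=; case: h.
Qed.

Lemma pred_on_itv s t h : 0 <= s -> s <= t -> t <= 1 -> pred_fun H h ->
  pred_fun H (on_itv s t h).
Proof. by move=> *; apply: measurable_funM => //; exact: pred_itv. Qed.

(** Processes of this form are the elementary integrands. They vanish off []s, t]], so a sublevel
    set is either a rectangle or the complement of one, according to the sign of the level. *)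
Lemma pred_start s t (U : Om -> R) : 0 <= s -> s <= t -> t <= 1 ->
  measurable_fun setT (U : g_sigma_algebraType (H s) -> R) ->
  pred_fun H (fun x => U x.2 * \1_(`]s, t]%classic) x.1).
Proof.
move=> s0; rewrite le_eqVlt => /orP[/eqP <- t1 mU|st t1 mU].
  rewrite (_ : (fun x => _) = fun=> 0); first exact: measurable_cst.
  apply/funext => x; rewrite indicE memNset ?mulr0//=.
  by rewrite in_itv/= => /andP[]; lra.
have s1 : s <= 1 by rewrite (le_trans (ltW st)).
have mB (B : set R) : measurable B -> H s (U @^-1` B).
  move=> mB; have [sH _] := fH.1 s (introT andP (conj s0 s1)).
  rewrite -(sigma_algebra_id sH) -[X in <<s _ >> X]setTI.
  exact: (mU (@measurableT _ (g_sigma_algebraType (H s))) B mB).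
have mR (B : set R) : measurable B ->
    measurable (`]s, t]%classic `*` (U @^-1` B) : set (predictable_type H)).
  move=> /mB HB; apply: sub_sigma_algebra; right.
  by exists s, t, (U @^-1` B).
have U0 x : ~ `]s, t]%classic x.1 -> U x.2 * \1_(`]s, t]%classic) x.1 = 0.
  by move=> nx; rewrite indicE memNset ?mulr0.
have U1 x : `]s, t]%classic x.1 -> U x.2 * \1_(`]s, t]%classic) x.1 = U x.2.
  by move=> nx; rewrite indicE mem_set ?mulr1.
apply (@measurable_fun_of_le _ (predictable_type H) R) => r.
have [r0|r0] := ltP r 0.
  rewrite (_ : mkset _ = `]s, t]%classic `*` (U @^-1` `]-oo, r])); first exact: mR.
  apply/seteqP; split => x /=.
    have [xs|xs] := pselect (`]s, t]%classic x.1).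
      by rewrite U1//; split => //=; rewrite in_itv.
    by rewrite U0//; lra.
  by move=> [xs]; rewrite in_itv/= U1.
rewrite (_ : mkset _ = ~` (`]s, t]%classic `*` (U @^-1` `]r, +oo[))).
  by apply: (@measurableC _ (predictable_type H)); exact: mR.
apply/seteqP; split => x /=.
  by move=> h [xs]; rewrite /= in_itv/= andbT; move: h; rewrite U1//; lra.
have [xs|xs] := pselect (`]s, t]%classic x.1); last by rewrite U0.
rewrite U1// => h; rewrite leNgt; apply/negP => rU; apply: h; split => //=.
by rewrite in_itv/= andbT.
Qed.

End point_process_integrals.

Section left_counts.
Context (R : realType) d (Om : measurableType d).
Variables (H : R -> set (set Om)) (N : R -> Om -> nat).
Hypothesis fH : filtration H.
Hypothesis cN : forall w, counting_path (N ^~ w).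
Hypothesis aN : adapted H N.
Implicit Types (s t : R) (w : Om) (x : R * Om).

Let one01 : 0 <= (1 : R) <= 1. Proof. by rewrite ler01 lexx. Qed.

Lemma adapted_mfun t : 0 <= t <= 1 ->
  measurable_fun setT (N t : g_sigma_algebraType (H t) -> nat).
Proof.
move=> t01 _ Y mY; rewrite setTI; apply: sub_sigma_algebra.
by apply: (aN t01); exists Y => //; rewrite setTI.
Qed.

Lemma indic_arrival s t w i : 0 <= s -> s <= t -> t <= 1 ->
  \1_(`]s, t]%classic) (arrival (N ^~ w) i) =
  (i <= N t w)%N%:R - (i <= N s w)%N%:R :> R.
Proof.
move=> s0 st t1; have s1 : s <= 1 by exact: le_trans t1.
have t0 : 0 <= t by exact: le_trans st.
have [_ ndN _ _] := cN w.
rewrite indicE mem_setE in_itv/= ltNge !arrival_le ?s0 ?t0//.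
have [ia|ia] /= := leqP i (N s w).
  by rewrite (leq_trans ia (ndN _ _ s0 st t1)) subrr.
by rewrite subr0.
Qed.

(* The left limit of [N] on ]0, 1]. *)
Definition left_count x : R :=
  if arrival (N ^~ x.2) (N x.1 x.2) == x.1 then (N x.1 x.2).-1%:R
  else (N x.1 x.2)%:R.

Lemma left_count_arrival w i : (i < N 1 w)%N ->
  left_count (arrival (N ^~ w) i.+1, w) = i%:R.
Proof.
move=> iN; have [_ _ e _] := arrivalP (cN w) (ltn0Sn i) iN.
by rewrite /left_count /= e eqxx.
Qed.

Lemma left_count_bound x : 0 <= left_count x <= (N x.1 x.2)%:R.
Proof. by rewrite /left_count; case: ifPn => _; apply/andP; split; rewrite ?ler0n// ler_nat// leq_pred. Qed.

Lemma arrival_leN w i t : 0 <= t <= 1 ->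
  (arrival (N ^~ w) i <= t) = (i <= N t w)%N.
Proof. by move=> t01; rewrite arrival_le. Qed.

(** The left limit counts the jumps strictly before [s]. If [s] is itself an arrival time its own
    jump is removed by the predecessor in [left_count]. *)
Lemma left_count_ge s w k : 0 < s <= 1 -> (0 < k)%N ->
  (k%:R <= left_count (s, w)) = (arrival (N ^~ w) k < s).
Proof.
move=> /andP[s0 s1] k0; have s01 : 0 <= s <= 1 by rewrite ltW.
have [_ ndN _ _] := cN w.
have as_ : arrival (N ^~ w) (N s w) <= s by rewrite arrival_le.
have ar0 := arrival_ge0 (N ^~ w).
rewrite /left_count /=; case: ifPn => [/eqP e|ne]; rewrite ler_nat.
  apply/idP/idP => [kN|ks].
    rewrite lt_neqAle arrival_leN// (leq_trans kN (leq_pred _)) andbT.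
    apply/negP => /eqP ek.
    have kN1 : (k <= N 1 w)%N.
      by rewrite (leq_trans kN)// (leq_trans (leq_pred _))// ndN// ltW.
    have [_ _ ek' _] := arrivalP (cN w) k0 kN1.
    by move: kN; rewrite -ek' ek -ltnS prednK ?ltnn//; rewrite -ek ek'.
  have kN : (k <= N s w)%N by rewrite -arrival_leN// ltW.
  have : k != N s w by apply: contraTneq ks => ->; rewrite e ltxx.
  move=> kn; have kN' : (k < N s w)%N by rewrite ltn_neqAle kn.
  by rewrite -ltnS prednK// (leq_ltn_trans _ kN').
apply/idP/idP => [kN|ks]; last by rewrite -arrival_leN// ltW.
apply: (@le_lt_trans _ _ (arrival (N ^~ w) (N s w))).
  rewrite arrival_leN ?ar0 ?(le_trans as_)//.
  apply: (leq_trans kN); rewrite -arrival_leN ?lexx// ar0 (le_trans as_)//.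
by rewrite lt_neqAle ne.
Qed.

(** Left limits are predictable: if the [k]-th jump comes strictly before [s], there is a rational
    [q] in between, so the superlevel sets are countable unions of rectangles over []q, 1]] whose
    bases are known at time [q]. *)
Lemma pred_left_count : pred_fun H (on_itv 0 1 left_count).
Proof.
have cE x : `]0, 1]%classic x.1 -> on_itv 0 1 left_count x = left_count x.
  by move=> x01; rewrite /on_itv indicE mem_set ?mulr1.
have c0 x : ~ `]0, 1]%classic x.1 -> on_itv 0 1 left_count x = 0.
  by move=> x01; rewrite /on_itv indicE memNset ?mulr0.
apply (@measurable_fun_of_le _ (predictable_type H) R) => r.
have [r0|r0] := ltP r 0.
  rewrite (_ : mkset _ = set0); first exact: (@measurable0 _ (predictable_type H)).
  apply/seteqP; split => // x /=.
  have [x01|x01] := pselect (`]0, 1]%classic x.1); last by rewrite c0//; lra.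
  by rewrite cE//; have /andP[] := left_count_bound x; lra.
(* The least integer above [r]: the left limit is an integer, so it exceeds [r] exactly when it is
   at least [k]. *)
pose k := (Num.truncn r).+1.
pose rq (q : rat) : R := ratr q.
pose A (q : rat) : set (predictable_type H) :=
  if 0 <= rq q < 1 then `](rq q), 1]%classic `*` [set w | (k <= N (rq q) w)%N]
  else set0.
rewrite (_ : mkset _ = ~` \bigcup_q A q).
  apply: (@measurableC _ (predictable_type H)).
  apply: bigcupT_measurable_rat => q; rewrite /A.
  case: ifPn => [/andP[q0 q1]|_]; last exact: (@measurable0 _ (predictable_type H)).
  apply: sub_sigma_algebra; right.
  exists (rq q), 1, [set w | (k <= N (rq q) w)%N]; split => //.
  apply: (@aN (rq q)); first by rewrite q0 ltW.
  by exists [set n | (k <= n)%N] => //; rewrite setTI.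
have key x : (exists q, A q x) <-> `]0, 1]%classic x.1 /\ r < left_count x.
  case: x => s w /=; split.
    move=> [q]; rewrite /A; case: ifPn => // /andP[q0 q1] [/=].
    rewrite !in_itv/= => /andP[qs s1] kN.
    have s0 : 0 < s by exact: le_lt_trans qs.
    rewrite s0 s1; split => //.
    apply: (@lt_le_trans _ _ k%:R); first by rewrite real_truncnS_gt// num_real.
    rewrite left_count_ge ?s0//; apply: le_lt_trans qs.
    by rewrite arrival_leN ?q0 ?ltW.
  move=> [+ rl]; rewrite in_itv/= => s01; have /andP[s0 s1] := s01.
  have kl : k%:R <= left_count (s, w).
    move: rl; rewrite /left_count; case: ifPn => _; rewrite -truncn_lt_nat// ler_nat//.
  rewrite left_count_ge// in kl.
  have [q] := rat_in_itvoo kl; rewrite in_itv/= => /andP[aq qs].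
  have q0 : 0 <= rq q :> R by rewrite (le_trans (arrival_ge0 _ _) (ltW aq)).
  have q1 : rq q < 1 :> R by exact: lt_le_trans s1.
  exists q; rewrite /A q0 q1/=; split => /=; first by rewrite in_itv/= qs.
  by rewrite -arrival_leN ?q0 ?ltW.
apply/seteqP; split => x /=.
  move=> xr [q _ Aq]; have [x01 rx] := (key x).1 (ex_intro _ q Aq).
  by move: xr; rewrite cE//; lra.
move=> nx; have [x01|x01] := pselect (`]0, 1]%classic x.1); last by rewrite c0.
rewrite cE// leNgt; apply/negP => rx; apply: nx.
by have [q Aq] := (key x).2 (conj x01 rx); exists q.
Qed.

End left_counts.

(** * Factorial moments of the counting process *)

Section counting_sums.
Context (R : realType).

Lemma sum_ord_affine (m : nat) (a : R) :
  \sum_(i < m) (i%:R - a) = m%:R * (m%:R - 1) / 2 - m%:R * a.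
Proof.
elim: m => [|m ih]; first by rewrite big_ord0; field.
by rewrite big_ord_recr/= ih -[m.+1%:R]natr1; field.
Qed.

Lemma sum_ord_falling2 (m : nat) :
  \sum_(i < m) (i%:R * (i%:R - 1)) =
  m%:R * (m%:R - 1) * (m%:R - 2) / 3 :> R.
Proof.
elim: m => [|m ih]; first by rewrite big_ord0; field.
by rewrite big_ord_recr/= ih -[m.+1%:R]natr1; field.
Qed.

Lemma sum_ord_ltn (n m : nat) (f : nat -> R) : (m <= n)%N ->
  \sum_(i < n) (f i * (i < m)%N%:R) = \sum_(i < m) f i.
Proof.
move=> mn; rewrite [RHS](big_ord_widen _ f mn) [RHS]big_mkcond/=.
by apply: eq_bigr => i _; case: ifPn => _; rewrite ?mulr1 ?mulr0.
Qed.

End counting_sums.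

Section U01_itv.
Context (R : realType).

Lemma U01_indic (s t : R) : 0 <= s -> s <= t -> t <= 1 ->
  \int[U01]_u \1_(`]s, t]%classic) u = t - s.
Proof.
move=> s0 st t1; have mI : measurable (`]s, t]%classic : set R) by exact: measurable_itv.
rewrite /Rintegral integral_U01; last exact/measurable_EFinP/measurable_indic.
rewrite integral_indic// setIidl; last first.
  move=> x /=; rewrite !in_itv/= => /andP[sx xt]; rewrite (le_trans xt t1) andbT.
  by rewrite ltW// (le_lt_trans s0).
rewrite [X in fine X](_ : _ = if s < t then (t%:E - s%:E)%E else 0%E); last first.
  by have := @lebesgue_measure_itv R `]s, t]; rewrite /= lte_fin.
case: ltP => [_|ts]; first by rewrite -EFinB.
by apply/esym/eqP; rewrite subr_eq0 eq_le ts st.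
Qed.

End U01_itv.

Section martingale_moments.
Context (R : realType) d (Om : measurableType d) (P : probability Om R).
Variables (H : R -> set (set Om)) (N : R -> Om -> nat) (C : R) (L : R * Om -> R).
Hypothesis fH : filtration H.
Hypothesis cN : forall w, counting_path (N ^~ w).
Hypothesis aN : adapted H N.
Hypothesis C0 : 0 < C.
Hypothesis bL : bounded_intensity P H N C L.
Local Notation M := (@U01 R \x P)%E.
Local Notation intN := (intN N).
Local Notation intL := (intL L).
Local Notation intM := (intM N L).
Implicit Types (h k : R * Om -> R) (s t : R) (w : Om).

Let mN := adapted_measurable fH aN.

Lemma mean_M_start (U : Om -> R) s t : 0 <= s -> s <= t -> t <= 1 ->
  Rintegrable P U ->
  Rintegrable M (fun x => U x.2 * \1_(`]s, t]%classic) x.1) /\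
  \int[M]_x (U x.2 * \1_(`]s, t]%classic) x.1) = (t - s) * \int[P]_w U w.
Proof.
move=> s0 st t1 iU; have mU := RintegrableM iU.
have mU2 : measurable_fun setT (fun x : R * Om => U x.2).
  exact: (measurableT_comp mU).
have iU2 : Rintegrable M (fun x => U x.2).
  apply/(integrable21ltyP U01 P); first exact/measurable_EFinP.
  have /integrableP[_] := iU; rewrite (_ : (\int[P]_x `|_|)%E =
    (\int[P]_y (\int[@U01 R]_x `|(EFin \o (fun x0 : R * Om => U x0.2)) (x, y)|))%E)//.
  apply: eq_integral => w _ /=; rewrite integral_cst//=.
  rewrite [X in (_ * X)%E](_ : _ = 1%E) ?mule1//; exact: probability_setT.
have i1 : Rintegrable M (fun x => U x.2 * \1_(`]s, t]%classic) x.1).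
  apply: Rintegrable_le (Rintegrable_abs iU2).
    apply: measurable_funM => //; apply: measurableT_comp => //.
  move=> x; rewrite normrM indicE.
  by case: (x.1 \in _); rewrite ?normr1 ?mulr1 ?normr0 ?mulr0.
split => //; have [_ <-] := Rfubini2 i1.
rewrite -RintZ//; apply: eq_Rintegral => w _.
have mI : measurable (`]s, t]%classic : set R) by exact: measurable_itv.
by rewrite /= (RintZ (U w) (Rintegrable_indic U01 mI)) U01_indic// mulrC.
Qed.

Lemma counting_increment_mean s t : 0 <= s -> s <= t -> t <= 1 ->
  Rintegrable P (fun w => (N t w)%:R - (N s w)%:R) /\
  \int[P]_w ((N t w)%:R - (N s w)%:R) <= C * (t - s).
Proof.
move=> s0 st t1.
have [i1 e1] := mean_M_start s0 st t1 (Rintegrable_cst P 1).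
rewrite Rint_cst mulr1 in e1.
have E : (fun x : R * Om => 1 * \1_(`]s, t]%classic) x.1) = on_itv s t (fun=> 1) by [].
rewrite E in i1 e1.
have p1 : pred_fun H (on_itv s t (fun=> 1) : R * Om -> R).
  by apply: pred_on_itv => //; exact: measurable_cst.
have [iN eN] := mean_intN fH cN aN bL p1 i1.
have NE w : intN (on_itv s t (fun=> 1)) w = (N t w)%:R - (N s w)%:R.
  exact: intN_on_itv.
split; first by rewrite -(funext NE).
under eq_Rintegral do rewrite -NE.
rewrite eN -e1 -RintZ//; apply: Rint_le => //.
- exact: (Rintegrable_ML fH bL).
- exact: RintegrableZ.
- move=> x; rewrite mulrC; apply: ler_wpM2r; last by have /andP[] := intensity_bounds bL x.
  by rewrite /on_itv mul1r.
Qed.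

Let N0 w : N 0 w = 0%N. Proof. by have [] := cN w. Qed.

Lemma counting_mean : Rintegrable P (fun w => (N 1 w)%:R) /\
  \int[P]_w (N 1 w)%:R <= C.
Proof.
have := counting_increment_mean (lexx 0) ler01 (lexx 1).
have E : (fun w => (N 1 w)%:R - (N 0 w)%:R) = (fun w => (N 1 w)%:R : R).
  by apply/funext => w; rewrite N0 subr0.
by rewrite E subr0 mulr1.
Qed.

(** With [n = N t - N s], [n (n - 1)] is twice the integral over []s, t]] of the predictable
    function [N(u-) - N s] against [dN]. Replacing [dN] by [L du <= C du] and bounding the integrand
    by [n] reduces the claim to the first moment. *)
Lemma counting_increment_moment2 s t : 0 <= s -> s <= t -> t <= 1 ->
  Rintegrable P (fun w => ((N t w)%:R - (N s w)%:R) * ((N t w)%:R - (N s w)%:R - 1)) /\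
  \int[P]_w (((N t w)%:R - (N s w)%:R) * ((N t w)%:R - (N s w)%:R - 1)) <=
    2 * (C * (t - s)) ^+ 2.
Proof.
move=> s0 st t1.
have s1 : s <= 1 by exact: le_trans t1.
have t0 : 0 <= t by exact: le_trans st.
pose k (x : R * Om) := on_itv s t (on_itv 0 1 (left_count N)) x -
  (N s x.2)%:R * \1_(`]s, t]%classic) x.1.
have pk : pred_fun H k.
  apply: measurable_funB; first by apply: pred_on_itv => //; exact: pred_left_count.
  apply: (pred_start fH (U := fun w => (N s w)%:R)) => //.
  apply: measurableT_comp => //; apply: adapted_mfun => //.
  by rewrite s0.
have mk := pred_fun_measurable fH pk.
have kE u w : `]s, t]%classic u -> k (u, w) = left_count N (u, w) - (N s w)%:R.
  move=> ust; have u01 : `]0, 1]%classic u.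
    move: ust; rewrite /= !in_itv/= => /andP[su ut].
    by rewrite (le_lt_trans s0 su) (le_trans ut).
  by rewrite /k /on_itv !indicE /= !mem_set// !mulr1.
have kE0 u w : ~ `]s, t]%classic u -> k (u, w) = 0.
  by move=> ust; rewrite /k /on_itv /= [\1_(`]s, t]%classic) u]indicE memNset// !mulr0 subrr.
have k0 x : 0 <= k x.
  case: x => u w; have [ust|ust] := pselect (`]s, t]%classic u); last by rewrite kE0.
  rewrite kE// subr_ge0; move: ust; rewrite /= in_itv/= => /andP[su ut].
  have [->|n0] := posnP (N s w); first by have /andP[] := left_count_bound N (u, w).
  rewrite left_count_ge ?(le_lt_trans s0) ?(le_trans ut)//.
  by apply: le_lt_trans su; rewrite arrival_leN// s0.
have kU x : k x <= ((N t x.2)%:R - (N s x.2)%:R) * \1_(`]s, t]%classic) x.1.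
  case: x => u w; have [ust|ust] := pselect (`]s, t]%classic u); last first.
    by rewrite kE0// indicE memNset// mulr0.
  rewrite kE//= indicE mem_set// mulr1 lerD2r.
  have /andP[_ /le_trans] := left_count_bound N (u, w); apply.
  rewrite ler_nat; have [_ ndN _ _] := cN w; apply: ndN => //=;
    by move: ust; rewrite /= in_itv/= => /andP[su ut] //; rewrite (le_trans s0 (ltW su)).
have [iD eD] := counting_increment_mean s0 st t1.
have [iU eU] := mean_M_start s0 st t1 iD.
have ik : Rintegrable M k.
  by apply: Rintegrable_le iU => // x; rewrite ger0_norm// kU.
have [iN eN] := mean_intN fH cN aN bL pk ik.
have NE w : 2 * intN k w = ((N t w)%:R - (N s w)%:R) * ((N t w)%:R - (N s w)%:R - 1).
  have [_ ndN _ _] := cN w.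
  rewrite intNE//.
  transitivity (2 * (\sum_(i < N 1 w) ((i%:R - (N s w)%:R) * (i < N t w)%N%:R) -
     \sum_(i < N 1 w) ((i%:R - (N s w)%:R) * (i < N s w)%N%:R)) : R).
    congr (_ * _); rewrite -sumrB; apply: eq_bigr => i _.
    have [a0 a1] := arrival01 cN (ltn_ord i).
    have e01 : \1_(`]0, 1]%classic) (arrival (N ^~ w) i.+1) = 1 :> R.
      by rewrite indicE mem_set//= in_itv/= a0 a1.
    rewrite /k /on_itv /= left_count_arrival// e01 indic_arrival//.
    by rewrite mulr1; ring.
  rewrite !(sum_ord_ltn (fun i => i%:R - (N s w)%:R)) ?ndN//.
  by rewrite !sum_ord_affine; field.
split.
  by rewrite -(funext NE); exact: RintegrableZ.
under eq_Rintegral do rewrite -NE.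
rewrite RintZ// ler_pM2l// eN.
apply: (@le_trans _ _ (C * \int[M]_x k x)).
  rewrite -RintZ//; apply: Rint_le => //.
  - exact: (Rintegrable_ML fH bL).
  - exact: RintegrableZ.
  - by move=> x; rewrite mulrC; apply: ler_wpM2r => //; have /andP[] := intensity_bounds bL x.
rewrite expr2 -mulrA ler_pM2l//.
apply: (le_trans (Rint_le ik iU kU)); rewrite eU.
by apply: ler_wpM2l; rewrite ?subr_ge0.
Qed.

(** Same mechanism one order higher: [n (n - 1) (n - 2)] is three times the integral of
    [N(u-) (N(u-) - 1)] against [dN], whence [3 C * 2 C ^ 2]. The other terms come from [n ^ 3 = n
    (n - 1) (n - 2) + 3 n (n - 1) + n]. *)
Lemma counting_moment3 : Rintegrable P (fun w => (N 1 w)%:R ^+ 3) /\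
  \int[P]_w ((N 1 w)%:R ^+ 3) <= 6 * C ^+ 3 + 6 * C ^+ 2 + C.
Proof.
have [i1 e1] := counting_mean.
have [i2 e2] := counting_increment_moment2 (lexx 0) ler01 (lexx 1).
have {}i2 : Rintegrable P (fun w => (N 1 w)%:R * ((N 1 w)%:R - 1)).
  by move: i2; under eq_fun do rewrite N0 subr0.
have {}e2 : \int[P]_w ((N 1 w)%:R * ((N 1 w)%:R - 1)) <= 2 * C ^+ 2.
  by move: e2; under eq_Rintegral do rewrite N0 subr0; rewrite subr0 mulr1.
pose k (x : R * Om) := on_itv 0 1 (left_count N) x * (on_itv 0 1 (left_count N) x - 1).
have pk : pred_fun H k.
  have := pred_left_count cN aN => pl.
  by apply: measurable_funM => //; apply: measurable_funB.
have mk := pred_fun_measurable fH pk.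
have nn (n : nat) : 0 <= n%:R * (n%:R - 1) :> R.
  by case: n => [|n]; rewrite ?mul0r// mulr_ge0// subr_ge0 ler1n.
have lcE x : exists n : nat, on_itv 0 1 (left_count N) x = n%:R.
  rewrite /on_itv indicE; case: (x.1 \in _); last by exists 0%N; rewrite mulr0.
  rewrite mulr1 /left_count; case: ifPn => _; last by exists (N x.1 x.2).
  by exists (N x.1 x.2).-1.
have k0 x : 0 <= k x by rewrite /k; have [n ->] := lcE x; exact: nn.
have kU x : k x <= (N 1 x.2)%:R * ((N 1 x.2)%:R - 1) * \1_(`]0, 1]%classic) x.1.
  case: x => u w; have [u01|u01] := pselect (`]0, 1]%classic u); last first.
    by rewrite /k /on_itv indicE memNset// !mulr0 mul0r.
  have : on_itv 0 1 (left_count N) (u, w) <= (N 1 w)%:R.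
    rewrite /on_itv indicE mem_set// mulr1.
    have /andP[_ /le_trans] := left_count_bound N (u, w); apply.
    rewrite ler_nat; have [_ ndN _ _] := cN w; apply: ndN => //=;
      by move: u01; rewrite /= in_itv/= => /andP[/ltW].
  rewrite /k; have [n ->] := lcE (u, w); rewrite /= indicE mem_set// mulr1 ler_nat.
  case: n => [|n] nN; first by rewrite mul0r; exact: nn.
  by apply: ler_pM; rewrite ?ler0n ?subr_ge0 ?ler1n ?lerD2r ?ler_nat.
have [iU eU] := mean_M_start (lexx 0) ler01 (lexx 1) i2.
have ik : Rintegrable M k.
  by apply: Rintegrable_le iU => // x; rewrite ger0_norm// kU.
have [iN eN] := mean_intN fH cN aN bL pk ik.
have NE w : 3 * intN k w = (N 1 w)%:R * ((N 1 w)%:R - 1) * ((N 1 w)%:R - 2).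
  rewrite intNE// (eq_bigr (fun i : 'I__ => i%:R * (i%:R - 1))).
    by rewrite sum_ord_falling2; field.
  move=> i _; rewrite /k /on_itv /= left_count_arrival//.
  have [a0 a1] := arrival01 cN (ltn_ord i).
  by rewrite indicE mem_set ?mulr1//= in_itv/= a0 a1.
have e3 : \int[P]_w (3 * intN k w) <= 6 * C ^+ 3.
  rewrite RintZ// eN.
  have h : \int[M]_x (k x * L x) <= C * \int[M]_x k x.
    rewrite -RintZ//; apply: Rint_le => //.
    - exact: (Rintegrable_ML fH bL).
    - exact: RintegrableZ.
    - by move=> x; rewrite mulrC; apply: ler_wpM2r => //; have /andP[] := intensity_bounds bL x.
  have h2 : \int[M]_x k x <= 2 * C ^+ 2.
    by apply: (le_trans (Rint_le ik iU kU)); rewrite eU subr0 mul1r.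
  have h3 : C * \int[M]_x k x <= C * (2 * C ^+ 2) by rewrite ler_pM2l.
  by rewrite exprS; lra.
have E w : (N 1 w)%:R ^+ 3 = 3 * intN k w +
    (3 * ((N 1 w)%:R * ((N 1 w)%:R - 1)) + (N 1 w)%:R) by rewrite NE; ring.
have j3 := RintegrableZ 3 iN; have j2 := RintegrableD (RintegrableZ 3 i2) i1.
rewrite (funext E); split; first exact: RintegrableD.
rewrite RintD// RintD//; last exact: RintegrableZ.
rewrite [X in _ + (X + _)]RintZ//; lra.
Qed.

Lemma counting_moment2 : Rintegrable P (fun w => (N 1 w)%:R ^+ 2) /\
  \int[P]_w ((N 1 w)%:R ^+ 2) <= 2 * C ^+ 2 + C.
Proof.
have [i1 e1] := counting_mean.
have [i2 e2] := counting_increment_moment2 (lexx 0) ler01 (lexx 1).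
have {}i2 : Rintegrable P (fun w => (N 1 w)%:R * ((N 1 w)%:R - 1)).
  by move: i2; under eq_fun do rewrite N0 subr0.
have {}e2 : \int[P]_w ((N 1 w)%:R * ((N 1 w)%:R - 1)) <= 2 * C ^+ 2.
  by move: e2; under eq_Rintegral do rewrite N0 subr0; rewrite subr0 mulr1.
have E w : (N 1 w)%:R ^+ 2 = (N 1 w)%:R * ((N 1 w)%:R - 1) + (N 1 w)%:R :> R by ring.
rewrite (funext E); split; first exact: RintegrableD.
by rewrite RintD//; lra.
Qed.

End martingale_moments.

Lemma Rint_abs_le d (T : measurableType d) (R : realType) (P : probability T R)
    (f : T -> R) (B : R) : measurable_fun setT f -> (forall x, `|f x| <= B) ->
  `|\int[P]_x f x| <= B.
Proof.
move=> mf fB; have If := Rintegrable_bounded P mf fB.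
apply: (le_trans (Rint_abs If)); apply: Rint_le_cst => //.
exact: Rintegrable_abs.
Qed.

(** Both sides are sums over pairs of distinct indices, and the pairs on the left are dominated one
    by one. With the bounds [a] equal to a constant on a cell, this says that the square of an
    integral against [dN] and the integral of the square differ only through pairs of jumps. *)
Lemma sum_sqr_dominated (R : realType) (n : nat) (g a : nat -> R) :
  (forall i, `|g i| <= a i) ->
  `|(\sum_(i < n) g i) ^+ 2 - \sum_(i < n) g i ^+ 2| <=
  (\sum_(i < n) a i) ^+ 2 - \sum_(i < n) a i ^+ 2.
Proof.
move=> ga; elim: n => [|n ih]; first by rewrite !big_ord0 !subr0 expr0n/= normr0.
rewrite !big_ord_recr/=.
set S := \sum_(i < n) g i in ih *; set Q := \sum_(i < n) g i ^+ 2 in ih *.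
set A := \sum_(i < n) a i in ih *; set B := \sum_(i < n) a i ^+ 2 in ih *.
have SA : `|S| <= A.
  by apply: (le_trans (ler_norm_sum _ _ _)); apply: ler_sum => i _.
have -> : (S + g n) ^+ 2 - (Q + g n ^+ 2) = S ^+ 2 - Q + 2 * (S * g n) by ring.
have -> : (A + a n) ^+ 2 - (B + a n ^+ 2) = A ^+ 2 - B + 2 * (A * a n) by ring.
apply: (le_trans (ler_normD _ _)); apply: lerD => //.
by rewrite normrM ger0_norm// ler_pM2l// normrM; apply: ler_pM.
Qed.

(** Each bisection halves the bound, because [2 (u / 2) ^ 2 = u ^ 2 / 2]. It turns a local estimate
    of second order into an exact identity, in place of limits of sums over partitions. *)
Lemma additive_quadratic_eq0 (R : realType) (a : R -> R -> R) (c : R) :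
  (forall s t, 0 <= s -> s <= t -> t <= 1 -> `|a s t| <= c * (t - s) ^+ 2) ->
  (forall s t u, 0 <= s -> s <= t -> t <= u -> u <= 1 -> a s u = a s t + a t u) ->
  forall s t, 0 <= s -> s <= t -> t <= 1 -> a s t = 0.
Proof.
move=> ac aD.
have h m : forall s t, 0 <= s -> s <= t -> t <= 1 ->
    `|a s t| <= c * (t - s) ^+ 2 / 2 ^+ m.
  elim: m => [|m ih] s t s0 st t1; first by rewrite expr0 divr1 ac.
  pose v := (s + t) / 2.
  have sv : s <= v by rewrite /v; lra.
  have vt : v <= t by rewrite /v; lra.
  rewrite (aD s v t)//; apply: (le_trans (ler_normD _ _)).
  have h1 := ih s v s0 sv (le_trans vt t1).
  have h2 := ih v t (le_trans s0 sv) vt t1.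
  apply: (le_trans (lerD h1 h2)); rewrite /v.
  have := exprS (2 : R) m; have : (2 : R) ^+ m != 0 by rewrite expf_neq0.
  move: (2 ^+ m) (2 ^+ m.+1) => p q p0 ->.
  by rewrite le_eqVlt; apply/orP; left; apply/eqP; field.
move=> s t s0 st t1; apply/eqP; rewrite -normr_le0; apply/ler_addgt0Pl => e e0.
rewrite addr0; set b := c * (t - s) ^+ 2 in h.
have b0 : 0 <= b by apply: le_trans (ac _ _ s0 st t1).
have [m bm] : exists m : nat, b / e < 2 ^+ m.
  exists (Num.truncn (b / e)).+1.
  apply: (@lt_le_trans _ _ (Num.truncn (b / e)).+1%:R).
    by rewrite real_truncnS_gt// num_real.
  by rewrite -natrX ler_nat; apply: ltnW; exact: ltn_expl.
apply: (le_trans (h m _ _ s0 st t1)); rewrite ler_pdivrMr ?exprn_gt0//.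
by rewrite -/b [leRHS]mulrC -ler_pdivrMr// ltW.
Qed.

(** * Adaptedness, orthogonality and isometry of integrals against the compensated process *)

Section stochastic_integral.
Context (R : realType) d (Om : measurableType d) (P : probability Om R).
Variables (H : R -> set (set Om)) (N : R -> Om -> nat) (C : R) (L : R * Om -> R).
Hypothesis fH : filtration H.
Hypothesis cN : forall w, counting_path (N ^~ w).
Hypothesis aN : adapted H N.
Hypothesis C0 : 0 < C.
Hypothesis bL : bounded_intensity P H N C L.
Local Notation M := (@U01 R \x P)%E.
Local Notation intN := (intN N).
Local Notation intL := (intL L).
Local Notation intM := (intM N L).
Variables (h : R * Om -> R) (K : R).
Hypothesis ph : pred_fun H h.
Hypothesis hK : forall x, `|h x| <= K.
Implicit Types (k : R * Om -> R) (s t : R) (w : Om).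

Let mN := adapted_measurable fH aN.
Let one01 : 0 <= (1 : R) <= 1. Proof. by rewrite ler01 lexx. Qed.
Let K0 : 0 <= K. Proof. exact: le_trans (hK (0, point)). Qed.
Let mh : measurable_fun setT h. Proof. exact: pred_fun_measurable ph. Qed.
Let mL := measurable_intensity fH bL.
Let L01 := intensity_bounds bL.

Lemma on_itv_bound s t x : `|on_itv s t h x| <= K * \1_(`]s, t]%classic) x.1.
Proof.
rewrite /on_itv normrM indicE; case: (x.1 \in _) => /=.
  by rewrite normr1 !mulr1.
by rewrite normr0 !mulr0.
Qed.

Lemma on_itv_boundK s t x : `|on_itv s t h x| <= K.
Proof.
by apply: (le_trans (on_itv_bound s t x)); rewrite -[leRHS]mulr1 ler_wpM2l.
Qed.

Lemma measurable_on_itv s t k : measurable_fun setT k ->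
  measurable_fun setT (on_itv s t k).
Proof.
move=> mk; apply: measurable_funM => //; apply: measurableT_comp => //.
Qed.

Lemma on_itvD s t u k : s <= t -> t <= u ->
  on_itv s u k = fun x => on_itv s t k x + on_itv t u k x.
Proof.
move=> st tu; apply/funext => x; rewrite /on_itv -mulrDr; congr (_ * _).
rewrite !indicE !mem_setE !in_itv/= -natrD; congr (_%:R).
have [xt|tx] := leP x.1 t.
  by rewrite (le_trans xt tu); case: (s < x.1).
by rewrite (le_lt_trans st tx); case: (x.1 <= u).
Qed.

Let section_bounded k (B : R) w : measurable_fun setT k -> (forall x, `|k x| <= B) ->
  Rintegrable U01 (fun s => k (s, w) * L (s, w)).
Proof.
move=> mk kB; apply: (@Rintegrable_bounded _ _ _ _ _ (B * C)).
  apply: measurable_funM.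
    exact: (measurableT_comp mk).
  exact: (measurableT_comp mL).
move=> s; rewrite normrM; apply: ler_pM => //.
by have /andP[L0 LC] := L01 (s, w); rewrite ger0_norm.
Qed.

Lemma intL_bound k (B : R) w : measurable_fun setT k -> (forall x, `|k x| <= B) ->
  `|intL k w| <= B * C.
Proof.
move=> mk kB; apply: Rint_abs_le.
  by apply: measurable_funM; [exact: (measurableT_comp mk)|exact: (measurableT_comp mL)].
move=> s; rewrite normrM; apply: ler_pM => //.
by have /andP[L0 LC] := L01 (s, w); rewrite ger0_norm.
Qed.

Lemma intL_on_itv_bound s t w : 0 <= s -> s <= t -> t <= 1 ->
  `|intL (on_itv s t h) w| <= K * C * (t - s).
Proof.
move=> s0 st t1.
have i1 : Rintegrable U01 (\1_(`]s, t]%classic) : R -> R).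
  by apply: Rintegrable_indic; exact: measurable_itv.
have mk := measurable_on_itv s t mh.
have i2 := section_bounded w mk (on_itv_boundK s t).
apply: (le_trans (Rint_abs i2)); rewrite -(U01_indic s0 st t1) -RintZ//.
apply: Rint_le; [exact: Rintegrable_abs|exact: RintegrableZ|move=> u].
rewrite normrM mulrAC; apply: ler_pM => //; first exact: on_itv_bound.
by have /andP[L0 LC] := L01 (u, w); rewrite ger0_norm.
Qed.

Lemma intN_bound k (B : R) w : (forall x, `|k x| <= B) ->
  `|intN k w| <= B * (N 1 w)%:R.
Proof.
move=> kB; apply: (le_trans (abs_intN cN _ _)); rewrite -(intN_cst cN).
exact: le_intN.
Qed.

Lemma intM_bound k (B : R) w : measurable_fun setT k -> (forall x, `|k x| <= B) ->
  `|intM k w| <= B * ((N 1 w)%:R + C).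
Proof.
move=> mk kB; rewrite mulrDr; apply: (le_trans (ler_normB _ _)).
by apply: lerD; [exact: intN_bound|exact: intL_bound].
Qed.

Lemma intM_on_itvD s t u w : s <= t -> t <= u ->
  intM (on_itv s u h) w = intM (on_itv s t h) w + intM (on_itv t u h) w.
Proof.
move=> st tu; rewrite !intME (on_itvD _ st tu) (intND cN).
rewrite [X in _ - X](_ : _ = intL (on_itv s t h) w + intL (on_itv t u h) w).
  by ring.
rewrite !intLE -RintD//.
- by apply: eq_Rintegral => v _; rewrite mulrDl.
- by apply: section_bounded (on_itv_boundK s t); exact: measurable_on_itv.
- by apply: section_bounded (on_itv_boundK t u); exact: measurable_on_itv.
Qed.

Section adapted.
Variable (t : R).
Hypothesis t01 : 0 <= t <= 1.
Let U := g_sigma_algebraType (H t).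
Let Dt := (`]0, t]%classic `*` [set: Om]).

Let pred_restr (E : set (predictable_type H)) : measurable E ->
  measurable (E `&` Dt : set (R * U)).
Proof.
have mD : measurable (Dt : set (R * U)) by exact: measurableX.
move: E; apply: smallest_sub.
  split.
  - by rewrite /= set0I; exact: measurable0.
  - move=> A mA /=; rewrite setTD setIC -setDE.
    rewrite (_ : Dt `\` A = Dt `\` (A `&` Dt)); first exact: measurableD.
    by rewrite setDIr setDv setU0.
  - by move=> A mA /=; rewrite setI_bigcupl; exact: bigcupT_measurable.
have /andP[t0 t1] := t01.
move=> _ [[A HA ->]|[s [u [A [s0 su u1 HA ->]]]]] /=.
  rewrite (_ : _ `&` _ = set0); first exact: measurable0.
  by apply/seteqP; split => // x [[/= x0 _] [/=]]; rewrite in_itv/= x0 ltxx.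
have [st|ts] := ltP s t; last first.
  rewrite (_ : _ `&` _ = set0); first exact: measurable0.
  apply/seteqP; split => // x [[/=]]; rewrite in_itv/= => /andP[sx _] _ [].
  by rewrite /= in_itv/= => /andP[_ xt]; have := lt_le_trans sx xt; rewrite ltNge ts.
rewrite (_ : _ `&` _ = `]s, (Num.min u t)]%classic `*` A).
  apply: measurableX; first exact: measurable_itv.
  by apply: sub_sigma_algebra; apply: fH.2 HA => //; exact: ltW.
apply/seteqP; split => x /=; rewrite !in_itv/= le_min.
  by move=> [[/andP[-> ->] ?] [/=]]; rewrite in_itv/= => /andP[_ ->].
move=> [/and3P[sx -> xt] Ax]; rewrite sx; split => //.
by split => //=; rewrite in_itv/= (le_lt_trans s0 sx).
Qed.

(** Progressive measurability: the trace of the predictable sigma-algebra on []0, t]] lies in the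
    product of the Borel sets with the sigma-algebra at time [t], since a rectangle that meets []0,
    t]] in its time component starts before [t]. *)
Lemma measurable_on_itv_filtration k : pred_fun H k ->
  measurable_fun setT (on_itv 0 t k : R * U -> R).
Proof.
move=> pk; rewrite (_ : on_itv 0 t k = k \_ Dt); last first.
  apply/funext => x; rewrite /on_itv /patch indicE.
  have -> : (x.1 \in `]0, t]%classic) = (x \in Dt).
    by apply/idP/idP => /set_mem h'; apply/mem_set; [split|case: h'].
  by case: ifPn => _; rewrite ?mulr1 ?mulr0.
apply/(measurable_restrictT _ _).1; first exact: measurableX.
move=> mD Y mY; rewrite setIC; apply: pred_restr.
rewrite -[X in measurable X]setTI.
exact: (pk (@measurableT _ (predictable_type H)) Y mY).
Qed.

(** The measurability lemmas for path integrals are applied on the space [U], which carries the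
    sigma-algebra at time [t]. The intensity is cut at [t] as well, which does not change the
    product with the integrand. *)
Lemma adapted_intM : measurable_fun setT (intM (on_itv 0 t h) : U -> R).
Proof.
have /andP[t0 t1] := t01; apply: measurable_funB.
  rewrite (_ : intN (on_itv 0 t h) =
      fun w => int_dN (fun s => on_itv 0 t h (s, w)) (N ^~ w) t).
    apply: (@measurable_int_dN _ U R N t cN t01 _ (on_itv 0 t h)).
      move=> s /andP[s0 st] _ Y mY; rewrite setTI; apply: sub_sigma_algebra.
      have s01 : 0 <= s <= 1 by rewrite s0 (le_trans st).
      apply: (fH.2 s t) => //; apply: (aN s01).
      by exists Y => //; rewrite setTI.
    apply: measurable_funTS; exact: measurable_on_itv_filtration.
  apply/funext => w; rewrite (intNE cN) int_dNE//.
  have [_ ndN _ _] := cN w.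
  have NN : (N t w <= N 1 w)%N by exact: ndN.
  rewrite [RHS](big_ord_widen _ (fun i => on_itv 0 t h (arrival (N ^~ w) i.+1, w)) NN).
  rewrite [RHS]big_mkcond/=; apply: eq_bigr => i _; case: ifPn => // iN.
  rewrite /on_itv indicE memNset ?mulr0//= in_itv/= arrival_leN//.
  by rewrite (negbTE iN) andbF.
rewrite (_ : intL (on_itv 0 t h) =
    fun w => \int[U01]_s (on_itv 0 t h (s, w) * on_itv 0 t L (s, w))).
  apply: (@measurable_Rint2 _ _ _ U _ U01
    (fun x => on_itv 0 t h x * on_itv 0 t L x)).
  have [pL _ _] := bL.
  by apply: measurable_funM; exact: measurable_on_itv_filtration.
apply/funext => w; apply: eq_Rintegral => s _; rewrite /on_itv /= !indicE.
by case: (s \in _); rewrite ?mulr1 ?mulr0 ?mul0r.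
Qed.

End adapted.

Lemma Rintegrable_M_bounded k (B : R) : measurable_fun setT k ->
  (forall x, `|k x| <= B) -> Rintegrable M k.
Proof. exact: Rintegrable_bounded. Qed.

(** A factor known at time [s] can be moved inside an integral over []s, t]] without losing
    predictability, and such integrals are centred. *)
Lemma intM_orthogonal (U : Om -> R) s t : 0 <= s -> s <= t -> t <= 1 ->
  measurable_fun setT (U : g_sigma_algebraType (H s) -> R) ->
  Rintegrable P U ->
  Rintegrable P (fun w => U w * intM (on_itv s t h) w) /\
  \int[P]_w (U w * intM (on_itv s t h) w) = 0.
Proof.
move=> s0 st t1 mU iU.
pose k (x : R * Om) := U x.2 * \1_(`]s, t]%classic) x.1 * h x.
have pk : pred_fun H k by apply: measurable_funM => //; exact: pred_start.
have [i1 _] := mean_M_start s0 st t1 iU.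
have ik : Rintegrable M k.
  apply: Rintegrable_le (RintegrableZ K (Rintegrable_abs i1)).
    exact: pred_fun_measurable pk.
  by move=> x; rewrite /k normrM mulrC ler_wpM2r.
have kE w : intM k w = U w * intM (on_itv s t h) w.
  rewrite !intME mulrBr; congr (_ - _).
    rewrite !(intNE cN) mulr_sumr; apply: eq_bigr => i _.
    by rewrite /k /on_itv /= -mulrA; congr (_ * _); rewrite mulrC.
  have i2 := section_bounded w (measurable_on_itv s t mh) (on_itv_boundK s t).
  rewrite !intLE -RintZ//; apply: eq_Rintegral => u _.
  by rewrite /k /on_itv /=; ring.
have [iM eM] := mean_intM fH cN aN bL pk ik.
by split; [rewrite -(funext kE)|under eq_Rintegral do rewrite -kE].
Qed.

Definition cumulated_variance s t := \int[M]_x (on_itv s t (fun x => h x ^+ 2) x * L x).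

Let i2 := (counting_moment2 fH cN aN C0 bL).1.

Lemma Rintegrable_intM_sqr k (B : R) : measurable_fun setT k ->
  (forall x, `|k x| <= B) -> Rintegrable P (fun w => intM k w ^+ 2).
Proof.
move=> mk kB.
have iD := RintegrableZ (2 * B ^+ 2) (RintegrableD i2 (Rintegrable_cst P (C ^+ 2))).
apply: Rintegrable_le iD.
  by apply: measurable_funX; exact: (measurable_intM fH cN aN bL mk).
move=> w; rewrite ger0_norm ?sqr_ge0//.
have hb := intM_bound w mk kB; set y := intM k w in hb *; set n := (N 1 w)%:R in hb *.
have B0 : 0 <= B by exact: le_trans (kB (0, point)).
have : y ^+ 2 <= (B * (n + C)) ^+ 2.
  by rewrite -real_normK ?num_real// ler_sqr ?nnegrE// (le_trans _ hb).
move=> /le_trans; apply; rewrite exprMn.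
have -> : 2 * B ^+ 2 * (n ^+ 2 + C ^+ 2) = B ^+ 2 * (2 * (n ^+ 2 + C ^+ 2)) by ring.
rewrite ler_wpM2l ?sqr_ge0//.
have := sqr_ge0 (n - C); nra.
Qed.

(** The difference of the two sides is additive over adjacent intervals, because consecutive
    increments are orthogonal, and it is of order [(t - s) ^ 2]: on a short interval the square of
    the integral differs from the integral of [h ^ 2] against [dN] only through pairs of jumps and
    terms with the compensator. Such a function of intervals is 0. *)
Lemma intM_isometry s t : 0 <= s -> s <= t -> t <= 1 ->
  \int[P]_w (intM (on_itv s t h) w ^+ 2) = cumulated_variance s t.
Proof.
pose a s t := \int[P]_w (intM (on_itv s t h) w ^+ 2) - cumulated_variance s t.
have h2K x : `|h x ^+ 2| <= K ^+ 2.
  by rewrite normrX ler_sqr ?nnegrE.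
have mh2 : measurable_fun setT (fun x => h x ^+ 2) by exact: measurable_funX.
have ph2 : pred_fun H (fun x => h x ^+ 2) by exact: measurable_funX.
have iv s' t' : Rintegrable M (on_itv s' t' (fun x => h x ^+ 2)).
  apply: (@Rintegrable_M_bounded _ (K ^+ 2)); first exact: measurable_on_itv.
  move=> x; rewrite /on_itv normrM -[leRHS]mulr1; apply: ler_pM => //.
  by rewrite ger0_norm// indicE lern1 leq_b1.
have isq s' t' := Rintegrable_intM_sqr (measurable_on_itv s' t' mh) (on_itv_boundK s' t').
suff a0 : forall s t, 0 <= s -> s <= t -> t <= 1 -> a s t = 0.
  by move=> s0 st t1; apply/eqP; rewrite -subr_eq0; apply/eqP; exact: a0.
(* The constant 5 is [2 + 2 + 1]: pairs of jumps, the cross term of the jumps with the compensator,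
   and the square of the compensator. *)
apply: (@additive_quadratic_eq0 _ _ (5 * K ^+ 2 * C ^+ 2)).
  move=> {}s {}t s0 st t1.
  pose n w : R := (N t w)%:R - (N s w)%:R.
  pose J := intN (on_itv s t h); pose A := intL (on_itv s t h).
  pose Q := intN (on_itv s t (fun x => h x ^+ 2)).
  have [in1 en1] := counting_increment_mean fH cN aN bL s0 st t1.
  have [in2 en2] := counting_increment_moment2 fH cN aN C0 bL s0 st t1.
  have [iQ eQ] := mean_intN fH cN aN bL (pred_on_itv fH s0 st t1 ph2) (iv s t).
  pose b := C * (t - s); have b0 : 0 <= b by rewrite mulr_ge0 ?subr_ge0// ltW.
  have bnd w : `|intM (on_itv s t h) w ^+ 2 - Q w| <=
      K ^+ 2 * (n w * (n w - 1)) + (2 * K ^+ 2 * b * n w + K ^+ 2 * b ^+ 2).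
    have nE : n w = \sum_(i < N 1 w) \1_(`]s, t]%classic) (arrival (N ^~ w) i.+1).
      rewrite /n -(intN_on_itv cN w s0 st t1) (intNE cN).
      by apply: eq_bigr => i _; rewrite /on_itv mul1r.
    have JQ : `|J w ^+ 2 - Q w| <= K ^+ 2 * (n w * (n w - 1)).
      have := @sum_sqr_dominated R (N 1 w)
        (fun i => on_itv s t h (arrival (N ^~ w) i.+1, w))
        (fun i => K * \1_(`]s, t]%classic) (arrival (N ^~ w) i.+1)).
      move=> /(_ (fun i => on_itv_bound s t (arrival (N ^~ w) i.+1, w))).
      have idem (x : R) : \1_(`]s, t]%classic) x ^+ 2 = \1_(`]s, t]%classic) x :> R.
        by rewrite indicE; case: (x \in _); rewrite ?expr1n ?expr0n.
      rewrite -mulr_sumr -nE.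
      rewrite [X in _ <= _ - X](_ : _ = K ^+ 2 * n w); last first.
        by rewrite nE mulr_sumr; apply: eq_bigr => i _; rewrite exprMn idem.
      rewrite /J /Q !(intNE cN) [X in `|_ - X| <= _ -> _](_ : _ =
        \sum_(i < N 1 w) on_itv s t (fun x => h x ^+ 2) (arrival (N ^~ w) i.+1, w)).
        by rewrite exprMn => /le_trans; apply; rewrite le_eqVlt; apply/orP; left; apply/eqP; ring.
      by apply: eq_bigr => i _; rewrite /on_itv exprMn idem.
    have Ab : `|A w| <= K * b by rewrite /b mulrA; exact: intL_on_itv_bound.
    have Jb : `|J w| <= K * n w.
      rewrite nE mulr_sumr /J (intNE cN); apply: (le_trans (ler_norm_sum _ _ _)).
      by apply: ler_sum => i _; exact: on_itv_bound.
    have -> : intM (on_itv s t h) w ^+ 2 - Q w =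
      (J w ^+ 2 - Q w) + (- 2 * (J w * A w) + A w ^+ 2).
      have -> : intM (on_itv s t h) w = J w - A w by [].
      by ring.
    apply: (le_trans (ler_normD _ _)); apply: lerD => //.
    apply: (le_trans (ler_normD _ _)); apply: lerD.
      rewrite !normrM normrN (ger0_norm (ler0n _ 2)).
      have -> : 2 * K ^+ 2 * b * n w = 2 * ((K * n w) * (K * b)) by ring.
      by rewrite ler_pM2l//; apply: ler_pM.
    by rewrite normrX -exprMn ler_sqr ?nnegrE//; exact: mulr_ge0.
  rewrite /a /cumulated_variance -eQ -RintB//.
  have iB : Rintegrable P (fun w => intM (on_itv s t h) w ^+ 2 - Q w) by exact: RintegrableB.
  apply: (le_trans (Rint_abs iB)).
  have j1 : Rintegrable P (fun w => K ^+ 2 * (n w * (n w - 1))) by exact: RintegrableZ.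
  have j2 : Rintegrable P (fun w => 2 * K ^+ 2 * b * n w) by exact: RintegrableZ.
  have j3 := RintegrableD j2 (Rintegrable_cst P (K ^+ 2 * b ^+ 2)).
  apply: (le_trans (Rint_le (Rintegrable_abs iB) (RintegrableD j1 j3) bnd)).
  rewrite RintD// RintD//; last exact: Rintegrable_cst.
  rewrite Rint_cst RintZ// RintZ//.
  have K2 : 0 <= K ^+ 2 by exact: sqr_ge0.
  have l1 : K ^+ 2 * \int[P]_w (n w * (n w - 1)) <= K ^+ 2 * (2 * b ^+ 2) by exact: ler_wpM2l.
  have l2 : 2 * K ^+ 2 * b * \int[P]_w n w <= 2 * K ^+ 2 * b * b.
    by rewrite ler_wpM2l// mulr_ge0// mulr_ge0.
  have -> : 5 * K ^+ 2 * C ^+ 2 * (t - s) ^+ 2 = 5 * K ^+ 2 * b ^+ 2 by rewrite /b; ring.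
  have : 2 * K ^+ 2 * b * b = 2 * K ^+ 2 * b ^+ 2 by ring.
  move=> e; rewrite e in l2; lra.
move=> {}s {}t u s0 st tu u1.
have s1 : s <= 1 by rewrite (le_trans st)// (le_trans tu).
have t1 : t <= 1 by exact: le_trans u1.
have t0 : 0 <= t by exact: le_trans st.
rewrite /a.
have -> : cumulated_variance s u = cumulated_variance s t + cumulated_variance t u.
  rewrite /cumulated_variance (on_itvD _ st tu) -RintD; [|exact: (Rintegrable_ML fH bL)..].
  by apply: eq_Rintegral => x _; rewrite mulrDl.
suff -> : \int[P]_w (intM (on_itv s u h) w ^+ 2) =
  \int[P]_w (intM (on_itv s t h) w ^+ 2) + \int[P]_w (intM (on_itv t u h) w ^+ 2).
  by rewrite opprD addrACA.
have E w : intM (on_itv s u h) w ^+ 2 = intM (on_itv s t h) w ^+ 2 +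
  (intM (on_itv t u h) w ^+ 2 + 2 * (intM (on_itv s t h) w * intM (on_itv t u h) w)).
  by rewrite (intM_on_itvD w st tu); ring.
have mst : measurable_fun setT (intM (on_itv s t h) : g_sigma_algebraType (H t) -> R).
  have -> : intM (on_itv s t h) = fun w => intM (on_itv 0 t h) w - intM (on_itv 0 s h) w.
    by apply/funext => w; rewrite (intM_on_itvD w s0 st); ring.
  apply: measurable_funB; first by apply: adapted_intM; rewrite t0.
  move=> mT Y mY; have s01 : 0 <= s <= 1 by rewrite s0.
  have := adapted_intM s01 measurableT mY; apply: sub_sigma_algebra2.
  exact: fH.2.
have ist := (Rint_sqr (measurable_intM fH cN aN bL (measurable_on_itv s t mh)) (isq s t)).1.
have [io eo] := intM_orthogonal t0 tu u1 mst ist.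
under eq_Rintegral do rewrite E.
rewrite [LHS](RintD (isq s t) (RintegrableD (isq t u) (RintegrableZ 2 io))).
congr (_ + _); rewrite [LHS](RintD (isq t u) (RintegrableZ 2 io)).
by rewrite [X in _ + X](RintZ 2 io) [X in _ + _ * X]eo mulr0 addr0.
Qed.

(** The increment after [s] is orthogonal to the value at [s], so only the variance at the earlier
    time remains. *)
Lemma intM_covariance s t : 0 <= s -> s <= t -> t <= 1 ->
  Rintegrable P (fun w => intM (on_itv 0 s h) w * intM (on_itv 0 t h) w) /\
  \int[P]_w (intM (on_itv 0 s h) w * intM (on_itv 0 t h) w) = cumulated_variance 0 s.
Proof.
move=> s0 st t1; have s1 : s <= 1 by exact: le_trans t1.
have isq := Rintegrable_intM_sqr (measurable_on_itv 0 s mh) (on_itv_boundK 0 s).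
have is_ := (Rint_sqr (measurable_intM fH cN aN bL (measurable_on_itv 0 s mh)) isq).1.
have s01 : 0 <= s <= 1 by rewrite s0.
have [io eo] := intM_orthogonal s0 st t1 (adapted_intM s01) is_.
have E w : intM (on_itv 0 s h) w * intM (on_itv 0 t h) w =
  intM (on_itv 0 s h) w ^+ 2 + intM (on_itv 0 s h) w * intM (on_itv s t h) w.
  by rewrite (intM_on_itvD w s0 st); ring.
rewrite (funext E); split; first exact: RintegrableD.
by rewrite RintD// eo addr0 intM_isometry.
Qed.

End stochastic_integral.

(** * Smoothed indicators of sup-norm balls *)

Lemma abs_le_of_derive (R : realType) (f df : R -> R) (B x : R) : f 0 = 0 ->
  (forall y : R, is_derive y (1 : R) f (df y)) -> (forall y, `|y| <= `|x| -> `|df y| <= B) ->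
  `|f x| <= B * `|x|.
Proof.
move=> f0 fd dfB.
have cf (a b : R) : {within `[a, b], continuous f}.
  apply: continuous_subspaceT => y; apply: differentiable_continuous.
  by apply/derivable1_diffP; have [] := fd y.
have [x0|x0] := leP 0 x.
  have [c] := MVT_segment x0 (fun y _ => fd y) (cf 0 x).
  rewrite in_itv/= => /andP[c0 cx]; rewrite f0 !subr0 => ->; rewrite normrM ler_wpM2r//.
  by apply: dfB; rewrite !ger0_norm.
have [c] := MVT_segment (ltW x0) (fun y _ => fd y) (cf x 0).
rewrite in_itv/= => /andP[xc c0]; rewrite f0 !sub0r => e.
rewrite -normrN e normrM normrN ler_wpM2r//; apply: dfB.
by rewrite !ler0_norm ?lerN2// ltW.
Qed.

(** The mean value theorem is applied three times, each remainder being the derivative of the next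
    one. Bounding every derivative at the largest modulus gives the constant 1 instead of 1/6. *)
Lemma expR_taylor2 (R : realType) (x : R) :
  `|expR x - 1 - x - x ^+ 2 / 2| <= `|x| ^+ 3 * expR `|x|.
Proof.
have h0 (y : R) : `|y| <= `|x| -> `|expR y| <= expR `|x|.
  by move=> yx; rewrite ger0_norm ?expR_ge0// ler_expR (le_trans _ yx)// ler_norm.
have h1 (y : R) : `|y| <= `|x| -> `|expR y - 1| <= expR `|x| * `|x|.
  move=> yx; apply: (@le_trans _ _ (expR `|x| * `|y|)); last first.
    by rewrite ler_wpM2l// expR_ge0.
  apply: (@abs_le_of_derive _ (fun y => expR y - 1) (fun y => expR y)).
  - by rewrite expR0 subrr.
  - by move=> z; apply: is_derive_eq; rewrite subr0.
  - by move=> z zy; apply: h0; exact: le_trans yx.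
have h2 (y : R) : `|y| <= `|x| -> `|expR y - 1 - y| <= expR `|x| * `|x| ^+ 2.
  move=> yx; apply: (@le_trans _ _ (expR `|x| * `|x| * `|y|)); last first.
    by rewrite expr2 mulrA ler_wpM2l// mulr_ge0// expR_ge0.
  apply: (@abs_le_of_derive _ (fun y => expR y - 1 - y) (fun y => expR y - 1)).
  - by rewrite expR0 subrr subr0.
  - by move=> z; apply: is_derive_eq; rewrite subr0.
  - by move=> z zy; apply: h1; exact: le_trans yx.
rewrite (_ : `|x| ^+ 3 * _ = expR `|x| * `|x| ^+ 2 * `|x|); last by ring.
apply: (@abs_le_of_derive _ (fun y => expR y - 1 - y - y ^+ 2 / 2) (fun y => expR y - 1 - y)).
- by rewrite expR0 subrr expr0n mul0r !subr0.
- by move=> z; apply: is_derive_eq; rewrite /GRing.scale/=; field.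
- by move=> z zy; exact: h2.
Qed.

(** From [exp (- 1/2) >= 1/2], hence [exp (1/2) <= 2]. *)
Lemma expR1_le4 (R : realType) : expR (1 : R) <= 4.
Proof.
have h : 2^-1 <= expR (- 2^-1 : R) by have := expR_ge1Dx (- 2^-1 : R); lra.
have -> : (1 : R) = 2^-1 + 2^-1 by lra.
rewrite expRD; have e0 := expR_gt0 (2^-1 : R).
have : expR (2^-1 : R) * expR (- 2^-1) = 1 by rewrite expRN divff// gt_eqF.
move: h e0; move: (expR (- 2^-1)) (expR 2^-1) => p q; nra.
Qed.

(* The remainder is expressed through the quantities of the second order
   expansion of [z |-> 1 / (1 + z)] at a sum of exponentials. *)
Lemma inverse_sum_taylor2 (R : realType) (I : finType) (w c : I -> R)
    (b s0 d1 d2 : R) :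
  0 <= b -> (forall i, 0 <= w i) -> (forall i, `|c i| <= b) ->
  s0 = 1 + \sum_i w i -> d1 = \sum_i w i * c i -> d2 = \sum_i w i * c i ^+ 2 ->
  `|(1 + \sum_i w i * expR (c i))^-1 -
    (s0^-1 - s0^-1 ^+ 2 * d1 + (s0^-1 ^+ 3 * d1 ^+ 2 - s0^-1 ^+ 2 * d2 / 2))|
  <= 252 * b ^+ 3.
Proof.
move=> b0 w0 cb s0E d1E d2E; set s1 := 1 + _; pose W := \sum_i w i.
have W0 : 0 <= W by apply: sumr_ge0.
rewrite -/W in s0E; have s00 : 0 < s0 by rewrite s0E; lra.
have s1ge1 : 1 <= s1.
  by rewrite lerDl; apply: sumr_ge0 => i _; rewrite mulr_ge0// expR_ge0.
set a := s0^-1; have a0 : 0 < a by rewrite invr_gt0.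
have aW : a * W <= 1 by rewrite /a mulrC ler_pdivrMr// mul1r s0E; lra.
have a1 : a <= 1 by rewrite /a invf_le1// s0E; lra.
have sumle (f : I -> R) (B : R) : (forall i, `|f i| <= B) -> 0 <= B ->
    `|a * \sum_i w i * f i| <= B.
  move=> fB B0; rewrite normrM (ger0_norm (ltW a0)).
  apply: (@le_trans _ _ (a * (W * B))); last first.
    by rewrite mulrA -[leRHS]mul1r ler_wpM2r.
  rewrite ler_pM2l//; apply: (le_trans (ler_norm_sum _ _ _)).
  rewrite mulr_suml; apply: ler_sum => i _.
  by rewrite normrM ger0_norm// ler_wpM2l.
pose z1 := a * d1; pose z2 := a * d2 / 2.
have z1b : `|z1| <= b by rewrite /z1 d1E; exact: sumle.
have z2b : `|z2| <= b ^+ 2 / 2.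
  rewrite /z2 normrM [in X in _ * X]ger0_norm ?invr_ge0//.
  rewrite ler_wpM2r ?invr_ge0// d2E; apply: sumle => [i|]; last exact: sqr_ge0.
  by rewrite normrX ler_sqr ?nnegrE.
have -> : a - a ^+ 2 * d1 + (a ^+ 3 * d1 ^+ 2 - a ^+ 2 * d2 / 2) =
    a * (1 - z1 + (z1 ^+ 2 - z2)) by rewrite /z1 /z2; field.
have z1sq : z1 ^+ 2 <= b ^+ 2.
  by rewrite -real_normK ?num_real// ler_sqr ?nnegrE.
have [bgt1|b1] := ltP 1 b.
  have s1i : 0 <= s1^-1 <= 1.
    by rewrite invr_ge0 (le_trans ler01 s1ge1)/= invf_le1// (lt_le_trans ltr01).
  have h1 : `|1 - z1 + (z1 ^+ 2 - z2)| <= 1 + b + 2 * b ^+ 2.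
    have := sqr_ge0 z1; move: z1b z2b; rewrite !ler_norml => /andP[? ?] /andP[? ?] ?.
    apply/andP; split; nra.
  have h2 : `|a * (1 - z1 + (z1 ^+ 2 - z2))| <= 1 + b + 2 * b ^+ 2.
    rewrite normrM (ger0_norm (ltW a0)) (le_trans _ h1)// -[leRHS]mul1r.
    by rewrite ler_wpM2r.
  apply: (le_trans (ler_normB _ _)).
  have : `|s1^-1| <= 1 by case/andP: s1i => p q; rewrite ger0_norm.
  have b2 : b <= b ^+ 2 by rewrite expr2; nra.
  have b3 : b ^+ 2 <= b ^+ 3 by rewrite exprSr; nra.
  lra.
pose r := \sum_i w i * (expR (c i) - 1 - c i - c i ^+ 2 / 2).
pose z3 := a * r.
have z3b : `|z3| <= 4 * b ^+ 3.
  apply: sumle => [i|]; last by rewrite mulr_ge0// exprn_ge0.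
  apply: (le_trans (expR_taylor2 _)); rewrite mulrC; apply: ler_pM.
  - exact: expR_ge0.
  - exact: exprn_ge0.
  - have h : expR `|c i| <= expR 1 by rewrite ler_expR (le_trans (cb i)).
    apply: (le_trans h); exact: expR1_le4.
  - by rewrite lerXn2r ?nnegrE// (le_trans _ (cb i)).
(* The relative change of the sum, split by order: [z1] is of order [b], [z2] of order [b ^ 2], and
   [z3] collects the remainders of the exponentials. *)
pose y := z1 + z2 + z3.
have s1E : s1 = s0 * (1 + y).
  have -> : s0 * (1 + y) = s0 + (d1 + d2 / 2 + r) by rewrite /y /z1 /z2 /z3 /a; field; lra.
  rewrite /s1 s0E d1E d2E /r /W -addrA; congr (1 + _).
  rewrite [X in _ = _ + (_ + X + _)]mulr_suml -!big_split/=.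
  by apply: eq_bigr => i _; field.
have y1 : 0 < 1 + y.
  by rewrite -(pmulr_rgt0 _ s00) -s1E; lra.
have yb : `|y| <= 6 * b.
  have b2 : b ^+ 2 <= b by rewrite expr2; nra.
  have b3 : b ^+ 3 <= b by rewrite exprSr; nra.
  apply: (le_trans (ler_normD _ _)); apply: (@le_trans _ _ (b + b ^+ 2 / 2 + 4 * b ^+ 3)).
    by apply: lerD => //; apply: (le_trans (ler_normD _ _)); apply: lerD.
  lra.
(* From [1 / (1 + y) = 1 - y + y ^ 2 - y ^ 3 / (1 + y)] and [y ^ 2 - z1 ^ 2 = (z2 + z3) (y + z1)].
   The two parts are bounded by [6 ^ 3 = 216] and by [4 + 63 / 2 <= 36] times [b ^ 3], whence
   252. *)
have -> : s1^-1 - a * (1 - z1 + (z1 ^+ 2 - z2)) =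
    - (s1^-1 * y ^+ 3) + a * (- z3 + (z2 + z3) * (y + z1)).
  have -> : s1^-1 = a * (1 + y)^-1 by rewrite s1E invfM.
  by rewrite /y; field; rewrite /y in y1; lra.
have y3 : `|- (s1^-1 * y ^+ 3)| <= 216 * b ^+ 3.
  rewrite normrN normrM normrX ger0_norm ?invr_ge0 ?(le_trans ler01 s1ge1)//.
  have -> : 216 * b ^+ 3 = (6 * b) ^+ 3 by ring.
  rewrite -[leRHS]mul1r; apply: ler_pM.
  - by rewrite invr_ge0 (le_trans ler01 s1ge1).
  - exact: exprn_ge0.
  - by rewrite invf_le1// (lt_le_trans ltr01).
  - by rewrite lerXn2r ?nnegrE// mulr_ge0.
have z23 : `|(z2 + z3) * (y + z1)| <= 63 / 2 * b ^+ 3.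
  have -> : 63 / 2 * b ^+ 3 = (b ^+ 2 / 2 + 4 * b ^+ 2) * (6 * b + b) by field.
  have b3 : b ^+ 3 <= b ^+ 2 by rewrite exprSr; have := sqr_ge0 b; nra.
  rewrite normrM; apply: ler_pM => //; apply: (le_trans (ler_normD _ _)); last exact: lerD.
  by apply: lerD => //; apply: (le_trans z3b); rewrite ler_pM2l.
have h : `|a * (- z3 + (z2 + z3) * (y + z1))| <= 36 * b ^+ 3.
  rewrite normrM ger0_norm ?(ltW a0)// -[leRHS]mul1r; apply: ler_pM => //.
    exact: ltW.
  apply: (le_trans (ler_normD _ _)); rewrite normrN.
  have := lerD z3b z23; have : 0 <= b ^+ 3 by exact: exprn_ge0.
  lra.
apply: (le_trans (ler_normD _ _)); have := lerD y3 h; have : 0 <= b ^+ 3 by exact: exprn_ge0.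
lra.
Qed.

Lemma measurable_funV_gt0 d (T : measurableType d) (R : realType) (f : T -> R) :
  (forall x, 0 < f x) -> measurable_fun setT f -> measurable_fun setT (fun x => (f x)^-1).
Proof.
move=> f0 mf; rewrite (_ : (fun x => _) = expR \o -%R \o (@ln R) \o f).
  do 3 apply: measurableT_comp => //.
by apply/funext => x /=; rewrite expRN lnK// posrE.
Qed.

(* A smooth version of the indicator of [max_k |a k| <= x]. *)
Definition soft_ball (R : realType) (K : nat) (beta x : R) (a : 'I_K -> R) : R :=
  (1 + \sum_(i : bool * 'I_K) expR (beta * ((-1) ^+ i.1 * a i.2 - x)))^-1.

Section soft_ball.
Context (R : realType) (K : nat) (beta x : R).
Implicit Types a u : 'I_K -> R.
Local Notation soft := (soft_ball beta x).

Let sum_ge0 a : 0 <= \sum_(i : bool * 'I_K) expR (beta * ((-1) ^+ i.1 * a i.2 - x)).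
Proof. by apply: sumr_ge0 => i _; exact: expR_ge0. Qed.

Lemma soft_ball_gt0 a : 0 < soft a.
Proof. by rewrite invr_gt0 (lt_le_trans ltr01)// lerDl. Qed.

Lemma soft_ball_le1 a : soft a <= 1.
Proof. by rewrite invf_le1 ?lerDl// (lt_le_trans ltr01)// lerDl. Qed.

(** Each of the [2 K] exponentials is at most [exp (- beta r)], and [1 - 1 / (1 + s) <= s]. *)
Lemma soft_ball_inside a (r : R) : 0 <= beta -> (forall k, `|a k| <= x - r) ->
  1 - soft a <= (2 * K)%:R * expR (- (beta * r)).
Proof.
move=> b0 ax; rewrite /soft_ball; set s := \sum_i _.
have s0 : 0 <= s := sum_ge0 a.
apply: (@le_trans _ _ s).
  rewrite lerBlDr -lerBlDl -[leRHS]mul1r ler_pdivlMr; nra.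
rewrite -[X in _ <= X * _](_ : #|{: bool * 'I_K}|%:R = _); last by rewrite card_prod card_bool card_ord.
rewrite mulr_natl -sumr_const; apply: ler_sum => -[b k] _ /=.
rewrite ler_expR -mulrN ler_wpM2l//.
have : (-1) ^+ b * a k <= `|a k| by rewrite (le_trans (ler_norm _))// normrM normr_sign mul1r.
by have := ax k; lra.
Qed.

(** The single exponential with index [k] and the sign of [a k] already exceeds [exp (beta r)]. *)
Lemma soft_ball_outside a (r : R) k : 0 <= beta -> x + r <= `|a k| ->
  soft a <= expR (- (beta * r)).
Proof.
move=> b0 ak; rewrite /soft_ball expRN lef_pV2 ?posrE ?expR_gt0//; last first.
  by rewrite (lt_le_trans ltr01)// lerDl.
pose b := a k < 0; have e : `|a k| = (-1) ^+ b * a k by rewrite normrEsign.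
rewrite (bigD1 (b, k))//= addrA -[leLHS]addr0 lerD//; last first.
  by apply: sumr_ge0 => i _; exact: expR_ge0.
rewrite -e -[leLHS]add0r lerD// ler_expR ler_wpM2l//; lra.
Qed.

Lemma measurable_soft_ball d (T : measurableType d) (u : T -> 'I_K -> R) :
  (forall k, measurable_fun setT (fun w => u w k)) ->
  measurable_fun setT (fun w => soft (u w)).
Proof.
move=> mu; apply: measurable_funV_gt0.
  by move=> w; rewrite (lt_le_trans ltr01)// lerDl.
  apply: measurable_funD => //; apply: measurable_sum => i.
  apply: measurableT_comp => //; apply: measurable_funM => //.
  by apply: measurable_funB => //; exact: measurable_funM.
Qed.

Definition soft_weight a (i : bool * 'I_K) := expR (beta * ((-1) ^+ i.1 * a i.2 - x)).
Definition soft_slope a u := \sum_i soft_weight a i * (beta * (-1) ^+ i.1 * u i.2).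
(** The terms of first and second order of the expansion of [soft] at [a] in the direction [u];
    [soft_slope] is, up to the factor [- soft a ^+ 2], the directional derivative. *)
Definition soft_expansion a u := - (soft a ^+ 2 * soft_slope a u) +
  (soft a ^+ 3 * soft_slope a u ^+ 2 -
   soft a ^+ 2 * (\sum_i soft_weight a i * (beta * (-1) ^+ i.1 * u i.2) ^+ 2) / 2).

Lemma soft_ball_taylor a u (b : R) : 0 <= beta -> 0 <= b -> (forall k, `|u k| <= b) ->
  `|soft (fun k => a k + u k) - (soft a + soft_expansion a u)|
  <= 252 * beta ^+ 3 * b ^+ 3.
Proof.
move=> beta0 b0 ub.
have := @inverse_sum_taylor2 R _ (soft_weight a) (fun i => beta * (-1) ^+ i.1 * u i.2)
  (beta * b) _ _ _ (mulr_ge0 beta0 b0) _ _ erefl erefl erefl.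
rewrite exprMn (mulrA 252) => h; apply: (le_trans _ (h _ _)) => [|i|i].
- rewrite le_eqVlt; apply/orP; left; apply/eqP; congr `|_ - _|.
    rewrite /soft_ball; congr (_^-1); congr (_ + _); apply: eq_bigr => i _.
    by rewrite /soft_weight -expRD; congr expR; ring.
  by rewrite -[(1 + \sum_i soft_weight a i)^-1]/(soft a) -/(soft_slope a u) /soft_expansion addrA.
- exact: expR_ge0.
- rewrite !normrM normr_sign mulr1 ger0_norm//; exact: ler_wpM2l.
Qed.

Section expectation.
Context d (T : measurableType d) (P : probability T R) (u : T -> 'I_K -> R).
Variables (c : 'I_K -> 'I_K -> R).
Hypothesis iu : forall k, Rintegrable P (fun w => u w k).
Hypothesis iuu : forall k l, Rintegrable P (fun w => u w k * u w l).
Hypothesis u0 : forall k, \int[P]_w u w k = 0.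
Hypothesis uc : forall k l, \int[P]_w (u w k * u w l) = c k l.

Lemma soft_expansion_mean a : Rintegrable P (fun w => soft_expansion a (u w)) /\
  \int[P]_w soft_expansion a (u w) =
  soft a ^+ 3 * (\sum_i \sum_j soft_weight a i * (beta * (-1) ^+ i.1) *
     (soft_weight a j * (beta * (-1) ^+ j.1)) * c i.2 j.2) -
  soft a ^+ 2 / 2 * \sum_i soft_weight a i * beta ^+ 2 * c i.2 i.2.
Proof.
have sl w : soft_slope a (u w) =
    \sum_i (soft_weight a i * (beta * (-1) ^+ i.1)) * u w i.2.
  by apply: eq_bigr => i _; rewrite !mulrA.
have sl2 w : soft_slope a (u w) ^+ 2 =
    \sum_i \sum_j soft_weight a i * (beta * (-1) ^+ i.1) *
     (soft_weight a j * (beta * (-1) ^+ j.1)) * (u w i.2 * u w j.2).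
  rewrite expr2 sl big_distrlr/=; apply: eq_bigr => i _; apply: eq_bigr => j _.
  by rewrite mulrACA.
have sq w : \sum_i soft_weight a i * (beta * (-1) ^+ i.1 * u w i.2) ^+ 2 =
    \sum_i soft_weight a i * beta ^+ 2 * (u w i.2 * u w i.2).
  apply: eq_bigr => i _; rewrite !exprMn -exprM mulnC exprM sqrrN expr1n expr1n mulr1.
  by rewrite -(expr2 (u w i.2)) mulrA.
have [i1 e1] : Rintegrable P (fun w => soft_slope a (u w)) /\
    \int[P]_w soft_slope a (u w) = 0.
  rewrite (funext sl); split; first by apply: Rintegrable_sum => i _; exact: RintegrableZ.
  rewrite Rint_sum => [|i _]; last exact: RintegrableZ.
  by rewrite big1// => i _; rewrite RintZ// u0 mulr0.
have [i2 e2] : Rintegrable P (fun w => soft_slope a (u w) ^+ 2) /\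
    \int[P]_w (soft_slope a (u w) ^+ 2) =
    \sum_i \sum_j soft_weight a i * (beta * (-1) ^+ i.1) *
     (soft_weight a j * (beta * (-1) ^+ j.1)) * c i.2 j.2.
  rewrite (funext sl2); split.
    by apply: Rintegrable_sum => i _; apply: Rintegrable_sum => j _; exact: RintegrableZ.
  rewrite Rint_sum => [|i _]; last by apply: Rintegrable_sum => j _; exact: RintegrableZ.
  apply: eq_bigr => i _; rewrite Rint_sum => [|j _]; last exact: RintegrableZ.
  by apply: eq_bigr => j _; rewrite RintZ// uc.
have [i3 e3] : Rintegrable P (fun w => \sum_i soft_weight a i * (beta * (-1) ^+ i.1 * u w i.2) ^+ 2) /\
    \int[P]_w (\sum_i soft_weight a i * (beta * (-1) ^+ i.1 * u w i.2) ^+ 2) =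
    \sum_i soft_weight a i * beta ^+ 2 * c i.2 i.2.
  rewrite (funext sq); split; first by apply: Rintegrable_sum => i _; exact: RintegrableZ.
  rewrite Rint_sum => [|i _]; last exact: RintegrableZ.
  by apply: eq_bigr => i _; rewrite RintZ// uc.
have E w : soft_expansion a (u w) = - soft a ^+ 2 * soft_slope a (u w) +
  (soft a ^+ 3 * soft_slope a (u w) ^+ 2 - soft a ^+ 2 / 2 *
   \sum_i soft_weight a i * (beta * (-1) ^+ i.1 * u w i.2) ^+ 2).
  by rewrite /soft_expansion mulNr [_ / 2 * _]mulrAC.
have j1 := RintegrableZ (- soft a ^+ 2) i1.
have j2 := RintegrableZ (soft a ^+ 3) i2.
have j3 := RintegrableZ (soft a ^+ 2 / 2) i3.
rewrite (funext E); split; first by apply: RintegrableD => //; exact: RintegrableB.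
rewrite [LHS](RintD j1 (RintegrableB j2 j3)) [X in X + _](RintZ _ i1) e1 mulr0 add0r.
by rewrite [LHS](RintB j2 j3) [X in X - _](RintZ _ i2) [X in _ - X](RintZ _ i3) e2 e3.
Qed.

(** Up to the cubic remainder, the mean depends on the law of a centred [u] only through its
    covariance [c]. Two increments with the same covariance can therefore be exchanged at a cubic
    cost. *)
Lemma soft_ball_increment_mean a (m : T -> R) : 0 <= beta ->
  (forall w k, `|u w k| <= m w) -> (forall w, 0 <= m w) ->
  Rintegrable P (fun w => m w ^+ 3) ->
  `|\int[P]_w soft (fun k => a k + u w k) -
    (soft a + (soft a ^+ 3 * (\sum_i \sum_j soft_weight a i * (beta * (-1) ^+ i.1) *
     (soft_weight a j * (beta * (-1) ^+ j.1)) * c i.2 j.2) -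
  soft a ^+ 2 / 2 * \sum_i soft_weight a i * beta ^+ 2 * c i.2 i.2))| <=
  252 * beta ^+ 3 * \int[P]_w (m w ^+ 3).
Proof.
move=> beta0 um m0 im; have [i1 <-] := soft_expansion_mean a.
have i2 : Rintegrable P (fun w => soft (fun k => a k + u w k)).
  apply: (@Rintegrable_bounded _ _ _ _ _ 1).
    apply: measurable_soft_ball => k; apply: measurable_funD => //.
    exact: RintegrableM (iu k).
  by move=> w; rewrite ger0_norm ?soft_ball_le1// ltW// soft_ball_gt0.
have i3 := RintegrableD (Rintegrable_cst P (soft a)) i1.
have -> : soft a + \int[P]_w soft_expansion a (u w) =
    \int[P]_w (soft a + soft_expansion a (u w)).
  by rewrite [RHS](RintD (Rintegrable_cst P (soft a)) i1) Rint_cst.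
rewrite -(RintB i2 i3); apply: (le_trans (Rint_abs (RintegrableB i2 i3))).
rewrite -(RintZ _ im); apply: Rint_le.
- exact: Rintegrable_abs (RintegrableB i2 i3).
- exact: RintegrableZ.
- by move=> w; exact: soft_ball_taylor.
Qed.

End expectation.

End soft_ball.

(** * Independence *)

Section same_law_integral.
Context (R : realType) d1 d2 d3 (T1 : measurableType d1) (T2 : measurableType d2)
  (V : measurableType d3) (m1 : {measure set T1 -> \bar R}) (m2 : {measure set T2 -> \bar R}).
Variables (u1 : T1 -> V) (u2 : T2 -> V).
Hypotheses (mu1 : measurable_fun setT u1) (mu2 : measurable_fun setT u2).
Hypothesis law : forall A, measurable A -> m1 (u1 @^-1` A) = m2 (u2 @^-1` A).

Lemma ge0_integral_law (phi : V -> \bar R) : measurable_fun setT phi ->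
  (forall x, (0 <= phi x)%E) -> (\int[m1]_x phi (u1 x) = \int[m2]_x phi (u2 x))%E.
Proof.
move=> mphi phi0.
have e1 := ge0_integral_pushforward mu1 m1 measurableT mphi (fun x _ => phi0 x).
have e2 := ge0_integral_pushforward mu2 m2 measurableT mphi (fun x _ => phi0 x).
rewrite !preimage_setT in e1 e2; rewrite -[LHS]e1 -[RHS]e2.
by apply: eq_measure_integral => A mA _; exact: law.
Qed.

Lemma integral_law (phi : V -> \bar R) : measurable_fun setT phi ->
  (\int[m1]_x phi (u1 x) = \int[m2]_x phi (u2 x))%E.
Proof.
move=> mphi; rewrite integralE [RHS]integralE; congr (_ - _)%E.
  transitivity (\int[m1]_x (phi^\+ (u1 x)))%E; first by apply: eq_integral => x _; rewrite !funeposE.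
  rewrite (ge0_integral_law (measurable_funepos mphi))//.
  by apply: eq_integral => x _; rewrite !funeposE.
transitivity (\int[m1]_x (phi^\- (u1 x)))%E; first by apply: eq_integral => x _; rewrite !funenegE.
rewrite (ge0_integral_law (measurable_funeneg mphi))//.
by apply: eq_integral => x _; rewrite !funenegE.
Qed.

Lemma Rint_law (phi : V -> R) : measurable_fun setT phi ->
  \int[m1]_x phi (u1 x) = \int[m2]_x phi (u2 x).
Proof.
move=> mphi; congr fine; apply: (integral_law (phi := EFin \o phi)).
exact/measurable_EFinP.
Qed.

Lemma Rintegrable_law (phi : V -> R) : measurable_fun setT phi ->
  Rintegrable m2 (fun x => phi (u2 x)) -> Rintegrable m1 (fun x => phi (u1 x)).
Proof.
move=> mphi /integrableP[_ i2]; apply/integrableP; split.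
  by apply/measurable_EFinP; exact: measurableT_comp.
apply: le_lt_trans i2; rewrite le_eqVlt; apply/orP; left; apply/eqP.
apply: (integral_law (phi := fun x => `|(phi x)%:E|%E)).
by apply/measurable_EFinP; exact: measurableT_comp.
Qed.

End same_law_integral.

Definition generated_system (Sm : Type) d (T : measurableType d) (I : Type)
    (U : I -> Sm -> T) (D : set I) : set (set Sm) :=
  \bigcup_(i in D) preimage_set_system setT (U i) measurable.

Section independence.
Context (R : realType) d (Sm : measurableType d) (Q : probability Sm R)
  (I : choiceType) d' (T : measurableType d') (U : I -> Sm -> T).
Hypothesis mU : forall i, measurable_fun setT (U i).
Hypothesis iU : mutually_independent Q U.
Implicit Types (D : set I).

Definition finite_cylinders D : set (set Sm) := [set E | exists K : {fset I},
  exists A : I -> set T, [/\ forall i, measurable (A i), [set` K] `<=` D &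
    E = \bigcap_(i in [set` K]) U i @^-1` A i]].

Lemma finite_cylinders_setI D : setI_closed (finite_cylinders D).
Proof.
move=> _ _ [K [A [mA KD ->]]] [L [B [mB LD ->]]].
exists (K `|` L)%fset, (fun i => (if i \in K then A i else setT) `&`
  (if i \in L then B i else setT)); split.
- by move=> i; apply: measurableI; case: ifP.
- by move=> i /=; rewrite inE => /orP[/KD|/LD].
- apply/seteqP; split => [w [wA wB] i _|w wAB].
    by split; case: ifP => // iK; [exact: wA|exact: wB].
  split => i /= iK; have /= := wAB i; rewrite inE iK ?orbT => /(_ isT) [] //.
Qed.

Lemma measurable_finite_cylinders D : finite_cylinders D `<=` measurable.
Proof.
move=> _ [K [A [mA KD ->]]]; apply: fin_bigcap_measurable => // i _.
by rewrite -[X in measurable X]setTI; exact: mU.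
Qed.

Lemma generated_cylinders D : generated_system U D `<=` finite_cylinders D.
Proof.
move=> _ [i Di [A mA <-]]; exists [fset i]%fset, (fun=> A); split => //.
  by move=> j /=; rewrite inE => /eqP ->.
rewrite setTI; apply/seteqP; split => [w wA j /=|w /(_ i) wA].
  by rewrite inE => /eqP ->.
by apply: wA; rewrite /= inE.
Qed.

Lemma generated_measurable D : <<s generated_system U D>> `<=` measurable.
Proof.
apply: smallest_sub; first exact: sigma_algebra_measurable.
by move=> A /generated_cylinders; exact: measurable_finite_cylinders.
Qed.

Lemma generated_fun_measurable D d1 (V : measurableType d1) (f : Sm -> V) :
  measurable_fun setT (f : g_sigma_algebraType (generated_system U D) -> V) ->
  measurable_fun setT f.
Proof.
move=> mf _ Y mY; apply: (@generated_measurable D).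
exact: (mf (@measurableT _ (g_sigma_algebraType (generated_system U D))) Y mY).
Qed.

Lemma measurable_generated D i : D i ->
  measurable_fun setT (U i : g_sigma_algebraType (generated_system U D) -> T).
Proof. by move=> Di _ Y mY; apply: sub_sigma_algebra; exists i => //; exists Y. Qed.

Variables (D1 D2 : set I).
Hypothesis D12 : D1 `&` D2 = set0.

(** The two cylinders are merged into one over the disjoint union of their index sets, where mutual
    independence applies and the product splits. *)
Lemma independent_cylinders A B : finite_cylinders D1 A -> finite_cylinders D2 B ->
  Q (A `&` B) = (Q A * Q B)%E.
Proof.
move=> [K [A' [mA KD ->]]] [L [B' [mB LD ->]]].
have KL i : i \in K -> i \in L -> False.
  move=> iK iL; suff : (D1 `&` D2) i by rewrite D12.
  by split; [exact: KD|exact: LD].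
pose AB i := if i \in K then A' i else B' i.
have -> : \bigcap_(i in [set` K]) U i @^-1` A' i `&` \bigcap_(i in [set` L]) U i @^-1` B' i =
    \bigcap_(i in [set` (K `|` L)%fset]) U i @^-1` AB i.
  apply/seteqP; split => [w [wA wB] i /=|w wAB].
    rewrite inE /AB; case: ifP => [iK _|_ /=]; [exact: wA|exact: wB].
  split => i /= iK; have /= := wAB i; rewrite inE iK ?orbT => /(_ isT); rewrite /AB ?iK//.
  by case: ifP => // iK'; case: (KL i).
rewrite !iU//; last by move=> i; rewrite /AB; case: ifP.
have pKL : perm_eq (K `|` L)%fset (K ++ L).
  apply: uniq_perm; rewrite ?fset_uniq//.
    rewrite cat_uniq !fset_uniq/= andbT; apply/hasPn => i iL; apply/negP => iK.
    exact: KL iK iL.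
  by move=> i; rewrite inE mem_cat.
rewrite (perm_big _ pKL)/= big_cat/=; congr (_ * _)%E; apply: eq_big_seq => i iK.
  by rewrite /AB iK.
by rewrite /AB; case: ifP => // iK'; case: (KL i).
Qed.

Lemma independent_sets A B : <<s generated_system U D1>> A ->
  <<s generated_system U D2>> B -> Q (A `&` B) = (Q A * Q B)%E.
Proof.
have cylT D : finite_cylinders D setT.
  exists fset0, (fun=> setT); split => //.
  by apply/seteqP; split.
(* Uniqueness of measures for [Q (. & E)] against [Q E] times [Q], with [E] frozen. It is used
   twice, once for each factor. *)
have key D (E : set Sm) : measurable E ->
    (forall C, finite_cylinders D C -> Q (C `&` E) = (Q C * Q E)%E) ->
    forall C, <<s generated_system U D>> C -> Q (C `&` E) = (Q C * Q E)%E.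
  move=> mE h C sC.
  have QE : 0 <= fine (Q E) by exact: fine_ge0.
  pose m2 := mscale (NngNum QE) Q.
  have m2E X : m2 X = (Q X * Q E)%E.
    by rewrite /m2 /mscale/= fineK ?fin_num_measure// muleC.
  rewrite -m2E -[LHS]/(mrestr Q mE C).
  apply: (@g_sigma_algebra_measure_unique _ _ _ (finite_cylinders D) _ (fun=> setT)) => //.
  - exact: measurable_finite_cylinders.
  - by apply/seteqP; split=> // x _; exists 0%N.
  - exact: finite_cylinders_setI.
  - by move=> X cX; apply: etrans (esym (m2E X)); exact: h.
  - move=> k; rewrite /mrestr; apply: (le_lt_trans (probability_le1 Q _)); last exact: ltry.
    by rewrite setTI.
  - by apply: sub_sigma_algebra2 sC; exact: generated_cylinders.
move=> sA sB; apply: (key _ _ _ _ _ sA); first exact: generated_measurable sB.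
move=> X cX; rewrite setIC muleC; apply: (key _ _ _ _ _ sB); first exact: measurable_finite_cylinders cX.
by move=> Y cY; rewrite setIC muleC; exact: independent_cylinders.
Qed.

Section pair.
Context d1 d2 (V1 : measurableType d1) (V2 : measurableType d2).
Variables (f : Sm -> V1) (g : Sm -> V2).
Hypothesis mf : measurable_fun setT
  (f : g_sigma_algebraType (generated_system U D1) -> V1).
Hypothesis mg : measurable_fun setT
  (g : g_sigma_algebraType (generated_system U D2) -> V2).

Let mf' := generated_fun_measurable mf.
Let mg' := generated_fun_measurable mg.

(** The form in which independence is used: functions of disjoint groups of variables may be read at
    two independent sample points, which makes Fubini available without conditional expectations. *)
Lemma independent_pair_law (E : set (V1 * V2)) : measurable E ->
  Q ((fun w => (f w, g w)) @^-1` E) =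
  (Q \x Q)%E ((fun z : Sm * Sm => (f z.1, g z.2)) @^-1` E).
Proof.
move=> mE.
have mfg : measurable_fun setT (fun w => (f w, g w)) by exact: measurable_fun_pair.
have mfg2 : measurable_fun setT (fun z : Sm * Sm => (f z.1, g z.2)).
  by apply: measurable_fun_pair; apply: measurableT_comp.
pose X1 := mfun_Sub (mem_set mf' : f \in mfun).
pose X2 := mfun_Sub (mem_set mg' : g \in mfun).
pose X12 := mfun_Sub (mem_set mfg : (fun w => (f w, g w)) \in mfun).
pose Y12 := mfun_Sub (mem_set mfg2 : (fun z : Sm * Sm => (f z.1, g z.2)) \in mfun).
transitivity ((distribution Q X1 \x distribution Q X2)%E E).
  rewrite (@product_measure_unique _ _ V1 V2 R (distribution Q X1) (distribution Q X2)
    (distribution Q X12))// => A B mA mB.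
  transitivity (Q (f @^-1` A `&` g @^-1` B)); first by [].
  apply: independent_sets; rewrite -[X in _ X]setTI.
    exact: (mf (@measurableT _ (g_sigma_algebraType _)) mA).
  exact: (mg (@measurableT _ (g_sigma_algebraType _)) mB).
rewrite (@product_measure_unique _ _ V1 V2 R (distribution Q X1) (distribution Q X2)
  (distribution (Q \x Q)%E Y12))// => A B mA mB.
transitivity ((Q \x Q)%E ((f @^-1` A) `*` (g @^-1` B))); first by [].
by rewrite product_measure1E//= -[X in measurable X]setTI; [exact: mf'|exact: mg'].
Qed.

Lemma Rint_independent_pair (phi : V1 * V2 -> R) : measurable_fun setT phi ->
  \int[Q]_w phi (f w, g w) = \int[(Q \x Q)%E]_z phi (f z.1, g z.2).
Proof.
apply: (Rint_law (u1 := fun w => (f w, g w)) (u2 := fun z => (f z.1, g z.2))).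
- exact: measurable_fun_pair.
- by apply: measurable_fun_pair; apply: measurableT_comp.
- exact: independent_pair_law.
Qed.

End pair.

End independence.

Section real_product.
Context (R : realType) d1 d2 (T1 : measurableType d1) (T2 : measurableType d2)
  (P1 : probability T1 R) (P2 : probability T2 R).

Lemma measurable_Rint1 (f : T1 * T2 -> R) : measurable_fun setT f ->
  measurable_fun setT (fun x => \int[P2]_y f (x, y)).
Proof.
move=> mf; apply: (@measurable_Rint2 _ _ _ _ _ P2 (fun z => f (z.2, z.1))).
by apply: (measurableT_comp mf); apply: measurable_fun_pair.
Qed.

Lemma Rfubini1 (f : T1 * T2 -> R) : Rintegrable (P1 \x P2)%E f ->
  Rintegrable P1 (fun x => \int[P2]_y f (x, y)) /\
  \int[P1]_x (\int[P2]_y f (x, y)) = \int[(P1 \x P2)%E]_z f z.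
Proof.
move=> If; have mf := RintegrableM If.
have e : {ae P1, forall x, fubini_F P2 (EFin \o f) x =
    (EFin \o (fun x => \int[P2]_y f (x, y))) x}.
  apply: filterS (ae_integrable1 If) => y iy.
  by rewrite /fubini_F /= RintE.
have mG : measurable_fun setT (EFin \o (fun x => \int[P2]_y f (x, y))).
  by apply/measurable_EFinP; exact: measurable_Rint1.
have mf' : measurable_fun setT (EFin \o f) by exact/measurable_EFinP.
have mF := measurable_fubini_F If.
have iG : P1.-integrable setT (fubini_F P2 (EFin \o f)).
  exact: integrable_fubini_F.
have iI : Rintegrable P1 (fun x => \int[P2]_y f (x, y)).
  apply/integrableP; split => //; have /integrableP[_] := iG.
  rewrite (_ : (\int[P1]_x `|fubini_F P2 (EFin \o f) x| =
      \int[P1]_x `|(EFin \o (fun x => (\int[P2]_y f (x, y))%R)) x|)%E)//.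
  apply: ae_eq_integral => //.
  - by apply: measurableT_comp.
  - by apply: measurableT_comp.
  - by apply: filterS e => y /= ->.
split => //; apply: EFin_inj; rewrite !RintE// -integral12_prod_meas1//.
by apply: ae_eq_integral => //; apply: filterS e => y /= ->.
Qed.

Lemma Rint_prod (f : T1 -> R) (g : T2 -> R) : Rintegrable P1 f -> Rintegrable P2 g ->
  Rintegrable (P1 \x P2)%E (fun z => f z.1 * g z.2) /\
  \int[(P1 \x P2)%E]_z (f z.1 * g z.2) = \int[P1]_x f x * \int[P2]_y g y.
Proof.
move=> If Ig; have mf := RintegrableM If; have mg := RintegrableM Ig.
have mfg : measurable_fun setT (fun z : T1 * T2 => f z.1 * g z.2).
  by apply: measurable_funM; [exact: measurableT_comp|exact: measurableT_comp].
have ifg : Rintegrable (P1 \x P2)%E (fun z => f z.1 * g z.2).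
  apply/(integrable21ltyP P1 P2); first exact/measurable_EFinP.
  have /integrableP[_ oog] := Rintegrable_abs Ig.
  have /integrableP[_ oof] := Rintegrable_abs If.
  rewrite (_ : (\int[P2]_y _)%E = (\int[P2]_y (fine (\int[P1]_x `|f x|%:E)%E * `|g y|)%:E)%E).
    have /integrableP[_] := RintegrableZ (fine (\int[P1]_x `|f x|%:E)%E) (Rintegrable_abs Ig).
    apply: le_lt_trans; apply: ge0_le_integral => //.
    - by move=> x _; rewrite lee_fin mulr_ge0// fine_ge0// integral_ge0.
    - by apply/measurable_EFinP; apply: measurable_funM => //; exact: measurableT_comp.
    - by apply/measurable_EFinP; apply: measurableT_comp => //;
        apply: measurable_funM => //; exact: measurableT_comp.
    - by move=> x _; rewrite lee_fin ler_norm.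
  apply: eq_integral => y _ /=.
  under eq_integral do rewrite normrM EFinM.
  rewrite ge0_integralZr//; first by rewrite EFinM (RintE (Rintegrable_abs If)).
  by apply/measurable_EFinP; exact: measurableT_comp.
split => //; have [_ <-] := Rfubini2 ifg.
under eq_Rintegral do rewrite /=.
rewrite -(RintZ _ Ig); apply: eq_Rintegral => y _.
under eq_Rintegral do rewrite mulrC.
by rewrite (RintZ _ If) mulrC.
Qed.

End real_product.

Lemma independent_mean (R : realType) d (Sm : measurableType d) (Q : probability Sm R)
    (I : choiceType) d' (T : measurableType d') (U : I -> Sm -> T)
    (D1 D2 : set I) (f g : Sm -> R) : (forall i, measurable_fun setT (U i)) ->
  mutually_independent Q U -> D1 `&` D2 = set0 ->
  measurable_fun setT (f : g_sigma_algebraType (generated_system U D1) -> R) ->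
  measurable_fun setT (g : g_sigma_algebraType (generated_system U D2) -> R) ->
  Rintegrable Q f -> Rintegrable Q g ->
  Rintegrable Q (fun w => f w * g w) /\
  \int[Q]_w (f w * g w) = \int[Q]_w f w * \int[Q]_w g w.
Proof.
move=> mU iU D12 mf mg If Ig; have [ifg efg] := Rint_prod If Ig.
have mm : measurable_fun setT (fun z : R * R => z.1 * z.2) by exact: measurable_funM.
have mf' := generated_fun_measurable mU mf; have mg' := generated_fun_measurable mU mg.
rewrite -efg; split; last exact: (Rint_independent_pair mU iU D12 mf mg mm).
apply: (Rintegrable_law (u1 := fun w => (f w, g w))
  (u2 := fun z : Sm * Sm => (f z.1, g z.2)) _ _ _ mm ifg).
- exact: measurable_fun_pair.
- by apply: measurable_fun_pair; apply: measurableT_comp.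
- exact: (independent_pair_law mU iU D12 mf mg).
Qed.

(** Completing the square: the exponential times the density is a constant times the normal density
    with mean [a * s ^+ 2]. *)
Lemma normal_mgf (R : realType) (s a : R) : s != 0 ->
  (\int[normal_prob 0 s]_x (expR (a * x))%:E = (expR (a ^+ 2 * s ^+ 2 / 2))%:E)%E.
Proof.
move=> s0.
have me : measurable_fun setT (fun x : measurableTypeR R => expR (a * x)).
  by apply: measurableT_comp => //; exact: measurable_funM.
rewrite (@integral_density _ (measurableTypeR R) R lebesgue_measure (normal_prob 0 s)
  (normal_pdf 0 s))//; last 2 first.
- by apply: measurable_normal_pdf.
- by move=> x; exact: normal_pdf_ge0.
rewrite (_ : (fun x => _) = fun x => ((expR (a ^+ 2 * s ^+ 2 / 2))%:E * (normal_pdf (a * s ^+ 2) s x)%:E)%E).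
  rewrite ge0_integralZl//.
  - by rewrite integral_normal_pdf mule1.
  - by apply/measurable_EFinP; exact: measurable_normal_pdf.
  - by move=> x _; rewrite lee_fin normal_pdf_ge0.
apply/funext => x; rewrite -EFinM; congr EFin.
rewrite /normal_pdf (negbTE s0) /normal_fun mulrCA [RHS]mulrCA -!expRD.
by congr (_ * expR _); field.
Qed.

Section gaussian_moments.
Context (R : realType) d (T : measurableType d) (P : probability T R).
Variables (D : T -> R) (v : R).
Hypothesis mD : measurable_fun setT D.
Hypothesis mgf : forall a : R,
  (\int[P]_w (expR (a * D w))%:E = (expR (a ^+ 2 * v / 2))%:E)%E.

Let ie (a : R) : Rintegrable P (fun w => expR (a * D w)).
Proof.
apply: Rintegrable_ge0.
- by apply: measurableT_comp => //; exact: measurable_funM.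
- by move=> w; exact: expR_ge0.
- by rewrite mgf ltry.
Qed.

Let ee (a : R) : \int[P]_w expR (a * D w) = expR (a ^+ 2 * v / 2).
Proof. by apply: EFin_inj; rewrite (RintE (ie a)) mgf. Qed.

Lemma gaussian_exp_abs (a : R) : 0 <= a -> Rintegrable P (fun w => expR (a * `|D w|)) /\
  \int[P]_w expR (a * `|D w|) <= 2 * expR (a ^+ 2 * v / 2).
Proof.
move=> a0; have i2 := RintegrableD (ie a) (ie (- a)).
have le w : expR (a * `|D w|) <= expR (a * D w) + expR (- a * D w).
  have [h|h] := leP 0 (D w); first by rewrite ger0_norm// lerDl expR_ge0.
  by rewrite ltr0_norm// mulrN mulNr lerDr expR_ge0.
have i1 : Rintegrable P (fun w => expR (a * `|D w|)).
  apply: Rintegrable_le i2.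
    by apply: measurableT_comp => //; apply: measurable_funM => //; exact: measurableT_comp.
  by move=> w; rewrite ger0_norm ?expR_ge0.
split => //; apply: (le_trans (Rint_le i1 i2 le)).
by rewrite (RintD (ie a) (ie (- a))) !ee sqrrN; lra.
Qed.

Let expX n (x : R) : `|x| ^+ n.+1 <= n.+1`!%:R * expR `|x|.
Proof.
have := expR_ge1Dxn n (normr_ge0 x); rewrite -lerBrDl.
rewrite ler_pdivrMr ?ltr0n ?fact_gt0// mulrC => /le_trans; apply.
by rewrite ler_wpM2l// gerBl.
Qed.

Let iX n : Rintegrable P (fun w => `|D w| ^+ n.+1).
Proof.
have [i1 _] := gaussian_exp_abs ler01.
apply: Rintegrable_le (RintegrableZ n.+1`!%:R i1).
  by apply: measurable_funX; exact: measurableT_comp.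
by move=> w; rewrite mul1r ger0_norm ?exprn_ge0.
Qed.

Lemma gaussian_integrable : Rintegrable P D /\ Rintegrable P (fun w => D w ^+ 2).
Proof.
split; first by apply: Rintegrable_le (iX 0) => // w; rewrite expr1.
by have := iX 1; congr Rintegrable; apply/funext => w; rewrite real_normK ?num_real.
Qed.

(** Mean and variance are read off the moment generating function: both sides of [mgf] are expanded
    to second order at [a = 0] with an error of order [|a| ^ 3], and the coefficients are
    compared. *)
Lemma gaussian_moments : \int[P]_w D w = 0 /\ \int[P]_w (D w ^+ 2) = v.
Proof.
have [i1 i2] := gaussian_integrable.
have [j1 _] := gaussian_exp_abs (ler0n R 2).
(* The remainder [|a D| ^ 3 exp |a D|] is dominated, for [|a| <= 1], by [|a| ^ 3] times
   [6 exp (2 |D|)], using [|x| ^ 3 <= 6 exp |x|]. *)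
pose c1 := 6 * \int[P]_w expR (2 * `|D w|).
have taylor (a : R) : `|a| <= 1 ->
    `|expR (a ^+ 2 * v / 2) - 1 - a * (\int[P]_w D w) - a ^+ 2 * (\int[P]_w (D w ^+ 2)) / 2|
    <= c1 * `|a| ^+ 3.
  move=> a1; have k1 := RintegrableZ a i1; have k2 := RintegrableZ (a ^+ 2 / 2) i2.
  have k0 := RintegrableB (ie a) (Rintegrable_cst P 1).
  have k3 := RintegrableB (RintegrableB k0 k1) k2.
  have -> : expR (a ^+ 2 * v / 2) - 1 - a * (\int[P]_w D w) - a ^+ 2 * (\int[P]_w (D w ^+ 2)) / 2 =
      \int[P]_w (expR (a * D w) - 1 - a * D w - a ^+ 2 / 2 * D w ^+ 2).
    rewrite (RintB (RintegrableB k0 k1) k2) (RintB k0 k1) (RintB (ie a) (Rintegrable_cst P 1)).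
    by rewrite ee Rint_cst (RintZ _ i1) (RintZ _ i2); ring.
  apply: (le_trans (Rint_abs k3)).
  have -> : c1 * `|a| ^+ 3 = (6 * `|a| ^+ 3) * \int[P]_w expR (2 * `|D w|) by rewrite /c1; ring.
  rewrite -(RintZ _ j1); apply: Rint_le; [exact: Rintegrable_abs|exact: RintegrableZ|].
  move=> w; have := expR_taylor2 (a * D w).
  rewrite (_ : (a * D w) ^+ 2 / 2 = a ^+ 2 / 2 * D w ^+ 2); last by field.
  move=> /le_trans; apply; rewrite normrM exprMn.
  have h1 : `|D w| ^+ 3 <= 6 * expR `|D w| := expX 2 (D w).
  have h2 : expR (`|a| * `|D w|) <= expR `|D w| by rewrite ler_expR ler_piMl.
  have -> : 6 * `|a| ^+ 3 * expR (2 * `|D w|) =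
      `|a| ^+ 3 * (6 * expR `|D w| * expR `|D w|).
    have -> : 2 * `|D w| = `|D w| + `|D w| by ring.
    by rewrite expRD; ring.
  rewrite -[leLHS]mulrA ler_wpM2l ?exprn_ge0//.
  by apply: ler_pM; rewrite ?expR_ge0 ?exprn_ge0.
pose c2 := v ^+ 2 / 8 + `|v / 2| ^+ 3 * expR `|v / 2|.
have taylor2 (a : R) : `|a| <= 1 ->
    `|expR (a ^+ 2 * v / 2) - 1 - a ^+ 2 * v / 2| <= c2 * `|a| ^+ 3.
  move=> a1; have a2 : a ^+ 2 <= 1 by rewrite -real_normK ?num_real// expr_le1.
  have := expR_taylor2 (a ^+ 2 * v / 2); set E := expR _ => h.
  have a40 : 0 <= `|a| ^+ 3 by exact: exprn_ge0.
  have a43 : a ^+ 4 <= `|a| ^+ 3.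
    rewrite (_ : a ^+ 4 = `|a| ^+ 4); last by rewrite -normrX ger0_norm// exprn_even_ge0.
    by rewrite exprSr ler_piMr.
  have h2 : `|a ^+ 2 * v / 2| ^+ 3 * expR `|a ^+ 2 * v / 2| <=
      `|a| ^+ 3 * (`|v / 2| ^+ 3 * expR `|v / 2|).
    rewrite -mulrA normrM exprMn -mulrA; apply: ler_pM; rewrite ?exprn_ge0 ?mulr_ge0 ?expR_ge0 ?exprn_ge0//.
      by rewrite normrX -exprM mulnC exprM expr2 ler_piMr// expr_le1.
    rewrite ler_wpM2l ?exprn_ge0// ler_expR ler_piMl//.
    by rewrite ger0_norm// sqr_ge0.
  have h3 : (a ^+ 2 * v / 2) ^+ 2 / 2 <= `|a| ^+ 3 * (v ^+ 2 / 8).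
    have -> : (a ^+ 2 * v / 2) ^+ 2 / 2 = a ^+ 4 * (v ^+ 2 / 8) by field.
    by rewrite ler_wpM2r// mulr_ge0// sqr_ge0.
  have h4 : 0 <= (a ^+ 2 * v / 2) ^+ 2 / 2 by rewrite mulr_ge0// sqr_ge0.
  have -> : c2 * `|a| ^+ 3 = `|a| ^+ 3 * (v ^+ 2 / 8) +
     `|a| ^+ 3 * (`|v / 2| ^+ 3 * expR `|v / 2|) by rewrite /c2; ring.
  rewrite -[X in `|X|](subrK ((a ^+ 2 * v / 2) ^+ 2 / 2)) (le_trans (ler_normD _ _))//.
  by rewrite addrC; apply: lerD; [rewrite ger0_norm|exact: le_trans h2].
have key (a : R) : `|a| <= 1 ->
    `|a * \int[P]_w D w + a ^+ 2 * (\int[P]_w (D w ^+ 2) - v) / 2| <= (c1 + c2) * `|a| ^+ 3.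
  move=> a1; have h1 := taylor a a1; have h2 := taylor2 a a1.
  have -> : a * \int[P]_w D w + a ^+ 2 * (\int[P]_w (D w ^+ 2) - v) / 2 =
    (expR (a ^+ 2 * v / 2) - 1 - a ^+ 2 * v / 2) -
    (expR (a ^+ 2 * v / 2) - 1 - a * (\int[P]_w D w) - a ^+ 2 * (\int[P]_w (D w ^+ 2)) / 2) by field.
  by apply: (le_trans (ler_normB _ _)); rewrite mulrDl [leRHS]addrC; exact: lerD.
set p := \int[P]_w D w in key *; set q := \int[P]_w (D w ^+ 2) in key *.
have small (x c : R) : (forall a : R, 0 < a -> a <= 1 -> `|x| <= c * a) -> x = 0.
  move=> h; apply/eqP; rewrite -normr_le0 leNgt; apply/negP => x0.
  have cx : `|x| <= c by have := h 1 ltr01 (lexx _); rewrite mulr1.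
  have c0 : 0 < c by exact: lt_le_trans cx.
  have := h (`|x| / (2 * c)); rewrite divr_gt0 ?mulr_gt0// => /(_ isT).
  rewrite ler_pdivrMr ?mulr_gt0// => h1; have {}h1 := h1 (ltac:(lra)).
  by rewrite (_ : c * (`|x| / (2 * c)) = `|x| / 2) in h1; [lra|field; lra].
(* Adding and subtracting the estimates at [a] and [- a] separates the coefficient of [a] from that
   of [a ^ 2]. *)
have both (a : R) : 0 < a -> a <= 1 -> `|p| <= (c1 + c2) * a /\ `|q - v| <= 2 * (c1 + c2) * a.
  move=> a0 a1; have aa : `|a| = a by rewrite gtr0_norm.
  have na : `|- a| = a by rewrite normrN.
  have := key a; rewrite aa => /(_ a1); have := key (- a); rewrite na => /(_ a1).
  rewrite sqrrN mulNr; set c := c1 + c2; move: (q - v) => r.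
  rewrite !ler_norml => /andP[x1 x2] /andP[x3 x4].
  have a2 : 0 < a ^+ 2 by rewrite exprn_gt0.
  have c0 : 0 <= c.
    have : 0 <= c * a ^+ 3 by lra.
    by rewrite pmulr_lge0// exprn_gt0.
  split.
    have aa2 : c * a ^+ 2 <= c * a by rewrite ler_wpM2l// expr2 ler_piMr// ltW.
    have e : c * a ^+ 3 = a * (c * a ^+ 2) by ring.
    have y1 : p <= c * a ^+ 2 by rewrite -(ler_pM2l a0) -e; lra.
    have y2 : - (c * a ^+ 2) <= p by rewrite -(ler_pM2l a0) mulrN -e; lra.
    by apply/andP; split; lra.
  have e : c * a ^+ 3 = a ^+ 2 * (c * a) by ring.
  have y1 : r <= 2 * c * a by rewrite -(ler_pM2l a2); move: x2 x4; rewrite e; lra.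
  have y2 : - (2 * c * a) <= r by rewrite -(ler_pM2l a2); move: x1 x3; rewrite e; lra.
  by apply/andP; split.
split; first by apply: (small p (c1 + c2)) => a a0 a1; case: (both a a0 a1).
by apply/eqP; rewrite -subr_eq0; apply/eqP; apply: (small _ (2 * (c1 + c2))) => a a0 a1; case: (both a a0 a1).
Qed.

End gaussian_moments.

(** * Lindeberg replacement *)

Lemma generated_fun_sub (Sm : pointedType) d (T : measurableType d) (I : Type)
    (U : I -> Sm -> T) (D E : set I) d1 (V : measurableType d1) (f : Sm -> V) : D `<=` E ->
  measurable_fun setT (f : g_sigma_algebraType (generated_system U D) -> V) ->
  measurable_fun setT (f : g_sigma_algebraType (generated_system U E) -> V).
Proof.
move=> DE mf _ Y mY.
have := mf (@measurableT _ (g_sigma_algebraType (generated_system U D))) Y mY.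
by apply: sub_sigma_algebra2; exact: bigcup_subset.
Qed.

Section independent_sums.
Context (R : realType) d (Sm : measurableType d) (Q : probability Sm R)
  (I : choiceType) d' (T : measurableType d') (U : I -> Sm -> T).
Hypothesis mU : forall i, measurable_fun setT (U i).
Hypothesis iU : mutually_independent Q U.
Context (K : nat) (D : nat -> set I) (X : nat -> Sm -> 'I_K -> R).
Hypothesis disj : forall i j, i != j -> D i `&` D j = set0.
Hypothesis mX : forall i k, measurable_fun setT
  ((fun w => X i w k) : g_sigma_algebraType (generated_system U (D i)) -> R).

Lemma measurable_summand i k : measurable_fun setT (fun w => X i w k).
Proof. exact: (generated_fun_measurable mU (@mX i k)). Qed.

(** Isolates one summand at an independent sample point, so that its mean can be taken with all the
    other summands frozen. The vectors are packed into tuples to be values in one measurable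
    space. *)
Lemma soft_ball_split (beta x : R) (c : 'I_K -> R) (s : seq nat) (i : nat) : i \notin s ->
  \int[Q]_w soft_ball beta x (fun k => c k + \sum_(j <- s) X j w k + X i w k) =
  \int[(Q \x Q)%E]_z
    soft_ball beta x (fun k => c k + \sum_(j <- s) X j z.1 k + X i z.2 k).
Proof.
move=> si; pose E := \bigcup_(j in [set` s]) D j.
have ED : E `&` D i = set0.
  rewrite setI_bigcupl; apply: bigcup0 => j /= js; apply: disj.
  by apply: contraNneq si => <-.
pose f w := [tuple \sum_(j <- s) X j w k | k < K]; pose g w := [tuple X i w k | k < K].
have mf : measurable_fun setT
    (f : g_sigma_algebraType (generated_system U E) -> K.-tuple R).
  apply/measurable_fun_tnthP => k.
  rewrite (_ : _ \o _ = fun w => \sum_(j <- s) (if j \in s then X j w k else 0)).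
    apply: (@measurable_sum _ (g_sigma_algebraType (generated_system U E))) => j.
    have [js|js] := boolP (j \in s); last exact: measurable_cst.
    by apply: (generated_fun_sub _ (@mX j k)) => y Dy; exists j.
  by apply/funext => w /=; rewrite tnth_mktuple; apply: eq_big_seq => j ->.
have mg : measurable_fun setT
    (g : g_sigma_algebraType (generated_system U (D i)) -> K.-tuple R).
  apply/measurable_fun_tnthP => k.
  rewrite (_ : _ \o _ = fun w => X i w k)//.
  by apply/funext => w /=; rewrite tnth_mktuple.
have mphi : measurable_fun setT (fun z : K.-tuple R * K.-tuple R =>
    soft_ball beta x (fun k => c k + tnth z.1 k + tnth z.2 k)).
  apply: measurable_soft_ball => k; apply: measurable_funD.
    apply: measurable_funD => //; exact: (measurableT_comp (measurable_tnth k)).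
  exact: (measurableT_comp (measurable_tnth k)).
have := Rint_independent_pair mU iU ED mf mg mphi.
have e (w w' : Sm) : soft_ball beta x (fun k => c k + tnth (f w) k + tnth (g w') k) =
  soft_ball beta x (fun k => c k + \sum_(j <- s) X j w k + X i w' k).
  by congr soft_ball; apply/funext => k; rewrite !tnth_mktuple.
under eq_Rintegral do rewrite /= e.
by under [X in _ = X -> _]eq_Rintegral do rewrite /= e.
Qed.

End independent_sums.

Section lindeberg.
Context (R : realType) d (Sm : measurableType d) (Q : probability Sm R)
  (I : choiceType) d' (T : measurableType d') (U : I -> Sm -> T).
Context e (Sm' : measurableType e) (Q' : probability Sm' R)
  (I' : choiceType) e' (T' : measurableType e') (U' : I' -> Sm' -> T').
Hypothesis mU : forall i, measurable_fun setT (U i).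
Hypothesis iU : mutually_independent Q U.
Hypothesis mU' : forall i, measurable_fun setT (U' i).
Hypothesis iU' : mutually_independent Q' U'.
Context (K m : nat) (D : nat -> set I) (X : nat -> Sm -> 'I_K -> R).
Context (D' : nat -> set I') (Y : nat -> Sm' -> 'I_K -> R).
Hypothesis disj : forall i j, i != j -> D i `&` D j = set0.
Hypothesis disj' : forall i j, i != j -> D' i `&` D' j = set0.
Hypothesis mX : forall i k, measurable_fun setT
  ((fun w => X i w k) : g_sigma_algebraType (generated_system U (D i)) -> R).
Hypothesis mY : forall i k, measurable_fun setT
  ((fun w => Y i w k) : g_sigma_algebraType (generated_system U' (D' i)) -> R).
Variables (c : nat -> 'I_K -> 'I_K -> R) (MX : nat -> Sm -> R) (MY : nat -> Sm' -> R)
  (b b' : R).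
Hypothesis X0 : forall i k, (i < m)%N -> Rintegrable Q (fun w => X i w k) /\
  \int[Q]_w X i w k = 0.
Hypothesis Y0 : forall i k, (i < m)%N -> Rintegrable Q' (fun w => Y i w k) /\
  \int[Q']_w Y i w k = 0.
Hypothesis Xc : forall i k l, (i < m)%N -> Rintegrable Q (fun w => X i w k * X i w l) /\
  \int[Q]_w (X i w k * X i w l) = c i k l.
Hypothesis Yc : forall i k l, (i < m)%N -> Rintegrable Q' (fun w => Y i w k * Y i w l) /\
  \int[Q']_w (Y i w k * Y i w l) = c i k l.
Hypothesis XM : forall i w k, `|X i w k| <= MX i w.
Hypothesis YM : forall i w k, `|Y i w k| <= MY i w.
Hypothesis MX0 : forall i w, 0 <= MX i w.
Hypothesis MY0 : forall i w, 0 <= MY i w.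
Hypothesis iMX : forall i, (i < m)%N -> Rintegrable Q (fun w => MX i w ^+ 3) /\
  \int[Q]_w (MX i w ^+ 3) <= b.
Hypothesis iMY : forall i, (i < m)%N -> Rintegrable Q' (fun w => MY i w ^+ 3) /\
  \int[Q']_w (MY i w ^+ 3) <= b'.
Variables (beta x : R).
Hypothesis beta0 : 0 <= beta.
Local Notation soft := (soft_ball beta x).
Local Notation W := (Q' \x Q)%E.

Let msX := measurable_summand mU mX.
Let msY := measurable_summand mU' mY.

(** The summands of the two families live on different spaces, joined by the product measure. The
    first [i] summands are taken from [X], the remaining ones from [Y]. *)
Let hybrid i : Sm' * Sm -> R := fun z =>
  soft (fun k => \sum_(j <- iota 0 i) X j z.2 k + \sum_(j <- iota i (m - i)) Y j z.1 k).

Let soft_bound (a : 'I_K -> R) : `|soft a| <= 1.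
Proof. by rewrite ger0_norm ?soft_ball_le1// ltW// soft_ball_gt0. Qed.

Let isoft d0 (V : measurableType d0) (P : probability V R) (u : V -> 'I_K -> R) :
  (forall k, measurable_fun setT (fun w => u w k)) ->
  Rintegrable P (fun w => soft (u w)).
Proof.
move=> mu; apply: (@Rintegrable_bounded _ _ _ _ _ 1) => //.
exact: measurable_soft_ball.
Qed.

Let msumX s k : measurable_fun setT (fun w => \sum_(j <- s) X j w k).
Proof. by apply: measurable_sum => j; exact: msX. Qed.

Let msumY s k : measurable_fun setT (fun w => \sum_(j <- s) Y j w k).
Proof. by apply: measurable_sum => j; exact: msY. Qed.

(** Consecutive hybrids share every summand but the [i]-th. Given the common part [a z], both means
    have the same second-order expansion, because [X i] and [Y i] are centred with the same
    covariance; only the two cubic remainders are left. *)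
Lemma lindeberg_step i : (i < m)%N ->
  `|\int[W]_z hybrid i.+1 z - \int[W]_z hybrid i z| <= 252 * beta ^+ 3 * (b + b').
Proof.
move=> im; pose s := iota 0 i; pose t := iota i.+1 (m - i.+1).
have is_ : i \notin s by rewrite mem_iota add0n ltnn andbF.
have it : i \notin t by rewrite mem_iota ltnn.
pose a (z : Sm' * Sm) (k : 'I_K) := \sum_(j <- s) X j z.2 k + \sum_(j <- t) Y j z.1 k.
have ma k : measurable_fun setT (fun z => a z k).
  by apply: measurable_funD; [exact: (measurableT_comp (msumX s k))|exact: (measurableT_comp (msumY t k))].
have ih j : Rintegrable W (hybrid j).
  apply: isoft => k; apply: measurable_funD.
    exact: (measurableT_comp (msumX _ k)).
  exact: (measurableT_comp (msumY _ k)).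
have m1 : measurable_fun setT (fun z : (Sm' * Sm) * Sm => soft (fun k => a z.1 k + X i z.2 k)).
  apply: measurable_soft_ball => k; apply: measurable_funD.
    exact: (measurableT_comp (ma k)).
  exact: (measurableT_comp (msX i k)).
have m2 : measurable_fun setT (fun z : (Sm' * Sm) * Sm' => soft (fun k => a z.1 k + Y i z.2 k)).
  apply: measurable_soft_ball => k; apply: measurable_funD.
    exact: (measurableT_comp (ma k)).
  exact: (measurableT_comp (msY i k)).
pose G1 z := \int[Q]_w soft (fun k => a z k + X i w k).
pose G2 z := \int[Q']_w soft (fun k => a z k + Y i w k).
have mG1 : measurable_fun setT G1 by exact: (measurable_Rint1 Q m1).
have mG2 : measurable_fun setT G2 by exact: (measurable_Rint1 Q' m2).
have bG1 z : `|G1 z| <= 1.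
  by apply: Rint_abs_le => //; apply: measurable_soft_ball => k; apply: measurable_funD.
have bG2 z : `|G2 z| <= 1.
  by apply: Rint_abs_le => //; apply: measurable_soft_ball => k; apply: measurable_funD.
have iG1 := Rintegrable_bounded W mG1 bG1.
have iG2 := Rintegrable_bounded W mG2 bG2.
have e1 : \int[W]_z hybrid i.+1 z = \int[W]_z G1 z.
  have [_ <-] := Rfubini1 (ih i.+1); have [_ <-] := Rfubini1 iG1.
  apply: eq_Rintegral => z _.
  have := @soft_ball_split _ _ _ Q _ _ _ U mU iU K D X disj mX beta x
    (fun k => \sum_(j <- t) Y j z k) s i is_.
  rewrite (_ : (fun w => _) = (fun w => hybrid i.+1 (z, w))); last first.
    apply/funext => w; rewrite /hybrid /=; congr soft; apply/funext => k.
    rewrite (_ : 0%N :: iota 1 i = s ++ [:: i]).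
      by rewrite big_cat/= big_seq1 [RHS]addrC addrA.
    by rewrite /s -[0%N :: _]/(iota 0 i.+1) -[i.+1]addn1 iotaD add0n.
  move=> ->.
  have iS : Rintegrable (Q \x Q)%E (fun z0 => soft (fun k =>
      \sum_(j <- t) Y j z k + \sum_(j <- s) X j z0.1 k + X i z0.2 k)).
    apply: isoft => k; apply: measurable_funD; last exact: (measurableT_comp (msX i k)).
    by apply: measurable_funD => //; exact: (measurableT_comp (msumX s k)).
  have [_ <-] := Rfubini1 iS.
  apply: eq_Rintegral => w _; apply: eq_Rintegral => w' _ /=.
  by congr soft; apply/funext => k; rewrite /a/=; congr (_ + _); exact: addrC.
have e2 : \int[W]_z hybrid i z = \int[W]_z G2 z.
  have [_ <-] := Rfubini2 (ih i); have [_ <-] := Rfubini2 iG2.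
  apply: eq_Rintegral => z _.
  have := @soft_ball_split _ _ _ Q' _ _ _ U' mU' iU' K D' Y disj' mY beta x
    (fun k => \sum_(j <- s) X j z k) t i it.
  rewrite (_ : (fun w => _) = (fun w => hybrid i (w, z))); last first.
    apply/funext => w; rewrite /hybrid /=; congr soft; apply/funext => k.
    rewrite -addrA; congr (_ + _).
    rewrite (_ : iota i (m - i) = i :: t); last by rewrite /t -(subnSK im).
    by rewrite big_cons addrC.
  move=> ->.
  have iS : Rintegrable (Q' \x Q')%E (fun z0 => soft (fun k =>
      \sum_(j <- s) X j z k + \sum_(j <- t) Y j z0.1 k + Y i z0.2 k)).
    apply: isoft => k; apply: measurable_funD; last exact: (measurableT_comp (msY i k)).
    by apply: measurable_funD => //; exact: (measurableT_comp (msumY t k)).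
  by have [_ <-] := Rfubini1 iS.
rewrite e1 e2 -(RintB iG1 iG2); apply: Rint_abs_le; first exact: measurable_funB.
move=> z; have h1 := soft_ball_increment_mean x (fun k => (X0 k im).1) (fun k l => (Xc k l im).1)
  (fun k => (X0 k im).2) (fun k l => (Xc k l im).2) (a z) beta0 (XM i) (MX0 i) (iMX im).1.
have h2 := soft_ball_increment_mean x (fun k => (Y0 k im).1) (fun k l => (Yc k l im).1)
  (fun k => (Y0 k im).2) (fun k l => (Yc k l im).2) (a z) beta0 (YM i) (MY0 i) (iMY im).1.
rewrite /G1 /G2 mulrDr; have bb : 0 <= 252 * beta ^+ 3 by rewrite mulr_ge0// exprn_ge0.
set E := soft (a z) + _ in h1 h2.
rewrite -[X in `|X|](subrKA E); apply: (le_trans (ler_normD _ _)); apply: lerD.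
  by apply: (le_trans h1); rewrite ler_wpM2l// (iMX im).2.
by rewrite distrC; apply: (le_trans h2); rewrite ler_wpM2l// (iMY im).2.
Qed.

Lemma lindeberg : 
  `|\int[Q]_w soft (fun k => \sum_(j < m) X j w k) -
    \int[Q']_w soft (fun k => \sum_(j < m) Y j w k)| <= m%:R * (252 * beta ^+ 3 * (b + b')).
Proof.
have tel i : (i <= m)%N -> `|\int[W]_z hybrid i z - \int[W]_z hybrid 0 z| <=
    i%:R * (252 * beta ^+ 3 * (b + b')).
  elim: i => [|i ih] im; first by rewrite subrr normr0 mul0r.
  rewrite -[X in `|X|](subrKA (\int[W]_z hybrid i z)); apply: (le_trans (ler_normD _ _)).
  by rewrite mulrS mulrDl mul1r; apply: lerD; [exact: lindeberg_step|exact: ih (ltnW im)].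
have i1 : Rintegrable W (hybrid m).
  apply: isoft => k; apply: measurable_funD.
    exact: (measurableT_comp (msumX _ k)).
  exact: (measurableT_comp (msumY _ k)).
have i2 : Rintegrable W (hybrid 0).
  apply: isoft => k; apply: measurable_funD.
    exact: (measurableT_comp (msumX _ k)).
  exact: (measurableT_comp (msumY _ k)).
have e1 : \int[W]_z hybrid m z = \int[Q]_w soft (fun k => \sum_(j < m) X j w k).
  have [_ <-] := Rfubini1 i1; rewrite -[RHS](Rint_cst Q').
  apply: eq_Rintegral => z _; apply: eq_Rintegral => w _; rewrite /hybrid/=.
  congr soft; apply/funext => k; rewrite subnn/= big_nil addr0.
  by rewrite -[in LHS](subn0 m) -/(index_iota 0 m) big_mkord.
have e2 : \int[W]_z hybrid 0 z = \int[Q']_w soft (fun k => \sum_(j < m) Y j w k).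
  have [_ <-] := Rfubini2 i2; rewrite -[RHS](Rint_cst Q).
  apply: eq_Rintegral => z _; apply: eq_Rintegral => w _; rewrite /hybrid/=.
  congr soft; apply/funext => k; rewrite big_nil add0r.
  by rewrite -/(index_iota 0 m) big_mkord.
by rewrite -e1 -e2; exact: tel.
Qed.

End lindeberg.

(** * Brownian increments and the supremum of the modulus *)

(** Above the level [a], write [y = a + z] and use [(a + z) ^ 3 <= 4 a ^ 3 + 4 z ^ 3] and
    [z ^ 3 <= 6 exp z]. Applied to a maximum of many Gaussian variables, the exponential term can be
    summed over them at the price of a factor [exp (- a)]. *)
Lemma cube_le_exp (R : realType) (a y : R) : 0 <= a -> 0 <= y ->
  y ^+ 3 <= 4 * a ^+ 3 + 24 * (expR y * expR (- a)).
Proof.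
move=> a0 y0; rewrite -expRD; have [ya|ay] := leP y a.
  have h : y ^+ 3 <= a ^+ 3 by rewrite lerXn2r ?nnegrE.
  have := exprn_ge0 3 a0; have := expR_ge0 (y - a); lra.
have z0 : 0 <= y - a by lra.
have := expR_ge1Dxn 2 z0; rewrite (_ : 3`!%:R = 6 :> R)//.
move: (expR (y - a)) => e; set z := y - a in z0 *; have -> : y = a + z by rewrite /z; ring.
have : (a + z) ^+ 3 <= 4 * a ^+ 3 + 4 * z ^+ 3.
  have : 0 <= 3 * (a + z) * (a - z) ^+ 2 by rewrite mulr_ge0 ?sqr_ge0// mulr_ge0// addr_ge0.
  rewrite -subr_ge0 => h; rewrite -subr_ge0; apply: le_trans h _.
  by rewrite le_eqVlt; apply/orP; left; apply/eqP; ring.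
move=> h1 h2; have : z ^+ 3 <= 6 * e.
  by rewrite mulrC -ler_pdivrMr//; lra.
lra.
Qed.

Section brownian_grid.
Context (R : realType) (dB : measure_display) (OB : measurableType dB)
  (PB : probability OB R) (B : R -> OB -> R).
Hypothesis bm : brownian_motion PB B.

Lemma bm_measurable t : 0 <= t <= 1 -> measurable_fun setT (B t).
Proof. by have [h _ _ _ _] := bm; exact: h. Qed.

(** The degenerate case [s = t] is included since consecutive points of a grid may coincide. *)
Lemma bm_increment_mgf s t (a : R) : 0 <= s -> s <= t -> t <= 1 ->
  (\int[PB]_w (expR (a * (B t w - B s w)))%:E = (expR (a ^+ 2 * (t - s) / 2))%:E)%E.
Proof.
move=> s0; rewrite le_eqVlt => /orP[/eqP <- t1|st t1].
  under eq_integral do rewrite subrr mulr0 expR0.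
  by rewrite subrr mulr0 mul0r expR0 integral_cst//= probability_setT mule1.
have [_ _ _ nB _] := bm.
have ms : measurable_fun setT (B s) by apply: bm_measurable; lra.
have mt : measurable_fun setT (B t) by apply: bm_measurable; lra.
have mD : measurable_fun setT (fun w => B t w - B s w : measurableTypeR R).
  by move=> _ Y mY; exact: (measurable_funB mt ms measurableT mY).
have me : measurable_fun setT (fun x : measurableTypeR R => (expR (a * x))%:E).
  by apply/measurable_EFinP; apply: measurableT_comp => //; exact: measurable_funM.
rewrite (@ge0_integral_law R _ _ _ OB (measurableTypeR R) (measurableTypeR R) PB
  (normal_prob 0 (Num.sqrt (t - s))) _ id mD _ _ (fun x => (expR (a * x))%:E) me)//.
- rewrite normal_mgf ?sqr_sqrtr ?subr_ge0 ?(ltW st)//.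
  by rewrite gt_eqF// sqrtr_gt0 subr_gt0.
- by move=> A mA; exact: (nB _ _ s0 st t1 A mA).
Qed.

Section increments.
Variables (tau : nat -> R).
Hypothesis tau01 : forall i, 0 <= tau i <= 1.
Hypothesis nd : forall i, tau i <= tau i.+1.
Let V i w := B (tau i.+1) w - B (tau i) w.

Lemma bm_grid_independent : mutually_independent PB V.
Proof. by have [_ _ _ _ h] := bm; exact: h. Qed.

Lemma bm_grid_measurable i : measurable_fun setT (V i).
Proof. by apply: measurable_funB; exact: bm_measurable. Qed.

Let mgf i (a : R) :
  (\int[PB]_w (expR (a * V i w))%:E = (expR (a ^+ 2 * (tau i.+1 - tau i) / 2))%:E)%E.
Proof. by apply: bm_increment_mgf => //; [case/andP: (tau01 i)|case/andP: (tau01 i.+1)]. Qed.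

Lemma bm_grid_moments i : [/\ Rintegrable PB (V i), Rintegrable PB (fun w => V i w ^+ 2),
  \int[PB]_w V i w = 0 & \int[PB]_w (V i w ^+ 2) = tau i.+1 - tau i].
Proof.
have [i1 i2] := gaussian_integrable (bm_grid_measurable i) (mgf i).
by have [m1 m2] := gaussian_moments (bm_grid_measurable i) (mgf i).
Qed.

Lemma bm_grid_generated i (E : set nat) : E i ->
  measurable_fun setT (V i : g_sigma_algebraType (generated_system V E) -> R).
Proof. exact: measurable_generated. Qed.

Lemma bm_grid_uncorrelated i j : i != j ->
  Rintegrable PB (fun w => V i w * V j w) /\ \int[PB]_w (V i w * V j w) = 0.
Proof.
move=> ij; have [i1 _ e1 _] := bm_grid_moments i; have [i2 _ _ _] := bm_grid_moments j.
have := @independent_mean _ _ _ PB _ _ _ V [set i] [set j] (V i) (V j)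
  bm_grid_measurable bm_grid_independent _ (bm_grid_generated erefl)
  (bm_grid_generated erefl) i1 i2.
rewrite e1 mul0r; apply; apply/seteqP; split => // k [/= -> /eqP].
by rewrite (negbTE ij).
Qed.

(** Generating functions multiply by independence. Needed for sums of increments over cells that are
    not adjacent, which are not themselves increments of [B]. *)
Lemma bm_grid_sum_mgf (s : seq nat) (a : R) : uniq s ->
  Rintegrable PB (fun w => expR (a * \sum_(i <- s) V i w)) /\
  \int[PB]_w expR (a * \sum_(i <- s) V i w) =
    expR (a ^+ 2 * (\sum_(i <- s) (tau i.+1 - tau i)) / 2).
Proof.
elim: s => [|i s ih] /=.
  move=> _; under eq_fun do rewrite big_nil mulr0 expR0.
  rewrite big_nil mulr0 mul0r expR0; split; first exact: Rintegrable_cst.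
  exact: Rint_cst.
move=> /andP[is_ us]; have [i2 e2] := ih us.
have i1 : Rintegrable PB (fun w => expR (a * V i w)).
  apply: Rintegrable_ge0.
  - by apply: measurableT_comp => //; apply: measurable_funM => //; exact: bm_grid_measurable.
  - by move=> w; exact: expR_ge0.
  - by rewrite mgf ltry.
have e1 : \int[PB]_w expR (a * V i w) = expR (a ^+ 2 * (tau i.+1 - tau i) / 2).
  by apply: EFin_inj; rewrite (RintE i1) mgf.
have E w : expR (a * \sum_(i <- i :: s) V i w) =
    expR (a * V i w) * expR (a * \sum_(i <- s) V i w).
  by rewrite big_cons mulrDr expRD.
have [] := @independent_mean _ _ _ PB _ _ _ V [set i] [set` s] (fun w => expR (a * V i w))
  (fun w => expR (a * \sum_(i <- s) V i w)) bm_grid_measurable bm_grid_independent _ _ _ i1 i2.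
- by apply/seteqP; split => // k [/= ->] /=; rewrite (negbTE is_).
- apply: (measurableT_comp (@measurable_expR R)).
  by apply: measurable_funM; [exact: measurable_cst|exact: bm_grid_generated].
- apply: (measurableT_comp (@measurable_expR R)).
  apply: measurable_funM; first exact: measurable_cst.
  rewrite (_ : (fun w => \sum_(i <- s) V i w) =
    fun w => \sum_(i <- s) (if i \in s then V i w else 0)); last first.
    by apply/funext => w; apply: eq_big_seq => j ->.
  apply: measurable_sum => j; have [js|js] := boolP (j \in s); last exact: measurable_cst.
  exact: bm_grid_generated.
move=> i3 e3; under eq_fun do rewrite E; split => //.
by rewrite [LHS]e3 e1 e2 -expRD big_cons; congr expR; ring.
Qed.

End increments.
End brownian_grid.

Lemma measurable_bigmax d (T : measurableType d) (R : realType) (I : Type) (s : seq I)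
    (f : I -> T -> R) : (forall i, measurable_fun setT (f i)) ->
  measurable_fun setT (fun w => \big[Num.max/0]_(i <- s) f i w).
Proof.
move=> mf; elim: s => [|i s ih].
  by under eq_fun do rewrite big_nil; exact: measurable_cst.
by under eq_fun do rewrite big_cons; exact: measurable_maxr.
Qed.

Section brownian_pieces.
Context (R : realType) (dB : measure_display) (OB : measurableType dB)
  (PB : probability OB R) (B : R -> OB -> R).
Hypothesis bm : brownian_motion PB B.
Variables (K m : nat) (s : nat -> R).
Hypothesis m0 : (0 < m)%N.
Hypothesis s0 : s 0%N = 0.
Hypothesis snd : forall l, s l <= s l.+1.
Hypothesis s1 : forall l, s l <= 1.

(** The index [p = l * m + i] stands for the [i]-th of [m] equal parts of the cell between [s l] and
    [s l.+1]; Euclidean division by [m] recovers [l] and [i]. *)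
Let tau p := s (p %/ m) + (p %% m)%:R / m%:R * (s (p %/ m).+1 - s (p %/ m)).
Let V p w := B (tau p.+1) w - B (tau p) w.
Let mR0 : m%:R != 0 :> R. Proof. by rewrite pnatr_eq0 -lt0n. Qed.

Lemma fine_gridE l i : (i <= m)%N ->
  tau (l * m + i) = s l + i%:R / m%:R * (s l.+1 - s l).
Proof.
rewrite leq_eqVlt => /orP[/eqP ->|im]; rewrite /tau.
  rewrite -mulSnr modnMl mulnK// mul0r mul0r addr0 divff//; ring.
by rewrite divnMDl// divn_small// addn0 modnMDl modn_small.
Qed.

Lemma fine_gridS l i : (i < m)%N ->
  tau (l * m + i).+1 - tau (l * m + i) = (s l.+1 - s l) / m%:R.
Proof. by move=> im; rewrite -addnS !fine_gridE ?(ltnW im)// mulrS; field. Qed.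

Let p_div p : p = (p %/ m * m + p %% m)%N. Proof. exact: divn_eq. Qed.

Lemma fine_grid_nd p : tau p <= tau p.+1.
Proof.
rewrite -subr_ge0 (p_div p) fine_gridS ?ltn_pmod//.
by rewrite divr_ge0// subr_ge0.
Qed.

Lemma fine_grid01 p : 0 <= tau p <= 1.
Proof.
have sge l : 0 <= s l by elim: l => [|l ih]; [rewrite s0|exact: le_trans (snd l)].
rewrite /tau; set q := (p %% m)%:R / m%:R.
have q0 : 0 <= q by rewrite divr_ge0.
have q1 : q <= 1 by rewrite ler_pdivrMr ?ltr0n// mul1r ler_nat ltnW// ltn_pmod.
have := sge (p %/ m)%N; have := snd (p %/ m)%N; have := s1 (p %/ m).+1%N.
move: (s (p %/ m)%N) (s (p %/ m).+1%N) => a b b1 ab a0.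
by apply/andP; split; nra.
Qed.

(* The [i]-th piece collects the [i]-th of the [m] subincrements of each cell of
   the grid [s]; the [m] pieces are independent and add up to [B] on the grid. *)
Definition bm_piece i w (k : 'I_K) : R :=
  \sum_(l < k.+1) (if (i < m)%N then V (l * m + i) w else 0).

Lemma bm_piece_sum w k : \sum_(i < m) bm_piece i w k = B (s k.+1) w.
Proof.
rewrite exchange_big/=.
transitivity (\sum_(l < k.+1) (B (s l.+1) w - B (s l) w)).
  apply: eq_bigr => l _; transitivity (\sum_(i < m) V (l * m + i) w).
    by apply: eq_bigr => i _; rewrite ltn_ord.
  rewrite -(big_mkord xpredT (fun i => V (l * m + i) w)) /V.
  under eq_bigr do rewrite -addnS.
  rewrite (telescope_sumr (fun i => B (tau (l * m + i)) w))//.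
  have -> : tau (l * m + m)%N = s l.+1 by rewrite fine_gridE// divff//; ring.
  by have -> : tau (l * m + 0)%N = s l by rewrite fine_gridE// mul0r mul0r addr0.
rewrite -(big_mkord xpredT (fun l => B (s l.+1) w - B (s l) w)).
rewrite (telescope_sumr (fun l => B (s l) w))// s0.
by have [_ -> _ _ _] := bm; rewrite subr0.
Qed.

Let D (i : nat) := [set p : nat | (p %% m)%N = i].

Lemma bm_piece_measurable i k : measurable_fun setT
  ((fun w => bm_piece i w k) : g_sigma_algebraType (generated_system V (D i)) -> R).
Proof.
apply: measurable_sum => l; have [im|im] := boolP (i < m)%N; last exact: measurable_cst.
by apply: bm_grid_generated; rewrite /D/= modnMDl modn_small.
Qed.

Let moments := bm_grid_moments bm fine_grid01 fine_grid_nd.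

Lemma bm_piece_mean i k : (i < m)%N ->
  Rintegrable PB (fun w => bm_piece i w k) /\ \int[PB]_w bm_piece i w k = 0.
Proof.
move=> im; rewrite /bm_piece im; split.
  by apply: Rintegrable_sum => l _; case: (moments (l * m + i)).
rewrite Rint_sum => [|l _]; last by case: (moments (l * m + i)).
by rewrite big1// => l _; case: (moments (l * m + i)).
Qed.

(** Distinct increments are uncorrelated, so only the cells common to both partial sums contribute,
    and their lengths telescope. *)
Lemma bm_piece_covariance i k k' : (i < m)%N ->
  Rintegrable PB (fun w => bm_piece i w k * bm_piece i w k') /\
  \int[PB]_w (bm_piece i w k * bm_piece i w k') = s (minn k k').+1 / m%:R.
Proof.
move=> im.
have E w : bm_piece i w k * bm_piece i w k' =
    \sum_(l < k.+1) \sum_(l' < k'.+1) V (l * m + i) w * V (l' * m + i) w.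
  by rewrite /bm_piece im big_distrlr.
have VV l l' : Rintegrable PB (fun w => V (l * m + i) w * V (l' * m + i) w) /\
    \int[PB]_w (V (l * m + i) w * V (l' * m + i) w) =
    if l == l' then (s l.+1 - s l) / m%:R else 0.
  case: eqVneq => [->|ll'].
    have [_ i2 _ e2] := moments (l' * m + i); rewrite -(fine_gridS l' im) -[RHS]e2.
    by split; [under eq_fun do rewrite -expr2|apply: eq_Rintegral => w _; rewrite expr2].
  apply: (bm_grid_uncorrelated bm fine_grid01 fine_grid_nd).
  by apply: contraNneq ll' => /eqP; rewrite eqn_add2r eqn_pmul2r.
rewrite (funext E); split.
  by apply: Rintegrable_sum => l _; apply: Rintegrable_sum => l' _; case: (VV l l').
rewrite Rint_sum => [|l _]; last by apply: Rintegrable_sum => l' _; case: (VV l l').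
transitivity (\sum_(l < k.+1 | (l < k'.+1)%N) (s l.+1 - s l) / m%:R).
  rewrite [RHS]big_mkcond/=; apply: eq_bigr => l _.
  rewrite Rint_sum => [|l' _]; last by case: (VV l l').
  under eq_bigr do rewrite (VV _ _).2.
  rewrite -big_mkcond/=; case: ifPn => lk'.
    by rewrite (big_pred1 (Ordinal lk')).
  by rewrite big_pred0// => l'; apply/negbTE; apply: contra lk' => /eqP ->.
rewrite -(big_mkord (fun l => (l < k'.+1)%N) (fun l => (s l.+1 - s l) / m%:R)).
transitivity (\sum_(0 <= l < (minn k k').+1) (s l.+1 - s l) / m%:R).
  have h : ((minn k k').+1 <= k.+1)%N by rewrite ltnS geq_minl.
  rewrite (big_cat_nat (n := (minn k k').+1))//= [X in _ + X](_ : _ = 0) ?addr0.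
    rewrite big_nat_cond [RHS]big_nat_cond; apply: eq_bigl => l /=.
    case: (l < (minn k k').+1)%N / ltnP => //=; rewrite ltnS leq_min => /andP[_ lk'].
    by rewrite ltnS lk'.
  rewrite big_nat_cond big_pred0// => l; rewrite ltnS [(l < k'.+1)%N]ltnS; apply/negP => /andP[/andP[h1 h2] h3].
  by move: h1; rewrite gtn_min -ltnS ltnS ltnNge h2/= ltnNge h3.
rewrite -mulr_suml telescope_sumr//.
by rewrite s0 subr0.
Qed.

Definition bm_piece_max i w : R := \big[Num.max/0]_(k < K) `|bm_piece i w k|.

Lemma bm_piece_max_ge0 i w : 0 <= bm_piece_max i w.
Proof. by rewrite /bm_piece_max; elim/big_ind: _ => // x y ? ?; rewrite le_max; apply/orP; left. Qed.

Lemma bm_piece_le_max i w k : `|bm_piece i w k| <= bm_piece_max i w.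
Proof. exact: le_bigmax_cond. Qed.

Let mpiece i k : measurable_fun setT (fun w => bm_piece i w k).
Proof.
apply: measurable_sum => l; have [im|im] := boolP (i < m)%N; last exact: measurable_cst.
exact: (bm_grid_measurable bm fine_grid01).
Qed.

(** Multiplied by the square root of [m], a piece has variance [s k.+1 <= 1], which gives
    [2 exp (1/2) <= 4]. *)
Lemma bm_piece_exp i k : (i < m)%N ->
  Rintegrable PB (fun w => expR (Num.sqrt m%:R * `|bm_piece i w k|)) /\
  \int[PB]_w expR (Num.sqrt m%:R * `|bm_piece i w k|) <= 4.
Proof.
move=> im; pose S := [seq (l * m + i)%N | l <- iota 0 k.+1].
have uS : uniq S.
  rewrite map_inj_uniq ?iota_uniq// => x y /eqP.
  by rewrite eqn_add2r eqn_pmul2r// => /eqP.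
have SE w : \sum_(p <- S) V p w = bm_piece i w k.
  by rewrite big_map -/(index_iota 0 k.+1) big_mkord /bm_piece im.
have vE : \sum_(p <- S) (tau p.+1 - tau p) = s k.+1 / m%:R.
  rewrite big_map -/(index_iota 0 k.+1).
  under eq_bigr do rewrite (fine_gridS _ im).
  by rewrite -mulr_suml telescope_sumr// s0 subr0.
have mgf (a : R) : (\int[PB]_w (expR (a * bm_piece i w k))%:E =
    (expR (a ^+ 2 * (s k.+1 / m%:R) / 2))%:E)%E.
  have [i1 e1] := bm_grid_sum_mgf bm fine_grid01 fine_grid_nd a uS.
  rewrite -vE -[in RHS]e1 (RintE i1); apply: eq_integral => w _.
  by rewrite SE.
have [i1 e1] := gaussian_exp_abs (mpiece i k) mgf (sqrtr_ge0 m%:R).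
split => //; apply: (le_trans e1); rewrite sqr_sqrtr//.
rewrite (_ : m%:R * (s k.+1 / m%:R) / 2 = s k.+1 / 2); last by field.
have h : expR (s k.+1 / 2) <= expR (2^-1) by rewrite ler_expR ler_pdivrMr// mulVf ?s1.
have : expR (2^-1 : R) <= 2.
  have h2 : 2^-1 <= expR (- 2^-1 : R) by have := expR_ge1Dx (- 2^-1 : R); lra.
  have e0 := expR_gt0 (2^-1 : R).
  have : expR (2^-1 : R) * expR (- 2^-1) = 1 by rewrite expRN divff// gt_eqF.
  move: h2 e0; move: (expR (- 2^-1)) (expR 2^-1) => p q; nra.
lra.
Qed.

(** The maximum is handled by summing the exponentials of [cube_le_exp] over all [K] coordinates;
    [96 = 24 * 4]. The free parameter [a] is taken much larger than [log K] later on. *)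
Lemma bm_piece_max_cube i (a : R) : (i < m)%N -> 0 <= a ->
  Rintegrable PB (fun w => bm_piece_max i w ^+ 3) /\
  \int[PB]_w (bm_piece_max i w ^+ 3) <=
    (4 * a ^+ 3 + 96 * K%:R * expR (- a)) / (Num.sqrt m%:R) ^+ 3.
Proof.
move=> im a0; set r := Num.sqrt m%:R.
have r0 : 0 < r by rewrite sqrtr_gt0 ltr0n.
pose f w := 4 * a ^+ 3 + (24 * expR (- a)) * \sum_(k < K) expR (r * `|bm_piece i w k|).
have ifs : Rintegrable PB (fun w => \sum_(k < K) expR (r * `|bm_piece i w k|)).
  by apply: Rintegrable_sum => k _; exact: (bm_piece_exp k im).1.
have if_ : Rintegrable PB f.
  by apply: RintegrableD; [exact: Rintegrable_cst|exact: RintegrableZ].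
have le w : bm_piece_max i w ^+ 3 <= (r ^+ 3)^-1 * f w.
  rewrite mulrC ler_pdivlMr ?exprn_gt0// -exprMn mulrC.
  have f0 : 4 * a ^+ 3 + 24 * expR (- a) * 0 <= f w.
    rewrite lerD2l ler_wpM2l ?mulr_ge0 ?expR_ge0//.
    by apply: sumr_ge0 => k _; exact: expR_ge0.
  rewrite /bm_piece_max; elim/big_ind: _ => [|x y hx hy|k _].
  - rewrite mulr0 expr0n/=; apply: le_trans f0.
    by rewrite mulr0 addr0 mulr_ge0// exprn_ge0.
  - by case: (leP x y).
  - apply: (le_trans (cube_le_exp a0 _)); first by rewrite mulr_ge0// ltW.
    rewrite lerD2l -mulrA ler_pM2l// [leRHS]mulrC ler_wpM2r ?expR_ge0//.
    rewrite (bigD1 k)//= lerDl; apply: sumr_ge0 => j _; exact: expR_ge0.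
have i1 : Rintegrable PB (fun w => bm_piece_max i w ^+ 3).
  apply: Rintegrable_le (RintegrableZ (r ^+ 3)^-1 if_).
    apply: measurable_funX; rewrite /bm_piece_max; apply: measurable_bigmax => k.
    by apply: measurableT_comp => //; exact: mpiece.
  by move=> w; rewrite ger0_norm// exprn_ge0// bm_piece_max_ge0.
split => //; apply: (le_trans (Rint_le i1 (RintegrableZ _ if_) le)).
rewrite (RintZ _ if_) mulrC ler_wpM2r ?invr_ge0 ?exprn_ge0 ?(ltW r0)//.
rewrite [leLHS](RintD (Rintegrable_cst PB _) (RintegrableZ _ ifs)) Rint_cst.
rewrite (RintZ _ ifs) lerD2l Rint_sum => [|k _]; last exact: (bm_piece_exp k im).1.
have : \sum_(k < K) \int[PB]_w expR (r * `|bm_piece i w k|) <= K%:R * 4.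
  have -> : K%:R * 4 = \sum_(k < K) (4 : R) by rewrite sumr_const card_ord mulr_natl.
  by apply: ler_sum => k _; exact: (bm_piece_exp k im).2.
have := expR_ge0 (- a); set S := \sum_(k < K) _; nra.
Qed.

End brownian_pieces.

(** * The supremum of the modulus and its approximation by maxima over grids *)

Section sup_abs.
Context (R : realType).
Implicit Types (f : R -> R).

Lemma le_sup_abs f (M : R) t : (forall u, 0 <= u <= 1 -> `|f u| <= M) ->
  0 <= t <= 1 -> `|f t| <= sup_abs f.
Proof.
move=> fM t01; apply: ub_le_sup; last by exists t => //=; rewrite in_itv.
by exists M => _ [u /= + <-]; rewrite in_itv/=; exact: fM.
Qed.

Lemma sup_abs_le f (r : R) : (forall t, 0 <= t <= 1 -> `|f t| <= r) -> sup_abs f <= r.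
Proof.
move=> fr; apply: ge_sup; first by exists `|f 0|, 0 => //=; rewrite in_itv/= lexx ler01.
by move=> _ [u /= + <-]; rewrite in_itv/=; exact: fr.
Qed.

Lemma sup_abs_ge0 f : 0 <= sup_abs f.
Proof.
(* For an unbounded path the real supremum has its default value 0. *)
have [[M hM]|nb] := pselect (has_ubound [set `|f t| | t in `[0, 1]%classic]).
  apply: (@le_trans _ _ `|f 0|) => //; apply: ub_le_sup; first by exists M.
  by exists 0 => //=; rewrite in_itv/= lexx ler01.
by rewrite /sup_abs sup_out// => -[].
Qed.

(** The common regularity of Brownian paths and of compensated sums: the supremum over [[0, 1]] is
    determined by the rational times, which makes it measurable. *)
Definition rational_path f := (exists M : R, forall t : R, 0 <= t <= 1 -> `|f t| <= M) /\
  forall t e : R, 0 <= t <= 1 -> 0 < e ->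
    exists2 q : rat, 0 <= (ratr q : R) <= 1 & `|f (ratr q) - f t| <= e.

Lemma measurable_sup_abs d (T : measurableType d) (W : R -> T -> R) :
  (forall w, rational_path (W ^~ w)) ->
  (forall t, 0 <= t <= 1 -> measurable_fun setT (W t)) ->
  measurable_fun setT (fun w => sup_abs (W ^~ w)).
Proof.
move=> rW mW; apply: measurable_fun_of_le => r.
(* Rational times are enumerated by their codes; codes of nothing, and rationals outside [[0, 1]],
   impose no condition. *)
pose A (n : nat) : set T := if @choice.unpickle rat n is Some q then
  (if 0 <= (ratr q : R) <= 1 then [set w | `|W (ratr q) w| <= r] else setT) else setT.
rewrite (_ : [set _ | _] = \bigcap_n A n).
  apply: bigcapT_measurable => n; rewrite /A; case: choice.unpickle => // q.
  case: ifPn => // q01.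
  rewrite -[X in measurable X]setTI; have := measurableT_comp (@normr_measurable R setT) (mW _ q01).
  move=> /(_ measurableT `]-oo, r]%classic (measurable_itv _)).
  by congr measurable; apply/seteqP; split => w /=; rewrite in_itv/= => -[].
have [M0 _] := rW point.
apply/seteqP; split => [w /= h n _|w h].
  rewrite /A; case: choice.unpickle => // q; case: ifPn => // q01 /=.
  by have [[M hM] _] := rW w; apply: le_trans h; exact: (le_sup_abs hM).
apply: sup_abs_le => t t01; apply/ler_addgt0Pr => e e0.
have [_ /(_ t e t01 e0)[q q01 qe]] := rW w.
have := h (choice.pickle q) I; rewrite /A choice.pickleK q01 /= => h1.
rewrite -[W t w](subrK (W (ratr q) w)) (le_trans (ler_normD _ _))// addrC lerD//.
by rewrite distrC.
Qed.

Definition path_continuous f := forall t e : R, 0 <= t <= 1 -> 0 < e ->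
  exists2 r : R, 0 < r & forall u : R, 0 <= u <= 1 -> `|u - t| < r -> `|f u - f t| < e.

Lemma within_path_continuous f : {within `[0, 1], continuous f} -> path_continuous f.
Proof.
move=> /subspace_continuousP cf t e t01 e0.
have t01' : `[0, 1]%classic t by rewrite /= in_itv.
have /cvgrPdist_lt/(_ e e0) := cf t t01'.
move=> /nbhs_ballP[r /= r0 h]; exists r => // u u01 ut.
by rewrite distrC; apply: h; rewrite /= ?in_itv// /ball/= distrC.
Qed.

Lemma within_path_bounded f : {within `[0, 1], continuous f} ->
  exists M, forall t, 0 <= t <= 1 -> `|f t| <= M.
Proof.
move=> cf; have cn : {within `[0, 1], continuous (fun t => `|f t|)}.
  by move=> x; apply: continuous_comp; [exact: cf|exact: norm_continuous].
have [c _ h] := EVT_max ler01 cn.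
by exists `|f c| => t t01; apply: h; rewrite in_itv.
Qed.

Lemma path_continuous_rational f : path_continuous f ->
  (exists M, forall t, 0 <= t <= 1 -> `|f t| <= M) -> rational_path f.
Proof.
move=> cf bf; split => // t e t01 e0; have [r r0 h] := cf t e t01 e0.
have : exists2 q : rat, 0 <= (ratr q : R) <= 1 & `|ratr q - t| < r.
  have /andP[t0 t1] := t01.
  have [t1'|t1'] := ltP t 1.
    have tm : t < Num.min 1 (t + r) by rewrite lt_min t1' ltrDl.
    have [q] := rat_in_itvoo tm; rewrite in_itv/= lt_min => /andP[tq /andP[q1 qr]]; exists q.
      by rewrite (le_trans t0 (ltW tq)) ltW.
    by rewrite gtr0_norm ?subr_gt0// ltrBlDl.
  have -> : t = 1 by apply/eqP; rewrite eq_le t1.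
  by exists 1%Q; rewrite rmorph1 ?lexx ?ler01// subrr normr0.
by move=> [q q01 qr]; exists q => //; apply: ltW; exact: h.
Qed.

Definition unit_grid (K : nat) (s : nat -> R) :=
  [/\ (0 < K)%N, s 0%N = 0, s K = 1, forall l, s l <= s l.+1 & forall l, s l <= 1].

Definition grid_max (K : nat) (s : nat -> R) f : R :=
  \big[Num.max/0]_(k < K) `|f (s k.+1)|.

Lemma unit_grid01 K s l : unit_grid K s -> 0 <= s l <= 1.
Proof.
move=> [_ s0 _ nd s1]; rewrite s1 andbT; elim: l => [|l ih]; first by rewrite s0.
exact: le_trans (nd l).
Qed.

Lemma grid_max_ge K s f (k : 'I_K) : `|f (s k.+1)| <= grid_max K s f.
Proof. exact: (@le_bigmax_cond _ _ _ _ _ _ (fun k : 'I_K => `|f (s k.+1)|)). Qed.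

Lemma grid_max_le K s f (r : R) : 0 <= r -> (forall k : 'I_K, `|f (s k.+1)| <= r) ->
  grid_max K s f <= r.
Proof.
move=> r0 fr; rewrite /grid_max; elim/big_ind: _ => // x y xr yr.
by rewrite ge_max xr.
Qed.

Lemma grid_near K s (r t : R) : unit_grid K s -> (forall l, s l.+1 - s l <= r) ->
  0 <= t <= 1 -> exists k : 'I_K, `|s k.+1 - t| <= r.
Proof.
move=> [K0 s0 sK nd s1] sr /andP[t0 t1].
have ex : exists k, t <= s k.+1 by exists K.-1; rewrite prednK// sK.
case: (ex_minnP ex) => k tk kmin.
have kK : (k < K)%N by rewrite -(prednK K0) ltnS; apply: kmin; rewrite prednK// sK.
exists (Ordinal kK) => /=; rewrite ger0_norm ?subr_ge0//; apply: le_trans (sr k).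
rewrite lerD2l lerN2.
case: k kmin tk {kK} => [|j] kmin tk; first by rewrite s0.
rewrite leNgt; apply/negP => h; have := kmin j (ltW h); by rewrite ltnn.
Qed.

(** A near-maximizer of [|f|] has a grid point within the mesh. The bound is uniform over grids
    because the grid used later depends on the law of the data. *)
Lemma grid_max_cvg f : path_continuous f ->
  (exists M, forall t, 0 <= t <= 1 -> `|f t| <= M) ->
  forall e, 0 < e -> exists2 r, 0 < r & forall K s, unit_grid K s ->
    (forall l, s l.+1 - s l <= r) -> `|grid_max K s f - sup_abs f| <= e.
Proof.
move=> cf [M bf] e e0; have e20 : 0 < e / 2 by rewrite divr_gt0.
have hs : has_sup [set `|f t| | t in `[0, 1]%classic].
  split; first by exists `|f 0|, 0 => //=; rewrite in_itv/= lexx ler01.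
  by exists M => _ [u /= + <-]; rewrite in_itv/=; exact: bf.
have [_ [t /= + <-] ht] := sup_adherent e20 hs; rewrite in_itv/= => t01.
have [r r0 h] := cf t _ t01 e20; exists (r / 2) => [|K s gs sr]; first by rewrite divr_gt0.
have [k sk] := grid_near gs sr t01.
have r2 : r / 2 < r by rewrite ltr_pdivrMr// ltr_pMr// ltr1n.
have := h _ (unit_grid01 k.+1 gs) (le_lt_trans sk r2).
have h1 := grid_max_ge s f k; move=> h2.
have h3 : grid_max K s f <= sup_abs f.
  apply: grid_max_le => [|i]; first exact: sup_abs_ge0.
  by apply: (le_sup_abs bf); exact: unit_grid01 gs.
rewrite distrC ger0_norm ?subr_ge0//.
have : `|f t| <= `|f (s k.+1)| + `|f (s k.+1) - f t|.
  rewrite distrC -[X in `|X| <= _](subrK (f (s k.+1))) addrC.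
  exact: ler_normD.
move: ht; rewrite -/(sup_abs f); lra.
Qed.

End sup_abs.

Lemma Rint_bounded_cvg0 (R : realType) d (T : measurableType d) (P : probability T R)
    (f : nat -> T -> R) (M : R) : (forall i, measurable_fun setT (f i)) ->
  (forall i x, `|f i x| <= M) -> (forall x e, 0 < e -> exists n, forall i, (n <= i)%N -> `|f i x| <= e) ->
  forall e, 0 < e -> exists n, forall i, (n <= i)%N -> `|\int[P]_x f i x| <= e.
Proof.
move=> mf fM f0 e e0.
have [] := @dominated_convergence _ T R P setT measurableT (fun i x => (f i x)%:E)
   (cst 0%E) (cst M%:E) _ _ _ _ _.
- by move=> i; exact/measurable_EFinP.
- exact: measurable_cst.
- apply: aeW => x _; apply: cvg_EFin; first exact: nearW.
  apply/cvgrPdist_le => r r0; have [n hn] := f0 x r r0; exists n => // i /= ni.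
  by rewrite sub0r normrN; exact: hn.
- exact: finite_measure_integrable_cst.
- by apply: aeW => x i _; rewrite lee_fin.
move=> _ _; rewrite integral0 => /fine_cvg/cvgrPdist_le/(_ e e0)[n _ hn].
by exists n => i ni; have := hn i ni; rewrite /= sub0r normrN.
Qed.

Definition regular_grid (R : realType) (K l : nat) : R := Num.min 1 (l%:R / K%:R).

Lemma regular_gridP (R : realType) K : (0 < K)%N -> unit_grid K (@regular_grid R K) /\
  forall l, regular_grid R K l.+1 - regular_grid R K l <= K%:R^-1.
Proof.
move=> K0; have KR : 0 < K%:R :> R by rewrite ltr0n.
split; first split => //.
- by rewrite /regular_grid mul0r min_r.
- by rewrite /regular_grid divff ?gt_eqF// minxx.
- move=> l; rewrite /regular_grid le_min ge_min lexx/= ge_min.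
  by rewrite ler_pM2r ?invr_gt0// ler_nat leqnSn orbT.
- by move=> l; rewrite /regular_grid ge_min lexx.
move=> l; rewrite /regular_grid lerBlDr mulrS mulrDl mul1r.
have Ki : 0 <= K%:R^-1 :> R by rewrite invr_ge0 ltW.
rewrite ge_min; have [h|h] := leP (1 : R) (l%:R / K%:R).
  by rewrite lerDr Ki.
by rewrite lexx orbT.
Qed.

Section brownian_sup.
Context (R : realType) (dB : measure_display) (OB : measurableType dB)
  (PB : probability OB R) (B : R -> OB -> R).
Hypothesis bm : brownian_motion PB B.
Let SB w := sup_abs (B ^~ w).

Lemma bm_path_continuous w : path_continuous (B ^~ w).
Proof. by have [_ _ cB _ _] := bm; exact: within_path_continuous. Qed.

Lemma bm_path_bounded w : exists M : R, forall t, 0 <= t <= 1 -> `|B t w| <= M.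
Proof. by have [_ _ cB _ _] := bm; exact: within_path_bounded (cB w). Qed.

Lemma bm_sup_measurable : measurable_fun setT SB.
Proof.
apply: measurable_sup_abs => [w|t t01]; last exact: (bm_measurable bm).
by apply: path_continuous_rational; [exact: bm_path_continuous|exact: bm_path_bounded].
Qed.

Lemma measurable_grid_max d (T : measurableType d) (W : R -> T -> R) K s :
  unit_grid K s -> (forall t, 0 <= t <= 1 -> measurable_fun setT (W t)) ->
  measurable_fun setT (fun w => grid_max K s (W ^~ w)).
Proof.
move=> gs mW; apply: measurable_bigmax => k; apply: measurableT_comp => //.
by apply: mW; exact: unit_grid01 gs.
Qed.

(** By contradiction: bad grids with mesh at most [1 / (i + 1)] form a sequence along which the grid
    maxima converge on every path, against bounded convergence. The cap at 2 is the most that a test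
    function bounded by 1 can vary. *)
Lemma bm_grid_approx (e : R) : 0 < e -> exists2 r, 0 < r & forall K s, unit_grid K s ->
  (forall l, s l.+1 - s l <= r) ->
  \int[PB]_w Num.min 2 `|grid_max K s (B ^~ w) - SB w| <= e.
Proof.
move=> e0; apply: contrapT => H.
have /choice[Ks hKs] : forall i : nat, exists Ks : nat * (nat -> R),
    [/\ unit_grid Ks.1 Ks.2, forall l, Ks.2 l.+1 - Ks.2 l <= i.+1%:R^-1 &
     e < \int[PB]_w Num.min 2 `|grid_max Ks.1 Ks.2 (B ^~ w) - SB w|].
  move=> i; apply: contrapT => Hi; apply: H; exists (i.+1%:R^-1) => // K s gs ms.
  by rewrite leNgt; apply/negP => h; apply: Hi; exists (K, s).
have m2 (x : R) : 0 <= x -> `|Num.min 2 x| <= 2.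
  by move=> x0; rewrite ger0_norm ?le_min ?x0 ?andbT// ge_min lexx.
have [|||] := @Rint_bounded_cvg0 R _ OB PB (fun i w =>
    Num.min 2 `|grid_max (Ks i).1 (Ks i).2 (B ^~ w) - SB w|) 2 _ _ _ e e0.
- move=> i; apply: measurable_minr => //; apply: measurableT_comp => //.
  apply: measurable_funB; last exact: bm_sup_measurable.
  have [gs _ _] := hKs i; apply: measurable_grid_max gs _ => t.
  exact: (bm_measurable bm).
- by move=> i w; exact: m2.
- move=> w r r0; have [x x0 hx] := grid_max_cvg (bm_path_continuous w) (bm_path_bounded w) r0.
  exists (Num.truncn x^-1) => i ni; rewrite ger0_norm; last by rewrite le_min normr_ge0 andbT.
  rewrite ge_min.
  have [gs ms _] := hKs i; rewrite hx ?orbT// => l; apply: (le_trans (ms l)).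
  rewrite invf_ple ?posrE//; apply: ltW.
  apply: lt_le_trans (_ : (Num.truncn x^-1).+1%:R <= _); last by rewrite ler_nat.
  by rewrite real_truncnS_gt// num_real.
move=> n /(_ n (leqnn _)); have [_ _ h] := hKs n; rewrite ger0_norm.
  by rewrite leNgt h.
by apply: Rint_ge0 => w; rewrite le_min normr_ge0 andbT.
Qed.

(** * The law of the supremum has no atoms *)

Section atoms.
Variables (e : R).
Hypothesis e01 : 0 < e < 1.
(** The path on [[e, 1]], with time rescaled to [[0, 1]]. It is [B e] plus an independent path, and
    the bounded density of [B e] prevents its supremum from sticking to a value. *)
Let Be t w := B (e + (1 - e) * t) w.

Let time01 t : 0 <= t <= 1 -> 0 <= e + (1 - e) * t <= 1.
Proof. by move: e01 => /andP[e0 e1] /andP[t0 t1]; apply/andP; split; nra. Qed.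

Let mBe t : 0 <= t <= 1 -> measurable_fun setT (Be t).
Proof. by move=> t01; apply: (bm_measurable bm); exact: time01. Qed.

Let cBe w : path_continuous (Be ^~ w).
Proof.
move=> t x t01 x0; have [r r0 h] := bm_path_continuous w (time01 t01) x0.
exists r => // u u01 ut; apply: h; first exact: time01.
rewrite opprD addrACA subrr add0r -mulrBr normrM.
move: e01 => /andP[e0 e1]; apply: le_lt_trans ut; rewrite ger0_norm ?subr_ge0 ?(ltW e1)//.
by rewrite ler_piMl// gerBl ltW.
Qed.

Let bBe w : exists M : R, forall t, 0 <= t <= 1 -> `|Be t w| <= M.
Proof. by have [M h] := bm_path_bounded w; exists M => t t01; exact/h/time01. Qed.

Let p := normal_peak (Num.sqrt e).

Let small_ball c (rho : R) : 0 < rho ->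
  \int[PB]_w \1_(`[c - rho, c + rho]%classic) (B e w) <= 2 * rho * p.
Proof.
move=> r0; have mI : measurable (`[c - rho, c + rho]%classic : set R) by exact: measurable_itv.
have [_ B0 _ nB _] := bm; have /andP[e0 e1] := e01.
have mB : measurable_fun setT (B e) by apply: (bm_measurable bm); rewrite !ltW.
have mE : measurable (B e @^-1` `[c - rho, c + rho]%classic).
  by rewrite -[X in measurable X]setTI; exact: mB.
rewrite (_ : (fun w => _) = \1_(B e @^-1` `[c - rho, c + rho]%classic)); last first.
  by apply/funext => w; rewrite !indicE.
rewrite (Rint_indic PB mE).
have -> : PB (B e @^-1` `[c - rho, c + rho]%classic) =
    normal_prob 0 (Num.sqrt e) `[c - rho, c + rho]%classic.
  rewrite -[X in Num.sqrt X]subr0 -(nB 0 e (lexx _) e0 (ltW e1) _ mI).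
  by congr (PB _); apply/seteqP; split => w /=; rewrite B0 subr0.
have s0 : Num.sqrt e != 0 by rewrite gt_eqF// sqrtr_gt0.
rewrite -lee_fin fineK ?fin_num_measure//.
rewrite /normal_prob; apply: (@le_trans _ _ (\int[lebesgue_measure]_(x in `[(c - rho)%R, (c + rho)%R]) (p%:E))%E).
  apply: ge0_le_integral => //.
  - by move=> x _; rewrite lee_fin normal_pdf_ge0.
  - by apply/measurable_EFinP/measurable_funTS; exact: measurable_normal_pdf.
  - by move=> x _; rewrite lee_fin normal_pdf_ub.
rewrite integral_cst//= lebesgue_measure_itv/= lte_fin ifT; last by lra.
rewrite -EFinB -EFinM lee_fin le_eqVlt; apply/orP; left; apply/eqP; ring.
Qed.

(** A Lipschitz function that is 1 at [z] and vanishes at distance [rho]; unlike the indicator of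
    [z], it passes to the limit from grid maxima to the supremum. *)
Let tent (z rho y : R) := Num.max 0 (1 - `|y - z| / rho).

Let tent01 z rho y : 0 < rho -> 0 <= tent z rho y <= 1.
Proof.
by move=> r0; rewrite le_max lexx ge_max ler01/= gerBl divr_ge0// ltW.
Qed.

Let tent_lip z rho x y : 0 < rho -> `|tent z rho x - tent z rho y| <= `|x - y| / rho.
Proof.
move=> r0; rewrite /tent; set a := `|x - z|; set b := `|y - z|.
have ab : `|a - b| <= `|x - y|.
  by rewrite (le_trans (ler_dist_dist _ _))// opprB addrA subrK.
have i0 : 0 < rho^-1 by rewrite invr_gt0.
apply: (@le_trans _ _ `|a / rho - b / rho|); last first.
  by rewrite -mulrBl normrM (gtr0_norm i0) ler_pM2r.
have lip (u v : R) : `|Num.max 0 u - Num.max 0 v| <= `|u - v|.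
  have := ler_norm (u - v); have := ler_norm (- (u - v)); rewrite normrN ler_norml.
  by case: (leP 0 u) => ?; case: (leP 0 v) => ? ? ?; apply/andP; split; lra.
by apply: (le_trans (lip _ _)); rewrite opprB addrC subrKA distrC.
Qed.

(** Freeze the increments after time [e]. The maximum of [|x + a k|] is attained either at the
    largest [a k], with a positive sign, or at the smallest, with a negative sign. So it is close to
    [z] only for [x = B e] in one of two intervals of length [2 rho], each of probability at most
    [2 rho p]. *)
Lemma bm_grid_concentration (z rho : R) K s : 0 < rho -> unit_grid K s ->
  \int[PB]_w tent z rho (grid_max K s (Be ^~ w)) <= 4 * rho * p.
Proof.
move=> r0 gs; have [K0 s0 sK snd s1] := gs; have /andP[e0 e1] := e01.
(* Time 0 is put in front of the rescaled grid, so that the increment of index 0 is [B e] and the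
   later ones are independent of it. *)
pose tau (l : nat) := if l is l'.+1 then e + (1 - e) * s l' else 0.
have tau01 i : 0 <= tau i <= 1.
  by case: i => [|i] /=; [rewrite lexx ler01|apply: time01; exact: unit_grid01 gs].
have tnd i : tau i <= tau i.+1.
  case: i => [|i] /=; first by rewrite s0 mulr0 addr0 ltW.
  by rewrite lerD2l ler_pM2l ?subr_gt0.
pose V i w := B (tau i.+1) w - B (tau i) w.
have [_ B0 _ _ _] := bm.
have V0 w : V 0%N w = B e w by rewrite /V/= s0 mulr0 addr0 B0 subr0.
pose f w := V 0%N w; pose g w := [tuple \sum_(l < k.+1) V l.+1 w | k < K].
have BeE w (k : 'I_K) : Be (s k.+1) w = V 0%N w + tnth (g w) k.
  rewrite tnth_mktuple -(big_mkord xpredT (fun l => V l.+1 w)).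
  rewrite (telescope_sumr (fun l => B (tau l.+1) w))//.
  by rewrite V0 [tau 1]/= s0 mulr0 addr0 addrC subrK.
pose phi (x : R * K.-tuple R) := tent z rho (\big[Num.max/0]_(k < K) `|x.1 + tnth x.2 k|).
have mphi : measurable_fun setT phi.
  apply: measurable_maxr => //; apply: measurable_funB => //; apply: measurable_funM => //.
  apply: measurableT_comp => //; apply: measurable_funB => //; apply: measurable_bigmax => k.
  apply: measurableT_comp => //; apply: measurable_funD => //.
  exact: (measurableT_comp (measurable_tnth k)).
have mf : measurable_fun setT (f : g_sigma_algebraType (generated_system V [set 0%N]) -> R).
  exact: bm_grid_generated.
have mg : measurable_fun setT
    (g : g_sigma_algebraType (generated_system V [set l | (0 < l)%N]) -> K.-tuple R).
  apply/measurable_fun_tnthP => k.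
  rewrite (_ : _ \o _ = fun w => \sum_(l < k.+1) V l.+1 w).
    by apply: measurable_sum => l; exact: bm_grid_generated.
  by apply/funext => w /=; rewrite tnth_mktuple.
have D12 : [set 0%N] `&` [set l | (0 < l)%N] = set0.
  by apply/seteqP; split => // l [/= ->].
have mV := bm_grid_measurable bm tau01.
have iV := bm_grid_independent bm tau01 tnd.
have phiE w : tent z rho (grid_max K s (Be ^~ w)) = phi (f w, g w).
  by rewrite /phi /grid_max/=; congr tent; apply: eq_bigr => k _; rewrite BeE.
rewrite (funext phiE) (Rint_independent_pair mV iV D12 mf mg mphi).
have phi1 x : `|phi x| <= 1.
  by have /andP[? ?] := tent01 z (\big[Num.max/0]_(k < K) `|x.1 + tnth x.2 k|) r0; rewrite ger0_norm.
have mf' := generated_fun_measurable mV mf; have mg' := generated_fun_measurable mV mg.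
have m2 : measurable_fun setT (fun x : OB * OB => phi (f x.1, g x.2)).
  apply: (measurableT_comp mphi); apply: measurable_fun_pair.
    exact: (measurableT_comp mf').
  exact: (measurableT_comp mg').
have iphi : Rintegrable (PB \x PB)%E (fun x => phi (f x.1, g x.2)).
  exact: (Rintegrable_bounded _ m2 (fun x => phi1 _)).
have [i1 <-] := Rfubini2 iphi; apply: Rint_le_cst => // w'.
set a := tnth (g w').
have [kM _ hM] := @arg_maxP _ R _ (Ordinal K0) xpredT a erefl.
have [km _ hm] := @arg_minP _ R _ (Ordinal K0) xpredT a erefl.
have {}hM j : a j <= a kM := hM j isT.
pose I1 := `[z - a kM - rho, z - a kM + rho]%classic.
pose I2 := `[- z - a km - rho, - z - a km + rho]%classic.
have mI1 : measurable (I1 : set R) by exact: measurable_itv.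
have mI2 : measurable (I2 : set R) by exact: measurable_itv.
have le w : phi (f w, g w') <= \1_I1 (B e w) + \1_I2 (B e w).
  have [r1|r1] := leP rho `|\big[Num.max/0]_(k < K) `|f w + a k| - z|.
    rewrite /phi/= /tent max_l ?addr_ge0// subr_le0 ler_pdivlMr// mul1r.
    exact: r1.
  have x1 : phi (f w, g w') <= 1 by rewrite (le_trans (ler_norm _))// phi1.
  have bM k : `|f w + a k| <= \big[Num.max/0]_(k < K) `|f w + a k|.
    exact: (@le_bigmax_cond _ _ _ _ _ _ (fun k => `|f w + a k|)).
  have [k hk] : exists k, \big[Num.max/0]_(k < K) `|f w + a k| = `|f w + a k|.
    have [k _ hk] := @arg_maxP _ R _ (Ordinal K0) xpredT (fun k => `|f w + a k|) erefl.
    exists k; apply/eqP; rewrite eq_le bM andbT.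
    elim/big_ind: _ => [//|x y hx hy|j _]; last exact: hk.
    by rewrite ge_max hx hy.
  move: r1 bM; rewrite hk => r1 bM.
  have fV : f w = B e w by exact: V0.
  have [h|h] := leP 0 (f w + a k).
    have : f w + a kM = f w + a k.
      apply/eqP; rewrite eq_le; apply/andP; split; last by rewrite lerD2l hM.
      rewrite -[leRHS](ger0_norm h).
      exact: le_trans (ler_norm _) (bM _).
    move: r1; rewrite (ger0_norm h) => r1 eM; rewrite -eM in r1.
    rewrite (le_trans x1)// indicE mem_set ?lerDl//=.
    rewrite /I1/= in_itv/= -fV; move: r1; rewrite ltr_norml => /andP[? ?].
    by apply/andP; split; lra.
  have : f w + a km = f w + a k.
    apply/eqP; rewrite eq_le lerD2l hm//=.
    have := bM km; rewrite [leRHS]ltr0_norm//.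
    have := ler_norm (- (f w + a km)); rewrite normrN; lra.
  move: r1; rewrite (ltr0_norm h) => r1 eM; rewrite -eM in r1.
  rewrite (le_trans x1)// [X in _ <= _ + X]indicE mem_set ?lerDr//=.
  rewrite /I2/= in_itv/= -fV; move: r1; rewrite ltr_norml => /andP[? ?].
  by apply/andP; split; lra.
have mB : measurable_fun setT (B e) by apply: (bm_measurable bm); rewrite !ltW.
have ii (J : set R) : measurable J -> Rintegrable PB (fun w => \1_J (B e w)).
  move=> mJ; apply: (@Rintegrable_bounded _ _ _ _ _ 1).
    by apply: (measurableT_comp _ mB); exact: measurable_indic.
  by move=> w; rewrite ger0_norm// indicE lern1 leq_b1.
apply: (le_trans (Rint_le _ (RintegrableD (ii _ mI1) (ii _ mI2)) le)).
  apply: (@Rintegrable_bounded _ _ _ _ _ 1) => //.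
  by apply: (measurableT_comp mphi); apply: measurable_fun_pair.
rewrite (RintD (ii _ mI1) (ii _ mI2)).
have := lerD (small_ball (z - a kM) r0) (small_ball (- z - a km) r0).
by move=> /le_trans; apply; rewrite le_eqVlt; apply/orP; left; apply/eqP; ring.
Qed.

(** The tent dominates the indicator of the level [z]. Its mean is at most [4 rho p], first for grid
    maxima and then in the limit, for every [rho]. *)
Lemma bm_late_sup_no_atom z : PB.-negligible [set w | sup_abs (Be ^~ w) = z].
Proof.
have mS : measurable_fun setT (fun w => sup_abs (Be ^~ w)).
  by apply: measurable_sup_abs => // w; apply: path_continuous_rational.
have mz : measurable [set w | sup_abs (Be ^~ w) = z].
  rewrite (_ : [set _ | _] = (fun w => sup_abs (Be ^~ w)) @^-1` [set z])//.
  by rewrite -[X in measurable X]setTI; exact: (mS measurableT _ (measurable_set1 z)).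
have key (rho : R) : 0 < rho -> fine (PB [set w | sup_abs (Be ^~ w) = z]) <= 4 * rho * p.
  move=> r0; rewrite -(Rint_indic PB mz).
  have mtent : measurable_fun setT (tent z rho).
    apply: measurable_maxr => //; apply: measurable_funB => //; apply: measurable_funM => //.
    by apply: measurableT_comp => //; apply: measurable_funB.
  have it d (T : measurableType d) (Q : probability T R) (u : T -> R) :
      measurable_fun setT u -> Rintegrable Q (fun w => tent z rho (u w)).
    move=> mu; apply: (@Rintegrable_bounded _ _ _ _ _ 1); first exact: measurableT_comp.
    by move=> w; have /andP[? ?] := tent01 z (u w) r0; rewrite ger0_norm.
  apply: (@le_trans _ _ (\int[PB]_w tent z rho (sup_abs (Be ^~ w)))).
    apply: Rint_le; [exact: Rintegrable_indic|exact: it|] => w.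
    rewrite indicE; case: (boolP (w \in _)) => [/set_mem/= ->|_]; last first.
      by have /andP[] := tent01 z (sup_abs (Be ^~ w)) r0.
    by rewrite /tent subrr normr0 mul0r subr0 le_max lexx orbT.
  apply/ler_addgt0Pr => x x0.
  pose G i w := grid_max i.+1 (regular_grid R i.+1) (Be ^~ w).
  have mG i : measurable_fun setT (G i).
    by apply: measurable_grid_max => //; exact: (regular_gridP R (ltn0Sn i)).1.
  have [|||n /(_ n (leqnn _))] := @Rint_bounded_cvg0 R _ OB PB (fun i w =>
     tent z rho (sup_abs (Be ^~ w)) - tent z rho (G i w)) 1 _ _ _ x x0.
  - by move=> i; apply: measurable_funB; exact: measurableT_comp.
  - move=> i w; have /andP[? ?] := tent01 z (sup_abs (Be ^~ w)) r0.
    have /andP[? ?] := tent01 z (G i w) r0; rewrite ler_norml; apply/andP; split; lra.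
  - move=> w y y0; have yr : 0 < y * rho by exact: mulr_gt0.
    have [r rr0 hr] := grid_max_cvg (cBe w) (bBe w) yr.
    exists (Num.truncn r^-1) => i ni.
    apply: (le_trans (tent_lip _ _ _ r0)); rewrite ler_pdivrMr// distrC.
    have [gs ms] := regular_gridP R (ltn0Sn i); apply: hr => // l.
    apply: (le_trans (ms l)); rewrite invf_ple ?posrE//; apply: ltW.
    apply: lt_le_trans (_ : (Num.truncn r^-1).+1%:R <= _); last by rewrite ler_nat.
    by rewrite real_truncnS_gt// num_real.
  rewrite RintB; [|exact: it..].
  move=> /(le_trans (ler_norm _)); rewrite lerBlDl => /le_trans; apply.
  rewrite lerD2r; apply: bm_grid_concentration => //.
  exact: (regular_gridP R (ltn0Sn n)).1.
have p0 : 0 <= p by exact: normal_peak_ge0.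
have fin : PB [set w | sup_abs (Be ^~ w) = z] \is a fin_num by exact: fin_num_measure.
suff PB0 : PB [set w | sup_abs (Be ^~ w) = z] = 0%E by exists [set w | sup_abs (Be ^~ w) = z]; split.
rewrite -(fineK fin); congr EFin; apply/eqP; rewrite eq_le fine_ge0// andbT.
apply/ler_addgt0Pr => x x0; rewrite add0r.
apply: (le_trans (key (x / (4 * (p + 1))) _)); first by rewrite divr_gt0// mulr_gt0//; lra.
rewrite (_ : 4 * _ * p = x * (p / (p + 1))); last by field; lra.
by rewrite ler_piMr ?(ltW x0)// ler_pdivrMr; lra.
Qed.

End atoms.

(** The event is covered by countably many null events on late suprema: for [z > 0] the path stays
    below [z / 2] near time 0, so the supremum is already that over [[e n, 1]] for some [n]; for
    [z <= 0] every late supremum equals [z]. *)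
Lemma bm_sup_no_atom z : PB [set w | SB w = z] = 0%E.
Proof.
have mz : measurable [set w | SB w = z].
  rewrite (_ : [set _ | _] = SB @^-1` [set z])//.
  have mS := bm_sup_measurable.
  by rewrite -[X in measurable X]setTI; exact: (mS measurableT _ (measurable_set1 z)).
pose e n : R := n.+2%:R^-1.
have e01 n : 0 < e n < 1 by rewrite invr_gt0 ltr0n/= invf_lt1 ?ltr1n.
pose A n := [set w | sup_abs (fun t => B (e n + (1 - e n) * t) w) = z].
have A0 n : PB.-negligible (A n) by exact: bm_late_sup_no_atom.
have cover : [set w | SB w = z] `<=` \bigcup_n A n.
  move=> w /= Sw; have [M hM] := bm_path_bounded w.
  have leS t : 0 <= t <= 1 -> `|B t w| <= z by rewrite -Sw; exact: (le_sup_abs hM).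
  have tm n t : 0 <= t <= 1 -> 0 <= e n + (1 - e n) * t <= 1.
    by have /andP[e0 e1] := e01 n; move=> /andP[t0 t1]; apply/andP; split; nra.
  have leA n : sup_abs (fun t => B (e n + (1 - e n) * t) w) <= z.
    by apply: sup_abs_le => t t01; exact/leS/tm.
  have [z0|z0] := leP z 0.
    exists 0%N => //; apply/eqP; rewrite eq_le leA/= (le_trans z0)//.
    exact: sup_abs_ge0.
  have z20 : 0 < z / 2 by rewrite divr_gt0.
  have zero01 : 0 <= (0 : R) <= 1 by rewrite lexx ler01.
  have [r r0 hr] := bm_path_continuous w zero01 z20.
  have [_ B0 _ _ _] := bm.
  pose n := Num.truncn r^-1.
  have er : e n < r.
    rewrite invf_plt ?posrE//; apply: (@lt_trans _ _ n.+1%:R); last by rewrite ltr_nat.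
    by rewrite real_truncnS_gt// num_real.
  exists n => //; apply/eqP; rewrite eq_le leA/= leNgt; apply/negP.
  set S := sup_abs _ => hS; have /andP[e0 e1] := e01 n.
  suff : SB w <= Num.max (z / 2) S.
    rewrite Sw le_max; apply/negP; rewrite negb_or -!ltNge hS andbT.
    by rewrite ltr_pdivrMr// ltr_pMr// ltr1n.
  apply: sup_abs_le => t t01; rewrite le_max; have /andP[t0 t1] := t01.
  have [te|te] := ltP t (e n).
    have := hr t t01; rewrite subr0 B0 subr0 (ger0_norm t0) => h.
    by rewrite ltW//; apply: h; exact: lt_trans te er.
  have n1 : 1 - e n != 0 by rewrite gt_eqF// subr_gt0.
  pose u := (t - e n) / (1 - e n).
  have -> : t = e n + (1 - e n) * u by rewrite /u mulrC divfK// addrC subrK.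
  apply/orP; right; apply: (@le_sup_abs _ (fun t => B (e n + (1 - e n) * t) w) z).
    by move=> v v01; exact/leS/tm.
  rewrite divr_ge0 ?subr_ge0 ?(ltW e1)//= ler_pdivrMr ?subr_gt0// mul1r.
  by rewrite lerD2r.
apply: measure_negligible => //; apply: negligibleS cover _.
exact: negligible_bigcup.
Qed.

End brownian_sup.

(** * The functional central limit theorem *)

Lemma lipschitz1_measurable (R : realType) (f : R -> R) :
  (forall x y, `|f x - f y| <= `|x - y|) -> measurable_fun setT f.
Proof.
move=> fL; apply: continuous_measurable_fun => x; apply/cvgrPdist_le => e e0.
apply/nbhs_ballP; exists e => //= y; rewrite /ball/= => xy; exact: le_trans (fL x y) (ltW xy).
Qed.

(** From [(x / n) ^ n <= exp x] with [n = p + 1] and [x = c r]. It shows that a number of grid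
    points polynomial in [r] is harmless against [exp (- c r)]. *)
Lemma expR_decay (R : realType) (p : nat) (c r : R) : 0 < c -> 0 < r ->
  r ^+ p * expR (- (c * r)) <= (p.+1%:R / c) ^+ p.+1 / r.
Proof.
move=> c0 r0; have p0 : p.+1%:R != 0 :> R by [].
have h : (c * r / p.+1%:R) ^+ p.+1 <= expR (c * r).
  have e : c * r = p.+1%:R * (c * r / p.+1%:R) by field.
  rewrite [X in expR X]e expRM_natl lerXn2r ?nnegrE ?expR_ge0//.
    by rewrite divr_ge0// mulr_ge0// ltW.
  by apply: le_trans (expR_ge1Dx _); rewrite lerDr.
rewrite expRN ler_pdivlMr// mulrAC -exprSr ler_pdivrMr ?expR_gt0//.
rewrite -ler_pdivrMl; last by rewrite exprn_gt0// divr_gt0.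
apply: le_trans h; rewrite -exprVn -exprMn le_eqVlt; apply/orP; left; apply/eqP.
by congr (_ ^+ _); rewrite invf_div mulrAC; congr (_ / _); exact: mulrC.
Qed.

Section bounded_lipschitz_test.
Context (R : realType) (K : nat) (beta delta kappa : R) (M : nat) (f : R -> R).
Hypothesis K0 : (0 < K)%N.
Hypothesis beta0 : 0 <= beta.
Hypothesis delta0 : 0 < delta.
Hypothesis kappaP : (2 * K)%:R * expR (- (beta * delta)) <= kappa.
Hypothesis fB : forall x, `|f x| <= 1.
Hypothesis fL : forall x y, `|f x - f y| <= `|x - y|.
Local Notation soft i := (soft_ball beta (i%:R * delta)).
Local Notation vmax a := (\big[Num.max/0]_(k < K) `|a k|).
Implicit Type a : 'I_K -> R.

Let expk : expR (- (beta * delta)) <= kappa.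
Proof.
apply: le_trans kappaP; rewrite ler_peMl ?expR_ge0// ler1n muln_gt0.
by rewrite K0.
Qed.

Let kappa0 : 0 <= kappa. Proof. exact: le_trans (expR_ge0 _) expk. Qed.

Let soft01 i a : 0 <= soft i a <= 1.
Proof. by rewrite soft_ball_le1 ltW// soft_ball_gt0. Qed.

Let soft_in i a : vmax a <= i%:R * delta - delta -> 1 - soft i a <= kappa.
Proof.
move=> h; apply: le_trans kappaP; apply: soft_ball_inside => // k.
apply: le_trans h; exact: (@le_bigmax_cond _ _ _ _ _ _ (fun k => `|a k|)).
Qed.

Let soft_out i a : i%:R * delta + delta <= vmax a -> soft i a <= kappa.
Proof.
move=> h; have [k hk] : exists k, i%:R * delta + delta <= `|a k|.
  have [k _ hk] := @arg_maxP _ R _ (Ordinal K0) xpredT (fun k => `|a k|) erefl.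
  exists k; apply: (le_trans h); elim/big_ind: _ => [//|x y hx hy|j _]; last exact: hk.
  by rewrite ge_max hx hy.
exact: le_trans (soft_ball_outside beta0 hk) expk.
Qed.

(* A smooth approximation of [a |-> f (max_k |a k|)], by summation by parts over
   the levels [i * delta]. *)
Definition smooth_test a : R := f (M%:R * delta) +
  \sum_(i < M) (f (i%:R * delta) - f (i.+1%:R * delta)) * soft i a.

Let mSd i : i%:R * delta + delta = i.+1%:R * delta.
Proof. by rewrite -[i.+1%:R]natr1 mulrDl mul1r. Qed.

Let df i : `|f (i%:R * delta) - f (i.+1%:R * delta)| <= delta.
Proof.
apply: (le_trans (fL _ _)); rewrite distrC -natr1 mulrDl mul1r addrC addKr.
by rewrite ger0_norm// ltW.
Qed.

Let vmax_ge0 a : 0 <= vmax a.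
Proof. by elim/big_ind: _ => // x y ? ?; rewrite le_max; apply/orP; left. Qed.

(** If the maximum lies between [j delta] and [(j + 1) delta], then [f (j delta)] is the same sum
    with [soft i] replaced by the indicator of [j <= i]. The two differ by at most [kappa] except
    for [i = j] and [i = j + 1], which cost [delta] each. Above [M delta] the last term exceeds 2
    and the claim is trivial. *)
Lemma smooth_test_approx a : (0 < M)%N ->
  `|f (vmax a) - smooth_test a| <=
  3 * delta + M%:R * delta * kappa + 2 * (1 - soft M.-1 a + kappa).
Proof.
move=> M0; set y := vmax a; have y0 : 0 <= y by exact: vmax_ge0.
have tail0 : 0 <= 1 - soft M.-1 a + kappa.
  by rewrite addr_ge0// subr_ge0; case/andP: (soft01 M.-1 a).
have dk : 0 <= delta * kappa by rewrite mulr_ge0// ltW.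
have [yM|yM] := ltP (M%:R * delta) y.
  have hs : `|\sum_(i < M) (f (i%:R * delta) - f (i.+1%:R * delta)) * soft i a| <=
      M%:R * delta * kappa.
    rewrite -mulrA mulr_natl -[X in _ *+ X]card_ord -sumr_const.
    apply: (le_trans (ler_norm_sum _ _ _)); apply: ler_sum => i _.
    rewrite normrM; apply: ler_pM => //; have /andP[? ?] := soft01 i a.
    rewrite ger0_norm//; apply: soft_out; apply: le_trans (ltW yM).
    by rewrite mSd ler_pM2r// ler_nat.
  have h1 : 1 <= 1 - soft M.-1 a + kappa.
    rewrite -addrA lerDl addrC subr_ge0; apply: soft_out.
    by rewrite mSd prednK// ltW.
  rewrite /smooth_test opprD addrA; apply: (le_trans (ler_normB _ _)).
  have := ler_normB (f y) (f (M%:R * delta)); have := fB y; have := fB (M%:R * delta).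
  move: hs h1 delta0; set s := soft _ _; set S := `|\sum_(i < M) _|.
  set a1 := `|f (M%:R * delta)|; set a2 := `|f y|; set a3 := `|f y - _|.
  move: s S a1 a2 a3 => s S a1 a2 a3; move: (M%:R * delta * kappa) => b; lra.
have [j jM yj] : exists2 j, (j <= M)%N & j%:R * delta <= y < j.+1%:R * delta.
  exists (Num.truncn (y / delta)).
    rewrite -ltnS -(ltr_nat R); apply: le_lt_trans (_ : y / delta < _).
      by rewrite truncn_le// divr_ge0// ltW.
    rewrite ltr_pdivrMr//; apply: (le_lt_trans yM).
    by rewrite ltr_pM2r// ltr_nat.
  rewrite -ler_pdivlMr// -ltr_pdivrMr// truncn_le ?real_truncnS_gt ?num_real//.
  by rewrite divr_ge0// ltW.
have /andP[jy yj1] := yj.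
have fj : f (j%:R * delta) = f (M%:R * delta) +
    \sum_(i < M) (f (i%:R * delta) - f (i.+1%:R * delta)) * (j <= i)%:R.
  transitivity (f (M%:R * delta) + \sum_(j <= i < M) (f (i%:R * delta) - f (i.+1%:R * delta))).
    under eq_bigr do rewrite -opprB.
    rewrite sumrN (telescope_sumr (fun i => f (i%:R * delta)))//.
    by rewrite opprB addrC subrK.
  congr (_ + _).
  rewrite -[RHS](big_mkord xpredT (fun i => (f (i%:R * delta) - f (i.+1%:R * delta)) * (j <= i)%:R)).
  rewrite [RHS](big_cat_nat (n := j))//= [X in _ = X + _](_ : _ = 0) ?add0r; last first.
    rewrite big_nat_cond big1// => i /andP[/andP[_ ij] _].
    by rewrite leqNgt ij mulr0.
  rewrite [LHS]big_nat_cond [RHS]big_nat_cond; apply: eq_bigr => i /andP[/andP[-> _] _].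
  by rewrite mulr1.
have e1 : `|f y - f (j%:R * delta)| <= delta.
  apply: (le_trans (fL _ _)); rewrite ger0_norm ?subr_ge0// lerBlDl.
  by rewrite mSd ltW.
have e2 : `|f (j%:R * delta) - smooth_test a| <= 2 * delta + M%:R * delta * kappa.
  rewrite fj /smooth_test opprD addrACA subrr add0r -sumrB.
  apply: (le_trans (ler_norm_sum _ _ _)).
  apply: (@le_trans _ _ (\sum_(i < M) (delta * kappa + delta * ((i == j :> nat)%:R + (i == j.+1 :> nat)%:R)))).
    apply: ler_sum => i _; rewrite -mulrBr normrM -mulrDr; apply: ler_pM => //.
    have /andP[s0 s1] := soft01 i a.
    have [ij|ji] := ltnP i j.
      rewrite sub0r normrN ger0_norm// (le_trans (soft_out _)) ?lerDl ?addr_ge0//.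
      by rewrite mSd; apply: le_trans jy; rewrite ler_pM2r// ler_nat.
    rewrite ger0_norm ?subr_ge0//.
    have [->|nij] := eqVneq (i : nat) j.
      have /andP[q0 q1] := soft01 j a; have := ler0n R (j == j.+1); move: kappa0 q0.
      by rewrite -[true%:R]/(1 : R); move: (soft j a) (j == j.+1)%:R => q z; lra.
    have [->|nij1] := eqVneq (i : nat) j.+1.
      have /andP[q0 q1] := soft01 j.+1 a; move: kappa0 q0.
      rewrite -[true%:R]/(1 : R) -[false%:R]/(0 : R).
      by move: (soft j.+1 a) => q; lra.
    rewrite !addr0; apply: soft_in; rewrite lerBrDr (le_trans (ltW (ltr_leD yj1 (lexx _))))//.
    by rewrite mSd ler_pM2r// ler_nat ltn_neqAle eq_sym nij1 ltn_neqAle eq_sym nij ji.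
  rewrite big_split/= sumr_const card_ord -[(delta * kappa) *+ _]mulr_natl mulrA [leRHS]addrC lerD2l.
  rewrite -mulr_sumr mulrC ler_pM2r// big_split/=.
  have one (q : nat) : \sum_(i < M) (i == q :> nat)%:R <= 1 :> R.
    have [qM|qM] := ltnP q M.
      rewrite (bigD1 (Ordinal qM))//= eqxx big1 ?addr0// => i.
      by rewrite -val_eqE/= => /negbTE ->.
    by rewrite big1// => i _; rewrite ltn_eqF// (leq_trans (ltn_ord i) qM).
  by have := lerD (one j) (one j.+1); rewrite -[1 + 1]/(2%:R).
have := ler_normD (f y - f (j%:R * delta)) (f (j%:R * delta) - smooth_test a).
rewrite subrKA; lra.
Qed.

Context d1 (T1 : measurableType d1) (P1 : probability T1 R) (u1 : T1 -> 'I_K -> R).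
Context d2 (T2 : measurableType d2) (P2 : probability T2 R) (u2 : T2 -> 'I_K -> R).
Hypothesis mu1 : forall k, measurable_fun setT (fun w => u1 w k).
Hypothesis mu2 : forall k, measurable_fun setT (fun w => u2 w k).
Variables (eta tau : R).
Hypothesis M2 : (1 < M)%N.
Hypothesis near_soft : forall i, (i < M)%N ->
  `|\int[P1]_w soft i (u1 w) - \int[P2]_w soft i (u2 w)| <= eta.
Hypothesis tail : \int[P2]_w \1_(`]M.-2%:R * delta, +oo[%classic) (vmax (u2 w)) <= tau.

(** Tightness is assumed under [P2] only: the smoothed indicator of level [M.-1] has nearly the same
    mean under both laws, which transfers the tail bound to [P1]. *)
Lemma bounded_lipschitz_compare :
  `|\int[P1]_w f (vmax (u1 w)) - \int[P2]_w f (vmax (u2 w))| <=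
  6 * delta + 2 * (M%:R * delta * kappa) + 4 * tau + 8 * kappa + 2 * eta +
  M%:R * delta * eta.
Proof.
have M0 : (0 < M)%N by exact: ltnW.
have mf := lipschitz1_measurable fL.
have mvm d (T : measurableType d) (u : T -> 'I_K -> R) :
    (forall k, measurable_fun setT (fun w => u w k)) ->
    measurable_fun setT (fun w => vmax (u w)).
  by move=> mu; apply: measurable_bigmax => k; exact: measurableT_comp.
have isoft d (T : measurableType d) (P : probability T R) (u : T -> 'I_K -> R) i :
    (forall k, measurable_fun setT (fun w => u w k)) ->
    Rintegrable P (fun w => soft i (u w)).
  move=> mu; apply: (@Rintegrable_bounded _ _ _ _ _ 1); first exact: measurable_soft_ball.
  by move=> w; have /andP[? ?] := soft01 i (u w); rewrite ger0_norm.
have if_ d (T : measurableType d) (P : probability T R) (u : T -> 'I_K -> R) :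
    (forall k, measurable_fun setT (fun w => u w k)) ->
    Rintegrable P (fun w => f (vmax (u w))).
  move=> mu; apply: (@Rintegrable_bounded _ _ _ _ _ 1) => //.
  by apply: (measurableT_comp mf); exact: mvm.
have iF d (T : measurableType d) (P : probability T R) (u : T -> 'I_K -> R) :
    (forall k, measurable_fun setT (fun w => u w k)) ->
    Rintegrable P (fun w => smooth_test (u w)) /\
    \int[P]_w smooth_test (u w) = f (M%:R * delta) +
      \sum_(i < M) (f (i%:R * delta) - f (i.+1%:R * delta)) * \int[P]_w soft i (u w).
  move=> mu; have is_ : Rintegrable P (fun w =>
      \sum_(i < M) (f (i%:R * delta) - f (i.+1%:R * delta)) * soft i (u w)).
    by apply: Rintegrable_sum => i _; apply: RintegrableZ; exact: isoft.
  split; first exact: RintegrableD (Rintegrable_cst P _) is_.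
  rewrite [LHS](RintD (Rintegrable_cst P (f (M%:R * delta))) is_) Rint_cst; congr (_ + _).
  rewrite Rint_sum => [|i _]; last by apply: RintegrableZ; exact: isoft.
  by apply: eq_bigr => i _; rewrite RintZ//; exact: isoft.
have approx d (T : measurableType d) (P : probability T R) (u : T -> 'I_K -> R) :
    (forall k, measurable_fun setT (fun w => u w k)) ->
    `|\int[P]_w f (vmax (u w)) - \int[P]_w smooth_test (u w)| <=
    3 * delta + M%:R * delta * kappa + 2 * (1 - \int[P]_w soft M.-1 (u w) + kappa).
  move=> mu; have [iF1 _] := iF _ _ P u mu; have if1 := if_ _ _ P u mu.
  have is1 := isoft _ _ P u M.-1 mu.
  rewrite -(RintB if1 iF1); apply: (le_trans (Rint_abs (RintegrableB if1 iF1))).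
  have ic := Rintegrable_cst P.
  pose c0 := 3 * delta + M%:R * delta * kappa + 2 * (1 + kappa).
  have ib : Rintegrable P (fun w => c0 - 2 * soft M.-1 (u w)).
    by apply: RintegrableB => //; exact: RintegrableZ.
  apply: (le_trans (Rint_le (Rintegrable_abs (RintegrableB if1 iF1)) ib _)).
    by move=> w; apply: (le_trans (smooth_test_approx (u w) M0)); rewrite /c0; lra.
  rewrite [leLHS](RintB (ic c0) (RintegrableZ 2 is1)) Rint_cst (RintZ 2 is1) /c0; lra.
have a1 := approx _ _ P1 u1 mu1; have a2 := approx _ _ P2 u2 mu2.
(* The threshold is [M.-2] because a smoothed indicator is close to 1 only one step [delta] below
   its level, here [M.-1]. *)
have tail2 : 1 - \int[P2]_w soft M.-1 (u2 w) <= tau + kappa.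
  have ic := Rintegrable_cst P2; have is2 := isoft _ _ P2 u2 M.-1 mu2.
  rewrite -[X in X - _](Rint_cst P2) -(RintB (ic 1) is2).
  have ii : Rintegrable P2 (fun w => \1_(`]M.-2%:R * delta, +oo[%classic) (vmax (u2 w)) : R).
    apply: (@Rintegrable_bounded _ _ _ _ _ 1).
      by apply: (measurableT_comp _ (mvm _ _ _ mu2)); apply: measurable_indic; exact: measurable_itv.
    by move=> w; rewrite ger0_norm// indicE lern1 leq_b1.
  apply: (@le_trans _ _ (\int[P2]_w (\1_(`]M.-2%:R * delta, +oo[%classic) (vmax (u2 w)) + kappa))).
    apply: Rint_le; [exact: RintegrableB|exact: RintegrableD|] => w.
    have /andP[s0 s1] := soft01 M.-1 (u2 w).
    rewrite indicE; case: (boolP (_ \in _)) => [_|/negP h].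
      by rewrite (@le_trans _ _ 1) ?lerDl// lerBlDr lerDl.
    rewrite add0r; apply: soft_in; rewrite leNgt; apply/negP => h2; apply: h.
    apply/mem_set; rewrite /= in_itv/= andbT; apply: le_lt_trans h2.
    have -> : M.-1%:R = M.-2%:R + 1 :> R by rewrite natr1 prednK// -ltnS prednK.
    by rewrite mulrDl mul1r addrK.
  by rewrite (RintD ii (ic kappa)) Rint_cst lerD2r.
have M1M : (M.-1 < M)%N by rewrite prednK.
have n1 := near_soft M1M.
have e0 : 0 <= eta by exact: le_trans n1.
have F12 : `|\int[P1]_w smooth_test (u1 w) - \int[P2]_w smooth_test (u2 w)| <= M%:R * delta * eta.
  have [_ ->] := iF _ _ P1 u1 mu1; have [_ ->] := iF _ _ P2 u2 mu2.
  rewrite opprD addrACA subrr add0r -sumrB.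
  apply: (le_trans (ler_norm_sum _ _ _)).
  rewrite -mulrA mulr_natl -[X in _ *+ X]card_ord -sumr_const; apply: ler_sum => i _.
  rewrite -mulrBr normrM.
  exact: (ler_pM (normr_ge0 _) (normr_ge0 _) (df i) (near_soft (ltn_ord i))).
move: a1 a2 F12 n1 tail2; rewrite !ler_norml.
set x1 := \int[P1]_w f _; set x2 := \int[P2]_w f _; set y1 := \int[P1]_w smooth_test _.
set y2 := \int[P2]_w smooth_test _; set z1 := \int[P1]_w _; set z2 := \int[P2]_w _.
move=> /andP[p1 p2] /andP[p3 p4] /andP[p5 p6] /andP[p7 p8] p9.
by apply/andP; split; lra.
Qed.

End bounded_lipschitz_test.

Section functional_clt.
Context (R : realType) d (Om : measurableType d) (P : probability Om R).
Variables (H : R -> set (set Om)) (N : R -> Om -> nat) (C : R) (L : R * Om -> R).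
Hypothesis fH : filtration H.
Hypothesis cN : forall w, counting_path (N ^~ w).
Hypothesis aN : adapted H N.
Hypothesis C0 : 0 < C.
Hypothesis bL : bounded_intensity P H N C L.
Variables (h : R * Om -> R) (C' : R).
Hypothesis ph : pred_fun H h.
Hypothesis hC' : forall x, `|h x| <= C'.
Local Notation M := (@U01 R \x P)%E.
Local Notation V := (cumulated_variance P L h).

Let C'0 : 0 <= C'. Proof. exact: le_trans (hC' (0, point)). Qed.
Let mh : measurable_fun setT h. Proof. exact: pred_fun_measurable ph. Qed.
Let mh2 : measurable_fun setT (fun x => h x ^+ 2). Proof. exact: measurable_funX. Qed.
Let mL := measurable_intensity fH bL.
Let L01 := intensity_bounds bL.

Let h2C x : `|h x ^+ 2| <= C' ^+ 2.
Proof. by rewrite normrX ler_sqr ?nnegrE. Qed.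

Let ih2 s t : Rintegrable M (fun x => on_itv s t (fun x => h x ^+ 2) x * L x).
Proof.
apply: (Rintegrable_ML fH bL); apply: (@Rintegrable_bounded _ _ _ _ _ (C' ^+ 2)).
  apply: measurable_funM => //; apply: measurableT_comp => //.
move=> x; rewrite /on_itv normrM -[leRHS]mulr1; apply: ler_pM => //.
by rewrite ger0_norm// indicE lern1 leq_b1.
Qed.

Lemma cumulated_varianceD s t u : s <= t -> t <= u -> V s u = V s t + V t u.
Proof.
move=> st tu; rewrite /cumulated_variance -(RintD (ih2 s t) (ih2 t u)).
by apply: eq_Rintegral => x _; rewrite (on_itvD _ st tu) mulrDl.
Qed.

Lemma cumulated_variance_ge0 s t : 0 <= V s t.
Proof.
apply: Rint_ge0 => x; have /andP[L0 _] := L01 x.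
by apply: mulr_ge0 => //; rewrite /on_itv mulr_ge0// sqr_ge0.
Qed.

Lemma cumulated_variance_le s t : 0 <= s -> s <= t -> t <= 1 ->
  V s t <= C' ^+ 2 * C * (t - s).
Proof.
move=> s0 st t1; have [i1 e1] := mean_M_start s0 st t1 (Rintegrable_cst P 1).
rewrite Rint_cst mulr1 in e1; rewrite -[t - s]e1 -(RintZ _ i1).
apply: Rint_le; [exact: ih2|exact: RintegrableZ|] => x.
rewrite /on_itv mul1r mulrAC; apply: ler_wpM2r => //.
have /andP[L0 LC] := L01 x; apply: ler_pM => //; first exact: sqr_ge0.
by have := h2C x; rewrite ger0_norm// sqr_ge0.
Qed.

Lemma cumulated_variance0 : V 0 0 = 0.
Proof.
apply/eqP; rewrite eq_le cumulated_variance_ge0 andbT.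
by have := cumulated_variance_le (lexx 0) (lexx 0) ler01; rewrite subrr mulr0.
Qed.

Let v := V 0 1.
Hypothesis v0 : 0 < v.

Let rg01 K k : (0 < K)%N -> 0 <= regular_grid R K k <= 1.
Proof. by move=> K0; apply: unit_grid01 (regular_gridP R K0).1. Qed.

(** The clock of the normalized martingale. The covariance of the martingale at two times is its
    variance at the earlier one, so Brownian motion read at these times has exactly the same
    covariances, whatever the law of the data. *)
Definition variance_grid K k := V 0 (regular_grid R K k) / v.

Lemma variance_gridP K : (0 < K)%N -> unit_grid K (variance_grid K) /\
  forall l, variance_grid K l.+1 - variance_grid K l <= C' ^+ 2 * C / (K%:R * v).
Proof.
move=> K0; have [gr mr] := regular_gridP R K0; have [_ r0 rK rnd r1] := gr.
have inc l : V 0 (regular_grid R K l.+1) = V 0 (regular_grid R K l) +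
    V (regular_grid R K l) (regular_grid R K l.+1).
  by apply: cumulated_varianceD => //; case/andP: (rg01 l K0).
split; first split => //.
- by rewrite /variance_grid r0 cumulated_variance0 mul0r.
- by rewrite /variance_grid rK divff// gt_eqF.
- by move=> l; rewrite /variance_grid inc ler_pM2r ?invr_gt0// lerDl cumulated_variance_ge0.
- move=> l; have /andP[l0 l1] := rg01 l K0.
  rewrite /variance_grid ler_pdivrMr// mul1r /v.
  by rewrite (cumulated_varianceD l0 l1) lerDl cumulated_variance_ge0.
move=> l; rewrite /variance_grid -mulrBl inc addrC addKr invfM [leRHS]mulrA.
rewrite ler_pM2r ?invr_gt0//.
have /andP[l0 l1] := rg01 l K0; have /andP[_ l2] := rg01 l.+1 K0.
apply: (le_trans (cumulated_variance_le l0 (rnd l) l2)).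
by rewrite ler_wpM2l ?mulr_ge0 ?sqr_ge0 ?(ltW C0).
Qed.

Context dS (Sm : measurableType dS) (Q : probability Sm R) (Z : nat -> Sm -> Om).
Hypothesis mZ : forall j, measurable_fun setT (Z j).
Hypothesis lawZ : forall j (A : set Om), measurable A -> Q (Z j @^-1` A) = P A.
Hypothesis iZ : mutually_independent Q Z.
Variables (m : nat) (sigma : nat -> nat).
Hypothesis m0 : (0 < m)%N.
Hypothesis sigma_inj : {in [pred i | (i < m)%N] &, injective sigma}.

(** The contribution of one observation: the value of its martingale at the grid time, an increment
    from 0 rather than from the preceding grid point. *)
Definition normalized_increment K (k : 'I_K) w : R :=
  intM N L (on_itv 0 (regular_grid R K k.+1) h) w / Num.sqrt (m%:R * v).

Let q : R := Num.sqrt (m%:R * v).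
Let q0 : 0 < q. Proof. by rewrite sqrtr_gt0 mulr_gt0// ltr0n. Qed.

Let lawR j (phi : Om -> R) : measurable_fun setT phi ->
  \int[Q]_w phi (Z j w) = \int[P]_w phi w.
Proof. move=> mphi; apply: (@Rint_law R _ _ _ Sm Om Om Q P (Z j) id (mZ j) _ _ phi mphi) => //.
exact: lawZ. Qed.

Let lawI j (phi : Om -> R) : Rintegrable P phi -> Rintegrable Q (fun w => phi (Z j w)).
Proof.
move=> iphi; have mphi := RintegrableM iphi.
apply: (@Rintegrable_law R _ _ _ Sm Om Om Q P (Z j) id (mZ j) _ _ phi mphi iphi) => //.
exact: lawZ.
Qed.

(** Bounds the third moment of [N 1 + C], through [(n + C) ^ 3 <= 4 (n ^ 3 + C ^ 3)]. The integral
    of [h] against the compensated process is at most [C' (N 1 + C)] at all times, which supplies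
    the envelope for the cubic remainders. *)
Let mom3 : R := 4 * (6 * C ^+ 3 + 6 * C ^+ 2 + C + C ^+ 3).

Let mN1 : measurable_fun setT (fun w => (N 1 w)%:R : R).
Proof. by apply: measurableT_comp => //; apply: (adapted_measurable fH aN); rewrite ler01 lexx. Qed.

Let cubeNC : Rintegrable P (fun w => ((N 1 w)%:R + C) ^+ 3) /\
  \int[P]_w (((N 1 w)%:R + C) ^+ 3) <= mom3.
Proof.
have [i3 e3] := counting_moment3 fH cN aN C0 bL.
have iD := RintegrableD i3 (Rintegrable_cst P (C ^+ 3)).
have le w : ((N 1 w)%:R + C) ^+ 3 <= 4 * ((N 1 w)%:R ^+ 3 + C ^+ 3).
  have n0 : 0 <= (N 1 w)%:R :> R by [].
  move: (N 1 w)%:R n0 => n n0; have c0 := ltW C0; rewrite -subr_ge0.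
  have : 0 <= 3 * (n + C) * (n - C) ^+ 2 by rewrite mulr_ge0 ?sqr_ge0// mulr_ge0// addr_ge0.
  by move=> /le_trans; apply; rewrite le_eqVlt; apply/orP; left; apply/eqP; ring.
have i1 : Rintegrable P (fun w => ((N 1 w)%:R + C) ^+ 3).
  apply: Rintegrable_le (RintegrableZ 4 iD).
    by apply: measurable_funX; exact: measurable_funD.
  by move=> w; rewrite ger0_norm// exprn_ge0// addr_ge0// ltW.
split => //; apply: (le_trans (Rint_le i1 (RintegrableZ 4 iD) le)).
rewrite (RintZ 4 iD) /mom3 ler_pM2l// (RintD i3 (Rintegrable_cst P _)) Rint_cst.
by rewrite lerD2r.
Qed.

Let mY K (k : 'I_K) : measurable_fun setT (normalized_increment k).
Proof.
apply: measurable_funM => //; apply: (measurable_intM fH cN aN bL).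
by apply: measurable_funM => //; exact: measurableT_comp.
Qed.

Let Ymean K (k : 'I_K) : Rintegrable P (normalized_increment k) /\
  \int[P]_w normalized_increment k w = 0.
Proof.
have K0 : (0 < K)%N by exact: leq_ltn_trans (ltn_ord k).
have /andP[t0 t1] := rg01 k.+1 K0.
have ih : Rintegrable M (on_itv 0 (regular_grid R K k.+1) h).
  apply: (@Rintegrable_bounded _ _ _ _ _ C').
    by apply: measurable_funM => //; exact: measurableT_comp.
  by move=> x; exact: on_itv_boundK.
have [i1 e1] := mean_intM fH cN aN bL (pred_on_itv fH (lexx 0) t0 t1 ph) ih.
have E w : normalized_increment k w = q^-1 * intM N L (on_itv 0 (regular_grid R K k.+1) h) w.
  by rewrite mulrC.
rewrite (funext E); split; first exact: RintegrableZ.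
by rewrite (RintZ _ i1) e1 mulr0.
Qed.

Let Ycov K (k l : 'I_K) : Rintegrable P (fun w => normalized_increment k w * normalized_increment l w) /\
  \int[P]_w (normalized_increment k w * normalized_increment l w) =
  variance_grid K (minn k l).+1 / m%:R.
Proof.
have K0 : (0 < K)%N by exact: leq_ltn_trans (ltn_ord k).
have [gr _] := regular_gridP R K0; have [_ _ _ rnd _] := gr.
have nd i j : (i <= j)%N -> regular_grid R K i <= regular_grid R K j.
  by move=> /subnK <-; elim: (j - i)%N => // p ih; rewrite addSn (le_trans ih).
wlog kl : k l / (k <= l)%N => [hw|].
  have [kl|] := boolP (k <= l)%N; first exact (hw k l kl).
  rewrite -ltnNge => /ltnW lk.
  have [i1 e1] := hw l k lk; rewrite minnC -e1; split.
    by under eq_fun do rewrite mulrC.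
  by apply: eq_Rintegral => w _; rewrite mulrC.
have /andP[k0 k1] := rg01 k.+1 K0; have /andP[l0 l1] := rg01 l.+1 K0.
have [i1 e1] := intM_covariance fH cN aN C0 bL ph hC' k0 (nd k.+1 l.+1 kl) l1.
have E w : normalized_increment k w * normalized_increment l w = (q ^+ 2)^-1 *
    (intM N L (on_itv 0 (regular_grid R K k.+1) h) w * intM N L (on_itv 0 (regular_grid R K l.+1) h) w).
  by rewrite /normalized_increment -/q; field; rewrite gt_eqF.
rewrite (funext E); split; first exact: RintegrableZ.
rewrite (RintZ _ i1) e1 (minn_idPl kl) /variance_grid sqr_sqrtr ?mulr_ge0 ?(ltW v0)//.
have mR : m%:R != 0 :> R by rewrite pnatr_eq0 -lt0n.
have vn : v != 0 by rewrite gt_eqF.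
by field; rewrite mR vn.
Qed.

Context (dB : measure_display) (OB : measurableType dB)
  (PB : probability OB R) (B : R -> OB -> R).
Hypothesis bm : brownian_motion PB B.

Definition normalized_sum K w (k : 'I_K) : R :=
  \sum_(i < m) normalized_increment k (Z (sigma i) w).

Lemma measurable_normalized_sum K k : measurable_fun setT (fun w => @normalized_sum K w k).
Proof. by apply: measurable_sum => i; apply: (measurableT_comp (mY k)). Qed.

(** Replaces the observations one by one by the [m] Brownian pieces. Observation and piece are
    centred, with covariance [variance_grid K (minn k l).+1 / m]. *)
Lemma clt_soft_ball K (beta x a : R) : (0 < K)%N -> 0 <= beta -> 0 <= a ->
  `|\int[Q]_w soft_ball beta x (normalized_sum (K := K) w) -
    \int[PB]_w soft_ball beta x (fun k : 'I_K => B (variance_grid K k.+1) w)| <=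
  m%:R * (252 * beta ^+ 3 * ((C' ^+ 3 * mom3 / (Num.sqrt v) ^+ 3 +
    (4 * a ^+ 3 + 96 * K%:R * expR (- a))) / (Num.sqrt m%:R) ^+ 3)).
Proof.
move=> K0 beta0 a0; have [gs _] := variance_gridP K0; have [_ g0 gK gnd g1] := gs.
(* The replacement lemma is about infinite sequences with pairwise disjoint index sets; beyond [m]
   the sets are empty and the summands 0. *)
pose D i := if (i < m)%N then [set sigma i] else set0.
pose X i w (k : 'I_K) := if (i < m)%N then normalized_increment k (Z (sigma i) w) else 0.
pose MX i w := if (i < m)%N then C' * ((N 1 (Z (sigma i) w))%:R + C) / q else 0.
have disj i j : i != j -> D i `&` D j = set0.
  move=> ij; apply/seteqP; split => // y; rewrite /D.
  case: ifPn => im; case: ifPn => jm => -[]// /= -> /(sigma_inj im jm) ij'.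
  by rewrite ij' eqxx in ij.
have disj' i j : i != j -> [set p : nat | (p %% m)%N = i] `&` [set p : nat | (p %% m)%N = j] = set0.
  by move=> ij; apply/seteqP; split => // y [/= -> ij']; rewrite ij' eqxx in ij.
have mX i k : measurable_fun setT
    ((fun w => X i w k) : g_sigma_algebraType (generated_system Z (D i)) -> R).
  rewrite /X /D; case: ifPn => im; last exact: measurable_cst.
  apply: (measurableT_comp (mY k)); exact: measurable_generated.
pose tau := fun p : nat => variance_grid K (p %/ m)%N + (p %% m)%:R / m%:R *
  (variance_grid K (p %/ m).+1 - variance_grid K (p %/ m)%N).
pose bb := C' ^+ 3 * mom3 / q ^+ 3.
pose b' := (4 * a ^+ 3 + 96 * K%:R * expR (- a)) / (Num.sqrt m%:R) ^+ 3.
have tau01 := fine_grid01 m0 g0 gnd g1.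
have taund := fine_grid_nd m0 gnd.
have X0 i k : (i < m)%N -> Rintegrable Q (fun w => X i w k) /\ \int[Q]_w X i w k = 0.
  move=> im; rewrite /X im; have [i1 e1] := Ymean k; split; first exact: lawI.
  by rewrite (lawR _ (mY k)).
have Xc i k l : (i < m)%N -> Rintegrable Q (fun w => X i w k * X i w l) /\
    \int[Q]_w (X i w k * X i w l) = variance_grid K (minn k l).+1 / m%:R.
  move=> im; rewrite /X im; have [i1 e1] := Ycov k l.
  have mm := RintegrableM i1; split; first exact: (lawI (sigma i) i1).
  by rewrite (lawR (sigma i) mm).
have XM i w k : `|X i w k| <= MX i w.
  rewrite /X /MX; case: ifPn => im; last by rewrite normr0.
  have qi : 0 <= q^-1 by rewrite invr_ge0 ltW.
  rewrite /normalized_increment -/q normrM (ger0_norm qi).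
  rewrite ler_pM2r ?invr_gt0//; apply: (intM_bound fH cN bL) => [|y].
    by apply: measurable_funM => //; exact: measurableT_comp.
  exact: on_itv_boundK.
have MX0 i w : 0 <= MX i w.
  by rewrite /MX; case: ifPn => // _; rewrite divr_ge0 ?(ltW q0)// mulr_ge0// addr_ge0// ltW.
have iMX i : (i < m)%N -> Rintegrable Q (fun w => MX i w ^+ 3) /\ \int[Q]_w (MX i w ^+ 3) <= bb.
  move=> im; have [i1 e1] := cubeNC.
  have E w : MX i w ^+ 3 = (C' ^+ 3 / q ^+ 3) * ((N 1 (Z (sigma i) w))%:R + C) ^+ 3.
    by rewrite /MX im !exprMn exprVn mulrAC.
  have i2 := lawI (sigma i) i1.
  rewrite (funext E); split; first exact: RintegrableZ.
  rewrite (RintZ _ i2) (lawR (sigma i) (RintegrableM i1)) /bb mulrAC.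
  by rewrite ler_wpM2r ?invr_ge0 ?exprn_ge0 ?(ltW q0)// ler_wpM2l ?exprn_ge0.
have key := @lindeberg R _ Sm Q _ _ _ Z _ OB PB _ _ _
  (fun p w => B (tau p.+1) w - B (tau p) w) mZ iZ (bm_grid_measurable bm tau01)
  (bm_grid_independent bm tau01 taund) K m D X
  (fun i => [set p : nat | (p %% m)%N = i]) (@bm_piece R dB OB B K m (variance_grid K))
  disj disj' mX (fun i k => @bm_piece_measurable R dB OB B K m (variance_grid K) i k)
  (fun _ k l => variance_grid K (minn k l).+1 / m%:R) MX
  (@bm_piece_max R dB OB B K m (variance_grid K)) bb b' X0
  (fun i k im => bm_piece_mean bm m0 g0 gnd g1 k im) Xc
  (fun i k l im => bm_piece_covariance bm m0 g0 gnd g1 k l im) XM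
  (fun i w k => @bm_piece_le_max R dB OB B K m (variance_grid K) i w k) MX0 (fun i w => @bm_piece_max_ge0 R dB OB B K m (variance_grid K) i w) iMX
  (fun i im => bm_piece_max_cube bm K m0 g0 gnd g1 im a0) beta x beta0.
move: key; rewrite [X in _ <= X -> _](_ : _ = m%:R * (252 * beta ^+ 3 *
  ((C' ^+ 3 * mom3 / (Num.sqrt v) ^+ 3 + (4 * a ^+ 3 + 96 * K%:R * expR (- a))) / (Num.sqrt m%:R) ^+ 3))); last first.
  congr (_ * (_ * _)); rewrite /bb /b' /q sqrtrM// exprMn.
  by field; rewrite !gt_eqF// sqrtr_gt0// ltr0n.
have eX : \int[Q]_w soft_ball beta x (normalized_sum (K := K) w) =
    \int[Q]_w soft_ball beta x (fun k : 'I_K => \sum_(j < m) X j w k).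
  apply: eq_Rintegral => w _; congr soft_ball; apply/funext => k.
  by apply: eq_bigr => i _; rewrite /X ltn_ord.
have eB : \int[PB]_w soft_ball beta x (fun k : 'I_K => B (variance_grid K k.+1) w) =
    \int[PB]_w soft_ball beta x (fun k : 'I_K =>
      \sum_(j < m) @bm_piece R dB OB B K m (variance_grid K) j w k).
  apply: eq_Rintegral => w _; congr soft_ball; apply/funext => k.
  by rewrite (bm_piece_sum bm).
by rewrite eX eB.
Qed.

End functional_clt.

Lemma bm_sup_tight (R : realType) (dB : measure_display) (OB : measurableType dB)
  (PB : probability OB R) (B : R -> OB -> R) : brownian_motion PB B ->
  forall delta e : R, 0 < delta -> 0 < e -> exists2 M : nat, (1 < M)%N &
    \int[PB]_w \1_(`]M.-2%:R * delta, +oo[%classic) (sup_abs (B ^~ w)) <= e.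
Proof.
move=> bm delta e delta0 e0.
have mS := bm_sup_measurable bm.
have [|||n hn] := @Rint_bounded_cvg0 R _ OB PB
    (fun i w => \1_(`]i%:R * delta, +oo[%classic) (sup_abs (B ^~ w))) 1 _ _ _ e e0.
- move=> i; apply: (measurableT_comp _ mS); apply: measurable_indic; exact: measurable_itv.
- by move=> i w; rewrite ger0_norm// indicE lern1 leq_b1.
- move=> w r r0; exists (Num.truncn (sup_abs (B ^~ w) / delta)).+1 => i ni.
  rewrite indicE memNset ?normr0 ?(ltW r0)//= in_itv/= andbT; apply/negP.
  rewrite -leNgt -ler_pdivrMr//; apply: ltW.
  apply: lt_le_trans (_ : (Num.truncn (sup_abs (B ^~ w) / delta)).+1%:R <= _).
    by rewrite real_truncnS_gt// num_real.
  by rewrite ler_nat.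
exists n.+2 => //=; apply: (le_trans (ler_norm _)); exact: hn.
Qed.

(* With [m = r ^ 16] observations, grids of [m ^ 3] points and [beta = a = r], all
   the error terms are of order [1 / r]. *)
Lemma functional_clt (R : realType) (dB : measure_display) (OB : measurableType dB)
  (PB : probability OB R) (B : R -> OB -> R) : brownian_motion PB B ->
  forall C C' v0 e : R, 0 < C -> 0 < C' -> 0 < v0 -> 0 < e ->
  exists m0 : nat, forall d (Om : measurableType d) (P : probability Om R)
    (H : R -> set (set Om)) (N : R -> Om -> nat) (L h : R * Om -> R)
    dS (Sm : measurableType dS) (Q : probability Sm R) (Z : nat -> Sm -> Om)
    (m : nat) (sigma : nat -> nat) (f : R -> R),
  filtration H -> (forall w, counting_path (N ^~ w)) -> adapted H N ->
  bounded_intensity P H N C L -> pred_fun H h -> (forall x, `|h x| <= C') ->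
  v0 <= cumulated_variance P L h 0 1 ->
  (forall j, measurable_fun setT (Z j)) ->
  (forall j (A : set Om), measurable A -> Q (Z j @^-1` A) = P A) ->
  mutually_independent Q Z -> (m0 <= m)%N ->
  {in [pred i | (i < m)%N] &, injective sigma} ->
  bounded_lipschitz1 f ->
  `|\int[Q]_w f (\big[Num.max/0]_(k < m ^ 3) `|normalized_sum P N L h Z m sigma w k|) -
    \int[PB]_w f (sup_abs (B ^~ w))| <= e.
Proof.
move=> bm C C' v0 e C0 C'0 v00 e0.
have aux (A a c y w : R) : A <= a -> y <= c -> 0 <= a -> 0 <= c -> 1 <= w ->
    A + (4 * w + 96 * y) <= (a + 4 + 96 * c) * w.
  move=> Aa yc a0 c0 w1.
  have h1 : a <= a * w by rewrite ler_peMr.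
  have h2 : c <= c * w by rewrite ler_peMr.
  lra.
(* The error terms at the end add up to less than [22 * delta]. *)
pose delta := e / 100; have delta0 : 0 < delta by rewrite divr_gt0.
have [M M1 tailM] := bm_sup_tight bm delta0 delta0.
have [rho rho0 approx] := bm_grid_approx bm delta0.
have M0 : 0 < M%:R :> R by rewrite ltr0n ltnW.
(* The second bound gives [M * kap <= 1 / 100], so that summing over the [M] levels of the smoothed
   test costs less than [delta]. *)
pose kap := Num.min delta (1 / (100 * M%:R)).
have kap0 : 0 < kap by rewrite lt_min delta0 divr_gt0// mulr_gt0.
pose mom3 : R := 4 * (6 * C ^+ 3 + 6 * C ^+ 2 + C + C ^+ 3).
pose c0 := C' ^+ 3 * mom3 / (Num.sqrt v0) ^+ 3.
have [c1 c1E] : exists c1 : R, c1 = 49 ^+ 49 by eexists.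
pose c2 := 252 * (c0 + 4 + 96 * c1).
have mom30 : 0 <= mom3 by rewrite mulr_ge0// !addr_ge0 ?mulr_ge0 ?exprn_ge0 ?(ltW C0).
have c00 : 0 <= c0 by rewrite divr_ge0 ?exprn_ge0 ?sqrtr_ge0// mulr_ge0 ?exprn_ge0 ?(ltW C'0).
have c10 : 0 <= c1 by rewrite c1E; exact: exprn_ge0.
have c20 : 0 <= c2.
  apply: mulr_ge0; first exact: ler0n.
  apply: addr_ge0; first by apply: addr_ge0 => //; exact: ler0n.
  by apply: mulr_ge0; [exact: ler0n|exact: c10].
(* One summand for each requirement on [r]: [exp (- r delta)] beats the number of grid points, the
   replacement error is below [kap], and the mesh of the variance grid is below [rho]. *)
pose r0 := 1 + 2 * (49 / delta) ^+ 49 / kap + c2 / kap + C' ^+ 2 * C / (v0 * rho).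
have q1 : 0 <= 2 * (49 / delta) ^+ 49 / kap.
  by rewrite divr_ge0 ?(ltW kap0)// mulr_ge0// exprn_ge0// divr_ge0// ltW.
have q2 : 0 <= c2 / kap by rewrite divr_ge0// ltW.
have q3 : 0 <= C' ^+ 2 * C / (v0 * rho).
  by rewrite divr_ge0 ?mulr_ge0 ?sqr_ge0// ltW.
have r0ge1 : 1 <= r0 by rewrite /r0; lra.
exists (Num.truncn (r0 ^+ 16)).+1 => d Om P H N L h dS Sm Q Z m sigma f.
move=> fH cN aN bL ph hC' vv mZ lawZ iZ mm inj [fB fL].
have m0 : (0 < m)%N by exact: leq_trans mm.
(* Iterated square roots give the sixteenth root. The replacement error is of order
   [m r ^ 3 r ^ 3 / m ^ (3/2)], that is [r ^ (- 2)] for [m = r ^ 16]; with [m = r ^ 8] it would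
   diverge. *)
pose s1 := Num.sqrt (m%:R : R); pose s2 := Num.sqrt s1; pose s3 := Num.sqrt s2.
pose r := Num.sqrt s3.
have mR0 : 0 < (m%:R : R) by rewrite ltr0n.
have r_gt0 : 0 < r by rewrite !sqrtr_gt0.
have r8 : r ^+ 8 = s1.
  rewrite -[8%N]/(2 * 4)%N exprM sqr_sqrtr ?sqrtr_ge0// -[4%N]/(2 * 2)%N exprM.
  by rewrite sqr_sqrtr ?sqrtr_ge0// sqr_sqrtr ?sqrtr_ge0.
have r16 : r ^+ 16 = m%:R by rewrite -[16%N]/(8 * 2)%N exprM r8 sqr_sqrtr// ltW.
have rr0 : r0 <= r.
  rewrite -(@ler_pXn2r _ 16)// ?nnegrE ?(ltW r_gt0) ?(le_trans ler01 r0ge1)// r16.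
  apply: ltW; apply: lt_le_trans (_ : (Num.truncn (r0 ^+ 16)).+1%:R <= _).
    by rewrite real_truncnS_gt// num_real.
  by rewrite ler_nat.
have rge1 : 1 <= r by exact: le_trans rr0.
have K0 : (0 < m ^ 3)%N by rewrite expn_gt0 m0.
have KE : (m ^ 3)%:R = r ^+ 48 :> R by rewrite natrX -r16 -exprM.
set v := cumulated_variance P L h 0 1 in vv.
have vgt0 : 0 < v by exact: lt_le_trans vv.
have [gs ms] := variance_gridP fH C0 bL ph hC' vgt0 K0.
set s := variance_grid P L h (m ^ 3) in gs ms.
have mesh l : s l.+1 - s l <= rho.
  apply: (le_trans (ms l)); rewrite ler_pdivrMr ?mulr_gt0 ?ltr0n//.
  have h1 : C' ^+ 2 * C <= rho * (r * v0).
    have : C' ^+ 2 * C / (v0 * rho) <= r by rewrite (le_trans _ rr0)// /r0; lra.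
    rewrite ler_pdivrMr ?mulr_gt0//; move=> /le_trans; apply.
    by rewrite le_eqVlt; apply/orP; left; apply/eqP; ring.
  apply: (le_trans h1); rewrite ler_pM2l// KE; apply: ler_pM => //; [exact: ltW|exact: ltW|].
  by rewrite -[leLHS]expr1 ler_weXn2l.
have kapP : (2 * m ^ 3)%:R * expR (- (r * delta)) <= kap.
  rewrite natrM KE [r * delta]mulrC -mulrA.
  have h1 := @expR_decay R 48 delta r delta0 r_gt0.
  apply: (@le_trans _ _ (2 * ((49 / delta) ^+ 49 / r))); first by rewrite ler_pM2l.
  rewrite mulrA ler_pdivrMr// [leRHS]mulrC -ler_pdivrMr//.
  by rewrite (le_trans _ rr0)// /r0; lra.
have near_soft x : `|\int[Q]_w soft_ball r x (normalized_sum P N L h Z m sigma (K := m ^ 3) w) -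
    \int[PB]_w soft_ball r x (fun k : 'I_(m ^ 3) => B (s k.+1) w)| <= kap.
  apply: (le_trans (clt_soft_ball fH cN aN C0 bL ph hC' vgt0 mZ lawZ iZ m0 inj bm x K0 (ltW r_gt0) (ltW r_gt0))).
  rewrite -/s1 -r8 KE -r16 -/mom3.
  have h1 : C' ^+ 3 * mom3 / (Num.sqrt v) ^+ 3 <= c0.
    apply: ler_wpM2l; first by rewrite mulr_ge0// exprn_ge0// ltW.
    rewrite lef_pV2 ?posrE ?exprn_gt0 ?sqrtr_gt0//.
    by rewrite lerXn2r ?nnegrE ?sqrtr_ge0// ler_sqrt// ltW.
  have h2 : r ^+ 48 * expR (- r) <= c1.
    have := @expR_decay R 48 1 r ltr01 r_gt0; rewrite mul1r divr1 -c1E => /le_trans; apply.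
    by rewrite ler_pdivrMr// ler_peMr.
  have h3 : C' ^+ 3 * mom3 / (Num.sqrt v) ^+ 3 + (4 * r ^+ 3 + 96 * r ^+ 48 * expR (- r)) <=
      (c0 + 4 + 96 * c1) * r ^+ 3.
    have r3 : 1 <= r ^+ 3 by rewrite exprn_ege1.
    by rewrite -[96 * _ * _]mulrA; exact: aux h1 h2 c00 c10 r3.
  rewrite -exprM -[(8 * 3)%N]/24%N.
  set X := C' ^+ 3 * mom3 / _ + _ in h3 *.
  have -> : r ^+ 16 * (252 * r ^+ 3 * (X / r ^+ 24)) = 252 * X / r ^+ 5.
    by field; rewrite gt_eqF.
  rewrite ler_pdivrMr ?exprn_gt0//; apply: (@le_trans _ _ (c2 * r ^+ 3)).
    by rewrite /c2 -mulrA ler_pM2l.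
  have : c2 <= kap * r by rewrite mulrC -ler_pdivrMr// (le_trans _ rr0)// /r0; lra.
  move=> h4; apply: (@le_trans _ _ (kap * r * r ^+ 3)).
    by rewrite ler_wpM2r// exprn_ge0// ltW.
  rewrite -mulrA -exprS ler_pM2l//; exact: ler_weXn2l.
have mu1 k : measurable_fun setT (fun w => normalized_sum P N L h Z m sigma (K := m ^ 3) w k).
  exact: (measurable_normalized_sum fH cN aN bL ph mZ m sigma k).
have s01 l := unit_grid01 l gs.
have mu2 (k : 'I_(m ^ 3)) : measurable_fun setT (fun w => B (s k.+1) w).
  exact: (bm_measurable bm).
have mS := bm_sup_measurable bm.
have leS w : grid_max (m ^ 3) s (B ^~ w) <= sup_abs (B ^~ w).
  have [Mw hMw] := bm_path_bounded bm w.
  apply: grid_max_le => [|k]; first exact: sup_abs_ge0.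
  exact: (le_sup_abs hMw).
have mgm : measurable_fun setT (fun w => grid_max (m ^ 3) s (B ^~ w)).
  by apply: (measurable_grid_max gs) => t; exact: (bm_measurable bm).
have tail : \int[PB]_w \1_(`]M.-2%:R * delta, +oo[%classic)
   (\big[Num.max/0]_(k < m ^ 3) `|B (s k.+1) w|) <= delta.
  have mi u : measurable_fun setT u -> Rintegrable PB (fun w => \1_(`]M.-2%:R * delta, +oo[%classic) (u w) : R).
    move=> mu; apply: (@Rintegrable_bounded _ _ _ _ _ 1).
      by apply: (measurableT_comp _ mu); apply: measurable_indic; exact: measurable_itv.
    by move=> w; rewrite ger0_norm// indicE lern1 leq_b1.
  apply: le_trans tailM; apply: Rint_le; [exact: (mi _ mgm)|exact: mi|] => w.
  rewrite !indicE ler_nat; case: (boolP (_ \in _)) => // /set_mem/=.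
  rewrite in_itv/= andbT => hw; rewrite mem_set//= in_itv/= andbT.
  exact: lt_le_trans hw (leS w).
have cmp := bounded_lipschitz_compare K0 (ltW r_gt0) delta0 kapP fB fL mu1 mu2 M1
  (fun i _ => near_soft (i%:R * delta)) tail.
have mf := lipschitz1_measurable fL.
have if_ u : measurable_fun setT u -> Rintegrable PB (fun w => f (u w)).
  by move=> mu; apply: (@Rintegrable_bounded _ _ _ _ _ 1) => //; exact: measurableT_comp.
have bmd : `|\int[PB]_w f (grid_max (m ^ 3) s (B ^~ w)) - \int[PB]_w f (sup_abs (B ^~ w))| <= delta.
  rewrite -(RintB (if_ _ mgm) (if_ _ mS)).
  have iD := RintegrableB (if_ _ mgm) (if_ _ mS).
  apply: (le_trans (Rint_abs iD)); apply: le_trans (approx _ _ gs mesh).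
  apply: Rint_le; [exact: Rintegrable_abs| |] => [|w].
    apply: (@Rintegrable_bounded _ _ _ _ _ 2).
      apply: measurable_minr => //; apply: measurableT_comp => //; exact: measurable_funB.
    by move=> w; rewrite ger0_norm ?ge_min ?lexx// le_min normr_ge0 andbT.
  rewrite le_min fL andbT (le_trans (ler_normB _ _))//.
  by have := lerD (fB (grid_max (m ^ 3) s (B ^~ w))) (fB (sup_abs (B ^~ w))).
have kapd : kap <= delta by rewrite ge_min lexx.
have kapM : M%:R * kap <= 1 / 100.
  rewrite mulrC -ler_pdivlMr//; apply: (@le_trans _ _ (1 / (100 * M%:R))).
    by rewrite ge_min lexx orbT.
  by rewrite le_eqVlt; apply/orP; left; apply/eqP; field; rewrite gt_eqF.
have kM : M%:R * delta * kap <= delta / 100.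
  by rewrite mulrAC mulrC ler_pM2l// -[100^-1]mul1r.
rewrite -[X in `|X|](subrKA (\int[PB]_w f (grid_max (m ^ 3) s (B ^~ w)))).
apply: (le_trans (ler_normD _ _)); move: cmp bmd kapd kM.
have -> : e = 100 * delta by rewrite /delta; field.
rewrite /grid_max; lra.
Qed.

(** * Residual processes *)

Lemma predictable_sub (R : realType) (Om : Type) (F H : R -> set (set Om))
    (W : R -> Om -> R) :
  (forall t, 0 <= t <= 1 -> F t `<=` H t) -> predictable F W -> predictable H W.
Proof.
move=> FH pW; apply: (subset_trans pW); apply: smallest_sub.
  exact: smallest_sigma_algebra.
move=> E hE; apply: sub_gen_smallest; case: hE => [[B FB ->]|[s [t [B [s0 st t1 FB ->]]]]].
  by left; exists B => //; apply: FH => //; rewrite lexx ler01.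
right; exists s, t, B; split => //; apply: FH => //.
by rewrite s0 (le_trans (ltW st)).
Qed.

Section enlarged.
Context (R : realType) d (Om : measurableType d) (P : probability Om R).
Variables (F : R -> set (set Om)) (X : R -> Om -> R).
Hypothesis uF : usual_filtration P F.
Hypothesis mX : forall t, 0 <= t <= 1 -> measurable_fun setT (X t).
Local Notation GF := (enlarged_filtration P F X).

Lemma usual_filtration_filtration : filtration F.
Proof. by have [h1 h2 _ _] := uF. Qed.

Lemma negligible_measurable A : P.-negligible A -> measurable A.
Proof.
have zero01 : 0 <= (0 : R) <= 1 by rewrite lexx ler01.
have [h1 _ _ h4] := uF; move=> nA; apply: (h1 0 zero01).2; exact: h4.
Qed.

Lemma sub_enlarged t : 0 <= t <= 1 -> F t `<=` GF t.
Proof.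
move=> /andP[t0 t1] A FA s hs; apply: sub_sigma_algebra; left; left.
have [_ h2 _ _] := uF.
have [ts s1] : t <= s /\ s <= 1 by case: hs => [/andP[/ltW]|->].
exact: (h2 t s).
Qed.

Lemma enlarged_filtration_filtration : filtration GF.
Proof.
split => [t /andP[t0 t1]|s t s0 st t1 A HA u hu]; last first.
  apply: HA => /=; case: hu => [/andP[tu u1]|->]; [left|by right].
  by rewrite u1 (le_lt_trans st tu).
split.
  split.
  - by move=> s _; exact: (@measurable0 _ (g_sigma_algebraType _)).
  - move=> A HA s hs; rewrite setTD; exact: (@measurableC _ (g_sigma_algebraType _) _ (HA s hs)).
  - by move=> A HA s hs; apply: (@bigcupT_measurable _ (g_sigma_algebraType _)) => i; exact: HA.
have one01 : 0 <= (1 : R) <= 1 by rewrite lexx ler01.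
have [h1 _ _ _] := uF.
move=> A /(_ 1 (or_intror erefl)); apply: smallest_sub; first exact: sigma_algebra_measurable.
move=> B [[/(h1 1 one01).2//|[u /= u01 [Y mY <-]]]|]; last exact: negligible_measurable.
by apply: mX => //; exact: measurableT.
Qed.

End enlarged.

Section caglad_predictable.
Context (R : realType) d (Om : measurableType d) (H : R -> set (set Om)).
Hypothesis fH : filtration H.
Variable (G : R -> Om -> R).
Hypothesis cG : caglad G.
Hypothesis aG : adapted H G.

Let mG s : 0 <= s <= 1 -> measurable_fun setT (G s : g_sigma_algebraType (H s) -> R).
Proof.
move=> s01 _ Y mY; apply: sub_sigma_algebra; apply: (aG s01); first by exists Y.
Qed.

(** Each cell carries the value at its left end, which is known when the cell starts; the steps
    converge because the paths are left-continuous. Time 0 is treated apart, as no interval []s, t]]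
    contains it. *)
Let step (n : nat) (x : R * Om) : R := G 0 x.2 * \1_[set (0 : R)] x.1 +
  \sum_(k < n.+1) G (k%:R / n.+1%:R) x.2 * \1_(`]k%:R / n.+1%:R, k.+1%:R / n.+1%:R]%classic) x.1.

Let pred_step n : pred_fun H (step n).
Proof.
have zero01 : 0 <= (0 : R) <= 1 by rewrite lexx ler01.
apply: measurable_funD.
  move=> _ Y mY; rewrite setTI.
  have -> : (fun x : R * Om => G 0 x.2 * \1_[set (0 : R)] x.1) @^-1` Y =
    ([set 0] `*` (G 0 @^-1` Y)) `|` (if 0 \in Y then ~` ([set 0] `*` setT) else set0).
    apply/seteqP; split => x /=.
      rewrite indicE; case: (boolP (x.1 \in [set (0 : R)])) => [/set_mem/= x0|nx].
        by rewrite mulr1 => Yx; left.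
      rewrite mulr0 => Y0; right; rewrite mem_set//= => -[/= x0 _].
      by move/negP: nx; apply; apply/mem_set.
    move=> [[/= x0 Yx]|]; first by rewrite indicE mem_set//= mulr1.
    case: ifPn => // /set_mem Y0 nx; rewrite indicE memNset ?mulr0//= => x0.
    by apply: nx; split.
  apply: measurableU.
    apply: sub_sigma_algebra; left; exists (G 0 @^-1` Y) => //.
    apply: (aG zero01); exists Y => //; by rewrite setTI.
  case: ifPn => _; last exact: measurable0.
  apply: measurableC; apply: sub_sigma_algebra; left; exists setT => //.
  exact: filtration_T.
apply: measurable_sum => k.
have n0 : 0 < n.+1%:R :> R by [].
have k1 : k.+1%:R / n.+1%:R <= 1 :> R by rewrite ler_pdivrMr// mul1r ler_nat.
have kk : k%:R / n.+1%:R <= k.+1%:R / n.+1%:R :> R by rewrite ler_pM2r ?invr_gt0// ler_nat.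
have k0 : 0 <= k%:R / n.+1%:R :> R by rewrite divr_ge0.
apply: (pred_start fH) => //; apply: mG.
by rewrite k0 (le_trans kk).
Qed.

Let step_cvg x : step n x @[n --> \oo] --> uncurry01 G x.
Proof.
case: x => s w; have [s01|ns] := boolP (0 <= s <= 1); last first.
  have -> : uncurry01 G (s, w) = 0 by rewrite /uncurry01 patchN// notin_setE/=; exact/negP.
  apply: cvg_near_cst; apply: nearW => n; rewrite /step/= indicE memNset ?mulr0 ?add0r; last first.
    by move=> /= s0; rewrite s0 lexx ler01 in ns.
  rewrite big1// => k _; rewrite indicE memNset ?mulr0//= in_itv/= => /andP[ks sk].
  move/negP: ns; apply; apply/andP; split.
    by rewrite ltW// (le_lt_trans _ ks)// divr_ge0.
  by rewrite (le_trans sk)// ler_pdivrMr// mul1r ler_nat.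
rewrite uncurry01E//; have /andP[s0 s1] := s01.
move: s0; rewrite le_eqVlt => /orP[/eqP s0|s0].
  apply: cvg_near_cst; apply: nearW => n; rewrite /step/= indicE mem_set//= mulr1 -s0.
  rewrite big1 ?addr0// => k _; rewrite indicE memNset ?mulr0//= in_itv/= => /andP[ks _].
  by have := le_lt_trans (divr_ge0 (ler0n R k) (ler0n R n.+1)) ks; rewrite ltxx.
have s01' : 0 < s <= 1 by rewrite s0.
have [cl _] := cG w; have cs := cl s s01'.
apply/cvgrPdist_le => e e0.
have /cvgrPdist_le/(_ e e0) hnear := cs.
have [r r0 hr] := near_left_ex hnear.
exists (Num.truncn r^-1) => // n /= nr.
have n0 : 0 < n.+1%:R :> R by [].
have nr1 : n.+1%:R^-1 < r.
  rewrite invf_plt ?posrE//; apply: lt_le_trans (_ : (Num.truncn r^-1).+1%:R <= _).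
    by rewrite real_truncnS_gt// num_real.
  by rewrite ler_nat.
have [k kn /andP[ks sk]] : exists2 k, (k < n.+1)%N & k%:R / n.+1%:R < s <= k.+1%:R / n.+1%:R.
  have ex : exists k, s <= k.+1%:R / n.+1%:R by exists n; rewrite divff// gt_eqF.
  case: (ex_minnP ex) => k sk kmin; exists k.
    by rewrite ltnS; apply: kmin; rewrite divff// gt_eqF.
  rewrite sk andbT; case: k sk kmin => [|k] sk kmin; first by rewrite mul0r.
  by rewrite ltNge; apply/negP => /kmin; rewrite ltnn.
rewrite /step/= indicE memNset ?mulr0 ?add0r; last by move=> /= h; rewrite h ltxx in s0.
rewrite (bigD1 (Ordinal kn))//= indicE mem_set ?mulr1; last by rewrite /= in_itv/= ks.
rewrite big1 ?addr0 => [|j jk]; last first.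
  rewrite indicE memNset ?mulr0//= in_itv/= => /andP[js sj].
  move/negP: jk; apply; apply/eqP/val_inj => /=; apply/eqP; rewrite eqn_leq.
  have h1 := lt_le_trans js sk; have h2 := lt_le_trans ks sj.
  move: h1 h2; rewrite !ltr_pM2r ?invr_gt0// !ltr_nat !ltnS => -> ->//.
apply: hr => //; rewrite ltrBlDr; apply: (le_lt_trans sk).
by rewrite -natr1 mulrDl mul1r ltrD2l.
Qed.

Lemma caglad_pred_fun : pred_fun H (uncurry01 G).
Proof.
apply: (@measurable_fun_cvg _ (predictable_type H) R setT step) => //.
Qed.

End caglad_predictable.

(** The bounds on [G] and on the estimates hold almost surely. Clipping makes them hold everywhere,
    keeps predictability, and is a contraction, so it does not increase estimation errors. *)
Definition clip (R : realType) (c a : R) : R := Num.max (- c) (Num.min c a).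

Section clip.
Context (R : realType) (c : R).
Hypothesis c0 : 0 <= c.

Lemma abs_clip a : `|clip c a| <= c.
Proof.
rewrite /clip ler_norml le_max lexx/= ge_max ge_min lexx/= andbT.
by rewrite -subr_ge0 opprK addr_ge0.
Qed.

Lemma clip_id a : `|a| <= c -> clip c a = a.
Proof. by rewrite ler_norml /clip => /andP[h1 h2]; rewrite min_r// max_r. Qed.

Lemma clip_lipschitz a b : `|clip c a - clip c b| <= `|a - b|.
Proof.
have cases x : [\/ x <= - c /\ clip c x = - c, - c <= x <= c /\ clip c x = x | c <= x /\ clip c x = c].
  rewrite /clip; case: (leP c x) => h1.
    by apply: Or33; rewrite max_r//; move: c0; clear; lra.
  case: (leP (- c) x) => h2; first by apply: Or32; split => //; rewrite ltW.
  by apply: Or31; rewrite ltW.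
have := ler_norm (a - b); have := ler_norm (b - a); rewrite (distrC b a).
move: `|a - b| => n h1 h2; rewrite ler_norml; move: c0.
by case: (cases a) => -[? ->]; case: (cases b) => -[? ->] ?; apply/andP; split; lra.
Qed.
End clip.

Lemma measurable_clip (R : realType) (c : R) : measurable_fun setT (clip c).
Proof.
by apply: measurable_maxr => //; apply: measurable_minr => //; exact: measurable_id.
Qed.

Section sub_sigma_orthogonal.
Context (R : realType) d (Om : measurableType d) (P : probability Om R).
Variable (A : set (set Om)).
Hypothesis mA : <<s A>> `<=` measurable.
Variables (X U : Om -> R) (K : R).
Hypothesis iX : Rintegrable P X.
Hypothesis X0 : forall E, <<s A>> E -> \int[P]_(w in E) X w = 0.
Hypothesis mU : measurable_fun setT (U : g_sigma_algebraType A -> R).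
Hypothesis bU : forall w, `|U w| <= K.

(** Vanishing of the integrals over the sets of the sigma-algebra extends to bounded measurable
    factors by uniform approximation with step functions. *)
Lemma sub_sigma_orthogonal : \int[P]_w (U w * X w) = 0.
Proof.
have K0 : 0 <= K by exact: le_trans (bU point).
have mU' : measurable_fun setT U.
  by move=> _ Y mY; rewrite setTI; apply: mA; rewrite -[_ @^-1` _]setTI; exact: (mU (@measurableT _ (g_sigma_algebraType A))).
have mX := RintegrableM iX.
have iUX : Rintegrable P (fun w => U w * X w).
  apply: (@Rintegrable_le _ _ _ _ _ (fun w => K * `|X w|)).
  - exact: measurable_funM.
  - by move=> w; rewrite normrM ler_wpM2r.
  - by apply: RintegrableZ; exact: Rintegrable_abs.
have intX0 : \int[P]_w X w = 0.
  by have := X0 (@measurableT _ (g_sigma_algebraType A)).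
pose I := \int[P]_w `|X w|.
have I0 : 0 <= I by apply: Rint_ge0.
suff key n : `|\int[P]_w (U w * X w)| <= n.+1%:R^-1 * I.
  apply/eqP; rewrite -normr_eq0; apply/negPn/negP => h.
  have {}h : 0 < `|\int[P]_w (U w * X w)| by rewrite lt_neqAle eq_sym h normr_ge0.
  set a := `|_| in h key; have := key (Num.truncn (I / a)).
  rewrite mulrC ler_pdivlMr// -ler_pdivlMl// mulrC leNgt; move/negP; apply.
  by rewrite real_truncnS_gt// num_real.
(* The step function [V] is [U + K] rounded down to a multiple of [1 / (n + 1)], written as a sum of
   indicators of superlevel sets; since [U + K <= 2 K], [m] of them suffice. *)
pose m := (Num.truncn ((2 * K) * n.+1%:R)).+1.
pose E k := [set w | k.+1%:R / n.+1%:R <= U w + K].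
have n0 : 0 < n.+1%:R :> R by [].
have gE k : <<s A>> (E k).
  have -> : E k = U @^-1` `[k.+1%:R / n.+1%:R - K, +oo[%classic.
    by apply/seteqP; split => w; rewrite /E/= in_itv/= andbT lerBlDr.
  by rewrite -[_ @^-1` _]setTI; exact: (mU (@measurableT _ (g_sigma_algebraType A))).
have mE k := mA (gE k).
pose V w : R := n.+1%:R^-1 * \sum_(k < m) (\1_(E k) w : R).
have VU w : `|U w + K - V w| <= n.+1%:R^-1.
  pose y := (U w + K) * n.+1%:R.
  have UK0 : 0 <= U w + K by have := bU w; rewrite ler_norml; lra.
  have y0 : 0 <= y by rewrite mulr_ge0.
  have -> : U w + K = n.+1%:R^-1 * y by rewrite /y mulrCA mulVf ?mulr1// gt_eqF.
  rewrite /V -mulrBr normrM ger0_norm ?invr_ge0// ler_piMr// ?invr_ge0//.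
  have -> : \sum_(k < m) \1_(E k) w = (Num.truncn y)%:R :> R.
    transitivity (\sum_(k < m) (1 * (k < Num.truncn y)%N%:R : R)).
      apply: eq_bigr => k _; rewrite mul1r indicE; congr (_%:R); congr nat_of_bool.
      rewrite truncn_ge_nat// -ler_pdivrMr//; apply/idP/idP; first by move/set_mem.
      by move=> h; apply/mem_set.
    rewrite (sum_ord_ltn (fun=> 1)) ?sumr_const ?card_ord// -(ler_nat R) (le_trans (proj1 (andP (truncn_itv y0))))//.
    apply: ltW; apply: le_lt_trans (_ : 2 * K * n.+1%:R < _); last by rewrite real_truncnS_gt// num_real.
    by rewrite ler_pM2r//; have := bU w; rewrite ler_norml; lra.
  have /andP[h1 h2] := truncn_itv y0.
  rewrite ger0_norm ?subr_ge0// lerBlDr; move: h2; rewrite -natr1; lra.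
have iV k : Rintegrable P (fun w => \1_(E k) w * X w) by exact: Rintegrable_indicM.
have iVX : Rintegrable P (fun w => V w * X w).
  have -> : (fun w => V w * X w) = (fun w => n.+1%:R^-1 * \sum_(k < m) \1_(E k) w * X w).
    by apply/funext => w; rewrite /V -mulrA mulr_suml.
  by apply: RintegrableZ; apply: Rintegrable_sum => k _.
have V0 : \int[P]_w (V w * X w) = 0.
  have -> : (fun w => V w * X w) = (fun w => n.+1%:R^-1 * \sum_(k < m) \1_(E k) w * X w).
    by apply/funext => w; rewrite /V -mulrA mulr_suml.
  rewrite RintZ ?Rint_sum//; last by apply: Rintegrable_sum => k _.
  by rewrite big1 ?mulr0// => k _; rewrite -Rintegral_indic X0.
have iKX : Rintegrable P (fun w => K * X w) by exact: RintegrableZ.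
have -> : \int[P]_w (U w * X w) = \int[P]_w ((U w + K - V w) * X w).
  transitivity (\int[P]_w (U w * X w) + \int[P]_w (K * X w) - \int[P]_w (V w * X w)).
    by rewrite V0 subr0 RintZ// intX0 mulr0 addr0.
  rewrite -RintD// -RintB//; last exact: RintegrableD.
  by apply: eq_Rintegral => w _; rewrite mulrBl mulrDl.
apply: (le_trans (Rint_abs _)).
  have -> : (fun w => (U w + K - V w) * X w) = fun w => U w * X w + K * X w - V w * X w.
    by apply/funext => w; rewrite mulrBl mulrDl.
  by apply: RintegrableB => //; exact: RintegrableD.
rewrite -RintZ; last exact: Rintegrable_abs.
apply: Rint_le.
- apply: Rintegrable_abs.
  have -> : (fun w => (U w + K - V w) * X w) = fun w => U w * X w + K * X w - V w * X w.
    by apply/funext => w; rewrite mulrBl mulrDl.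
  by apply: RintegrableB => //; exact: RintegrableD.
- by apply: RintegrableZ; exact: Rintegrable_abs.
- by move=> w; rewrite normrM ler_wpM2r.
Qed.
End sub_sigma_orthogonal.

(** A predictable process is known just before [s]: the section at [s] of a rectangle over []a, b]]
    is nonempty only if [a < s], and then its base belongs to the past at time [a]. *)
Lemma pred_fun_left (R : realType) d (Om : measurableType d) (F : R -> set (set Om))
    (D : R * Om -> R) (s : R) : 0 < s -> pred_fun F D ->
  measurable_fun setT ((fun w => D (s, w)) :
    g_sigma_algebraType (\bigcup_(u in [set u : R | 0 <= u < s]) F u) -> R).
Proof.
move=> s0 pD; pose T := g_sigma_algebraType (\bigcup_(u in [set u : R | 0 <= u < s]) F u).
have mpair : measurable_fun setT ((fun w => (s, w)) : T -> predictable_type F).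
  refine (@measurability _ _ T (predictable_type F) setT _ (predictable_rectangles F) (erefl _) _).
  move=> _ [_ [[A FA ->]|[a [b [A [a0 ab b1 FA ->]]]]] <-].
    rewrite (_ : _ `&` _ = set0)//; apply/seteqP; split => // w [_ [/= h _]].
    by rewrite h ltxx in s0.
  have [sab|sab] := boolP (s \in `]a, b]).
    rewrite (_ : _ `&` _ = A); last first.
      by apply/seteqP; split => w; [case=> _ []|split].
    apply: sub_sigma_algebra; exists a => //=; move: sab; rewrite in_itv/= a0.
    by case/andP.
  rewrite (_ : _ `&` _ = set0)//; apply/seteqP; split => // w [_ [/= h _]].
  by rewrite h in sab.
exact: (measurableT_comp pD mpair).
Qed.

Section residual.
Context (R : realType) d (Om : measurableType d) (P : probability Om R).
Variables (F : R -> set (set Om)) (X G : R -> Om -> R) (C' : R).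
Hypothesis uF : usual_filtration P F.
Hypothesis mX : forall t, 0 <= t <= 1 -> measurable_fun setT (X t).
Hypothesis rG : residual_process P F X G.
Hypothesis C'0 : 0 < C'.
Hypothesis GC : \forall w \ae P, forall t, 0 <= t <= 1 -> `|G t w| <= C'.

Definition clipped (W : R -> Om -> R) (c : R) : R * Om -> R := fun x => clip c (uncurry01 W x).

Lemma pred_fun_residual : pred_fun (enlarged_filtration P F X) (clipped G C').
Proof.
have [cG aG _] := rG; apply: measurableT_comp; first exact: measurable_clip.
by apply: caglad_pred_fun cG aG; exact: enlarged_filtration_filtration.
Qed.

(** [D (s, .)] is bounded and known just before [s], where the residual has conditional mean 0. Time
    0 is left aside; it has measure 0 in all the integrals over time. *)
Lemma residual_orthogonal (D : R * Om -> R) (K s : R) : pred_fun F D ->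
  (forall x, `|D x| <= K) -> 0 < s <= 1 ->
  \int[P]_w (clipped G C' (s, w) * D (s, w)) = 0.
Proof.
move=> pD bD /andP[s0 s1]; have s01 : 0 <= s <= 1 by rewrite ltW.
have [_ _ /(_ s s01)[iG _ _ cE]] := rG.
have fF := usual_filtration_filtration uF.
rewrite /left_filtration gt_eqF// in cE.
have GE : \int[P]_w (D (s, w) * G s w) = 0.
  apply: (@sub_sigma_orthogonal _ _ _ P (\bigcup_(u in [set u : R | 0 <= u < s]) F u) _ (G s) (fun w => D (s, w)) K).
  - apply: smallest_sub; first exact: sigma_algebra_measurable.
    move=> A [u /= /andP[u0 us] FA]; apply: (fF.1 u _).2 => //.
    by rewrite u0 (le_trans (ltW us)).
  - exact: iG.
  - by move=> E hE; rewrite cE// Rintegral_indic -[RHS](Rint_cst P 0); apply: eq_Rintegral => w _; rewrite mulr0.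
  - exact: pred_fun_left.
  - by move=> w.
rewrite -GE; apply: Rint_ae.
- apply: measurable_funM.
    apply: (measurableT_comp (pred_fun_measurable (enlarged_filtration_filtration uF mX) pred_fun_residual)).
    exact: pair1_measurable.
  apply: (measurableT_comp (pred_fun_measurable fF pD)).
  exact: pair1_measurable.
- apply: measurable_funM; last exact: (RintegrableM iG).
  apply: (measurableT_comp (pred_fun_measurable fF pD)).
  exact: pair1_measurable.
- apply: filterS GC => w /(_ s s01) h.
  by rewrite /clipped uncurry01E// clip_id// mulrC.
Qed.
End residual.

(** * The statistic for fixed estimators *)

Section iid_sums.
Context (R : realType) d (Om : measurableType d) (P : probability Om R).
Context dS (Sm : measurableType dS) (Q : probability Sm R) (Z : nat -> Sm -> Om).
Hypothesis mZ : forall j, measurable_fun setT (Z j).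
Hypothesis lawZ : forall j (A : set Om), measurable A -> Q (Z j @^-1` A) = P A.
Hypothesis iZ : mutually_independent Q Z.
Variables (m : nat) (sigma : nat -> nat).
Hypothesis sigma_inj : {in [pred i | (i < m)%N] &, injective sigma}.

Lemma replication_mean (phi : Om -> R) j : measurable_fun setT phi ->
  \int[Q]_w phi (Z j w) = \int[P]_w phi w.
Proof. by move=> mphi; apply: (@Rint_law R _ _ _ Sm Om Om Q P (Z j) id (mZ j) _ _ phi mphi) => //; exact: lawZ. Qed.

Lemma replication_integrable (phi : Om -> R) j : Rintegrable P phi ->
  Rintegrable Q (fun w => phi (Z j w)).
Proof.
move=> iphi; have mphi := RintegrableM iphi.
by apply: (@Rintegrable_law R _ _ _ Sm Om Om Q P (Z j) id (mZ j) _ _ phi mphi) => //; exact: lawZ.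
Qed.

Lemma replication_product (f g : Om -> R) (i j : 'I_m) : i != j ->
  Rintegrable P f -> Rintegrable P g ->
  Rintegrable Q (fun w => f (Z (sigma i) w) * g (Z (sigma j) w)) /\
  \int[Q]_w (f (Z (sigma i) w) * g (Z (sigma j) w)) = \int[P]_w f w * \int[P]_w g w.
Proof.
move=> ij If Ig; have mf := RintegrableM If; have mg := RintegrableM Ig.
have [] := @independent_mean _ _ _ Q _ _ _ Z [set sigma i] [set sigma j]
  (fun w => f (Z (sigma i) w)) (fun w => g (Z (sigma j) w)) mZ iZ.
- apply/seteqP; split => // k [/= -> /sigma_inj h].
  by move/negP: ij; apply; apply/eqP/val_inj; apply: h; rewrite inE.
- by apply: (measurableT_comp mf); exact: measurable_generated.
- by apply: (measurableT_comp mg); exact: measurable_generated.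
- exact: replication_integrable.
- exact: replication_integrable.
by move=> i1 ->; rewrite !replication_mean.
Qed.

Lemma iid_sum_sqr (g : Om -> R) : measurable_fun setT g ->
  Rintegrable P (fun w => g w ^+ 2) -> \int[P]_w g w = 0 ->
  Rintegrable Q (fun w => (\sum_(i < m) g (Z (sigma i) w)) ^+ 2) /\
  \int[Q]_w ((\sum_(i < m) g (Z (sigma i) w)) ^+ 2) = m%:R * \int[P]_w (g w ^+ 2).
Proof.
move=> mg ig2 g0; have [ig _] := Rint_sqr mg ig2.
have E : (fun w => (\sum_(i < m) g (Z (sigma i) w)) ^+ 2) =
    fun w => \sum_(i < m) \sum_(j < m) (g (Z (sigma i) w) * g (Z (sigma j) w)).
  apply/funext => w; rewrite expr2 mulr_suml; apply: eq_bigr => i _.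
  by rewrite mulr_sumr.
have I (i j : 'I_m) : Rintegrable Q (fun w => g (Z (sigma i) w) * g (Z (sigma j) w)).
  have [<-|ij] := eqVneq i j; last by have [] := replication_product ij ig ig.
  exact: (replication_integrable (phi := fun w => g w * g w) _ ig2).
have I1 (i : 'I_m) : Rintegrable Q (fun w => \sum_(j < m) (g (Z (sigma i) w) * g (Z (sigma j) w))).
  by apply: Rintegrable_sum => j _.
rewrite E; split; first by apply: Rintegrable_sum => i _.
rewrite Rint_sum//.
transitivity (\sum_(i < m) \int[P]_w (g w ^+ 2)); last by rewrite sumr_const card_ord mulr_natl.
apply: eq_bigr => i _; rewrite Rint_sum// (bigD1 i)//= big1 => [|j ji]; last first.
  by rewrite eq_sym in ji; have [_ ->] := replication_product ji ig ig; rewrite g0 mul0r.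
rewrite addr0 -(replication_mean (sigma i)); first by [].
by apply: measurable_funX.
Qed.

Lemma iid_mean_variance (g : Om -> R) : (0 < m)%N -> measurable_fun setT g ->
  Rintegrable P (fun w => g w ^+ 2) ->
  Rintegrable Q (fun w => (m%:R^-1 * \sum_(i < m) g (Z (sigma i) w) - \int[P]_w g w) ^+ 2) /\
  \int[Q]_w ((m%:R^-1 * \sum_(i < m) g (Z (sigma i) w) - \int[P]_w g w) ^+ 2) <=
    m%:R^-1 * \int[P]_w (g w ^+ 2).
Proof.
move=> m0 mg ig2; have [ig _] := Rint_sqr mg ig2.
set a := \int[P]_w g w; have m1 : m%:R != 0 :> R by rewrite pnatr_eq0 -lt0n.
pose k w := g w - a.
have mk : measurable_fun setT k by apply: measurable_funB.
have ia := Rintegrable_cst P (a ^+ 2); have iga := RintegrableZ (2 * a) ig.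
have kE : (fun w => k w ^+ 2) = fun w => g w ^+ 2 - 2 * a * g w + a ^+ 2.
  by apply/funext => w; rewrite /k; ring.
have ik2 : Rintegrable P (fun w => k w ^+ 2).
  by rewrite kE; apply: RintegrableD => //; apply: RintegrableB.
have k0 : \int[P]_w k w = 0.
  rewrite [LHS](RintB ig (Rintegrable_cst P a)) Rint_cst.
  by rewrite subrr.
have [] := iid_sum_sqr mk ik2 k0.
have E w : m%:R^-1 * \sum_(i < m) g (Z (sigma i) w) - a = m%:R^-1 * \sum_(i < m) k (Z (sigma i) w).
  by rewrite big_split/= sumr_const card_ord mulrDr -[X in _ + _ * X]mulr_natl mulrA mulVf// mul1r.
have E2 : (fun w => (m%:R^-1 * \sum_(i < m) g (Z (sigma i) w) - a) ^+ 2) =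
    fun w => m%:R^-1 ^+ 2 * (\sum_(i < m) k (Z (sigma i) w)) ^+ 2.
  by apply/funext => w; rewrite E exprMn.
move=> i1 e1; rewrite E2; split; first exact: RintegrableZ.
rewrite RintZ// e1 mulrA expr2 -(mulrA m%:R^-1) mulVf// mulr1 ler_pM2l ?invr_gt0 ?ltr0n//.
rewrite kE [leLHS](RintD (RintegrableB ig2 iga) ia) (RintB ig2 iga) (RintZ _ ig) Rint_cst -/a.
by rewrite -subr_ge0; have := sqr_ge0 a; lra.
Qed.

(* The replicates of [U (s, .)] are centred at each time [s], so that no martingale
   structure of [U] in [s] is needed. *)
Lemma drift_bound (U : R * Om -> R) (B : R) : measurable_fun setT U ->
  (forall x, `|U x| <= B) -> (forall s : R, 0 < s <= 1 -> \int[P]_w U (s, w) = 0) ->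
  Rintegrable Q (fun w => \int[U01]_s `|\sum_(i < m) U (s, Z (sigma i) w)|) /\
  (\int[Q]_w \int[U01]_s `|\sum_(i < m) U (s, Z (sigma i) w)|) ^+ 2 <=
    m%:R * \int[(@U01 R \x P)%E]_x (U x ^+ 2).
Proof.
move=> mU bU U0; pose A (x : R * Sm) := \sum_(i < m) U (x.1, Z (sigma i) x.2).
have mA : measurable_fun setT A.
  apply: measurable_sum => i; apply: (measurableT_comp mU).
  exact: (measurable_fun_pair measurable_fst (measurableT_comp (mZ (sigma i)) measurable_snd)).
have bA x : `|A x| <= m%:R * B.
  apply: (le_trans (ler_norm_sum _ _ _)).
  by rewrite mulr_natl -[X in _ *+ X]card_ord -sumr_const; exact: ler_sum.
have bA2 x : `|A x ^+ 2| <= (m%:R * B) ^+ 2.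
  by rewrite normrX ler_pXn2r ?nnegrE// (le_trans _ (bA x)).
have mA2 : measurable_fun setT (fun x => A x ^+ 2) by exact: measurable_funX.
have iA2 : Rintegrable (@U01 R \x Q)%E (fun x => A x ^+ 2).
  exact: (@Rintegrable_bounded _ _ _ (@U01 R \x Q)%E _ _ mA2 bA2).
have [iA le1] := @Rint_sqr _ _ _ (@U01 R \x Q)%E _ mA iA2.
have iAa := Rintegrable_abs iA.
have [i2 e2] := Rfubini2 iAa.
split => //; rewrite [X in X ^+ 2]e2.
apply: (le_trans le1); have [_ <-] := Rfubini1 iA2.
have mU2 : measurable_fun setT (fun x => U x ^+ 2) by exact: measurable_funX.
have bU2 x : `|U x ^+ 2| <= B ^+ 2.
  by rewrite normrX ler_pXn2r ?nnegrE// (le_trans _ (bU x)).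
have iU2 : Rintegrable (@U01 R \x P)%E (fun x => U x ^+ 2).
  exact: (@Rintegrable_bounded _ _ _ (@U01 R \x P)%E _ _ mU2 bU2).
have [i3 <-] := Rfubini1 iU2; rewrite -(RintZ _ i3).
rewrite le_eqVlt; apply/orP; left; apply/eqP; apply: Rint_ae.
- exact: (@measurable_Rint1 _ _ _ _ _ Q (fun x => A x ^+ 2) mA2).
- by apply: measurable_funM => //; exact: (@measurable_Rint1 _ _ _ _ _ P (fun x => U x ^+ 2) mU2).
exists (~` `]0, 1]%classic); split => //; first exact: measurableC.
  exact: U01_itv.
move=> s /= h s01; apply: h; apply: (iid_sum_sqr _ _ _).2.
- by apply: (measurableT_comp mU); exact: pair1_measurable.
- apply: (@Rintegrable_bounded _ _ _ P _ (B ^+ 2)) => //.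
  by apply: (measurableT_comp mU2); exact: pair1_measurable.
- by apply: U0; move: s01; rewrite in_itv/=.
Qed.
End iid_sums.

Section fixed_estimates.
Context (R : realType) d (Om : measurableType d) (P : probability Om R).
Variables (H : R -> set (set Om)) (N : R -> Om -> nat) (C C' : R) (L : R * Om -> R).
Hypothesis fH : filtration H.
Hypothesis cN : forall w, counting_path (N ^~ w).
Hypothesis aN : adapted H N.
Hypothesis C0 : 0 < C.
Hypothesis C'0 : 0 < C'.
Hypothesis bL : bounded_intensity P H N C L.
Variables (G h l : R * Om -> R).
Hypothesis mG : measurable_fun setT G.
Hypothesis ph : pred_fun H h.
Hypothesis ml : measurable_fun setT l.
Hypothesis GC : forall x, `|G x| <= C'.
Hypothesis hC : forall x, `|h x| <= C'.
Hypothesis lC : forall x, `|l x| <= C.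
Hypothesis orth : forall s : R, 0 < s <= 1 ->
  \int[P]_w (G (s, w) * (L (s, w) - l (s, w))) = 0.
Context dS (Sm : measurableType dS) (Q : probability Sm R) (Z : nat -> Sm -> Om).
Hypothesis mZ : forall j, measurable_fun setT (Z j).
Hypothesis lawZ : forall j (A : set Om), measurable A -> Q (Z j @^-1` A) = P A.
Hypothesis iZ : mutually_independent Q Z.
Variables (m : nat) (sigma : nat -> nat).
Hypothesis m0 : (0 < m)%N.
Hypothesis sigma_inj : {in [pred i | (i < m)%N] &, injective sigma}.
Local Notation M := (@U01 R \x P)%E.
Local Notation grid := (regular_grid R).
Local Notation v := (cumulated_variance P L h 0 1).

Let mh : measurable_fun setT h. Proof. exact: pred_fun_measurable ph. Qed.
Let mLL := measurable_intensity fH bL.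
Let one01 : 0 <= (1 : R) <= 1. Proof. by rewrite ler01 lexx. Qed.

Definition intensity_error (x : R * Om) := L x - l x.
Local Notation D := intensity_error.

Lemma measurable_intensity_error : measurable_fun setT D.
Proof. exact: measurable_funB. Qed.
Let mD := measurable_intensity_error.

Lemma intensity_error_bound x : `|D x| <= 2 * C.
Proof.
rewrite (le_trans (ler_normB _ _))// mulr_natl mulr2n lerD//.
by have /andP[h0 h1] := intensity_bounds bL x; rewrite ger0_norm.
Qed.

Definition true_sum t w := \sum_(i < m) intM N L (on_itv 0 t h) (Z (sigma i) w).
Definition estimated_sum t w := \sum_(i < m) intM N l (on_itv 0 t h) (Z (sigma i) w).
(** Bounds the effect of a wrong intensity for all [t] at once. In the part with [G] the absolute
    value stays outside the sum over observations, to keep the cancellation of centred variables; in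
    the part with [h - G] nothing cancels and both factors are taken in modulus. *)
Definition drift_error w :=
  \int[U01]_s `|\sum_(i < m) (fun x => G x * D x) (s, Z (sigma i) w)| +
  \sum_(i < m) (fun y => \int[U01]_s (`|h (s, y) - G (s, y)| * `|D (s, y)|)) (Z (sigma i) w).

Let iU (k : R * Om -> R) (B : R) y : measurable_fun setT k -> (forall x, `|k x| <= B) ->
  Rintegrable U01 (fun s => k (s, y)).
Proof.
move=> mk bk; apply: (@Rintegrable_bounded _ _ _ U01 _ B) => //.
by apply: (measurableT_comp mk); exact: pair2_measurable.
Qed.

Let bI (a b : R) (u : R) : (`|\1_(`]a, b]%classic) u : R| <= 1).
Proof. by rewrite indicE; case: (_ \in _); rewrite ?normr1 ?normr0. Qed.

Let mfst (a b : R) : measurable_fun setT (fun x : R * Om => \1_(`]a, b]%classic) x.1 : R).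
Proof. by apply: measurableT_comp => //; exact: measurable_indic. Qed.

Lemma drift_error_le t w : 0 <= t <= 1 -> `|estimated_sum t w - true_sum t w| <= drift_error w.
Proof.
move=> t01; pose k := on_itv 0 t h.
have mk : measurable_fun setT k by exact: measurable_on_itv.
have bk x : `|k x| <= C' by exact: on_itv_boundK.
have bkL x : `|k x * L x| <= C' * C.
  rewrite normrM ler_pM//; have /andP[h0 h1] := intensity_bounds bL x; by rewrite ger0_norm.
have bkl x : `|k x * l x| <= C' * C by rewrite normrM ler_pM.
have e1 y : intM N l k y - intM N L k y = \int[U01]_s (k (s, y) * D (s, y)).
  rewrite /intM opprB addrC addrA subrK /intL.
  rewrite -[LHS](@RintB _ _ _ U01 (fun s => k (s, y) * L (s, y)) (fun s => k (s, y) * l (s, y))).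
  - by apply: eq_Rintegral => s _; rewrite -mulrBr.
  - exact: (iU _ (measurable_funM mk mLL) bkL).
  - exact: (iU _ (measurable_funM mk ml) bkl).
pose k1 (x : R * Om) := (\1_(`]0, t]%classic) x.1 : R) * (G x * D x).
pose k2 (x : R * Om) := (\1_(`]0, t]%classic) x.1 : R) * ((h x - G x) * D x).
have mGD : measurable_fun setT (fun x => G x * D x) by exact: measurable_funM.
have mhG : measurable_fun setT (fun x => h x - G x) by exact: measurable_funB.
have mk1 : measurable_fun setT k1 by exact: measurable_funM.
have mk2 : measurable_fun setT k2 by apply: measurable_funM => //; exact: measurable_funM.
have bGD x : `|G x * D x| <= C' * (2 * C) by rewrite normrM ler_pM// intensity_error_bound.
have bhG x : `|h x - G x| <= 2 * C'.
  by rewrite (le_trans (ler_normB _ _))// mulr_natl mulr2n lerD.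
have bhGD x : `|(h x - G x) * D x| <= (2 * C') * (2 * C) by rewrite normrM ler_pM// intensity_error_bound.
have bk1 x : `|k1 x| <= C' * (2 * C).
  by rewrite normrM -[leRHS]mul1r ler_pM// bI.
have bk2 x : `|k2 x| <= (2 * C') * (2 * C).
  by rewrite normrM -[leRHS]mul1r ler_pM// bI.
have e2 y : intM N l k y - intM N L k y = \int[U01]_s k1 (s, y) + \int[U01]_s k2 (s, y).
  rewrite e1 -RintD; [|exact: (iU _ mk1 bk1)|exact: (iU _ mk2 bk2)].
  by apply: eq_Rintegral => s _; rewrite /k1 /k2 /k /on_itv/=; ring.
rewrite /estimated_sum /true_sum -sumrB; under eq_bigr => i _ do rewrite e2.
rewrite big_split/= (le_trans (ler_normD _ _))// lerD//.
  rewrite -(@Rint_sum _ _ _ U01); last by move=> i _; exact: (iU _ mk1 bk1).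
  apply: (le_trans (Rint_abs _)).
    by apply: Rintegrable_sum => i _; exact: (iU _ mk1 bk1).
  apply: Rint_le.
  - by apply: Rintegrable_abs; apply: Rintegrable_sum => i _; exact: (iU _ mk1 bk1).
  - by apply: Rintegrable_abs; apply: Rintegrable_sum => i _; exact: (iU _ mGD bGD).
  - by move=> s; rewrite /k1/= -mulr_sumr normrM ler_piMl// bI.
apply: (le_trans (ler_norm_sum _ _ _)); apply: ler_sum => i _.
apply: (le_trans (Rint_abs (iU _ mk2 bk2))).
have mab : measurable_fun setT (fun x => `|h x - G x| * `|D x|).
  by apply: measurable_funM; exact: measurableT_comp.
apply: Rint_le.
- exact: (Rintegrable_abs (iU _ mk2 bk2)).
- by apply: (iU (B := (2 * C') * (2 * C)) _ mab) => x; rewrite -normrM normr_id.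
- by move=> s; rewrite /k2/= !normrM ler_piMl ?mulr_ge0// bI.
Qed.

(** The first part is the square root of [m] times a norm by orthogonality of the observations, the
    second a Cauchy-Schwarz bound. Divided by the square root of [m] they become [C' e] and
    [sqrt m * g * e], which the rate assumptions make small. *)
Lemma drift_error_mean (e g : R) : 0 <= e -> 0 <= g ->
  \int[M]_x (D x ^+ 2) <= e ^+ 2 -> \int[M]_x ((G x - h x) ^+ 2) <= g ^+ 2 ->
  [/\ Rintegrable Q drift_error, forall w, 0 <= drift_error w &
    \int[Q]_w drift_error w <= Num.sqrt m%:R * (C' * e) + m%:R * (g * e)].
Proof.
move=> e0 g0 De Gg.
have mGD : measurable_fun setT (fun x => G x * D x) by exact: measurable_funM.
have bGD x : `|G x * D x| <= C' * (2 * C) by rewrite normrM ler_pM// intensity_error_bound.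
have bD2 x : `|D x ^+ 2| <= (2 * C) ^+ 2.
  by rewrite normrX ler_pXn2r ?nnegrE ?intensity_error_bound// mulr_ge0// ltW.
have mD2 : measurable_fun setT (fun x => D x ^+ 2) by exact: measurable_funX.
have iD2 : Rintegrable M (fun x => D x ^+ 2) := @Rintegrable_bounded _ _ _ M _ _ mD2 bD2.
have mGh : measurable_fun setT (fun x => `|h x - G x|).
  by apply: measurableT_comp => //; exact: measurable_funB.
have mhG : measurable_fun setT (fun x => `|h x - G x| ^+ 2) by exact: measurable_funX.
have bGh x : `| `|h x - G x| | <= 2 * C'.
  by rewrite normr_id (le_trans (ler_normB _ _))// mulr_natl mulr2n lerD.
have bhG x : `| `|h x - G x| ^+ 2| <= (2 * C') ^+ 2.
  by rewrite normrX ler_pXn2r ?nnegrE// mulr_ge0// ltW.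
have ihG : Rintegrable M (fun x => `|h x - G x| ^+ 2) := @Rintegrable_bounded _ _ _ M _ _ mhG bhG.
have mDa : measurable_fun setT (fun x => `|D x|) by exact: measurableT_comp.
have iDa : Rintegrable M (fun x => `|D x| ^+ 2).
  by under [X in Rintegrable _ X]eq_fun do rewrite real_normK ?num_real//.
have [i1 le1] := drift_bound mZ lawZ iZ sigma_inj mGD bGD orth.
have [i2 le2] := Rint_CauchySchwarz mGh mDa ihG iDa.
have mab : measurable_fun setT (fun x => `|h x - G x| * `|D x|) by exact: measurable_funM.
have [i3 e3] := Rfubini2 i2.
have i4 : Rintegrable Q (fun w => \sum_(i < m) (fun y => \int[U01]_s (`|h (s, y) - G (s, y)| * `|D (s, y)|)) (Z (sigma i) w)).
  by apply: Rintegrable_sum => i _; exact: (replication_integrable mZ lawZ (sigma i) i3).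
split; first exact: RintegrableD.
  move=> w; rewrite addr_ge0//; first by apply: Rint_ge0.
  by apply: sumr_ge0 => i _; apply: Rint_ge0 => s; rewrite mulr_ge0.
rewrite [leLHS](RintD i1 i4) lerD//.
  have b0 : 0 <= Num.sqrt m%:R * (C' * e) :> R by rewrite !mulr_ge0// ltW.
  rewrite -[leRHS]ger0_norm// -sqrtr_sqr -[leLHS]ger0_norm ?Rint_ge0//; last by move=> w; exact: Rint_ge0.
  rewrite -sqrtr_sqr ler_sqrt ?sqr_ge0// (le_trans le1)// exprMn sqr_sqrtr// ler_pM2l ?ltr0n//.
  rewrite exprMn; apply: le_trans (_ : C' ^+ 2 * \int[M]_x (D x ^+ 2) <= _); last by rewrite ler_pM2l ?exprn_gt0.
  rewrite -(RintZ _ iD2); apply: Rint_le.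
  - apply: (@Rintegrable_bounded _ _ _ M _ ((C' * (2 * C)) ^+ 2)); first exact: measurable_funX.
    by move=> x; rewrite normrX ler_pXn2r ?nnegrE// !mulr_ge0// ltW.
  - exact: RintegrableZ.
  - move=> x; rewrite exprMn ler_wpM2r ?sqr_ge0// -(real_normK (num_real (G x))).
    by rewrite ler_pXn2r ?nnegrE// ltW.
rewrite Rint_sum; last by move=> i _; exact: (replication_integrable mZ lawZ (sigma i) i3).
under eq_bigr => i _ do rewrite (replication_mean mZ lawZ (sigma i) (RintegrableM i3)) e3.
rewrite sumr_const card_ord -[leLHS]mulr_natl ler_wpM2l//.
rewrite -[leRHS]ger0_norm ?mulr_ge0// -sqrtr_sqr -[leLHS]ger0_norm; last first.
  by apply: Rint_ge0 => x; rewrite mulr_ge0.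
rewrite -sqrtr_sqr ler_sqrt ?sqr_ge0// (le_trans le2)// exprMn ler_pM//.
- by apply: Rint_ge0 => x; exact: sqr_ge0.
- by apply: Rint_ge0 => x; exact: sqr_ge0.
- apply: le_trans Gg; rewrite le_eqVlt; apply/orP; left; apply/eqP.
  by apply: eq_Rintegral => x _; rewrite real_normK ?num_real// -sqrrN opprB.
- apply: le_trans De; rewrite le_eqVlt; apply/orP; left; apply/eqP.
  by apply: eq_Rintegral => x _; rewrite real_normK ?num_real.
Qed.

Definition variance_estimate w := m%:R^-1 * \sum_(i < m) intN N (fun x => h x ^+ 2) (Z (sigma i) w).

(** The estimate is unbiased for [v], since [L] is the intensity. Its second moment is controlled by
    [h ^ 2 <= C' ^ 2] and the second moment of [N 1]. *)
Lemma variance_estimate_error :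
  Rintegrable Q (fun w => (variance_estimate w - v) ^+ 2) /\
  \int[Q]_w ((variance_estimate w - v) ^+ 2) <= m%:R^-1 * (C' ^+ 4 * (2 * C ^+ 2 + C)).
Proof.
have mh2 : measurable_fun setT (fun x => h x ^+ 2) by exact: measurable_funX.
have bh2 x : `|h x ^+ 2| <= C' ^+ 2.
  by rewrite normrX ler_pXn2r ?nnegrE// ltW.
have mI : measurable_fun setT (intN N (fun x => h x ^+ 2)) := measurable_intN fH cN aN mh2.
have [i2 le2] := counting_moment2 fH cN aN C0 bL.
have bI2 y : intN N (fun x => h x ^+ 2) y ^+ 2 <= C' ^+ 4 * (N 1 y)%:R ^+ 2.
  have -> : C' ^+ 4 * (N 1 y)%:R ^+ 2 = (C' ^+ 2 * (N 1 y)%:R) ^+ 2 by rewrite exprMn -exprM.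
  rewrite -(real_normK (num_real (intN _ _ _))) ler_pXn2r ?nnegrE ?mulr_ge0 ?(ltW C'0)//.
  exact: (intN_bound cN y bh2).
have iI2 : Rintegrable P (fun y => intN N (fun x => h x ^+ 2) y ^+ 2).
  apply: (@Rintegrable_le _ _ _ _ _ (fun y => C' ^+ 4 * (N 1 y)%:R ^+ 2)).
  - exact: measurable_funX.
  - move=> z; rewrite ger0_norm ?sqr_ge0//; exact: bI2.
  - exact: RintegrableZ.
have vE : v = \int[P]_y intN N (fun x => h x ^+ 2) y.
  have p2 : pred_fun H (on_itv 0 1 (fun x => h x ^+ 2)).
    by apply: pred_on_itv => //; exact: measurable_funX.
  have i3 : Rintegrable M (on_itv 0 1 (fun x => h x ^+ 2)).
    apply: (@Rintegrable_bounded _ _ _ M _ (C' ^+ 2)); first exact: measurable_on_itv.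
    by move=> x; rewrite /on_itv normrM -[leRHS]mulr1 ler_pM// bI.
  rewrite /cumulated_variance -(mean_intN fH cN aN bL p2 i3).2.
  apply: eq_Rintegral => y _; apply: (eq_intN cN) => s s01.
  by rewrite /on_itv/= indicE mem_set ?mulr1//= in_itv/=.
have [i3 le3] := iid_mean_variance mZ lawZ iZ sigma_inj m0 mI iI2.
rewrite /variance_estimate vE; split => //; apply: (le_trans le3).
rewrite ler_pM2l ?invr_gt0 ?ltr0n//; apply: le_trans (_ : C' ^+ 4 * \int[P]_y ((N 1 y)%:R ^+ 2) <= _).
  by rewrite -(RintZ _ i2); apply: Rint_le => //; exact: RintegrableZ.
by rewrite ler_pM2l ?exprn_gt0.
Qed.

End fixed_estimates.

Section crowding.
Context (R : realType) d (Om : measurableType d) (P : probability Om R).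
Variables (H : R -> set (set Om)) (N : R -> Om -> nat) (C C' : R) (L : R * Om -> R).
Hypothesis fH : filtration H.
Hypothesis cN : forall w, counting_path (N ^~ w).
Hypothesis aN : adapted H N.
Hypothesis C0 : 0 < C.
Hypothesis C'0 : 0 < C'.
Hypothesis bL : bounded_intensity P H N C L.
Variables (G h l : R * Om -> R).
Hypothesis mG : measurable_fun setT G.
Hypothesis ph : pred_fun H h.
Hypothesis ml : measurable_fun setT l.
Hypothesis GC : forall x, `|G x| <= C'.
Hypothesis hC : forall x, `|h x| <= C'.
Hypothesis lC : forall x, `|l x| <= C.
Context dS (Sm : measurableType dS) (Q : probability Sm R) (Z : nat -> Sm -> Om).
Hypothesis mZ : forall j, measurable_fun setT (Z j).
Hypothesis lawZ : forall j (A : set Om), measurable A -> Q (Z j @^-1` A) = P A.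
Hypothesis iZ : mutually_independent Q Z.
Variables (m : nat) (sigma : nat -> nat).
Hypothesis m0 : (0 < m)%N.
Hypothesis sigma_inj : {in [pred i | (i < m)%N] &, injective sigma}.
Variable (K : nat).
Hypothesis K0 : (0 < K)%N.
Local Notation grid := (regular_grid R K).
Local Notation v := (cumulated_variance P L h 0 1).
Local Notation S := (true_sum N L h Z m sigma).
Local Notation Y := (estimated_sum N h l Z m sigma).
Local Notation rho := (drift_error L G h l Z m sigma).

Let gridP := (regular_gridP R K0).1.
Let grid_step := (regular_gridP R K0).2.
Let grid01 k : 0 <= grid k <= 1. Proof. exact: (unit_grid01 k gridP). Qed.
Let gridS k : grid k <= grid k.+1. Proof. by have [_ _ _ h1 _] := gridP. Qed.
Let mh : measurable_fun setT h. Proof. exact: pred_fun_measurable ph. Qed.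

Definition increment (s t : R) (y : Om) : R := (N t y)%:R - (N s y)%:R.
Definition crowding w := \sum_(k < K)
  (\sum_(i < m) increment (grid k) (grid k.+1) (Z (sigma i) w)) *
  (\sum_(i < m) increment (grid k) (grid k.+1) (Z (sigma i) w) - 1).

Let falling_square (a : 'I_m -> R) : (\sum_i a i) * (\sum_i a i - 1) =
  \sum_i a i * (a i - 1) + \sum_i \sum_(j | j != i) a i * a j.
Proof.
rewrite mulrBr mulr1 mulr_suml -[X in _ - X](eq_bigr (fun i => a i) (fun i _ => erefl)) -sumrB -big_split/=.
apply: eq_bigr => i _; rewrite mulr_sumr (bigD1 i)//=; ring.
Qed.

(* [n (n - 1)] is at least 2 as soon as a cell contains [n >= 2] pooled jumps. *)
Lemma crowding_mean : Rintegrable Q crowding /\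
  \int[Q]_w crowding w <= 3 * (m%:R * C) ^+ 2 / K%:R.
Proof.
have m1 : 1 <= m%:R :> R by rewrite ler1n.
have K1 : 0 < K%:R :> R by rewrite ltr0n.
pose a k i w := increment (grid k) (grid k.+1) (Z (sigma i) w).
pose X k w := \sum_(i < m) a k i w * (a k i w - 1) + \sum_(i < m) \sum_(j < m | j != i) a k i w * a k j w.
have key k : (k < K)%N -> Rintegrable Q (X k) /\ \int[Q]_w X k w <= 3 * (m%:R * C) ^+ 2 / K%:R ^+ 2.
  move=> kK; have /andP[g0 _] := grid01 k; have /andP[_ g1] := grid01 k.+1.
  have [i1 le1] := counting_increment_mean fH cN aN bL g0 (gridS k) g1.
  have [i2 le2] := counting_increment_moment2 fH cN aN C0 bL g0 (gridS k) g1.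
  have i3 (i : 'I_m) : Rintegrable Q (fun w => a k i w * (a k i w - 1)).
    exact: (replication_integrable mZ lawZ (sigma i) i2).
  have i4 (i j : 'I_m) : j != i -> Rintegrable Q (fun w => a k i w * a k j w).
    by rewrite eq_sym => ij; have [] := replication_product mZ lawZ iZ sigma_inj ij i1 i1.
  have i5 (i : 'I_m) : Rintegrable Q (fun w => \sum_(j < m | j != i) a k i w * a k j w).
    by apply: Rintegrable_sum => j; exact: i4.
  have i6 : Rintegrable Q (fun w => \sum_(i < m) a k i w * (a k i w - 1)).
    by apply: Rintegrable_sum => i _; exact: i3.
  have i7 : Rintegrable Q (fun w => \sum_(i < m) \sum_(j < m | j != i) a k i w * a k j w).
    by apply: Rintegrable_sum => i _; exact: i5.
  split; first exact: RintegrableD.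
  have D0 : 0 <= grid k.+1 - grid k by rewrite subr_ge0.
  have CD : (C * (grid k.+1 - grid k)) ^+ 2 <= (C / K%:R) ^+ 2.
    rewrite ler_pXn2r ?nnegrE ?mulr_ge0 ?invr_ge0// ?(ltW C0)//.
    by rewrite ler_pM2l//; exact: grid_step.
  have E0 : 0 <= \int[P]_w ((N (grid k.+1) w)%:R - (N (grid k) w)%:R).
    apply: Rint_ge0 => w; rewrite subr_ge0 ler_nat.
    by have [_ mono _ _] := cN w; apply: mono.
  rewrite [leLHS](RintD i6 i7).
  (* The factor 3 comes from 2 for pairs of jumps of the same observation and 1 for pairs of jumps
     of two observations. *)
  apply: le_trans (_ : m%:R * (2 * (C / K%:R) ^+ 2) + m%:R ^+ 2 * (C / K%:R) ^+ 2 <= _); last first.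
    have -> : 3 * (m%:R * C) ^+ 2 / K%:R ^+ 2 = m%:R ^+ 2 * (2 * (C / K%:R) ^+ 2) + m%:R ^+ 2 * (C / K%:R) ^+ 2.
      by rewrite !exprMn exprVn; ring.
    rewrite lerD2r; apply: ler_wpM2r; first by rewrite mulr_ge0// sqr_ge0.
    by rewrite [leRHS]expr2 ler_peMl.
  rewrite lerD//.
    rewrite Rint_sum; last by move=> i _; exact: i3.
    rewrite mulr_natl -[X in _ *+ X]card_ord -sumr_const ler_sum// => i _.
    rewrite (replication_mean mZ lawZ (sigma i) (RintegrableM i2)) (le_trans le2)//.
    by rewrite ler_pM2l.
  rewrite Rint_sum; last by move=> i _; exact: i5.
  rewrite expr2 -mulrA mulr_natl -[X in _ *+ X]card_ord -sumr_const ler_sum// => i _.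
  rewrite Rint_sum; last by move=> j; exact: i4.
  apply: le_trans (_ : \sum_(j < m | j != i) (C / K%:R) ^+ 2 <= _).
    apply: ler_sum => j; rewrite eq_sym => ij.
    have [_ ->] := replication_product mZ lawZ iZ sigma_inj ij i1 i1.
    by rewrite -expr2 (le_trans _ CD)// ler_pXn2r ?nnegrE// mulr_ge0// ltW.
  rewrite big_mkcond/=; apply: le_trans (_ : \sum_(j < m) (C / K%:R) ^+ 2 <= _).
    by apply: ler_sum => j _; case: ifP => // _; rewrite sqr_ge0.
  by rewrite sumr_const card_ord mulr_natl.
have E : crowding = fun w => \sum_(k < K) X k w.
  by apply/funext => w; apply: eq_bigr => k _; rewrite falling_square.
have iX (k : 'I_K) : Rintegrable Q (X k) by have [] := key k (ltn_ord k).
rewrite E; split; first by apply: Rintegrable_sum => k _.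
rewrite Rint_sum//; apply: le_trans (_ : \sum_(k < K) 3 * (m%:R * C) ^+ 2 / K%:R ^+ 2 <= _).
  by apply: ler_sum => k _; have [] := key k (ltn_ord k).
rewrite sumr_const card_ord -[leLHS]mulr_natl le_eqVlt; apply/orP; left; apply/eqP.
by field; rewrite gt_eqF.
Qed.

Let incr_nat (s t : R) w : 0 <= s -> s <= t -> t <= 1 ->
  \sum_(i < m) increment s t (Z (sigma i) w) =
  (\sum_(i < m) (N t (Z (sigma i) w) - N s (Z (sigma i) w)))%N%:R.
Proof.
move=> s0 st t1; rewrite natr_sum; apply: eq_bigr => i _.
by have [_ mono _ _] := cN (Z (sigma i) w); rewrite /increment natrB// mono.
Qed.

Let falling_ge0 (n : nat) : 0 <= n%:R * (n%:R - 1) :> R.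
Proof.
by case: n => [|n]; [rewrite mul0r|rewrite mulr_ge0// -natr1 addrK].
Qed.

Lemma crowding_ge0 w : 0 <= crowding w.
Proof.
apply: sumr_ge0 => k _; have /andP[g0 _] := grid01 k; have /andP[_ g1] := grid01 k.+1.
by rewrite incr_nat.
Qed.

Lemma crowding_lt1 w k : crowding w < 1 -> (k < K)%N ->
  (\sum_(i < m) (N (grid k.+1) (Z (sigma i) w) - N (grid k) (Z (sigma i) w)) <= 1)%N.
Proof.
move=> cw kK; rewrite leqNgt; apply/negP; set n := (\sum_(i < m) _)%N => n2.
suff : n%:R * (n%:R - 1) <= crowding w.
  move=> h1; have := le_lt_trans h1 cw; rewrite ltNge => /negP; apply.
  by rewrite -(@natrB R n 1) ?(ltnW n2)// -natrM ler1n muln_gt0 subn_gt0 n2 ltnW.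
have gP (j : nat) : [/\ 0 <= grid j, grid j <= grid j.+1 & grid j.+1 <= 1].
  by have /andP[-> _] := grid01 j; have /andP[_ ->] := grid01 j.+1.
rewrite /crowding (bigD1 (Ordinal kK))//=; have [a1 a2 a3] := gP k.
rewrite incr_nat// -/n lerDl; apply: sumr_ge0 => j _.
by have [? ? ?] := gP j; rewrite incr_nat.
Qed.

Let intN_increment (s t : R) y : 0 <= s -> s <= t -> t <= 1 ->
  `|intN N (on_itv s t h) y| <= C' * increment s t y.
Proof.
move=> s0 st t1; rewrite /increment -(intN_on_itv cN y s0 st t1) -(intNZ cN).
apply: (le_trans (abs_intN cN _ _)); apply: (le_intN cN) => x.
by rewrite {2}/on_itv mul1r; exact: on_itv_bound.
Qed.

(** Without jumps only the compensators move, at speed at most [C' * C] for each observation. *)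
Let quiet (s t : R) w : 0 <= s -> s <= t -> t <= 1 ->
  (\sum_(i < m) (N t (Z (sigma i) w) - N s (Z (sigma i) w)))%N = 0%N ->
  `|S t w - S s w| <= m%:R * (C' * C * (t - s)).
Proof.
move=> s0 st t1 q0; rewrite /true_sum -sumrB.
apply: (le_trans (ler_norm_sum _ _ _)).
rewrite mulr_natl -[X in _ *+ X]card_ord -sumr_const; apply: ler_sum => i _.
have bh : forall x, `|h x| <= C' by [].
rewrite (intM_on_itvD fH cN bL ph bh _ s0 st) addrC addKr /intM.
have i0 : increment s t (Z (sigma i) w) = 0.
  have [_ mono _ _] := cN (Z (sigma i) w).
  move/eqP: q0; rewrite sum_nat_eq0 => /forallP/(_ i)/=/eqP q0.
  by rewrite /increment -natrB ?mono// q0.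
have : intN N (on_itv s t h) (Z (sigma i) w) = 0.
  by apply/eqP; rewrite -normr_le0 (le_trans (intN_increment _ s0 st t1))// i0 mulr0.
move=> ->; rewrite sub0r normrN.
exact: (intL_on_itv_bound fH bL ph bh _ s0 st t1).
Qed.

Let S0 w : S 0 w = 0.
Proof.
rewrite /true_sum big1// => i _.
have bh : forall x, `|h x| <= C' by [].
have := intM_on_itvD fH cN bL ph bh (Z (sigma i) w) (lexx 0) (lexx 0).
by move/eqP; rewrite -subr_eq0 opprD addrA subrr sub0r oppr_eq0 => /eqP.
Qed.

(** With at most one pooled jump in the cell of [t], there is none between [t] and one of the two
    ends of the cell; that end is the grid point sought. *)
Lemma oscillation t w : crowding w < 1 -> 0 <= t <= 1 ->
  exists2 k : nat, (k <= K)%N & `|S t w - S (grid k) w| <= m%:R * (C' * C / K%:R).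
Proof.
move=> cw /andP[t0 t1].
have CC : 0 <= C' * C by rewrite mulr_ge0// ltW.
have bnd (s u : R) : u - s <= K%:R^-1 -> m%:R * (C' * C * (u - s)) <= m%:R * (C' * C / K%:R).
  by move=> h1; rewrite ler_wpM2l// ler_wpM2l.
have [_ g0 gK _ _] := gridP.
move: t0; rewrite le_eqVlt => /orP[/eqP <-|t0].
  by exists 0%N => //; rewrite g0 subrr normr0 mulr_ge0// mulr_ge0.
have ex : exists k, (t <= grid k.+1) && (k < K)%N by exists K.-1; rewrite prednK// gK t1 leqnn.
case: (ex_minnP ex) => k /andP[tk kK] kmin.
have kt : grid k <= t.
  case: k tk kK kmin => [|k] tk kK kmin; first by rewrite g0 ltW.
  rewrite leNgt; apply/negP => ht; have := kmin k; rewrite (ltW ht) (ltnW kK) ltnn.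
  by move=> /(_ isT).
have /andP[gk0 _] := grid01 k; have /andP[_ gk1] := grid01 k.+1.
have := crowding_lt1 cw kK.
have -> : (\sum_(i < m) (N (grid k.+1) (Z (sigma i) w) - N (grid k) (Z (sigma i) w)) =
  \sum_(i < m) (N t (Z (sigma i) w) - N (grid k) (Z (sigma i) w)) +
  \sum_(i < m) (N (grid k.+1) (Z (sigma i) w) - N t (Z (sigma i) w)))%N.
  rewrite -big_split/=; apply: eq_bigr => i _.
  have [_ mono _ _] := cN (Z (sigma i) w).
  have := mono _ _ gk0 kt t1; have := mono _ _ (ltW t0) tk gk1.
  by move=> *; rewrite addnC addnBA// subnK.
case: (posnP (\sum_(i < m) (N t (Z (sigma i) w) - N (grid k) (Z (sigma i) w)))) => [q0|q1] le1.
  exists k; first exact: ltnW.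
  apply: (le_trans (quiet gk0 kt t1 q0)); apply: bnd.
  by apply: le_trans (grid_step k); rewrite lerD2r.
exists k.+1 => //; rewrite distrC.
apply: (le_trans (quiet (ltW t0) tk gk1 _)).
  by apply/eqP; rewrite -leqn0 -(leq_add2l 1) addn0 (leq_trans _ le1)// leq_add2r.
apply: bnd; apply: le_trans (grid_step k); by rewrite lerD2l lerN2.
Qed.

Hypothesis v0 : 0 < v.

(** Both directions lose [rho w] for the replacement of [l] by [L]; passing from a grid value to an
    arbitrary time also costs the oscillation in a cell. The square root undoes the normalization of
    [normalized_sum]. *)
Lemma sup_estimated_sum w : crowding w < 1 ->
  (forall t : R, 0 <= t <= 1 -> `|Y t w - S t w| <= rho w) ->
  `|sup_abs (Y ^~ w) - Num.sqrt (m%:R * v) *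
     \big[Num.max/0]_(k < K) `|normalized_sum P N L h Z m sigma w k| | <=
  m%:R * (C' * C / K%:R) + rho w.
Proof.
move=> cw yr; set gm := \big[Num.max/0]_(k < K) _.
have CC : 0 <= m%:R * (C' * C / K%:R) by rewrite mulr_ge0// mulr_ge0 ?invr_ge0// mulr_ge0// ltW.
have one01 : 0 <= (1 : R) <= 1 by rewrite ler01 lexx.
have r0 : 0 <= rho w by exact: le_trans (yr 1 one01).
have mv : 0 < Num.sqrt (m%:R * v) by rewrite sqrtr_gt0 mulr_gt0// ltr0n.
have nS (k : 'I_K) : normalized_sum P N L h Z m sigma w k = S (grid k.+1) w / Num.sqrt (m%:R * v).
  by rewrite /normalized_sum /normalized_increment -mulr_suml.
have gm_ge (k : 'I_K) : `|S (grid k.+1) w| <= Num.sqrt (m%:R * v) * gm.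
  rewrite -ler_pdivrMl// mulrC -[X in _ * X]ger0_norm ?invr_ge0 ?(ltW mv)// -normrM -nS.
  exact: (le_bigmax _ (fun k : 'I_K => `|normalized_sum P N L h Z m sigma w k|)).
have gm0 : 0 <= gm by exact: bigmax_ge_id.
have bh : forall x, `|h x| <= C' by [].
have Ybound : exists M, forall t : R, 0 <= t <= 1 -> `|Y t w| <= M.
  exists (\sum_(i < m) (C' * ((N 1 (Z (sigma i) w))%:R + C)) + rho w) => t t01.
  rewrite -[Y t w](subrK (S t w)) addrC (le_trans (ler_normD _ _))// lerD ?yr//.
  apply: (le_trans (ler_norm_sum _ _ _)); apply: ler_sum => i _.
  apply: (intM_bound fH cN bL); first exact: measurable_on_itv.
  by move=> x; exact: on_itv_boundK.
rewrite ler_distl; apply/andP; split; last first.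
  apply: sup_abs_le => t t01; have [k kK osc] := oscillation cw t01.
  have Sk : `|S (grid k) w| <= Num.sqrt (m%:R * v) * gm.
    case: k kK osc => [|k] kK _; last exact: (gm_ge (Ordinal kK)).
    by have [_ -> _ _ _] := gridP; rewrite S0 normr0 mulr_ge0// ltW.
  have tri (a b c : R) : a = b + (c - b) + (a - c) by ring.
  rewrite (tri (Y t w) (S (grid k) w) (S t w)) [leRHS]addrA (le_trans (ler_normD _ _))// lerD ?yr//.
  by rewrite (le_trans (ler_normD _ _))// lerD.
rewrite lerBlDr; apply: le_trans (_ : sup_abs (Y ^~ w) + rho w <= _); last by rewrite lerD2l lerDr.
rewrite -ler_pdivlMl//; apply: bigmax_le.
  by rewrite mulr_ge0 ?invr_ge0 ?(ltW mv)// addr_ge0// sup_abs_ge0.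
move=> k _; rewrite nS normrM mulrC ger0_norm ?invr_ge0 ?(ltW mv)// ler_pM2l ?invr_gt0//.
have g01 := grid01 k.+1; have [M bM] := Ybound.
rewrite -[S (grid k.+1) w](subrK (Y (grid k.+1) w)) addrC (le_trans (ler_normD _ _))//.
by rewrite lerD ?(le_sup_abs bM)// distrC yr.
Qed.

End crowding.

(** A Lipschitz substitute for the indicator of large values. The tail of the grid maximum is
    controlled by applying the limit theorem itself to this test function. *)
Definition ramp (R : realType) (a x : R) : R := Num.min 1 (Num.max 0 (x - a)).

Section ramp.
Context (R : realType) (a : R).

Lemma ramp_ge0 x : 0 <= ramp a x.
Proof. by rewrite /ramp le_min ler01 le_max lexx. Qed.

Lemma ramp_ge1 x : a + 1 <= x -> ramp a x = 1.
Proof. by move=> ax; rewrite /ramp min_l// le_max lerBrDl ax orbT. Qed.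

Lemma ramp_le_indic x : ramp a x <= \1_(`]a, +oo[%classic) x.
Proof.
rewrite indicE; case: (ltP a x) => ax.
  by rewrite mem_set ?ge_min ?lexx//= in_itv/= ax.
rewrite memNset; last by rewrite /= in_itv/= andbT; apply/negP; rewrite -leNgt.
by rewrite /ramp ge_min; apply/orP; right; rewrite ge_max lexx subr_le0.
Qed.

Lemma ramp_bounded_lipschitz : @bounded_lipschitz1 R (ramp a).
Proof.
split=> [x|x y]; first by rewrite ger0_norm ?ramp_ge0// ge_min lexx.
have := ler_norm (x - y); have := ler_norm (y - x); rewrite (distrC y x).
move: `|x - y| => n h1 h2; rewrite ler_norml /ramp.
case: (leP 0 (x - a)) => ?; case: (leP 0 (y - a)) => ?.
- by case: (leP 1 (x - a)) => ?; case: (leP 1 (y - a)) => ?; apply/andP; split; lra.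
- by rewrite (@min_r _ _ 1 0) ?ler01//; case: (leP 1 (x - a)) => ?; apply/andP; split; lra.
- by rewrite (@min_r _ _ 1 0) ?ler01//; case: (leP 1 (y - a)) => ?; apply/andP; split; lra.
- by rewrite (@min_r _ _ 1 0) ?ler01//; apply/andP; split; lra.
Qed.
End ramp.

Lemma small_over_nat (R : realType) (x y : R) : 0 <= x -> 0 < y ->
  exists m0 : nat, forall m, (m0 <= m)%N -> x / m%:R <= y.
Proof.
move=> x0 y0; exists (Num.truncn (x / y)).+1 => m mm.
have m0 : 0 < m%:R :> R by rewrite ltr0n (leq_trans _ mm).
rewrite ler_pdivrMr// mulrC -ler_pdivrMr//; apply: ltW.
apply: lt_le_trans (_ : (Num.truncn (x / y)).+1%:R <= _); last by rewrite ler_nat.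
by rewrite real_truncnS_gt// num_real.
Qed.

(** Here [s] and [u] are the true and the estimated standard deviation. Their difference is that of
    the squares divided by [s + u >= s0], and [y / u - g] equals [(y - s g + g (s - u)) / u]. *)
Lemma ratio_perturbation (R : realType) (s0 s u y g a b delta : R) :
  0 < s0 -> s0 <= s -> s0 / 2 <= u -> 0 <= g -> g <= b ->
  `|y - s * g| <= a -> `|s ^+ 2 - u ^+ 2| <= delta ->
  `|y / u - g| <= 2 / s0 * (a + b * (delta / s0)).
Proof.
move=> s00 ss uu g0 gb ya sd.
have u0 : 0 < u by rewrite (lt_le_trans _ uu)// divr_gt0.
have a0 : 0 <= a by exact: le_trans ya.
have d0 : 0 <= delta by exact: le_trans sd.
have su : `|s - u| <= delta / s0.
  rewrite ler_pdivlMr//; apply: le_trans sd.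
  rewrite subr_sqr normrM ler_wpM2l// ger0_norm; last by rewrite addr_ge0// ltW// (lt_le_trans s00).
  by rewrite (le_trans ss)// lerDl ltW.
have -> : y / u - g = u^-1 * (y - s * g + g * (s - u)).
  by field; rewrite gt_eqF.
rewrite normrM ger0_norm ?invr_ge0 ?(ltW u0)//; apply: ler_pM => //.
- by rewrite invr_ge0 ltW.
- by rewrite -[leRHS]invf_div lef_pV2 ?posrE// divr_gt0.
- rewrite (le_trans (ler_normD _ _))// lerD// normrM (ger0_norm g0).
  by apply: ler_pM.
Qed.

Definition statistic (R : realType) (m : nat) (Y V : R) : R :=
  if V == 0 then 0 else Num.sqrt m%:R / Num.sqrt V * (m%:R^-1 * Y).

Section bookkeeping.
Context (R : realType).
Implicit Types (x y z t u e v : R).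

Lemma le_sum4 x y z t : 0 <= x -> 0 <= y -> 0 <= z -> 0 <= t ->
  [/\ x <= x + y + z + t, y <= x + y + z + t, z <= x + y + z + t & t <= x + y + z + t].
Proof. by move=> *; split; lra. Qed.

(** Settles the bad events: two values of a test function differ by at most 2, and on such an event
    one of the normalized errors is at least 1. *)
Lemma dominated_two e u x : 0 <= e -> u <= 2 -> 1 <= x -> u <= e + 2 * x.
Proof. by move=> *; lra. Qed.

Lemma half_lower_bound x v0 v e : `|x - v| < e -> e <= v0 / 2 -> v0 <= v -> v0 / 2 <= x.
Proof. by rewrite ltr_norml => /andP[h1 _] h2 h3; lra. Qed.

Lemma total_error e x y z t u : 0 < e -> 2 * (2 * x) <= e / 16 -> 2 * y <= e / 16 ->
  2 * z <= e / 16 -> t <= e / 16 -> u <= e / 32 ->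
  e / 8 + 2 * (2 * x + y + z + t) + u <= e.
Proof. by move=> *; lra. Qed.

Lemma ramp_tail e x y : `|x - y| <= e / 32 -> y <= e / 32 -> x <= e / 16.
Proof. by rewrite ler_norml => /andP[_ h1] h2; lra. Qed.
End bookkeeping.

(** The tolerance [kappa] and the sample size [m0] come before the spaces, the laws and the
    estimates: this order of quantifiers carries the uniformity in [th]. *)
Definition limit_property (R : realType) (dB : measure_display) (OB : measurableType dB)
    (PB : probability OB R) (B : R -> OB -> R) (C C' v0 e kappa : R) (m0 : nat) : Prop :=
  forall d (Om : measurableType d) (P : probability Om R)
    (H : R -> set (set Om)) (N : R -> Om -> nat) (L G h l : R * Om -> R)
    dS (Sm : measurableType dS) (Q : probability Sm R) (Z : nat -> Sm -> Om)
    (m : nat) (sigma : nat -> nat) (f : R -> R) (T : Sm -> R) (a b : R),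
  filtration H -> (forall w, counting_path (N ^~ w)) -> adapted H N ->
  bounded_intensity P H N C L -> measurable_fun setT G -> pred_fun H h ->
  measurable_fun setT l ->
  (forall x, `|G x| <= C') -> (forall x, `|h x| <= C') -> (forall x, `|l x| <= C) ->
  (forall s : R, 0 < s <= 1 -> \int[P]_w (G (s, w) * (L (s, w) - l (s, w))) = 0) ->
  v0 <= cumulated_variance P L h 0 1 ->
  (forall j, measurable_fun setT (Z j)) ->
  (forall j (A : set Om), measurable A -> Q (Z j @^-1` A) = P A) ->
  mutually_independent Q Z -> (m0 <= m)%N ->
  {in [pred i | (i < m)%N] &, injective sigma} ->
  0 <= a -> 0 <= b ->
  \int[(@U01 R \x P)%E]_x (intensity_error L l x ^+ 2) <= b ^+ 2 ->
  \int[(@U01 R \x P)%E]_x ((G x - h x) ^+ 2) <= a ^+ 2 ->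
  b <= kappa -> Num.sqrt m%:R * a * b <= kappa ->
  measurable_fun setT T ->
  (forall w, T w = statistic m (sup_abs (fun t => estimated_sum N h l Z m sigma t w))
    (variance_estimate N h Z m sigma w)) ->
  bounded_lipschitz1 f ->
  `|\int[Q]_w f (T w) - \int[PB]_w f (sup_abs (B ^~ w))| <= e.

Lemma fixed_estimator_limit (R : realType) (dB : measure_display) (OB : measurableType dB)
  (PB : probability OB R) (B : R -> OB -> R) : brownian_motion PB B ->
  forall C C' v0 e : R, 0 < C -> 0 < C' -> 0 < v0 -> 0 < e ->
  exists2 kappa : R, 0 < kappa & exists m0 : nat, limit_property PB B C C' v0 e kappa m0.
Proof.
move=> bm C C' v0 e C0 C'0 v00 e0.
pose s0 := Num.sqrt v0; have s00 : 0 < s0 by rewrite sqrtr_gt0.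
have s0E : s0 ^+ 2 = v0 by rewrite sqr_sqrtr// ltW.
have e32 : 0 < e / 32 by rewrite divr_gt0.
have [A A1 tailA] := bm_sup_tight bm ltr01 e32.
pose al : R := A.-2%:R; pose b1 := al + 1.
have b10 : 0 < b1 by rewrite ltr_wpDl.
(* [eta] is the tolerance on the drift and on the oscillation, after division by the square root of
   [m]. [delta] is the tolerance on the variance: its first bound keeps the estimate above [v0 / 2],
   its second makes [b1 * (delta / s0) <= eta]. [kappa] is such that the mean of the drift error
   contributes [e / 16]. *)
pose eta := e * s0 / 64; have eta0 : 0 < eta by rewrite divr_gt0// mulr_gt0.
pose delta := Num.min (v0 / 2) (e * v0 / (64 * b1)).
have delta0 : 0 < delta by rewrite lt_min !divr_gt0// mulr_gt0.
pose kappa := e * eta / (32 * (C' + 1)).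
have C'1 : 0 < C' + 1 by rewrite addr_gt0.
exists kappa; first by rewrite divr_gt0 ?mulr_gt0.
have [m1 clt] := functional_clt bm C0 C'0 v00 e32.
pose c4 := C' ^+ 4 * (2 * C ^+ 2 + C).
have c40 : 0 <= c4 by rewrite mulr_ge0 ?exprn_ge0 ?(ltW C'0)// addr_ge0 ?mulr_ge0 ?sqr_ge0// ltW.
have [m2 hm2] := small_over_nat (mulr_ge0 (ltW C'0) (ltW C0)) eta0.
have [m3 hm3] := @small_over_nat R (12 * C ^+ 2) (e / 16) (mulr_ge0 (ler0n _ _) (sqr_ge0 C)) (divr_gt0 e0 (ltr0n _ _ : 0 < 16)).
have [m4 hm4] := @small_over_nat R (2 * (c4 / delta ^+ 2)) (e / 16) (mulr_ge0 (ler0n _ _) (divr_ge0 c40 (sqr_ge0 _))) (divr_gt0 e0 (ltr0n _ _ : 0 < 16)).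
exists (maxn 1 (maxn (maxn m1 m2) (maxn m3 m4))) => d Om P H N L G h l dS Sm Q Z m sigma f T a b.
move=> fH cN aN bL mG ph ml GC hC lC orth vv mZ lawZ iZ mm inj a0 b0 Db Ga bk abk mT TE [fB fL].
move: mm; rewrite !geq_max => /andP[m0 /andP[/andP[mm1 mm2] /andP[mm3 mm4]]].
have mR : 0 < m%:R :> R by rewrite ltr0n.
have m1' : 1 <= m%:R :> R by rewrite ler1n.
have K0 : (0 < m ^ 3)%N by rewrite expn_gt0 m0.
set v := cumulated_variance P L h 0 1 in vv.
have vgt0 : 0 < v by exact: lt_le_trans vv.
pose gm w := \big[Num.max/0]_(k < m ^ 3) `|normalized_sum P N L h Z m sigma w k|.
have mgm : measurable_fun setT gm.
  apply: measurable_bigmax => k; apply: measurableT_comp => //.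
  exact: (measurable_normalized_sum fH cN aN bL ph mZ m sigma k).
have gm0 w : 0 <= gm w by exact: bigmax_ge_id.
pose rho := drift_error L G h l Z m sigma.
have [ir r0 le_r] := drift_error_mean fH C0 C'0 bL mG ph ml GC hC lC orth mZ lawZ iZ m0 inj b0 a0 Db Ga.
have [ic le_c] := crowding_mean fH cN aN C0 bL mZ lawZ iZ m0 inj K0.
have [iv le_v] := variance_estimate_error fH cN aN C0 C'0 bL ph hC mZ lawZ iZ m0 inj.
have c0 := crowding_ge0 cN Z m sigma K0.
pose cr := crowding N Z m sigma (m ^ 3); pose ve := variance_estimate N h Z m sigma.
have fm := lipschitz1_measurable fL.
have [rB rL] := ramp_bounded_lipschitz al; have rm := lipschitz1_measurable rL.
(* Each term in the inner sum is at least 1 on one bad event: a crowded cell, a large drift error, a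
   bad variance estimate, a grid maximum above [b1]. Elsewhere the ratio differs from the grid
   maximum by at most [e / 8]. *)
pose dom w := e / 8 + 2 * (2 * cr w + (eta * Num.sqrt m%:R)^-1 * rho w + (delta ^+ 2)^-1 * (ve w - v) ^+ 2 + ramp al (gm w)).
have point w : `|f (T w) - f (gm w)| <= dom w.
  have two : `|f (T w) - f (gm w)| <= 2.
    by rewrite (le_trans (ler_normB _ _))// -[leRHS]/(1 + 1) lerD.
  have t1 : 0 <= cr w by exact: c0.
  have t2 : 0 <= (eta * Num.sqrt m%:R)^-1 * rho w.
    by rewrite mulr_ge0 ?r0// invr_ge0 mulr_ge0 ?sqrtr_ge0// ltW.
  have t3 : 0 <= (delta ^+ 2)^-1 * (ve w - v) ^+ 2 by rewrite mulr_ge0 ?sqr_ge0// invr_ge0 sqr_ge0.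
  have t4 := ramp_ge0 al (gm w).
  rewrite /dom.
  have t1' : 0 <= 2 * cr w by rewrite mulr_ge0.
  have [u1 u2 u3 u4] := le_sum4 t1' t2 t3 t4.
  have e8 : 0 <= e / 8 by rewrite divr_ge0// ltW.
  have [cw|cw] := leP (1 / 2) (cr w).
    apply: dominated_two => //; apply: le_trans u1.
    by rewrite -ler_pdivrMl// mulrC.
  have [rw|rw] := leP (eta * Num.sqrt m%:R) (rho w).
    apply: dominated_two => //; apply: le_trans u2.
    by rewrite ler_pdivlMl ?mulr1// mulr_gt0 ?sqrtr_gt0.
  have [vw|vw] := leP delta `|ve w - v|.
    apply: dominated_two => //; apply: le_trans u3.
    rewrite ler_pdivlMl ?exprn_gt0// mulr1 -(real_normK (num_real (_ - v))).
    by rewrite ler_pXn2r ?nnegrE// ltW.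
  have [gw|gw] := leP b1 (gm w).
    by apply: dominated_two => //; apply: le_trans u4; rewrite (ramp_ge1 gw).
  apply: le_trans (_ : e / 8 <= _); last by rewrite lerDl mulr_ge0// (le_trans t1').
  apply: (le_trans (fL _ _)).
  have cw1 : cr w < 1 by rewrite (lt_trans cw)// ltr_pdivrMr// mul1r ltr1n.
  have dle t : 0 <= t <= 1 -> `|estimated_sum N h l Z m sigma t w - true_sum N L h Z m sigma t w| <= rho w.
    by move=> t01; apply: (drift_error_le fH bL mG ph ml GC hC lC).
  have := sup_estimated_sum fH cN C0 C'0 bL ph hC m0 K0 vgt0 cw1 dle.
  rewrite -/(gm w); set Y := sup_abs _ => Yg.
  have vev : v0 / 2 <= ve w.
    by apply: (half_lower_bound vw _ vv); rewrite ge_min lexx.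
  have ve0 : 0 < ve w by rewrite (lt_le_trans _ vev)// divr_gt0.
  have sm0 : 0 < Num.sqrt m%:R :> R by rewrite sqrtr_gt0.
  have smE : Num.sqrt m%:R ^+ 2 = m%:R :> R by rewrite sqr_sqrtr// ltW.
  have TE' : T w = (Y / Num.sqrt m%:R) / Num.sqrt (ve w).
    rewrite TE /statistic gt_eqF// -/(ve w) -/Y -[in m%:R^-1]smE.
    by field; rewrite !gt_eqF// sqrtr_gt0.
  have sqrt_le (x y : R) : 0 <= x -> x ^+ 2 <= y -> x <= Num.sqrt y.
    move=> x0 xy; rewrite -[x]ger0_norm// -sqrtr_sqr ler_sqrt//.
    by rewrite (le_trans _ xy)// sqr_ge0.
  rewrite TE'.
  apply: le_trans (@ratio_perturbation R s0 (Num.sqrt v) (Num.sqrt (ve w)) _ (gm w) (2 * eta) b1 delta s00 _ _ (gm0 w) (ltW gw) _ _) _.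
  - by rewrite ler_sqrt// ltW.
  - apply: sqrt_le; first by rewrite divr_ge0// ltW.
    by rewrite expr_div_n s0E (le_trans _ vev)// ler_pM2l// lef_pV2 ?posrE// -natrX ler_nat.
  - have -> : Y / Num.sqrt m%:R - Num.sqrt v * gm w = (Y - Num.sqrt (m%:R * v) * gm w) / Num.sqrt m%:R.
      by rewrite sqrtrM ?ler0n//; field; rewrite gt_eqF.
    rewrite normrM [X in _ * X]ger0_norm ?invr_ge0 ?sqrtr_ge0// ler_pdivrMr//.
    apply: (le_trans Yg); rewrite (_ : 2 * eta * Num.sqrt m%:R = eta * Num.sqrt m%:R + eta * Num.sqrt m%:R); last by ring.
    rewrite lerD ?(ltW rw)//.
    have sm1 : 1 <= Num.sqrt m%:R :> R by rewrite -[leLHS]sqrtr1 ler_sqrt.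
    apply: le_trans (_ : eta <= _); last by rewrite ler_peMr// ltW.
    apply: le_trans (hm2 m mm2); rewrite natrX (_ : m%:R * (C' * C / m%:R ^+ 3) = C' * C / m%:R / m%:R); last by field; rewrite gt_eqF.
    by rewrite ler_pdivrMr// ler_peMr// divr_ge0// mulr_ge0// ltW.
  - by rewrite !sqr_sqrtr ?(ltW vgt0) ?(ltW ve0)// distrC ltW.
  have : b1 * (delta / s0) <= eta.
    have d2 : delta <= e * v0 / (64 * b1) by rewrite ge_min lexx orbT.
    rewrite mulrA ler_pdivrMr// (le_trans (_ : _ <= b1 * (e * v0 / (64 * b1))))// ?ler_pM2l//.
    rewrite le_eqVlt; apply/orP; left; apply/eqP; rewrite -s0E /eta; field; rewrite gt_eqF//.
  rewrite -(ler_pM2l (_ : 0 < 2 / s0)) ?divr_gt0//; set X := b1 * _ => hX.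
  have : 2 / s0 * eta = e / 32 by rewrite /eta; field; rewrite gt_eqF.
  move=> h1; have e1 : 2 / s0 * (2 * eta) = 2 * (e / 32) by rewrite mulrCA h1.
  rewrite mulrDr e1; apply: le_trans (lerD (lexx _) hX) _.
  rewrite h1 (_ : e / 8 = 2 * (e / 32) + 2 * (e / 32)); last by field.
  by rewrite lerD2l mulr_natl mulr2n lerDr ltW.
have iram : Rintegrable Q (fun w => ramp al (gm w)).
  by apply: (@Rintegrable_bounded _ _ _ Q _ 1); [exact: measurableT_comp|move=> w; exact: rB].
have i1 : Rintegrable Q (fun w => 2 * cr w) by exact: RintegrableZ.
have i2 : Rintegrable Q (fun w => (eta * Num.sqrt m%:R)^-1 * rho w) by exact: RintegrableZ.
have i3 : Rintegrable Q (fun w => (delta ^+ 2)^-1 * (ve w - v) ^+ 2) by exact: RintegrableZ.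
have i12 := RintegrableD i1 i2; have i123 := RintegrableD i12 i3.
have i1234 := RintegrableD i123 iram; have idom2 := RintegrableZ 2 i1234.
have idom : Rintegrable Q dom by exact: (RintegrableD (Rintegrable_cst Q (e / 8)) idom2).
have ifT : Rintegrable Q (fun w => f (T w)).
  by apply: (@Rintegrable_bounded _ _ _ Q _ 1) => //; exact: measurableT_comp.
have ifg : Rintegrable Q (fun w => f (gm w)).
  by apply: (@Rintegrable_bounded _ _ _ Q _ 1) => //; exact: measurableT_comp.
have cl1 := clt d Om P H N L h dS Sm Q Z m sigma f fH cN aN bL ph hC vv mZ lawZ iZ mm1 inj (conj fB fL).
have cl2 := clt d Om P H N L h dS Sm Q Z m sigma _ fH cN aN bL ph hC vv mZ lawZ iZ mm1 inj (ramp_bounded_lipschitz al).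
have msup := bm_sup_measurable bm.
have tl : \int[PB]_w ramp al (sup_abs (B ^~ w)) <= e / 32.
  apply: le_trans tailA; apply: Rint_le.
  - by apply: (@Rintegrable_bounded _ _ _ PB _ 1) => //; exact: measurableT_comp.
  - apply: (@Rintegrable_bounded _ _ _ PB _ 1).
      by apply: measurableT_comp => //; exact: measurable_indic.
    by move=> w; rewrite indicE; case: (_ \in _); rewrite ?normr1 ?normr0.
  - by move=> w; rewrite mulr1; exact: ramp_le_indic.
have lram : \int[Q]_w ramp al (gm w) <= e / 16.
  exact: ramp_tail cl2 tl.
have main : `|\int[Q]_w f (T w) - \int[Q]_w f (gm w)| <= \int[Q]_w dom w.
  rewrite -(RintB ifT ifg); apply: (le_trans (Rint_abs (RintegrableB ifT ifg))).
  by apply: Rint_le => //; exact: Rintegrable_abs (RintegrableB ifT ifg).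
have E : \int[Q]_w dom w = e / 8 + 2 * (2 * \int[Q]_w cr w + (eta * Num.sqrt m%:R)^-1 * \int[Q]_w rho w +
    (delta ^+ 2)^-1 * \int[Q]_w ((ve w - v) ^+ 2) + \int[Q]_w ramp al (gm w)).
  rewrite [LHS](RintD (Rintegrable_cst Q (e / 8)) idom2) Rint_cst (RintZ 2 i1234).
  by rewrite (RintD i123 iram) (RintD i12 i3) (RintD i1 i2) (RintZ _ ic) (RintZ _ ir) (RintZ _ iv).
have q1 : 2 * (2 * \int[Q]_w cr w) <= e / 16.
  apply: le_trans (hm3 m mm3); apply: le_trans (_ : 4 * (3 * (m%:R * C) ^+ 2 / (m ^ 3)%:R) <= _).
    by rewrite mulrA -natrM ler_pM2l.
  by rewrite natrX le_eqVlt; apply/orP; left; apply/eqP; field; rewrite gt_eqF.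
have q2 : 2 * ((eta * Num.sqrt m%:R)^-1 * \int[Q]_w rho w) <= e / 16.
  have sm0 : 0 < Num.sqrt m%:R :> R by rewrite sqrtr_gt0.
  have smE : Num.sqrt m%:R * Num.sqrt m%:R = m%:R :> R by rewrite -expr2 sqr_sqrtr// ltW.
  have h1 : \int[Q]_w rho w <= Num.sqrt m%:R * (kappa * (C' + 1)).
    apply: (le_trans le_r); rewrite -[X in X * (a * b)]smE -mulrA -mulrDr ler_pM2l//.
    rewrite mulrA mulrDr mulr1 lerD// mulrC ler_pM2r//.
  apply: le_trans (_ : 2 * ((eta * Num.sqrt m%:R)^-1 * (Num.sqrt m%:R * (kappa * (C' + 1)))) <= _).
    by rewrite ler_pM2l// ler_pM2l// invr_gt0 mulr_gt0.
  rewrite le_eqVlt; apply/orP; left; apply/eqP; rewrite /kappa; field.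
  by rewrite !gt_eqF.
have q3 : 2 * ((delta ^+ 2)^-1 * \int[Q]_w ((ve w - v) ^+ 2)) <= e / 16.
  apply: le_trans (hm4 m mm4).
  apply: le_trans (_ : 2 * ((delta ^+ 2)^-1 * (m%:R^-1 * c4)) <= _).
    by rewrite ler_pM2l// ler_pM2l// invr_gt0 exprn_gt0.
  rewrite le_eqVlt; apply/orP; left; apply/eqP; field.
  by rewrite !gt_eqF.
rewrite (_ : _ - _ = (\int[Q]_w f (T w) - \int[Q]_w f (gm w)) + (\int[Q]_w f (gm w) - \int[PB]_w f (sup_abs (B ^~ w)))); last by rewrite addrA subrK.
apply: (le_trans (ler_normD _ _)).
apply: le_trans (lerD main (lexx _)) _; rewrite E.
exact: total_error.
Qed.

(** * Sample splitting *)

(** [sigma] enumerates the replications of the evaluation sample; the successor is there because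
    replication 0 is the additional copy. *)
Lemma sum_split_enum (R : realType) (n : nat) (J : {set 'I_n}) (F : nat -> R) :
  let sigma i := (nth 0%N [seq val j | j <- enum J] i).+1 in
  \sum_(j in J) F j.+1 = \sum_(i < #|J|) F (sigma i).
Proof.
move=> sigma; rewrite -big_enum/= -(big_map val xpredT (fun k => F k.+1)) (big_nth 0%N).
by rewrite size_map -cardE big_mkord.
Qed.

Lemma enum_inj (n : nat) (J : {set 'I_n}) :
  {in [pred i | (i < #|J|)%N] &, injective (fun i => (nth 0%N [seq val j | j <- enum J] i).+1)}.
Proof.
move=> i j; rewrite !inE cardE -(size_map val) => iJ jJ [] /eqP.
rewrite nth_uniq//; first by move/eqP.
by rewrite (map_inj_uniq val_inj) enum_uniq.
Qed.

Section compensated_paths.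
Context (R : realType) d (Om : measurableType d) (N : R -> Om -> nat).
Hypothesis cN : forall w, counting_path (N ^~ w).
Variables (h l : R * Om -> R) (C C' : R).
Hypothesis mh : measurable_fun setT h.
Hypothesis ml : measurable_fun setT l.
Hypothesis hC : forall x, `|h x| <= C'.
Hypothesis lC : forall x, `|l x| <= C.
Let C0 : 0 <= C. Proof. exact: le_trans (lC (0, point)). Qed.
Let C'0 : 0 <= C'. Proof. exact: le_trans (hC (0, point)). Qed.

Let bI (a b : R) (u : R) : (`|\1_(`]a, b]%classic) u : R| <= 1).
Proof. by rewrite indicE; case: (_ \in _); rewrite ?normr1 ?normr0. Qed.

Let isec (s t : R) y : Rintegrable U01 (fun u => on_itv s t h (u, y) * l (u, y)).
Proof.
apply: (@Rintegrable_bounded _ _ _ U01 _ (C' * C)).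
  have m1 : measurable_fun setT (fun x => on_itv s t h x * l x).
    by apply: measurable_funM => //; exact: measurable_on_itv.
  by apply: (measurableT_comp m1); exact: pair2_measurable.
move=> u; rewrite normrM ler_pM// /on_itv normrM -[leRHS]mulr1 ler_pM//.
Qed.

Lemma intN_hold (s t : R) y : 0 <= s -> s <= t -> t <= 1 -> N s y = N t y ->
  intN N (on_itv s t h) y = 0.
Proof.
move=> s0 st t1 e; apply/eqP; rewrite -normr_le0; apply: (le_trans (abs_intN cN _ _)).
apply: (@le_trans _ _ (intN N (fun x => C' * on_itv s t (fun=> 1) x) y)).
  by apply: (le_intN cN) => x; rewrite {2}/on_itv mul1r; exact: on_itv_bound.
by rewrite (intNZ cN) (intN_on_itv cN y s0 st t1) e subrr mulr0.
Qed.

Lemma intL_itv_bound (s t : R) y : 0 <= s -> s <= t -> t <= 1 ->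
  `|intL l (on_itv s t h) y| <= C' * C * (t - s).
Proof.
move=> s0 st t1; apply: (le_trans (Rint_abs (isec s t y))).
rewrite -(U01_indic s0 st t1) -RintZ; last first.
  by apply: (@Rintegrable_bounded _ _ _ U01 _ 1) => //; exact: measurable_indic.
apply: Rint_le.
- exact: Rintegrable_abs.
- apply: RintegrableZ; apply: (@Rintegrable_bounded _ _ _ U01 _ 1) => //; exact: measurable_indic.
- move=> u; rewrite /on_itv/= !normrM mulrAC.
  have -> : `|\1_(`]s, t]%classic) u : R| = \1_(`]s, t]%classic) u.
    by rewrite ger0_norm// indicE.
  by rewrite ler_wpM2r ?indicE// ler_pM.
Qed.

Lemma intM_itvD (s t : R) y : 0 <= s -> s <= t ->
  intM N l (on_itv 0 t h) y = intM N l (on_itv 0 s h) y + intM N l (on_itv s t h) y.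
Proof.
move=> s0 st; rewrite /intM (on_itvD h s0 st) (intND cN) [X in _ - X](_ : _ =
  intL l (on_itv 0 s h) y + intL l (on_itv s t h) y); first by rewrite opprD addrACA.
rewrite /intL -(RintD (isec 0 s y) (isec s t y)).
by apply: eq_Rintegral => u _; rewrite mulrDl.
Qed.

Lemma intM_abs_bound t y : 0 <= t <= 1 ->
  `|intM N l (on_itv 0 t h) y| <= C' * (N 1 y)%:R + C' * C.
Proof.
move=> /andP[t0 t1]; rewrite /intM (le_trans (ler_normB _ _))// lerD//.
  by apply: (intN_bound cN) => x; exact: on_itv_boundK.
apply: (le_trans (intL_itv_bound y (lexx 0) t0 t1)).
by rewrite subr0 ler_piMr// mulr_ge0.
Qed.

(** Just to the right of [t] none of the counting paths moves, and the compensators move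
    continuously, so a rational slightly above [t] does. Here [l] is an estimate, known only to be
    bounded. *)
Lemma compensated_sum_rational (I : finType) (J : {set I}) (y : I -> Om) :
  rational_path (fun t => \sum_(j in J) intM N l (on_itv 0 t h) (y j)).
Proof.
split.
  exists (\sum_(j in J) (C' * (N 1 (y j))%:R + C' * C)) => t t01.
  apply: (le_trans (ler_norm_sum _ _ _)); apply: ler_sum => j _; exact: intM_abs_bound.
move=> t e /andP[t0 t1] e0; move: t1; rewrite le_eqVlt => /orP[/eqP ->|t1].
  by exists 1; rewrite ?rmorph1 ?ler01 ?lexx// subrr normr0 ltW.
have /near_right_ex[r r0 hr] : \forall u \near t^'+, forall j, j \in J -> N u (y j) = N t (y j).
  have : \forall u \near t^'+, forall j, N u (y j) = N t (y j).
    by apply: filter_forall => j; have [_ _ rc _] := cN (y j); apply: rc; rewrite t0.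
  by apply: filterS => u hu j _.
(* The summand 1 keeps the denominator positive even if [J] is empty. *)
pose b := e / (#|J|%:R * (C' * C) + 1).
have K0 : 0 < #|J|%:R * (C' * C) + 1 by rewrite ltr_wpDl// mulr_ge0// mulr_ge0.
have b0 : 0 < b by rewrite divr_gt0.
have : t < Num.min 1 (Num.min (t + r) (t + b)) by rewrite !lt_min t1 !ltrDl r0 b0.
move=> /rat_in_itvoo[q]; rewrite in_itv/= !lt_min => /and4P[tq q1 qr qb].
have q01 : 0 <= (ratr q : R) <= 1 by rewrite (le_trans t0 (ltW tq)) ltW.
exists q => //; rewrite -sumrB; apply: (le_trans (ler_norm_sum _ _ _)).
apply: le_trans (_ : \sum_(j in J) C' * C * (ratr q - t) <= _).
  apply: ler_sum => j jJ; rewrite (intM_itvD (y j) t0 (ltW tq)) addrC addKr /intM.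
  by rewrite (intN_hold t0 (ltW tq) (ltW q1)) ?hr// sub0r normrN intL_itv_bound// ltW.
rewrite sumr_const -[leLHS]mulr_natl mulrA.
apply: le_trans (_ : (#|J|%:R * (C' * C) + 1) * (ratr q - t) <= _).
  by rewrite ler_wpM2r ?lerDl// subr_ge0 ltW.
by rewrite mulrC -ler_pdivlMr// lerBlDl ltW.
Qed.
End compensated_paths.

Section joint_measurability.
Context (R : realType) d (Om : measurableType d) (F : R -> set (set Om)).
Variables (N : R -> Om -> nat) (n : nat) (J : {set 'I_n}).
Hypothesis cN : forall w, counting_path (N ^~ w).
Hypothesis mN : forall t, 0 <= t <= 1 -> measurable_fun setT (N t).

Lemma measurable_estimator (H : R -> set (set Om)) (e : n.-tuple Om -> R -> Om -> R)
  dS (S : measurableType dS) (x : S -> n.-tuple Om) (s : S -> R) (y : S -> Om) :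
  sample_split_estimator H J e -> measurable_fun setT x -> measurable_fun setT s ->
  measurable_fun setT y -> measurable_fun setT (fun z => uncurry01 (e (x z)) (s z, y z)).
Proof.
move=> [me _ _] mx ms my.
have m1 : measurable_fun setT ((fun p : n.-tuple Om * R * Om => e p.1.1 p.1.2 p.2) \_ [set p | 0 <= p.1.2 <= 1]).
  apply/(measurable_restrictT _ _).1 => //.
  have -> : [set p : n.-tuple Om * R * Om | 0 <= p.1.2 <= 1] = (fun p => p.1.2) @^-1` `[0, 1]%classic.
    by apply/seteqP; split => p; rewrite /= in_itv.
  rewrite -[_ @^-1` _]setTI; apply: (measurableT_comp measurable_snd measurable_fst) => //.
have m2 : measurable_fun setT (fun z => ((x z, s z), y z)).
  by apply: measurable_fun_pair => //; exact: measurable_fun_pair.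
have := measurableT_comp m1 m2; congr (measurable_fun _ _); apply/funext => z.
Qed.

Variables (GF : R -> set (set Om)) (lamhat Ghat : n.-tuple Om -> R -> Om -> R) (C C' : R).
Hypothesis C0 : 0 <= C.
Hypothesis C'0 : 0 <= C'.
Hypothesis sl : sample_split_estimator F J lamhat.
Hypothesis sG : sample_split_estimator GF J Ghat.

Definition compensated_sum (x : n.-tuple Om) (y : 'I_n -> Om) t :=
  \sum_(j in J) intM N (clipped (lamhat x) C) (on_itv 0 t (clipped (Ghat x) C')) (y j).
Definition jump_variance (x : n.-tuple Om) (y : 'I_n -> Om) :=
  #|J|%:R^-1 * \sum_(j in J) intN N (fun p => clipped (Ghat x) C' p ^+ 2) (y j).
Definition clipped_statistic x y :=
  statistic #|J| (sup_abs (compensated_sum x y)) (jump_variance x y).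

Definition outside (c a : R) : R := \1_(~` `[- c, c]%classic) a.
(* Vanishes iff the clipped estimates agree with the original ones at the jumps
   and at almost all times; unlike the pointwise bounds, this is a measurable
   condition, which transfers from the additional copy to the evaluation sample. *)
Definition defect (x : n.-tuple Om) (y : Om) : R :=
  intN N (fun p => outside C' (uncurry01 (Ghat x) p)) y +
  \int[U01]_s (outside C' (uncurry01 (Ghat x) (s, y)) + outside C (uncurry01 (lamhat x) (s, y))).

Lemma outside_ge0 c a : 0 <= outside c a.
Proof. by rewrite /outside indicE. Qed.

Lemma outside_le1 c a : outside c a <= 1.
Proof. by rewrite /outside indicE; case: (_ \in _). Qed.

Lemma outside0 c a : outside c a = 0 -> `|a| <= c.
Proof.
rewrite /outside indicE; case: (boolP (a \in _)) => [_ /eqP|]; first by rewrite oner_eq0.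
by rewrite notin_setE/= => /contrapT; rewrite in_itv/= -ler_norml.
Qed.

Lemma outside_in c a : `|a| <= c -> outside c a = 0.
Proof. by rewrite ler_norml => ac; rewrite /outside indicE memNset//=; apply; rewrite in_itv. Qed.

Lemma measurable_outside c : measurable_fun setT (outside c).
Proof. by apply: measurable_indic; exact: measurableC. Qed.

Lemma measurable_statistic dS (S : measurableType dS) (m : nat) (Y V : S -> R) :
  (forall z, 0 <= V z) -> measurable_fun setT Y -> measurable_fun setT V ->
  measurable_fun setT (fun z => statistic m (Y z) (V z)).
Proof.
move=> V0 mY mV; have mb : measurable_fun setT (fun z => V z == 0).
  by apply: measurable_fun_eqr.
(* Replacing the value 0 by 1 makes the reciprocal of the square root measurable by the lemma on
   positive functions; where [V] vanishes the statistic is 0 anyway. *)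
pose V' z := if V z == 0 then 1 else V z.
have mV' : measurable_fun setT V' by exact: measurable_fun_ifT.
have V'0 z : 0 < V' z by rewrite /V'; case: eqVneq => // Vz; rewrite lt_neqAle eq_sym Vz V0.
have -> : (fun z => statistic m (Y z) (V z)) = fun z => if V z == 0 then 0 else
    Num.sqrt m%:R * (Num.sqrt (V' z))^-1 * (m%:R^-1 * Y z).
  by apply/funext => z; rewrite /statistic /V'; case: ifP.
apply: measurable_fun_ifT => //; apply: measurable_funM; last exact: measurable_funM.
apply: measurable_funM => //; apply: measurable_funV_gt0; first by move=> z; rewrite sqrtr_gt0.
have -> : (fun z => Num.sqrt (V' z)) = fun z => expR (ln (V' z) / 2).
  apply/funext => z; rewrite -powR12_sqrt ?ltW// /powR gt_eqF// mulrC.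
  by congr (expR _); rewrite mulrC.
apply: measurableT_comp => //; apply: measurable_funM => //.
by apply: measurableT_comp => //; exact: measurable_ln.
Qed.

Section joint.
Context dS (S : measurableType dS) (x : S -> n.-tuple Om).
Hypothesis mx : measurable_fun setT x.

Lemma measurable_joint_G (y : S -> Om) : measurable_fun setT y ->
  measurable_fun setT (fun p : R * S => uncurry01 (Ghat (x p.2)) (p.1, y p.2)).
Proof.
move=> my; apply: (measurable_estimator sG (x := fun p : R * S => x p.2)
  (s := fun p : R * S => p.1) (y := fun p : R * S => y p.2)).
- exact: (measurableT_comp mx measurable_snd).
- exact: measurable_fst.
- exact: (measurableT_comp my measurable_snd).
Qed.

Lemma measurable_joint_l (y : S -> Om) : measurable_fun setT y ->
  measurable_fun setT (fun p : R * S => uncurry01 (lamhat (x p.2)) (p.1, y p.2)).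
Proof.
move=> my; apply: (measurable_estimator sl (x := fun p : R * S => x p.2)
  (s := fun p : R * S => p.1) (y := fun p : R * S => y p.2)).
- exact: (measurableT_comp mx measurable_snd).
- exact: measurable_fst.
- exact: (measurableT_comp my measurable_snd).
Qed.

Lemma measurable_joint_intN (y : S -> Om) (k : R * S -> R) : measurable_fun setT y ->
  measurable_fun setT k ->
  measurable_fun setT (fun z => int_dN (fun s => k (s, z)) (N ^~ (y z)) 1).
Proof.
move=> my mk; apply: (measurable_int_dN1 (N := fun s z => N s (y z))) => //.
by move=> t t01; exact: (measurableT_comp (mN t01) my).
Qed.

Lemma measurable_defect (y : S -> Om) : measurable_fun setT y ->
  measurable_fun setT (fun z => defect (x z) (y z)).
Proof.
move=> my; have mg := measurableT_comp (@measurable_outside C') (measurable_joint_G my).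
have ml := measurableT_comp (@measurable_outside C) (measurable_joint_l my).
apply: measurable_funD; first exact: (measurable_joint_intN my mg).
exact: (@measurable_Rint2 _ _ _ _ _ U01 _ (measurable_funD mg ml)).
Qed.

Lemma measurable_clipped_statistic (y : 'I_n -> S -> Om) :
  (forall j, measurable_fun setT (y j)) ->
  measurable_fun setT (fun z => clipped_statistic (x z) (y ^~ z)).
Proof.
move=> my; have mg j := measurableT_comp (@measurable_clip R C') (measurable_joint_G (my j)).
have ml j := measurableT_comp (@measurable_clip R C) (measurable_joint_l (my j)).
apply: measurable_statistic.
- move=> z; rewrite mulr_ge0 ?invr_ge0//; apply: sumr_ge0 => j _.
  by rewrite /intN int_dNE ?ler01 ?lexx//; apply: sumr_ge0 => i _; exact: sqr_ge0.
- apply: measurable_sup_abs => [z|t t01].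
    apply: (compensated_sum_rational (C := C) (C' := C') cN).
    + apply: measurableT_comp; first exact: measurable_clip.
      by apply: (measurable_estimator sG (x := cst (x z)) (s := fst) (y := snd)).
    + apply: measurableT_comp; first exact: measurable_clip.
      by apply: (measurable_estimator sl (x := cst (x z)) (s := fst) (y := snd)).
    + by move=> p; exact: abs_clip.
    + by move=> p; exact: abs_clip.
  rewrite /compensated_sum; under eq_fun do rewrite -big_enum.
  apply: measurable_sum => j; have mi : measurable_fun setT (fun p : R * S => \1_(`]0, t]%classic) p.1 : R).
    by apply: measurableT_comp => //; exact: measurable_indic.
  apply: measurable_funB.
    exact: (measurable_joint_intN (my j) (measurable_funM (mg j) mi)).
  exact: (@measurable_Rint2 _ _ _ _ _ U01 _ (measurable_funM (measurable_funM (mg j) mi) (ml j))).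
- rewrite /jump_variance; under eq_fun do rewrite -big_enum.
  apply: measurable_funM => //; apply: measurable_sum => j.
  exact: (measurable_joint_intN (my j) (measurable_funX 2 (mg j))).
Qed.
End joint.

End joint_measurability.

Section sup_abs_scale.
Context (R : realType).

Lemma eq_sup_abs (f g : R -> R) : (forall t : R, 0 <= t <= 1 -> f t = g t) ->
  sup_abs f = sup_abs g.
Proof.
move=> fg; congr sup; apply: eq_imagel => t; rewrite /= in_itv/= => t01.
by rewrite fg.
Qed.

Lemma sup_absZ (c : R) (f : R -> R) : 0 <= c -> (exists M : R, forall t : R, 0 <= t <= 1 -> `|f t| <= M) ->
  sup_abs (fun t => c * f t) = c * sup_abs f.
Proof.
move=> c0 [M bf]; have bcf (t : R) : 0 <= t <= 1 -> `|c * f t| <= c * M.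
  by move=> t01; rewrite normrM ger0_norm// ler_wpM2l// bf.
apply/eqP; rewrite eq_le; apply/andP; split.
  apply: sup_abs_le => t t01; rewrite normrM ger0_norm// ler_wpM2l//.
  exact: (le_sup_abs bf).
have [->|cn0] := eqVneq c 0; first by rewrite mul0r sup_abs_ge0.
have {}c0 : 0 < c by rewrite lt_neqAle eq_sym cn0.
rewrite -ler_pdivlMl//; apply: sup_abs_le => t t01.
rewrite ler_pdivlMl// -[X in X * _]ger0_norm ?(ltW c0)// -normrM.
exact: (le_sup_abs bcf).
Qed.
End sup_abs_scale.

Lemma Rint_U01 (R : realType) (f : R -> R) : measurable_fun setT f ->
  \int[lebesgue_measure]_(s in `[0, 1]) f s = \int[U01]_s f s.
Proof.
by move=> mf; congr fine; rewrite integral_U01//; exact/measurable_EFinP.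
Qed.

Section no_defect.
Context (R : realType) d (Om : measurableType d) (N : R -> Om -> nat).
Hypothesis cN : forall w, counting_path (N ^~ w).
Variables (g l : R -> Om -> R) (C C' : R) (y : Om).
Hypothesis mg : measurable_fun setT (uncurry01 g).
Hypothesis ml : measurable_fun setT (uncurry01 l).
Hypothesis jumps : intN N (fun p => outside C' (uncurry01 g p)) y = 0.
Hypothesis times : \int[U01]_s (outside C' (uncurry01 g (s, y)) + outside C (uncurry01 l (s, y))) = 0.

Lemma arrival_clipped i : (i < N 1 y)%N ->
  clipped g C' (arrival (N ^~ y) i.+1, y) = g (arrival (N ^~ y) i.+1) y.
Proof.
move=> iN; have [a0 a1] := arrival01 cN iN.
rewrite /clipped uncurry01E ?a1 ?ltW// clip_id//; apply: outside0.
move/eqP: jumps; rewrite (intNE cN) psumr_eq0 => [/allP/(_ (Ordinal iN))|k _]; last exact: outside_ge0.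
rewrite mem_index_enum => /(_ isT)/=/eqP.
by rewrite uncurry01E ?a1 ?ltW.
Qed.

Lemma int_dN_clipped (t : R) : 0 <= t <= 1 ->
  int_dN (g ^~ y) (N ^~ y) t = intN N (on_itv 0 t (clipped g C')) y.
Proof.
move=> t01; have /andP[t0 t1] := t01; rewrite (intNE cN) int_dNE//.
have Nt : (N t y <= N 1 y)%N by have [_ mono _ _] := cN y; apply: mono.
rewrite -(sum_ord_ltn (fun i => g (arrival (N ^~ y) i.+1) y) Nt).
apply: eq_bigr => i _; rewrite /on_itv arrival_clipped//=; congr (_ * _).
have [a0 _] := arrival01 cN (ltn_ord i).
by rewrite indicE mem_setE in_itv/= a0/= (arrival_le _ (cN y) t01).
Qed.

Lemma int_dN_sqr_clipped :
  int_dN (fun s => g s y ^+ 2) (N ^~ y) 1 = intN N (fun p => clipped g C' p ^+ 2) y.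
Proof.
rewrite (intNE cN) int_dNE ?lexx ?ler01//; apply: eq_bigr => i _.
by rewrite arrival_clipped.
Qed.

Let msec (k : R * Om -> R) : measurable_fun setT k -> measurable_fun setT (fun s => k (s, y)).
Proof. by move=> mk; apply: (measurableT_comp mk); exact: pair2_measurable. Qed.

(** At almost every time both estimates are within their bounds, so clipping is invisible to the
    time integral; the closed interval [[0, t]] and []0, t]] differ by a null set. *)
Lemma int_leb_clipped (t : R) : 0 <= t <= 1 ->
  \int[lebesgue_measure]_(s in `[0, t]) (g s y * l s y) =
  intL (clipped l C) (on_itv 0 t (clipped g C')) y.
Proof.
move=> /andP[t0 t1].
pose k s := (\1_(`[0, t]%classic) s : R) * (uncurry01 g (s, y) * uncurry01 l (s, y)).
have mk : measurable_fun setT k.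
  by apply: measurable_funM; [exact: measurable_indic|apply: measurable_funM; exact: msec].
transitivity (\int[U01]_s k s).
  rewrite -(Rint_U01 mk) [LHS]Rintegral_indic [RHS]Rintegral_indic; apply: eq_Rintegral => s _.
  rewrite /k !indicE; have [st|st] := boolP (s \in `[0, t]%classic); last by rewrite !mul0r mulr0.
  have s01 : 0 <= s <= 1.
    by move: st => /set_mem; rewrite /= in_itv/= => /andP[-> /le_trans ->].
  by rewrite [s \in _]mem_set /= ?in_itv//= !uncurry01E// !mul1r.
have mo : measurable_fun setT (fun s => outside C' (uncurry01 g (s, y)) + outside C (uncurry01 l (s, y))).
  by apply: measurable_funD; apply: measurableT_comp; [exact: measurable_outside|exact: msec|exact: measurable_outside|exact: msec].
have o0 s : 0 <= outside C' (uncurry01 g (s, y)) + outside C (uncurry01 l (s, y)).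
  by rewrite addr_ge0 ?outside_ge0.
have io : Rintegrable U01 (fun s => outside C' (uncurry01 g (s, y)) + outside C (uncurry01 l (s, y))).
  apply: (@Rintegrable_bounded _ _ _ U01 _ 2) => // s; rewrite ger0_norm//.
  by rewrite -[leRHS]/(1 + 1) lerD ?outside_le1.
have e0 : (\int[U01]_s (outside C' (uncurry01 g (s, y)) + outside C (uncurry01 l (s, y)))%:E = 0)%E.
  by rewrite -(RintE io) times.
have ae := Rint_eq0_ae mo o0 e0.
have ae1 : \forall s \ae U01, (0 : R) < s.
  exists (~` `]0, 1]%classic); split; [exact: measurableC|exact: U01_itv|].
  by move=> s /= h /=; rewrite in_itv/= => /andP[s0 _].
apply: Rint_ae => //.
  apply: measurable_funM; last exact: (measurableT_comp (@measurable_clip R C) (msec ml)).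
  apply: measurable_funM; last by exact: measurable_indic.
  exact: (measurableT_comp (@measurable_clip R C') (msec mg)).
apply: filterS2 ae ae1 => s os s0.
have [h1 h2] : outside C' (uncurry01 g (s, y)) = 0 /\ outside C (uncurry01 l (s, y)) = 0.
  by move/eqP: os; rewrite paddr_eq0 ?outside_ge0// => /andP[/eqP ? /eqP ?].
rewrite /k /on_itv /clipped/= !clip_id ?outside0//.
have -> : \1_(`[0, t]%classic) s = \1_(`]0, t]%classic) s :> R.
  by rewrite !indicE !mem_setE !in_itv/= s0 ltW.
by rewrite mulrCA mulrA.
Qed.

Lemma int_dM_clipped (t : R) : 0 <= t <= 1 ->
  int_dM (g ^~ y) (N ^~ y) (l ^~ y) t = intM N (clipped l C) (on_itv 0 t (clipped g C')) y.
Proof. by move=> t01; rewrite /int_dM int_dN_clipped// int_leb_clipped. Qed.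
End no_defect.

(** * Independence of the training and the evaluation samples *)

Section training.
Context (R : realType) d (Om : measurableType d) (P : probability Om R).
Context dS (Sm : measurableType dS) (Q : probability Sm R) (Z : nat -> Sm -> Om).
Hypothesis mZ : forall j, measurable_fun setT (Z j).
Hypothesis lawZ : forall j (A : set Om), measurable A -> Q (Z j @^-1` A) = P A.
Hypothesis iZ : mutually_independent Q Z.
Variables (n : nat) (J : {set 'I_n}).

(** Coordinates outside [D] are set to the default point, so the tuple depends on the replications
    in [D] only. An estimate that ignores the evaluation observations does not see the difference
    between the sample and its masked version. *)
Definition masked (D : {set 'I_n}) (w : Sm) : n.-tuple Om :=
  [tuple if j \in D then Z j.+1 w else point | j < n].
Definition indices (D : {set 'I_n}) : set nat := [set k | exists2 j : 'I_n, j \in D & k = j.+1].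

Lemma measurable_masked_generated (D : {set 'I_n}) : measurable_fun setT
  (masked D : g_sigma_algebraType (generated_system Z (indices D)) -> n.-tuple Om).
Proof.
apply/measurable_fun_tnthP => j.
have [jD|jD] := boolP (j \in D).
  have -> : (@tnth n Om)^~ j \o masked D = Z j.+1.
    by apply/funext => w; rewrite /= tnth_mktuple jD.
  by apply: measurable_generated; exists j.
have -> : (@tnth n Om)^~ j \o masked D = cst point.
  by apply/funext => w; rewrite /= tnth_mktuple (negbTE jD).
exact: measurable_cst.
Qed.

Lemma measurable_masked D : measurable_fun setT (masked D).
Proof. exact: (generated_fun_measurable mZ (@measurable_masked_generated D)). Qed.

Lemma measurable_sample : measurable_fun setT (sample n Z).
Proof.
apply/measurable_fun_tnthP => j.
by rewrite (_ : _ \o _ = Z j.+1)//; apply/funext => w; rewrite /= tnth_mktuple.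
Qed.

(** Training and evaluation parts may be read at two independent sample points; the first can then
    be frozen. *)
Lemma training_evaluation (phi : n.-tuple Om * n.-tuple Om -> R) : measurable_fun setT phi ->
  \int[Q]_w phi (masked (~: J) w, masked J w) =
  \int[(Q \x Q)%E]_z phi (masked (~: J) z.1, masked J z.2).
Proof.
apply: (Rint_independent_pair mZ iZ (D1 := indices (~: J)) (D2 := indices J)).
- apply/seteqP; split => // k [[i iJ ->] [j jJ [/val_inj ij]]].
  by move: iJ; rewrite inE ij jJ.
- exact: measurable_masked_generated.
- exact: measurable_masked_generated.
Qed.

Lemma product_law k d1 (V : measurableType d1) (p1 : probability V R) (E : set (V * Om)) : measurable E ->
  (p1 \x Q)%E ((fun z : V * Sm => (z.1, Z k z.2)) @^-1` E) = (p1 \x P)%E E.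
Proof.
move=> mE; apply: eq_integral => x _ /=.
rewrite -(lawZ k); last exact: measurable_xsection.
by congr (Q _); apply/seteqP; split => w; rewrite /xsection/= !inE.
Qed.

(** The joint law of the training part and of replication [k] is the same for every [k] that is not
    a training index. Bounds and errors known on the additional copy thus carry over to each
    evaluation observation. *)
Lemma training_law k : (forall j : 'I_n, k = j.+1 -> j \in J) ->
  forall E : set (n.-tuple Om * Om), measurable E ->
  Q ((fun w => (masked (~: J) w, Z k w)) @^-1` E) =
  (Q \x P)%E ((fun z : Sm * Om => (masked (~: J) z.1, z.2)) @^-1` E).
Proof.
move=> kJ E mE; rewrite (independent_pair_law mZ iZ (D1 := indices (~: J)) (D2 := [set k])) //.
- rewrite -(product_law k); first by [].
  have mm : measurable_fun setT (fun z : Sm * Om => (masked (~: J) z.1, z.2)).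
    exact: (measurable_fun_pair (measurableT_comp (measurable_masked (~: J)) measurable_fst) measurable_snd).
  by rewrite -[X in measurable X]setTI; exact: mm.
- apply/seteqP; split => // i [[j jJ ->] /= jk].
  by move: jJ; rewrite inE kJ.
- exact: measurable_masked_generated.
- exact: measurable_generated.
Qed.

Lemma training_mean k (phi : n.-tuple Om * Om -> R) (B : R) :
  (forall j : 'I_n, k = j.+1 -> j \in J) -> measurable_fun setT phi ->
  (forall z, `|phi z| <= B) ->
  \int[Q]_w phi (masked (~: J) w, Z k w) =
  \int[Q]_w \int[P]_y phi (masked (~: J) w, y).
Proof.
move=> kJ mphi bphi.
have mm : measurable_fun setT (fun z : Sm * Om => (masked (~: J) z.1, z.2)).
  exact: (measurable_fun_pair (measurableT_comp (measurable_masked (~: J)) measurable_fst) measurable_snd).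
have iphi : Rintegrable (Q \x P)%E (fun z => phi (masked (~: J) z.1, z.2)).
  by apply: (@Rintegrable_bounded _ _ _ (Q \x P)%E _ B) => //; exact: (measurableT_comp mphi mm).
have [_ ->] := Rfubini1 iphi.
apply: (Rint_law (u1 := fun w => (masked (~: J) w, Z k w)) (u2 := fun z : Sm * Om => (masked (~: J) z.1, z.2))) => //.
- exact: (measurable_fun_pair (measurable_masked (~: J)) (mZ k)).
- exact: training_law.
Qed.

Lemma training_null k k' (E : set (n.-tuple Om * Om)) :
  (forall j : 'I_n, k = j.+1 -> j \in J) -> (forall j : 'I_n, k' = j.+1 -> j \in J) ->
  measurable E ->
  (\forall w \ae Q, ~ E (masked (~: J) w, Z k w)) -> \forall w \ae Q, ~ E (masked (~: J) w, Z k' w).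
Proof.
move=> kJ k'J mE ae.
have mp i : measurable ((fun w => (masked (~: J) w, Z i w)) @^-1` E).
  by rewrite -[X in measurable X]setTI; exact: (measurable_fun_pair (measurable_masked (~: J)) (mZ i)).
have h0 : Q ((fun w => (masked (~: J) w, Z k w)) @^-1` E) = 0%E.
  apply: measure_negligible => //.
  by apply: negligibleS ae => w /= Ew; apply.
exists ((fun w => (masked (~: J) w, Z k' w)) @^-1` E); split => //.
  by rewrite training_law// -(training_law kJ).
by move=> w /= /contrapT.
Qed.
End training.

Section norm2.
Context (R : realType) dS (Sm : measurableType dS) (Q : probability Sm R).
Variables (W : R -> Sm -> R) (eta : R).
Hypothesis mW : measurable_fun setT (uncurry01 W).
Hypothesis eta0 : 0 <= eta.
Hypothesis Weta : (norm2 Q W <= eta%:E)%E.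
Local Notation M := (@U01 R \x Q)%E.

Lemma norm2_integral : Rintegrable M (fun x => uncurry01 W x ^+ 2) /\
  \int[M]_x (uncurry01 W x ^+ 2) <= eta ^+ 2.
Proof.
have mW2 : measurable_fun setT (fun x => uncurry01 W x ^+ 2) by exact: measurable_funX.
have mE : measurable_fun setT (fun x : R * Sm => (uncurry01 W x ^+ 2)%:E) by exact/measurable_EFinP.
have fE : (\int[M]_x (uncurry01 W x ^+ 2)%:E =
    \int[Q]_w \int[lebesgue_measure]_(s in `[0%R, 1%R]) (W s w ^+ 2)%:E)%E.
  rewrite fubini_tonelli2//=; last by move=> x; rewrite lee_fin sqr_ge0.
  apply: eq_integral => w _; rewrite /fubini_G ge0_integral_U01.
  - by apply: eq_integral => s; rewrite inE/= in_itv/= => s01; rewrite uncurry01E.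
  - by apply: (measurableT_comp mE); exact: pair2_measurable.
  - by move=> s; rewrite lee_fin sqr_ge0.
have le : (\int[M]_x (uncurry01 W x ^+ 2)%:E <= (eta ^+ 2)%:E)%E.
  rewrite fE -lee_sqrt ?lee_fin ?sqr_ge0//= sqrtr_sqr ger0_norm//.
have i2 : Rintegrable M (fun x => uncurry01 W x ^+ 2).
  by apply: Rintegrable_ge0 => //; [move=> x; exact: sqr_ge0|exact: le_lt_trans le (ltry _)].
by split => //; rewrite -lee_fin (RintE i2).
Qed.

(** The term [k], of integral 0, absorbs a null set on which the pointwise comparison with [W]
    fails. *)
Lemma norm2_bound (c k : R * Sm -> R) : Rintegrable M c -> Rintegrable M k ->
  \int[M]_x k x = 0 -> (forall x, c x <= uncurry01 W x ^+ 2 + k x) ->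
  \int[Q]_w \int[U01]_s c (s, w) <= eta ^+ 2.
Proof.
move=> ic ik k0 ck; have [iW leW] := norm2_integral.
have [_ ->] := Rfubini2 ic.
apply: le_trans (_ : \int[M]_x (uncurry01 W x ^+ 2 + k x) <= _).
  by apply: Rint_le => //; exact: RintegrableD.
by rewrite (RintD iW ik) k0 addr0.
Qed.
End norm2.

Section single_law.
Context (R : realType) d (Om : measurableType d) (P : probability Om R).
Variables (F : R -> set (set Om)) (N : R -> Om -> nat) (X lam G : R -> Om -> R).
Context dS (Sm : measurableType dS) (Q : probability Sm R) (Z : nat -> Sm -> Om).
Variables (n : nat) (J : {set 'I_n}) (lamhat Ghat : n.-tuple Om -> R -> Om -> R).
Variables (C C' : R) (L : R * Om -> R).
Local Notation GF := (enlarged_filtration P F X).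
Local Notation M := (@U01 R \x P)%E.
Hypothesis uF : usual_filtration P F.
Hypothesis NF : counting_process F N.
Hypothesis mX : forall t, 0 <= t <= 1 -> measurable_fun setT (X t).
Hypothesis rG : residual_process P F X G.
Hypothesis iidZ : iid_replications P Q Z.
Hypothesis sl : sample_split_estimator F J lamhat.
Hypothesis sG : sample_split_estimator GF J Ghat.
Hypothesis C0 : 0 < C.
Hypothesis C'0 : 0 < C'.
Hypothesis GC : \forall w \ae P, forall t, 0 <= t <= 1 -> `|G t w| <= C'.
Hypothesis lhC : \forall w \ae Q, forall t, 0 <= t <= 1 ->
  `|lamhat (sample n Z w) t (Z 0%N w)| <= C.
Hypothesis GhC : \forall w \ae Q, forall t, 0 <= t <= 1 ->
  `|Ghat (sample n Z w) t (Z 0%N w)| <= C'.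
Local Notation train := (masked Z (~: J)).
Local Notation evaluate := (masked Z J).

Let cN w : counting_path (N ^~ w). Proof. by have [_] := NF. Qed.
Let fF := usual_filtration_filtration uF.
Let mN t : 0 <= t <= 1 -> measurable_fun setT (N t).
Proof. by have [aN _] := NF; exact: adapted_measurable fF aN t. Qed.
Let mZ j : measurable_fun setT (Z j). Proof. by have [_ h _ _] := iidZ. Qed.
Let lawZ j (A : set Om) : measurable A -> Q (Z j @^-1` A) = P A.
Proof. by have [_ _ h _] := iidZ; exact: h. Qed.
Let iZ : mutually_independent Q Z. Proof. by have [] := iidZ. Qed.

Let train_out w j : j \notin J -> tnth (train w) j = tnth (sample n Z w) j.
Proof. by move=> jJ; rewrite !tnth_mktuple inE jJ. Qed.

Lemma train_G w : Ghat (train w) = Ghat (sample n Z w).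
Proof. by have [_ h _] := sG; apply: h => j; exact: train_out. Qed.

Lemma train_l w : lamhat (train w) = lamhat (sample n Z w).
Proof. by have [_ h _] := sl; apply: h => j; exact: train_out. Qed.

Let mhat_G x : measurable_fun setT (uncurry01 (Ghat x)).
Proof. by apply: (measurable_estimator sG (x := cst x) (s := fst) (y := snd)). Qed.

Let mhat_l x : measurable_fun setT (uncurry01 (lamhat x)).
Proof. by apply: (measurable_estimator sl (x := cst x) (s := fst) (y := snd)). Qed.

Lemma no_defect_new : \forall w \ae Q, defect N lamhat Ghat C C' (train w) (Z 0%N w) = 0.
Proof.
apply: filterS2 lhC GhC => w hl hG; rewrite /defect train_G train_l.
have u01 (W : R -> Om -> R) (c s : R) y : 0 <= c -> (forall t, 0 <= t <= 1 -> `|W t y| <= c) ->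
    outside c (uncurry01 W (s, y)) = 0.
  move=> c0 h; apply: outside_in; have [s01|s01] := boolP (0 <= s <= 1).
    by rewrite uncurry01E// h.
  by rewrite /uncurry01 patchE memNset/= ?normr0//; exact/negP.
rewrite (intNE cN) big1 ?add0r => [|i _]; last by rewrite (u01 _ _ _ _ (ltW C'0) hG).
rewrite -[RHS](Rint_cst U01 0); apply: eq_Rintegral => s _.
by rewrite (u01 _ _ _ _ (ltW C'0) hG) (u01 _ _ _ _ (ltW C0) hl) addr0.
Qed.

Let mdefect : measurable_fun setT (fun z : n.-tuple Om * Om => defect N lamhat Ghat C C' z.1 z.2).
Proof. exact: (measurable_defect cN mN C C' sl sG measurable_fst measurable_snd). Qed.

Lemma no_defect_evaluation : \forall w \ae Q, forall j, j \in J ->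
  defect N lamhat Ghat C C' (train w) (Z j.+1 w) = 0.
Proof.
apply: filterS (_ : \forall w \ae Q, forall j : 'I_n, (j \in J) ==> (defect N lamhat Ghat C C' (train w) (Z j.+1 w) == 0)).
  by move=> w h j jJ; have := h j; rewrite jJ => /eqP.
apply: filter_forall => j; have [jJ|jJ] := boolP (j \in J); last exact: nearW.
pose E := [set z : n.-tuple Om * Om | defect N lamhat Ghat C C' z.1 z.2 != 0].
have mE : measurable E.
  rewrite (_ : E = (fun z => defect N lamhat Ghat C C' z.1 z.2) @^-1` (~` [set 0])).
    by rewrite -[X in measurable X]setTI; apply: mdefect => //; exact: measurableC.
  by apply/seteqP; split => z /eqP.
have h0 : \forall w \ae Q, ~ E (train w, Z 0%N w).
  by apply: filterS no_defect_new => w /= e; rewrite /E/= e eqxx.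
have j0 (i : 'I_n) : 0%N = i.+1 -> i \in J by [].
have j1 (i : 'I_n) : j.+1 = i.+1 -> i \in J by move=> /succn_inj/val_inj <-.
apply: filterS (training_null mZ lawZ iZ j0 j1 mE h0) => w nE.
apply/implyP => _; case: eqP => // d0; exfalso; apply: nE; rewrite /E/=.
by apply/eqP.
Qed.

(** Two sample points: [w] provides the training data and [z] the evaluation data. The statistic is
    the diagonal value almost surely, and by independence has the law of this function under the
    product measure. *)
Definition reduced w z := clipped_statistic N J lamhat Ghat C C' (train w) (tnth (evaluate z)).

Let evaluate_tnth w j : j \in J -> tnth (evaluate w) j = Z j.+1 w.
Proof. by move=> jJ; rewrite tnth_mktuple jJ. Qed.

Lemma T_hat_reduced : \forall w \ae Q, T_hat N Z J lamhat Ghat w = reduced w w.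
Proof.
apply: filterS no_defect_evaluation => w h.
have nd (j : 'I_n) : j \in J ->
    intN N (fun p => outside C' (uncurry01 (Ghat (train w)) p)) (Z j.+1 w) = 0 /\
    \int[U01]_s (outside C' (uncurry01 (Ghat (train w)) (s, Z j.+1 w)) +
      outside C (uncurry01 (lamhat (train w)) (s, Z j.+1 w))) = 0.
  move=> jJ; have /eqP := h j jJ; rewrite /defect paddr_eq0.
  - by move=> /andP[/eqP -> /eqP ->].
  - by rewrite (intNE cN); apply: sumr_ge0 => i _; exact: outside_ge0.
  - by apply: Rint_ge0 => s; rewrite addr_ge0 ?outside_ge0.
have VE : variance_hat J (fun j t => N t (Z j.+1 w)) (fun j t => Ghat (sample n Z w) t (Z j.+1 w)) 1 =
    jump_variance N J Ghat C' (train w) (tnth (evaluate w)).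
  rewrite /variance_hat /jump_variance -train_G; congr (_ * _); apply: eq_bigr => j jJ.
  have [h1 _] := nd j jJ.
  by rewrite (int_dN_sqr_clipped cN h1) evaluate_tnth.
have gE (t : R) : 0 <= t <= 1 ->
    gamma_hat J (fun j t => N t (Z j.+1 w)) (fun j t => Ghat (sample n Z w) t (Z j.+1 w))
     (fun j t => lamhat (sample n Z w) t (Z j.+1 w)) t =
    #|J|%:R^-1 * compensated_sum N J lamhat Ghat C C' (train w) (tnth (evaluate w)) t.
  move=> t01; rewrite /gamma_hat /compensated_sum -train_G -train_l; congr (_ * _); apply: eq_bigr => j jJ.
  have [h1 h2] := nd j jJ.
  by rewrite (int_dM_clipped cN (mhat_G _) (mhat_l _) h1 h2 t01) evaluate_tnth.
rewrite /T_hat /lct_statistic /reduced /clipped_statistic /statistic VE.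
case: ifP => // _; congr (_ * _); rewrite (eq_sup_abs gE) sup_absZ ?invr_ge0//.
have [] := @compensated_sum_rational R _ _ N cN (clipped (Ghat (train w)) C') (clipped (lamhat (train w)) C) C C' _ _ _ _ _ J (tnth (evaluate w)).
- exact: (measurableT_comp (@measurable_clip R C') (mhat_G _)).
- exact: (measurableT_comp (@measurable_clip R C) (mhat_l _)).
- by move=> x; apply: abs_clip; exact: ltW.
- by move=> x; apply: abs_clip; exact: ltW.
by [].
Qed.

Lemma measurable_reduced : measurable_fun setT (fun z : Sm * Sm => reduced z.1 z.2).
Proof.
have mx : measurable_fun setT (fun z : Sm * Sm => train z.1).
  exact: (measurableT_comp (measurable_masked mZ (~: J)) measurable_fst).
have my j : measurable_fun setT (fun z : Sm * Sm => tnth (evaluate z.2) j).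
  apply: (measurableT_comp (measurable_tnth j)).
  exact: (measurableT_comp (measurable_masked mZ J) measurable_snd).
exact: (measurable_clipped_statistic cN mN (ltW C0) (ltW C'0) sl sG mx my).
Qed.

(** Off a null set the statistic is the measurable clipped one; on the null set completeness of the
    sample space takes over. *)
Lemma measurable_T_hat : measurable_fun setT (T_hat N Z J lamhat Ghat).
Proof.
have [cQ _ _ _] := iidZ; have mr : measurable_fun setT (fun w => reduced w w).
  have mp : measurable_fun setT (fun w : Sm => (w, w)) by exact: (measurable_fun_pair (@measurable_id _ _ _) (@measurable_id _ _ _)).
  exact: (measurableT_comp measurable_reduced mp).
move=> _ Y mY; rewrite setTI; have [A [mA A0 hA]] := T_hat_reduced.
rewrite (_ : _ @^-1` _ = (((fun w => reduced w w) @^-1` Y) `\` A) `|` ((T_hat N Z J lamhat Ghat @^-1` Y) `&` A)).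
  apply: measurableU; last by apply: cQ; exists A; split => // w [].
  by apply: measurableD => //; rewrite -[X in measurable X]setTI; exact: mr.
have inA w : ~ A w -> T_hat N Z J lamhat Ghat w = reduced w w.
  by move=> nA; apply: contrapT => h; apply: nA; exact: hA.
apply/seteqP; split => w /=.
  by have [Aw|nA] := pselect (A w) => Yw; [right|left; split => //; rewrite -inA].
by move=> [[Yw nA]|[]//]; rewrite inA.
Qed.

Lemma T_hat_mean (f : R -> R) : bounded_lipschitz1 f ->
  Rintegrable Q (fun w => \int[Q]_z f (reduced w z)) /\
  \int[Q]_w f (T_hat N Z J lamhat Ghat w) = \int[Q]_w \int[Q]_z f (reduced w z).
Proof.
move=> [fB fL]; have mf := lipschitz1_measurable fL.
have mr : measurable_fun setT (fun z : Sm * Sm => f (reduced z.1 z.2)).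
  exact: (measurableT_comp mf measurable_reduced).
have ir : Rintegrable (Q \x Q)%E (fun z : Sm * Sm => f (reduced z.1 z.2)).
  by apply: (@Rintegrable_bounded _ _ _ (Q \x Q)%E _ 1).
have [i1 ->] := Rfubini1 ir; split => //.
pose phi (z : n.-tuple Om * n.-tuple Om) := f (clipped_statistic N J lamhat Ghat C C' z.1 (tnth z.2)).
have mphi : measurable_fun setT phi.
  apply: (measurableT_comp mf).
  have my j : measurable_fun setT (fun z : n.-tuple Om * n.-tuple Om => tnth z.2 j).
    exact: (measurableT_comp (measurable_tnth j) measurable_snd).
  exact: (measurable_clipped_statistic cN mN (ltW C0) (ltW C'0) sl sG measurable_fst my).
rewrite -[RHS](training_evaluation mZ iZ J mphi); apply: Rint_ae.
- exact: (measurableT_comp mf measurable_T_hat).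
- apply: (measurableT_comp mphi).
  exact: (measurable_fun_pair (measurable_masked mZ (~: J)) (measurable_masked mZ J)).
- by apply: filterS T_hat_reduced => w ->.
Qed.

Hypothesis bL : bounded_intensity P GF N C L.
Hypothesis pL : pred_fun F L.

Let fGF := enlarged_filtration_filtration uF mX.
Let aN : adapted GF N.
Proof. by have [h _] := NF; move=> t t01 Y hY; apply: (sub_enlarged uF t01); exact: h. Qed.
Local Notation Gc := (clipped G C').
Let pGc := pred_fun_residual C' uF mX rG.
Let mGc := pred_fun_measurable fGF pGc.

Definition residual_error w := \int[M]_x ((Gc x - clipped (Ghat (train w)) C' x) ^+ 2).
Definition intensity_estimation_error w :=
  \int[M]_x (intensity_error L (clipped (lamhat (train w)) C) x ^+ 2).

Context (dB : measure_display) (OB : measurableType dB) (PB : probability OB R)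
  (B : R -> OB -> R) (v0 e kappa : R) (m0 : nat).
Hypothesis FX : limit_property PB B C C' v0 e kappa m0.

(** For a frozen training point all estimates are fixed functions. The orthogonality required by
    [limit_property] holds because [L] minus the clipped estimate is predictable for the small
    filtration. *)
Lemma conditional_limit w (f : R -> R) : (m0 <= #|J|)%N ->
  v0 <= cumulated_variance P L (clipped (Ghat (train w)) C') 0 1 ->
  Num.sqrt (intensity_estimation_error w) <= kappa ->
  Num.sqrt #|J|%:R * Num.sqrt (residual_error w) * Num.sqrt (intensity_estimation_error w) <= kappa ->
  bounded_lipschitz1 f ->
  `|\int[Q]_z f (reduced w z) - \int[PB]_z f (sup_abs (B ^~ z))| <= e.
Proof.
move=> mm vv k1 k2 bf; have [_ _ pG] := sG; have [_ _ pl] := sl.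
have pg : pred_fun GF (clipped (Ghat (train w)) C').
  exact: (measurableT_comp (@measurable_clip R C') (predictable_pred_fun fGF (pG (train w)))).
have plc : pred_fun F (clipped (lamhat (train w)) C).
  exact: (measurableT_comp (@measurable_clip R C) (predictable_pred_fun fF (pl (train w)))).
pose sigma i := (nth 0%N [seq val j | j <- enum J] i).+1.
apply: (FX (P := P) (N := N) (L := L) (G := Gc) (h := clipped (Ghat (train w)) C')
  (l := clipped (lamhat (train w)) C) (Q := Q) (Z := Z) (m := #|J|) (sigma := sigma)
  (a := Num.sqrt (residual_error w)) (b := Num.sqrt (intensity_estimation_error w)) fGF cN aN bL mGc pg (pred_fun_measurable fF plc)) => //.
- by move=> x; apply: abs_clip; exact: ltW.
- by move=> x; apply: abs_clip; exact: ltW.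
- by move=> x; apply: abs_clip; exact: ltW.
- move=> s s01; have pD : pred_fun F (fun x => L x - clipped (lamhat (train w)) C x) by exact: measurable_funB.
  apply: (residual_orthogonal uF mX rG GC pD (K := 2 * C) _ s01) => x.
  rewrite (le_trans (ler_normB _ _))// mulr_natl mulr2n lerD//; last by apply: abs_clip; exact: ltW.
  by have /andP[h0 h1] := intensity_bounds bL x; rewrite ger0_norm.
- exact: enum_inj.
- by rewrite sqr_sqrtr// Rint_ge0// => x; exact: sqr_ge0.
- by rewrite sqr_sqrtr// Rint_ge0// => x; exact: sqr_ge0.
- exact: (measurableT_comp measurable_reduced (pair1_measurable w)).
- move=> z; rewrite /reduced /clipped_statistic; congr statistic.
    congr sup_abs; apply/funext => t; rewrite /compensated_sum /estimated_sum.
    rewrite -(sum_split_enum J (fun k => intM N (clipped (lamhat (train w)) C)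
      (on_itv 0 t (clipped (Ghat (train w)) C')) (Z k z))).
    by apply: eq_bigr => j jJ; rewrite evaluate_tnth.
  rewrite /jump_variance /variance_estimate; congr (_ * _).
  rewrite -(sum_split_enum J (fun k => intN N (fun x => clipped (Ghat (train w)) C' x ^+ 2) (Z k z))).
  by apply: eq_bigr => j jJ; rewrite evaluate_tnth.
Qed.

Let hG w := clipped (Ghat (train w)) C'.
Let Gc_bound x : `|Gc x| <= C'. Proof. by apply: abs_clip; exact: ltW. Qed.
Let hG_bound w x : `|hG w x| <= C'. Proof. by apply: abs_clip; exact: ltW. Qed.
Let mhG w : measurable_fun setT (hG w).
Proof. exact: (measurableT_comp (@measurable_clip R C') (mhat_G _)). Qed.
Let mLL := measurable_intensity fGF bL.

Let Rb (k : R * Om -> R) (K : R) : measurable_fun setT k -> (forall x, `|k x| <= K) -> Rintegrable M k.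
Proof. exact: (@Rintegrable_bounded _ _ _ M). Qed.

Let mu_G : measurable_fun setT (uncurry01 G).
Proof. have [cG aG _] := rG; have pu := caglad_pred_fun fGF cG aG.
exact: (pred_fun_measurable fGF pu). Qed.

Lemma true_variance : variance_function P N G 1 = (cumulated_variance P L Gc 0 1)%:E.
Proof.
have zero1 : 0 <= (1 : R) <= 1 by rewrite ler01 lexx.
have bI (x : R * Om) : `|on_itv 0 1 (fun x => Gc x ^+ 2) x| <= C' ^+ 2.
  rewrite /on_itv normrM -[leRHS]mulr1 ler_pM// ?normrX ?ler_pXn2r ?nnegrE ?(ltW C'0)//.
  by rewrite indicE; case: (_ \in _); rewrite ?normr1 ?normr0.
have mk : measurable_fun setT (on_itv 0 1 (fun x => Gc x ^+ 2)).
  by apply: measurable_on_itv; exact: measurable_funX.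
have pk : pred_fun GF (on_itv 0 1 (fun x => Gc x ^+ 2)).
  by apply: (pred_on_itv fGF) => //; exact: measurable_funX.
have [ik ek] := mean_intN fGF cN aN bL pk (Rb mk bI).
rewrite /cumulated_variance -ek (RintE ik) /variance_function.
have E w : int_dN (fun s => G s w ^+ 2) (N ^~ w) 1 = intN N (fun p => uncurry01 G p ^+ 2) w.
  rewrite (intNE cN) int_dNE//; apply: eq_bigr => i _.
  by have [a0 a1] := arrival01 cN (ltn_ord i); rewrite uncurry01E ?a1 ?ltW.
have mi k : measurable_fun setT k -> measurable_fun setT (fun w => (intN N k w)%:E).
  by move=> mk'; apply/measurable_EFinP; exact: (measurable_intN fGF cN aN mk').
transitivity (\int[P]_w (intN N (fun p => uncurry01 G p ^+ 2) w)%:E)%E.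
  by apply: eq_integral => w _; rewrite E.
apply: ae_eq_integral => //.
- by apply: mi; exact: measurable_funX.
- exact: mi.
- apply: filterS GC => w hw _; congr EFin; apply: (eq_intN cN) => s /andP[s0 s1].
  rewrite /on_itv/= indicE mem_set ?mulr1//= ?in_itv/= ?s0//.
  by rewrite /clipped uncurry01E ?s1 ?ltW// clip_id// hw// s1 ltW.
Qed.

(** From [|G ^ 2 - h ^ 2| <= 2 C' |G - h|], the bound [C] on the intensity, and Cauchy-Schwarz: the
    variance with the estimated residual stays bounded below when the residual error is small. *)
Lemma variance_lower (delta1 : R) w : (delta1%:E <= variance_function P N G 1)%E ->
  delta1 - 2 * C' * C * Num.sqrt (residual_error w) <= cumulated_variance P L (hG w) 0 1.
Proof.
rewrite true_variance lee_fin => dV; rewrite lerBlDr; apply: (le_trans dV).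
have mD : measurable_fun setT (fun x => Gc x - hG w x) by exact: measurable_funB.
have bD x : `|Gc x - hG w x| <= 2 * C'.
  by rewrite (le_trans (ler_normB _ _))// mulr_natl mulr2n lerD.
have mD2 : measurable_fun setT (fun x => (Gc x - hG w x) ^+ 2) by exact: measurable_funX.
have bD2 x : `|(Gc x - hG w x) ^+ 2| <= (2 * C') ^+ 2.
  by rewrite normrX ler_pXn2r ?nnegrE// mulr_ge0// ltW.
have [iD leD] := @Rint_sqr _ _ _ M _ mD (Rb mD2 bD2).
have bI (u : R) : `|\1_(`]0, 1]%classic) u : R| <= 1.
  by rewrite indicE; case: (_ \in _); rewrite ?normr1 ?normr0.
have sq (k : R * Om -> R) : measurable_fun setT k -> (forall x, `|k x| <= C') ->
    Rintegrable M (fun x => on_itv 0 1 (fun x => k x ^+ 2) x * L x).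
  move=> mk bk; apply: (@Rb _ (C' ^+ 2 * C)).
    by apply: measurable_funM => //; apply: measurable_on_itv; exact: measurable_funX.
  move=> x; rewrite normrM ler_pM//; last by have /andP[h0 h1] := intensity_bounds bL x; rewrite ger0_norm.
  by rewrite /on_itv normrM -[leRHS]mulr1 ler_pM// normrX ler_pXn2r ?nnegrE// ltW.
have i1 := sq _ mGc Gc_bound; have i2 := sq _ (mhG w) (hG_bound w).
have i3 := RintegrableZ (2 * C' * C) (Rintegrable_abs iD).
rewrite -lerBlDl /cumulated_variance -(RintB i1 i2).
apply: le_trans (_ : \int[M]_x (2 * C' * C * `|Gc x - hG w x|) <= _).
  apply: Rint_le => //; first exact: RintegrableB.
  move=> x; rewrite -mulrBl /on_itv -mulrBl subr_sqr.
  apply: (le_trans (ler_norm _)); rewrite !normrM.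
  have /andP[h0 h1] := intensity_bounds bL x; rewrite (ger0_norm h0).
  have hs : `|Gc x + hG w x| <= 2 * C' by rewrite (le_trans (ler_normD _ _))// mulr_natl mulr2n lerD.
  rewrite [leRHS](_ : _ = `|Gc x - hG w x| * (2 * C') * 1 * C); last by ring.
  apply: ler_pM; rewrite ?mulr_ge0//; apply: ler_pM; rewrite ?mulr_ge0//.
  exact: ler_wpM2l.
rewrite (RintZ _ (Rintegrable_abs iD)) ler_pM2l ?mulr_gt0//.
rewrite -[leLHS]ger0_norm ?Rint_ge0// -sqrtr_sqr ler_sqrt//.
by rewrite Rint_ge0// => x; exact: sqr_ge0.
Qed.

(** Replication 0 is independent of the training data, so the error conditional on the training
    sample averages to the error on the additional copy, which is what the rates measure. *)
Lemma training_error_mean (k : R * (n.-tuple Om * Om) -> R) (K : R) :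
  measurable_fun setT k -> (forall z, `|k z| <= K) ->
  Rintegrable Q (fun w => \int[M]_x k (x.1, (train w, x.2))) /\
  \int[Q]_w \int[M]_x k (x.1, (train w, x.2)) = \int[Q]_w \int[U01]_s k (s, (train w, Z 0%N w)).
Proof.
move=> mk bk; pose phi z := \int[U01]_s k (s, z).
have mphi : measurable_fun setT phi by exact: (@measurable_Rint2 _ _ _ _ _ U01 _ mk).
have msec z : measurable_fun setT (fun s => k (s, z)).
  by apply: (measurableT_comp mk); exact: pair2_measurable.
have bphi z : `|phi z| <= K by apply: Rint_abs_le => [|s]; [exact: msec|exact: bk].
have j0 (i : 'I_n) : 0%N = i.+1 -> i \in J by [].
have E w : \int[M]_x k (x.1, (train w, x.2)) = \int[P]_y phi (train w, y).
  have mkw : measurable_fun setT (fun x : R * Om => k (x.1, (train w, x.2))).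
    apply: (measurableT_comp mk); apply: (measurable_fun_pair measurable_fst).
    exact: (measurableT_comp (pair1_measurable (train w)) measurable_snd).
  have ikw : Rintegrable M (fun x => k (x.1, (train w, x.2))) by exact: (Rb mkw).
  by have [_ <-] := Rfubini2 ikw.
have mt : measurable_fun setT (fun z : Sm * Om => phi (train z.1, z.2)).
  apply: (measurableT_comp mphi).
  exact: (measurable_fun_pair (measurableT_comp (measurable_masked mZ (~: J)) measurable_fst) measurable_snd).
rewrite (funext E); split; last by rewrite -(training_mean mZ lawZ iZ j0 mphi bphi).
apply: (@Rintegrable_bounded _ _ _ Q _ K).
  exact: (@measurable_Rint1 _ _ _ _ _ P _ mt).
move=> w; apply: Rint_abs_le => //.
exact: (measurableT_comp mphi (pair1_measurable (train w))).
Qed.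

Let mpair0 : measurable_fun setT (fun x : R * Sm => (x.1, Z 0%N x.2)).
Proof. exact: (measurable_fun_pair measurable_fst (measurableT_comp (mZ 0%N) measurable_snd)). Qed.

Let mtriple : measurable_fun setT (fun x : R * Sm => (x.1, (train x.2, Z 0%N x.2))).
Proof.
apply: (measurable_fun_pair measurable_fst).
exact: (measurableT_comp (measurable_fun_pair (measurable_masked mZ (~: J)) (mZ 0%N)) measurable_snd).
Qed.

Let mtr : measurable_fun setT (fun z : R * (n.-tuple Om * Om) => (z.1, z.2.2)).
Proof. exact: (measurable_fun_pair measurable_fst (measurableT_comp measurable_snd measurable_snd)). Qed.

Let mjG : measurable_fun setT (fun z : R * (n.-tuple Om * Om) => uncurry01 (Ghat z.2.1) (z.1, z.2.2)).
Proof. exact: (measurable_joint_G sG measurable_fst measurable_snd). Qed.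

Let mjl : measurable_fun setT (fun z : R * (n.-tuple Om * Om) => uncurry01 (lamhat z.2.1) (z.1, z.2.2)).
Proof. exact: (measurable_joint_l sl measurable_fst measurable_snd). Qed.

Let uncurry01B (W1 : R -> Om -> R) (W2 : R -> Sm -> Om -> R) :
  uncurry01 (fun s w => W1 s (Z 0%N w) - W2 s w (Z 0%N w)) =
  fun x => uncurry01 W1 (x.1, Z 0%N x.2) - uncurry01 (W2 ^~ x.2) (x.1, Z 0%N x.2).
Proof.
apply/funext => -[s w]/=; have [s01|s01] := boolP (0 <= s <= 1); first by rewrite !uncurry01E.
by rewrite /uncurry01 !patchE !memNset/= ?subr0//; exact/negP.
Qed.

(** Clipping both the residual and its estimate is a contraction, so the conditional errors average
    to no more than the squared norm. *)
Lemma residual_error_mean (a : R) : 0 <= a ->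
  (norm2 Q (fun s w => (G s (Z 0%N w) - Ghat (sample n Z w) s (Z 0%N w))%R) <= a%:E)%E ->
  Rintegrable Q residual_error /\ \int[Q]_w residual_error w <= a ^+ 2.
Proof.
move=> a0 na.
pose k (z : R * (n.-tuple Om * Om)) := (Gc (z.1, z.2.2) - clip C' (uncurry01 (Ghat z.2.1) (z.1, z.2.2))) ^+ 2.
have mk : measurable_fun setT k.
  apply: measurable_funX; apply: measurable_funB; first exact: (measurableT_comp mGc mtr).
  exact: (measurableT_comp (@measurable_clip R C') mjG).
have bk z : `|k z| <= (2 * C') ^+ 2.
  rewrite normrX ler_pXn2r ?nnegrE ?mulr_ge0 ?(ltW C'0)//.
  rewrite (le_trans (ler_normB _ _))// mulr_natl mulr2n lerD//; apply: abs_clip; exact: ltW.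
have [ik ek] := training_error_mean mk bk.
split; first exact: ik.
rewrite [leLHS]ek.
have WE := uncurry01B G (fun s w => Ghat (sample n Z w) s).
have mW : measurable_fun setT (uncurry01 (fun s w => G s (Z 0%N w) - Ghat (sample n Z w) s (Z 0%N w))).
  rewrite WE; apply: measurable_funB; first exact: (measurableT_comp mu_G mpair0).
  have := measurableT_comp mjG mtriple; congr (measurable_fun _ _).
  by apply/funext => x /=; rewrite train_G.
apply: (norm2_bound mW a0 na (c := fun x => k (x.1, (train x.2, Z 0%N x.2))) (k := fun=> 0)).
- apply: (@Rintegrable_bounded _ _ _ (@U01 R \x Q)%E _ ((2 * C') ^+ 2)) => //.
  exact: (measurableT_comp mk mtriple).
- exact: Rintegrable_cst.
- exact: Rint_cst.
- move=> x; rewrite addr0 WE /k/= train_G -[leLHS](real_normK (num_real _)) -[leRHS](real_normK (num_real _)).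
  by rewrite ler_pXn2r ?nnegrE//; apply: clip_lipschitz; exact: ltW.
Qed.

Hypothesis lamL : \forall x \ae M, uncurry01 lam x = L x.
Hypothesis mlam : measurable_fun setT (uncurry01 lam).

Lemma intensity_error_mean (b : R) : 0 <= b ->
  (norm2 Q (fun s w => (lam s (Z 0%N w) - lamhat (sample n Z w) s (Z 0%N w))%R) <= b%:E)%E ->
  Rintegrable Q intensity_estimation_error /\ \int[Q]_w intensity_estimation_error w <= b ^+ 2.
Proof.
move=> b0 nb.
pose k (z : R * (n.-tuple Om * Om)) := (L (z.1, z.2.2) - clip C (uncurry01 (lamhat z.2.1) (z.1, z.2.2))) ^+ 2.
have mk : measurable_fun setT k.
  apply: measurable_funX; apply: measurable_funB; first exact: (measurableT_comp mLL mtr).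
  exact: (measurableT_comp (@measurable_clip R C) mjl).
have LC x : `|L x| <= C by have /andP[h0 h1] := intensity_bounds bL x; rewrite ger0_norm.
have bk z : `|k z| <= (2 * C) ^+ 2.
  rewrite normrX ler_pXn2r ?nnegrE ?mulr_ge0 ?(ltW C0)//.
  rewrite (le_trans (ler_normB _ _))// mulr_natl mulr2n lerD//; apply: abs_clip; exact: ltW.
have [ik ek] := training_error_mean mk bk.
have EE w : intensity_estimation_error w = \int[M]_x k (x.1, (train w, x.2)).
  by apply: eq_Rintegral => -[s y] _.
rewrite (funext EE); split; first exact: ik.
rewrite [leLHS]ek.
have WE := uncurry01B lam (fun s w => lamhat (sample n Z w) s).
have mW : measurable_fun setT (uncurry01 (fun s w => lam s (Z 0%N w) - lamhat (sample n Z w) s (Z 0%N w))).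
  rewrite WE; apply: measurable_funB; first exact: (measurableT_comp mlam mpair0).
  have := measurableT_comp mjl mtriple; congr (measurable_fun _ _).
  by apply/funext => x /=; rewrite train_l.
pose E := [set x | uncurry01 lam x != L x].
have mE : measurable E.
  rewrite (_ : E = (fun x => uncurry01 lam x - L x) @^-1` (~` [set 0])).
    by rewrite -[X in measurable X]setTI; apply: (measurable_funB mlam mLL) => //; exact: measurableC.
  apply/seteqP; split => x /=; first by move=> /eqP h /eqP; rewrite subr_eq0 => /eqP.
  by move=> h; apply/eqP => h1; apply: h; rewrite h1 subrr.
have ME : M E = 0%E.
  by apply: measure_negligible => //; apply: negligibleS lamL => x /= /eqP.
(* On the null set where [lam] and [L] differ the clipped error is still at most [(2 * C) ^+ 2]. *)
pose kk (x : R * Sm) := (2 * C) ^+ 2 * (\1_E (x.1, Z 0%N x.2) : R).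
have iE : Rintegrable M (\1_E : R * Om -> R) by exact: (@Rintegrable_indic _ _ _ M).
have lawM (A : set (R * Om)) : measurable A ->
    (@U01 R \x Q)%E ((fun x => (x.1, Z 0%N x.2)) @^-1` A) = M (id @^-1` A).
  by move=> mA; rewrite (product_law lawZ 0%N).
have mIE : measurable_fun setT (\1_E : R * Om -> R) by exact: measurable_indic.
have iEQ : Rintegrable (@U01 R \x Q)%E (fun x : R * Sm => \1_E (x.1, Z 0%N x.2) : R).
  exact: (Rintegrable_law mpair0 (@measurable_id _ _ _) lawM mIE iE).
apply: (norm2_bound mW b0 nb (c := fun x => k (x.1, (train x.2, Z 0%N x.2))) (k := kk)).
- apply: (@Rintegrable_bounded _ _ _ (@U01 R \x Q)%E _ ((2 * C) ^+ 2)) => //.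
  exact: (measurableT_comp mk mtriple).
- exact: RintegrableZ.
- rewrite (RintZ _ iEQ) (Rint_law mpair0 (@measurable_id _ _ _) lawM mIE).
  have -> : \int[M]_x (\1_E x : R) = 0.
    by transitivity (fine (M E)); [exact: (@Rint_indic _ _ _ M _ mE)|rewrite ME].
  by rewrite mulr0.
- move=> x; have [xE|xE] := boolP ((x.1, Z 0%N x.2) \in E).
    by rewrite /kk indicE xE mulr1 ler_wpDl ?sqr_ge0// (le_trans (ler_norm _)).
  rewrite /kk indicE (negbTE xE) mulr0 addr0 WE /k/= train_l.
  have lE : uncurry01 lam (x.1, Z 0%N x.2) = L (x.1, Z 0%N x.2).
    by apply: contrapT => h; move/negP: xE; apply; rewrite mem_set//; exact/eqP.
  rewrite lE -[leLHS](real_normK (num_real _)) -[leRHS](real_normK (num_real _)).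
  rewrite ler_pXn2r ?nnegrE// -[X in `|X - clip _ _|](clip_id (LC _)).
  by apply: clip_lipschitz; exact: ltW.
Qed.

(** The bound [e] holds for good training points. The bad ones are counted by Markov's inequality,
    for the two squared errors and for the product of their square roots, whose mean is at most
    [a * b] by Cauchy-Schwarz. *)
Lemma single_law_limit (a b delta1 kappa2 : R) (f : R -> R) : 0 <= a -> 0 <= b ->
  0 <= e -> 0 < kappa -> 0 < kappa2 ->
  (norm2 Q (fun s w => (G s (Z 0%N w) - Ghat (sample n Z w) s (Z 0%N w))%R) <= a%:E)%E ->
  (norm2 Q (fun s w => (lam s (Z 0%N w) - lamhat (sample n Z w) s (Z 0%N w))%R) <= b%:E)%E ->
  (delta1%:E <= variance_function P N G 1)%E ->
  v0 <= delta1 - 2 * C' * C * kappa2 -> (m0 <= #|J|)%N -> bounded_lipschitz1 f ->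
  measurable_fun setT (fun z => sup_abs (B ^~ z)) ->
  `|\int[Q]_w f (T_hat N Z J lamhat Ghat w) - \int[PB]_z f (sup_abs (B ^~ z))| <=
  e + 2 * (b ^+ 2 / kappa ^+ 2 + Num.sqrt #|J|%:R * a * b / kappa + a ^+ 2 / kappa2 ^+ 2).
Proof.
move=> a0 b0 e0 k0 k20 na nb dV vd mm bf msup; have [fB fL] := bf.
have mf := lipschitz1_measurable fL.
have [iA leA] := residual_error_mean a0 na; have [iB leB] := intensity_error_mean b0 nb.
pose A := residual_error; pose D := intensity_estimation_error.
have A0 w : 0 <= A w by rewrite Rint_ge0// => x; exact: sqr_ge0.
have D0 w : 0 <= D w by rewrite Rint_ge0// => x; exact: sqr_ge0.
have msq (g : Sm -> R) : measurable_fun setT g -> measurable_fun setT (fun w => Num.sqrt (g w)).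
  by move=> mg; apply: measurableT_comp => //; apply: continuous_measurable_fun; exact: sqrt_continuous.
have sqA : Rintegrable Q (fun w => Num.sqrt (A w) ^+ 2).
  by under [X in Rintegrable _ X]eq_fun do rewrite sqr_sqrtr//.
have sqD : Rintegrable Q (fun w => Num.sqrt (D w) ^+ 2).
  by under [X in Rintegrable _ X]eq_fun do rewrite sqr_sqrtr//.
have [iAD leAD] := Rint_CauchySchwarz (msq _ (RintegrableM iA)) (msq _ (RintegrableM iB)) sqA sqD.
set c := \int[PB]_z _; have [iT ->] := T_hat_mean bf.
have cB : `|c| <= 1.
  by apply: Rint_abs_le => //; exact: (measurableT_comp mf msup).
(* Each of the three terms in the inner sum is at least 1 when the corresponding smallness condition
   on the training point fails. *)
pose dom w := e + 2 * ((kappa ^+ 2)^-1 * D w + Num.sqrt #|J|%:R / kappa * (Num.sqrt (A w) * Num.sqrt (D w)) +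
   (kappa2 ^+ 2)^-1 * A w).
have point w : `|\int[Q]_z f (reduced w z) - c| <= dom w.
  have two : `|\int[Q]_z f (reduced w z) - c| <= 2.
    rewrite (le_trans (ler_normB _ _))// -[leRHS]/(1 + 1) lerD//.
    apply: Rint_abs_le => //.
    exact: (measurableT_comp mf (measurableT_comp measurable_reduced (pair1_measurable w))).
  have t1 : 0 <= (kappa ^+ 2)^-1 * D w by rewrite mulr_ge0 ?invr_ge0 ?sqr_ge0.
  have t2 : 0 <= Num.sqrt #|J|%:R / kappa * (Num.sqrt (A w) * Num.sqrt (D w)).
    by rewrite !mulr_ge0 ?invr_ge0 ?sqrtr_ge0// ltW.
  have t3 : 0 <= (kappa2 ^+ 2)^-1 * A w by rewrite mulr_ge0 ?invr_ge0 ?sqr_ge0.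
  have [u1 u2 u3 _] := le_sum4 t1 t2 t3 (lexx 0); rewrite addr0 in u1 u2 u3.
  have [h1|h1] := leP kappa (Num.sqrt (D w)).
    apply: dominated_two => //; apply: le_trans u1.
    by rewrite ler_pdivlMl ?exprn_gt0// mulr1 -(sqr_sqrtr (D0 w)) ler_pXn2r ?nnegrE ?sqrtr_ge0// ltW.
  have [h2|h2] := leP kappa (Num.sqrt #|J|%:R * Num.sqrt (A w) * Num.sqrt (D w)).
    apply: dominated_two => //; apply: le_trans u2.
    by rewrite mulrAC ler_pdivlMr// mul1r mulrA.
  have [h3|h3] := leP kappa2 (Num.sqrt (A w)).
    apply: dominated_two => //; apply: le_trans u3.
    by rewrite ler_pdivlMl ?exprn_gt0// mulr1 -(sqr_sqrtr (A0 w)) ler_pXn2r ?nnegrE ?sqrtr_ge0// ltW.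
  apply: le_trans (_ : e <= _); last by rewrite lerDl mulr_ge0// (le_trans t1).
  apply: conditional_limit => //; [|exact: ltW|exact: ltW].
  apply: (le_trans vd); apply: le_trans (variance_lower w dV).
  by rewrite lerD2l lerN2 ler_pM2l ?mulr_gt0// ltW.
have i1 := RintegrableZ (kappa ^+ 2)^-1 iB.
have i2 := RintegrableZ (Num.sqrt #|J|%:R / kappa) iAD.
have i3 := RintegrableZ (kappa2 ^+ 2)^-1 iA.
have i12 := RintegrableD i1 i2; have i123 := RintegrableD i12 i3.
have i4 := RintegrableZ 2 i123; have idom := RintegrableD (Rintegrable_cst Q e) i4.
have iTc := RintegrableB iT (Rintegrable_cst Q c).
rewrite -[X in _ - X](Rint_cst Q c) -(RintB iT (Rintegrable_cst Q c)).
apply: (le_trans (Rint_abs iTc)).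
apply: (@le_trans _ _ (\int[Q]_w dom w)).
  by apply: Rint_le => //; exact: Rintegrable_abs.
rewrite [leLHS](RintD (Rintegrable_cst Q e) i4) Rint_cst lerD2l (RintZ 2 i123) ler_pM2l//.
rewrite (RintD i12 i3) (RintD i1 i2) (RintZ _ iB) (RintZ _ iAD) (RintZ _ iA).
apply: lerD; [apply: lerD|].
- by rewrite mulrC ler_wpM2r// invr_ge0 sqr_ge0.
- rewrite [leRHS](_ : _ = Num.sqrt #|J|%:R / kappa * (a * b)); last by rewrite [RHS]mulrAC !mulrA.
  apply: ler_wpM2l; first by rewrite mulr_ge0 ?sqrtr_ge0// invr_ge0 ltW.
  have ab0 : 0 <= a * b by rewrite mulr_ge0.
  rewrite -[leLHS]ger0_norm; last by apply: Rint_ge0 => w; rewrite mulr_ge0 ?sqrtr_ge0.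
  rewrite -sqrtr_sqr -[leRHS]ger0_norm// -sqrtr_sqr ler_sqrt ?sqr_ge0// (le_trans leAD)// exprMn.
  have EA : \int[Q]_w (Num.sqrt (A w) ^+ 2) = \int[Q]_w A w by apply: eq_Rintegral => w _; rewrite sqr_sqrtr.
  have ED : \int[Q]_w (Num.sqrt (D w) ^+ 2) = \int[Q]_w D w by apply: eq_Rintegral => w _; rewrite sqr_sqrtr.
  by rewrite EA ED ler_pM ?Rint_ge0.
- by rewrite mulrC ler_wpM2r// invr_ge0 sqr_ge0.
Qed.

End single_law.

(** * Uniformity and level *)

Section intensity_integrable.
Context (R : realType) d (Om : measurableType d) (P : probability Om R).
Variables (F : R -> set (set Om)) (lam : R -> Om -> R).
Context dS (Sm : measurableType dS) (Q : probability Sm R) (Z : nat -> Sm -> Om).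
Variables (n : nat) (J : {set 'I_n}) (lamhat : n.-tuple Om -> R -> Om -> R) (C b : R).
Hypothesis iidZ : iid_replications P Q Z.
Hypothesis sl : sample_split_estimator F J lamhat.
Hypothesis mlam : measurable_fun setT (uncurry01 lam).
Hypothesis C0 : 0 < C.
Hypothesis b0 : 0 <= b.
Hypothesis lhC : \forall w \ae Q, forall t, 0 <= t <= 1 ->
  `|lamhat (sample n Z w) t (Z 0%N w)| <= C.
Hypothesis nb : (norm2 Q (fun s w =>
  (lam s (Z 0%N w) - lamhat (sample n Z w) s (Z 0%N w))%R) <= b%:E)%E.
Local Notation MQ := (@U01 R \x Q)%E.

(** No bound on [lam] is assumed. On the additional copy it is the sum of [lam] minus its estimate,
    square integrable because the norm is finite, and of the estimate, bounded almost everywhere;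
    the law of replication 0 carries this back to [P]. *)
Lemma intensity_integrable : Rintegrable (@U01 R \x P)%E (uncurry01 lam).
Proof.
have [_ mZ lawZ _] := iidZ.
pose lh (x : R * Sm) := uncurry01 (lamhat (sample n Z x.2)) (x.1, Z 0%N x.2).
pose la (x : R * Sm) := uncurry01 lam (x.1, Z 0%N x.2).
have mpair : measurable_fun setT (fun x : R * Sm => (x.1, Z 0%N x.2)).
  exact: (measurable_fun_pair measurable_fst (measurableT_comp (mZ 0%N) measurable_snd)).
have mlh : measurable_fun setT lh.
  apply: (measurable_estimator sl (x := fun p : R * Sm => sample n Z p.2)
    (s := fun p : R * Sm => p.1) (y := fun p : R * Sm => Z 0%N p.2)).
  - by apply: measurableT_comp; [exact: measurable_sample|exact: measurable_snd].
  - exact: measurable_fst.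
  - exact: (measurableT_comp (mZ 0%N) measurable_snd).
have mla : measurable_fun setT la by exact: (measurableT_comp mlam mpair).
have WE : uncurry01 (fun s w => lam s (Z 0%N w) - lamhat (sample n Z w) s (Z 0%N w)) = fun x => la x - lh x.
  apply/funext => -[s w]; rewrite /la /lh/=; have [s01|s01] := boolP (0 <= s <= 1); first by rewrite !uncurry01E.
  by rewrite /uncurry01 !patchE !memNset/= ?subr0//; exact/negP.
have mW : measurable_fun setT (uncurry01 (fun s w => lam s (Z 0%N w) - lamhat (sample n Z w) s (Z 0%N w))).
  by rewrite WE; exact: measurable_funB.
have [iW _] := norm2_integral mW b0 nb; rewrite WE in iW.
have mo : measurable_fun setT (fun x => outside C (lh x)) by exact: (measurableT_comp (@measurable_outside R C) mlh).
have bo x : `|outside C (lh x)| <= 1 by rewrite ger0_norm ?outside_ge0// outside_le1.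
have io : Rintegrable MQ (fun x => outside C (lh x)) by exact: (@Rintegrable_bounded _ _ _ MQ _ _ mo bo).
have o0 : \int[MQ]_x outside C (lh x) = 0.
  have [i1 <-] := Rfubini2 io; rewrite -[RHS](Rint_cst Q 0); apply: Rint_ae => //.
  - exact: (RintegrableM i1).
  - apply: filterS lhC => w hw; rewrite -[RHS](Rint_cst U01 0); apply: eq_Rintegral => s _.
    apply: outside_in; rewrite /lh/=; have [s01|s01] := boolP (0 <= s <= 1).
      by rewrite uncurry01E// hw.
    by rewrite /uncurry01 patchE memNset/= ?normr0 ?(ltW C0)//; exact/negP.
have oae : \forall x \ae MQ, outside C (lh x) = 0.
  apply: Rint_eq0_ae; [exact: mo|by move=> x; exact: outside_ge0|].
  by rewrite -(RintE io) o0.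
have mc : measurable_fun setT (fun x => clip C (lh x)) by exact: (measurableT_comp (@measurable_clip R C) mlh).
have ic : Rintegrable MQ (fun x => clip C (lh x)).
  by apply: (@Rintegrable_bounded _ _ _ MQ _ C) => // x; apply: abs_clip; exact: ltW.
have ilh : Rintegrable MQ lh.
  apply: (Rintegrable_ae mlh _ ic); apply: filterS oae => x /outside0 h.
  by rewrite clip_id.
have ila : Rintegrable MQ la.
  apply: (Rintegrable_le (g := fun x => (la x - lh x) ^+ 2 + 1 + `|lh x|)) => //.
    move=> x; rewrite -{1}[la x](subrK (lh x)) (le_trans (ler_normD _ _))// lerD2r.
    rewrite -(real_normK (num_real (la x - lh x))).
    have [h|h] := leP `|la x - lh x| 1; first by rewrite (le_trans h)// lerDr sqr_ge0.
    by rewrite ler_wpDr// expr2 ler_peMr// ltW.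
  apply: RintegrableD; last exact: Rintegrable_abs.
  by apply: RintegrableD => //; exact: Rintegrable_cst.
apply: (Rintegrable_law (@measurable_id _ _ _) mpair _ mlam ila) => A mA.
by apply/esym; apply: (product_law lawZ 0%N).
Qed.
End intensity_integrable.

(** Includes the empty set, where the supremum is 0; this is the case of an empty [Theta0]. *)
Lemma sup_le_bounds (R : realType) (A : set R) (e : R) : 0 <= e ->
  (forall x, A x -> 0 <= x <= e) -> 0 <= sup A <= e.
Proof.
move=> e0 Ae; have [->|/set0P[x Ax]] := eqVneq A set0; first by rewrite sup0 lexx.
apply/andP; split; last by apply: ge_sup; [exists x|move=> y /Ae/andP[]].
have /andP[x0 _] := Ae x Ax; apply: (le_trans x0); apply: ub_le_sup => //.
by exists e => y /Ae/andP[].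
Qed.

(** * From convergence in law to the level of the test *)

Section quantile.
Context (R : realType) (dS : measure_display) (OS : measurableType dS) (PS : probability OS R)
  (S : {RV PS >-> R}) (dB : measure_display) (OB : measurableType dB) (PB : probability OB R)
  (B : R -> OB -> R) (alpha : R).
Hypothesis bm : brownian_motion PB B.
Hypothesis lawS : same_law PS PB S (fun w => sup_abs (B ^~ w)).
Hypothesis alpha01 : 0 < alpha < 1.
Local Notation z := (quantile S (1 - alpha)).

Let a0 : 0 < alpha. Proof. by case/andP: alpha01. Qed.
Let mS (A : set R) : measurable A -> measurable (S @^-1` A).
Proof. by move=> mA; rewrite -[X in measurable X]setTI; exact: measurable_funP. Qed.

Let cdfE x : cdf S x = PB [set w | sup_abs (B ^~ w) <= x].
Proof.
rewrite /cdf/= /distribution/= /pushforward (lawS (measurable_itv _)).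
by congr (PB _); apply/seteqP; split => w; rewrite /= in_itv.
Qed.

(** Any [x] above the quantile is above some point where the distribution function is at least
    [1 - alpha]. Tightness of the supremum shows that such points exist, so that the infimum is a
    genuine one. *)
Lemma quantile_tail (x : R) : z < x -> (PS [set w | (x < S w)%R] <= alpha%:E)%E.
Proof.
move=> zx; have ne : [set y | ((1 - alpha)%:E <= cdf S y)%E] !=set0.
  have [M M1 tail] := bm_sup_tight bm ltr01 a0.
  exists (M.-2%:R : R) => /=; rewrite cdfE.
  have msup := bm_sup_measurable bm.
  pose E := [set w | sup_abs (B ^~ w) <= M.-2%:R].
  have mE : measurable E.
    rewrite (_ : E = (fun w => sup_abs (B ^~ w)) @^-1` `]-oo, M.-2%:R]%classic).
      by rewrite -[X in measurable X]setTI; exact: msup.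
    by apply/seteqP; split => w; rewrite /= in_itv.
  have -> : (PB E = (1 - fine (PB (~` E)))%:E)%E.
    have mEC := measurableC mE.
    by rewrite -{1}(setCK E) probability_setC// EFinB fineK ?fin_num_measure.
  rewrite lee_fin lerB// (le_trans _ tail)// -(Rint_indic PB (measurableC mE)).
  rewrite le_eqVlt; apply/orP; left; apply/eqP; apply: eq_Rintegral => w _.
  rewrite mulr1 !indicE; congr (_%:R); congr nat_of_bool.
  by apply/idP/idP => /set_mem/=; rewrite ?in_itv/= ?andbT => h; apply/mem_set; rewrite /= ?in_itv/= ?andbT; [rewrite ltNge; exact/negP|apply/negP; rewrite -ltNge].
have [y /= yz yx] := inf_lt ne zx.
rewrite (_ : [set w | _] = ~` (S @^-1` `]-oo, x]%classic)); last first.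
  apply/seteqP; split => w /=; rewrite in_itv/=; first by move=> h; apply/negP; rewrite -ltNge.
  by move=> /negP; rewrite -ltNge.
rewrite probability_setC; last by apply: mS.
rewrite leeBlDr ?fin_num_measure//; last by apply: mS.
rewrite addeC -leeBlDr//.
have cdfS : cdf S y = PS (S @^-1` `]-oo, y]%classic) by [].
rewrite -EFinB; apply: (le_trans yz); rewrite cdfS; apply: le_measure; rewrite ?inE.
- by apply: mS.
- by apply: mS.
- by move=> w /=; rewrite !in_itv/= => /le_trans; apply; exact: ltW.
Qed.

(** As [S] has no atom at [z], a small window around [z] has small probability; above the window the
    tail is at most [alpha]. *)
Lemma quantile_approx (e : R) : 0 < e -> exists2 delta : R, 0 < delta <= 1 &
  fine (PS [set w | (z - delta < S w)%R]) <= alpha + e.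
Proof.
move=> e0.
have msupS : measurable_fun setT (S : OS -> R) by exact: measurable_funP.
have mI (k : nat) : measurable [set w | z - k.+1%:R^-1 < S w <= z + k.+1%:R^-1].
  rewrite (_ : [set w | _] = S @^-1` `]z - k.+1%:R^-1, z + k.+1%:R^-1]%classic); first exact: mS.
  by apply/seteqP; split => w; rewrite /= in_itv.
have mz : measurable [set w | S w = z].
  by rewrite (_ : [set w | _] = S @^-1` [set z])//; exact: mS.
have Pz : PS [set w | S w = z] = 0%E.
  by rewrite -(bm_sup_no_atom bm z); exact: (lawS (measurable_set1 z)).
pose f k w : R := \1_[set w | z - k.+1%:R^-1 < S w <= z + k.+1%:R^-1] w - \1_[set w | S w = z] w.
have [||w r r0|k hk] := @Rint_bounded_cvg0 R _ _ PS f 1 _ _ _ _ e0.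
- by move=> k; apply: measurable_funB; exact: measurable_indic.
- move=> k w; rewrite /f !indicE; case: (_ \in _); case: (_ \in _); rewrite ?subrr ?subr0 ?sub0r ?normrN ?normr1 ?normr0//.
- have [Sz|Sz] := eqVneq (S w) z.
    exists 0%N => i _; rewrite /f !indicE !mem_set//= ?subrr ?normr0 ?(ltW r0)//.
    by rewrite Sz ltrBlDr ltrDl lerDl invr_gt0 invr_ge0 ltr0n ler0n.
  have d0 : 0 < `|S w - z| by rewrite normr_gt0 subr_eq0.
  exists (Num.truncn `|S w - z|^-1) => i hi; rewrite /f !indicE !memNset ?subrr ?normr0 ?(ltW r0)//=.
    by move/eqP: Sz.
  move=> /andP[h1 h2]; have : `|S w - z| <= i.+1%:R^-1.
    by rewrite ler_distl h2 andbT ltW.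
  rewrite leNgt => /negP; apply; rewrite invf_plt ?posrE ?ltr0n//.
  apply: lt_le_trans (_ : (Num.truncn `|S w - z|^-1).+1%:R <= _); last by rewrite ler_nat.
  by rewrite real_truncnS_gt// num_real.
pose delta : R := k.+1%:R^-1; have d0 : 0 < delta by rewrite invr_gt0 ltr0n.
exists delta; first by rewrite d0 invf_le1 ?ltr0n// ler1n.
have := hk k (leqnn k); rewrite (RintB (Rintegrable_indic PS (mI k)) (Rintegrable_indic PS mz)).
rewrite !Rint_indic// Pz subr0 => hP.
have mt x : measurable [set w | x < S w].
  rewrite (_ : [set w | _] = S @^-1` `]x, +oo[%classic); first exact: mS.
  by apply/seteqP; split => w; rewrite /= in_itv/= andbT.
have zd : z < z + delta by rewrite ltrDl.
have tail := quantile_tail zd.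
rewrite -lee_fin fineK ?fin_num_measure//.
apply: (@le_trans _ _ (PS ([set w | (z + delta < S w)%R] `|` [set w | z - delta < S w <= z + delta]))).
  apply: le_measure; rewrite ?inE//; first by apply: measurableU => //; exact: mI.
  by move=> w /= h; have [h1|h1] := ltP (z + delta) (S w); [left|right; apply/andP].
apply: (le_trans (measureU2 _ _ _)) => //; first exact: mI.
rewrite EFinD; apply: leeD => //.
rewrite -[leLHS]fineK ?fin_num_measure//; last exact: mI.
by rewrite lee_fin; exact: le_trans (ler_norm _) hP.
Qed.

(** The test function equals [delta] above [z] and 0 below [z - delta], with slope at most 1 in
    between; being of height [delta <= 1] it is an admissible test function, and dividing by [delta]
    turns the error [delta * e] into [e]. *)
Lemma level_from_limit dT (T : measurableType dT) (Q : probability T R) (U : T -> R) (e delta : R) :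
  measurable_fun setT U -> 0 < delta <= 1 -> 0 < e ->
  fine (PS [set w | (z - delta < S w)%R]) <= alpha + e ->
  (forall f : R -> R, bounded_lipschitz1 f ->
    `|\int[Q]_w f (U w) - \int[PS]_w f (S w)| <= delta * e) ->
  (Q [set w | lct z (U w) = 1%N] <= (alpha + e + e)%:E)%E.
Proof.
move=> mU /andP[d0 d1] e0 hS hf.
have msupS : measurable_fun setT (S : OS -> R) by exact: measurable_funP.
pose f x := Num.min delta (ramp (z - delta) x).
have [rB rL] := @ramp_bounded_lipschitz R (z - delta).
have f0 x : 0 <= f x by rewrite /f le_min (ltW d0) ramp_ge0.
have fbl : bounded_lipschitz1 f.
  split=> [x|x y]; first by rewrite ger0_norm ?f0// /f ge_min d1.
  have := ler_norm (x - y); have := ler_norm (y - x); rewrite (distrC y x).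
  have := rL x y; rewrite /f; move: (ramp _ x) (ramp _ y) `|x - y| => p q r.
  rewrite !ler_norml => /andP[h1 h2] h3 h4.
  by case: (leP delta p) => ?; case: (leP delta q) => ?; apply/andP; split; lra.
have mf := lipschitz1_measurable fbl.2.
have EU : [set w | lct z (U w) = 1%N] = [set w | z < U w].
  by apply/seteqP; split => w; rewrite /= /lct; case: ifP.
have mE : measurable [set w | z < U w].
  rewrite (_ : [set w | _] = U @^-1` `]z, +oo[%classic).
    by rewrite -[X in measurable X]setTI; exact: mU.
  by apply/seteqP; split => w; rewrite /= in_itv/= andbT.
have mt : measurable [set w | z - delta < S w].
  rewrite (_ : [set w | _] = S @^-1` `]z - delta, +oo[%classic); first exact: mS.
  by apply/seteqP; split => w; rewrite /= in_itv/= andbT.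
have ifU : Rintegrable Q (fun w => f (U w)).
  by apply: (@Rintegrable_bounded _ _ _ Q _ 1); [exact: (measurableT_comp mf mU)|move=> w; exact: fbl.1].
have ifS : Rintegrable PS (fun w => f (S w)).
  by apply: (@Rintegrable_bounded _ _ _ PS _ 1); [exact: (measurableT_comp mf msupS)|move=> w; exact: fbl.1].
rewrite EU -[leLHS]fineK ?fin_num_measure// lee_fin -(ler_pM2l d0).
have iE := Rintegrable_indic Q mE; have it := Rintegrable_indic PS mt.
have l1 : delta * fine (Q [set w | z < U w]) <= \int[Q]_w f (U w).
  rewrite -(Rint_indic Q mE) -(RintZ _ iE); apply: Rint_le => //; first exact: RintegrableZ.
  move=> w; rewrite indicE; have [Uw|Uw] := ltP z (U w).
    rewrite mem_set//= mulr1 /f le_min lexx/= /ramp le_min d1 le_max.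
    by apply/orP; right; rewrite opprB addrCA lerDl subr_ge0 ltW.
  by rewrite memNset ?mulr0//=; apply/negP; rewrite -leNgt.
have l2 : \int[PS]_w f (S w) <= delta * fine (PS [set w | (z - delta < S w)%R]).
  rewrite -(Rint_indic PS mt) -(RintZ _ it); apply: Rint_le => //; first exact: RintegrableZ.
  move=> w; rewrite indicE; have [Sw|Sw] := ltP (z - delta) (S w).
    by rewrite mem_set//= mulr1 /f ge_min lexx.
  rewrite memNset ?mulr0//=; last by apply/negP; rewrite -leNgt.
  by rewrite /f /ramp !ge_min ge_max lexx subr_le0 Sw !orbT.
have l3 : delta * fine (PS [set w | (z - delta < S w)%R]) <= delta * (alpha + e) by rewrite ler_pM2l.
have := hf f fbl; rewrite ler_norml => /andP[_ l4].
rewrite mulrDr (le_trans l1)// -lerBlDr (le_trans _ l3)// (le_trans _ l2)//.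
by rewrite lerBlDl -lerBlDr.
Qed.
End quantile.

Lemma real_between (R : realType) (x : \bar R) (eta : R) : (0 <= x)%E -> (x <= eta%:E)%E ->
  exists r : R, [/\ x = r%:E, 0 <= r & r <= eta].
Proof. by case: x => [r| |]//=; rewrite !lee_fin => *; exists r. Qed.

Lemma rate_total (R : realType) (a b s eta kappa kappa2 e : R) : 0 <= a -> 0 <= b ->
  0 < kappa -> 0 < kappa2 -> a <= eta -> b <= eta -> eta <= 1 -> s * a * b <= eta ->
  2 * (eta * ((kappa ^+ 2)^-1 + kappa^-1 + (kappa2 ^+ 2)^-1)) <= e ->
  2 * (b ^+ 2 / kappa ^+ 2 + s * a * b / kappa + a ^+ 2 / kappa2 ^+ 2) <= e.
Proof.
move=> a0 b0 k0 k20 ae be eta1 abe; apply: le_trans; rewrite ler_pM2l// !mulrDr.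
have sq (x : R) : 0 <= x -> x <= eta -> x ^+ 2 <= eta.
  by move=> x0 xe; rewrite expr2 (le_trans _ xe)// ler_piMr// (le_trans xe).
by rewrite !lerD// ler_pM2r ?invr_gt0 ?exprn_gt0// sq.
Qed.

Lemma uniform_limit (R : realType) (Theta : Type)
  (d : measure_display) (Om : Theta -> measurableType d)
  (P : forall th, probability (Om th) R)
  (F : forall th, R -> set (set (Om th)))
  (N : forall th, R -> Om th -> nat)
  (X lam blam G : forall th, R -> Om th -> R)
  (d' : measure_display) (Sm : Theta -> measurableType d')
  (Q : forall th, probability (Sm th) R)
  (Z : forall th, nat -> Sm th -> Om th)
  (J : forall n, {set 'I_n})
  (lamhat Ghat : forall th n, n.-tuple (Om th) -> R -> Om th -> R)
  (dB : measure_display) (OB : measurableType dB) (PB : probability OB R)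
  (B : R -> OB -> R) (C C' delta1 : R) :
  let GF th := enlarged_filtration (P th) (F th) (X th) in
  let T th n w := T_hat (N th) (Z th) (J n) (lamhat th n) (Ghat th n) w in
  let g th n := norm2 (Q th) (fun s w =>
    G th s (Z th 0%N w) - Ghat th n (sample n (Z th) w) s (Z th 0%N w)) in
  let h th n := norm2 (Q th) (fun s w =>
    lam th s (Z th 0%N w) - lamhat th n (sample n (Z th) w) s (Z th 0%N w)) in
  (forall th, usual_filtration (P th) (F th)) ->
  (forall th, counting_process (F th) (N th)) ->
  (forall th t, 0 <= t <= 1 -> measurable_fun setT (X th t)) ->
  (forall th, is_intensity (P th) (F th) (N th) (lam th)) ->
  (forall th, is_intensity (P th) (GF th) (N th) (blam th)) ->
  (forall th, residual_process (P th) (F th) (X th) (G th)) ->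
  (forall th, iid_replications (P th) (Q th) (Z th)) ->
  (forall th n, sample_split_estimator (F th) (J n) (lamhat th n)) ->
  (forall th n, sample_split_estimator (GF th) (J n) (Ghat th n)) ->
  brownian_motion PB B -> 0 < C -> 0 < C' ->
  (forall th, \forall w \ae P th, forall t, 0 <= t <= 1 -> blam th t w <= C) ->
  (forall th, \forall w \ae P th, forall t, 0 <= t <= 1 -> `|G th t w| <= C') ->
  (forall th n, \forall w \ae Q th, forall t, 0 <= t <= 1 ->
     `|lamhat th n (sample n (Z th) w) t (Z th 0%N w)| <= C) ->
  (forall th n, \forall w \ae Q th, forall t, 0 <= t <= 1 ->
     `|Ghat th n (sample n (Z th) w) t (Z th 0%N w)| <= C') ->
  #|J n| @[n --> \oo] --> \oo ->
  (fun n => ereal_sup [set maxe (maxe (g th n) (h th n))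
                            ((Num.sqrt #|J n|%:R)%:E * g th n * h th n)%E
                      | th in [set: Theta]]) @ \oo --> 0%E ->
  0 < delta1 ->
  (forall th, (delta1%:E <= variance_function (P th) (N th) (G th) 1)%E) ->
  forall e, 0 < e -> exists n0, forall n, (n0 <= n)%N -> forall th,
    local_martingale (P th) (GF th) (compensated (N th) (lam th)) ->
    measurable_fun setT (T th n) /\
    forall f : R -> R, bounded_lipschitz1 f ->
    `|\int[Q th]_w f (T th n w) - \int[PB]_z f (sup_abs (B ^~ z))| <= e.
Proof.
move=> GF T g h uF cNF mX ilam iblam rG iidZ sl sG bm C0 C'0 blamC GC lhC GhC Jn rates delta10 dV e e0.
(* [kappa2] is the residual error allowed by the variance: it makes the loss [2 * C' * C * kappa2]
   equal to half of [delta1], the other half being [v0]. *)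
have CC : 0 < 2 * C' * C by rewrite !mulr_gt0.
pose v0 := delta1 / 2; pose kappa2 := delta1 / 2 / (2 * C' * C).
have v00 : 0 < v0 by rewrite divr_gt0.
have k20 : 0 < kappa2 by rewrite !divr_gt0.
have e20 : 0 < e / 2 by rewrite divr_gt0.
have [kappa k0 [m0 FX]] := fixed_estimator_limit bm C0 C'0 v00 e20.
pose K := (kappa ^+ 2)^-1 + kappa^-1 + (kappa2 ^+ 2)^-1.
have K0 : 0 < K by rewrite !addr_gt0 ?invr_gt0 ?exprn_gt0.
(* The common bound on the three rates; the Markov terms sum to at most [2 * (eta * K)], which is at
   most [e / 2]. *)
pose eta := Num.min 1 (e / (4 * K)).
have eta0 : 0 < eta by rewrite lt_min ltr01 divr_gt0 ?mulr_gt0.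
have eta1 : eta <= 1 by rewrite ge_min lexx.
have etaK : 2 * (eta * K) <= e / 2.
  have : eta <= e / (4 * K) by rewrite ge_min lexx orbT.
  rewrite ler_pdivlMr ?mulr_gt0// ler_pdivlMr// => le.
  by apply: le_trans le; rewrite le_eqVlt; apply/orP; left; apply/eqP; ring.
have [n1 _ hn1] := rates _ (@nbhs_open_ereal_lt R 0 (fun=> eta) eta0).
have /cvgnyPge/(_ m0)[n2 _ hn2] := Jn.
exists (maxn n1 n2) => n; rewrite geq_max => /andP[nn1 nn2] th lm.
have sup_lt := hn1 n nn1.
have : (maxe (maxe (g th n) (h th n)) ((Num.sqrt #|J n|%:R)%:E * g th n * h th n)%E <= eta%:E)%E.
  by apply: le_trans (ltW sup_lt); apply: ereal_sup_ubound; exists th.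
rewrite !ge_max => /andP[/andP[gn hn] ghn].
have g0 : (0 <= g th n)%E by exact: sqrte_ge0.
have h0 : (0 <= h th n)%E by exact: sqrte_ge0.
have [a [gf a0 ae]] := real_between g0 gn; have [b [hf b0 be]] := real_between h0 hn.
have abe : Num.sqrt #|J n|%:R * a * b <= eta by move: ghn; rewrite gf hf -!EFinM lee_fin.
have fF := usual_filtration_filtration (uF th).
have fGF := enlarged_filtration_filtration (uF th) (mX th).
have [aN cN] := cNF th; have mN := adapted_measurable fF aN.
have [plam il _] := ilam th; have [pbl ibl mbl] := iblam th.
have mlam : measurable_fun setT (uncurry01 (lam th)) by exact: (pred_fun_measurable fF (predictable_pred_fun fF plam)).
have nb : (norm2 (Q th) (fun s w =>
  (lam th s (Z th 0%N w) - lamhat th n (sample n (Z th) w) s (Z th 0%N w))%R) <= b%:E)%E.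
  rewrite -hf; exact: lexx.
have na : (norm2 (Q th) (fun s w =>
  (G th s (Z th 0%N w) - Ghat th n (sample n (Z th) w) s (Z th 0%N w))%R) <= a%:E)%E.
  rewrite -gf; exact: lexx.
have lamM := intensity_integrable (iidZ th) (sl th n) mlam C0 b0 (lhC th n) nb.
have plamG : predictable (GF th) (lam th).
  by apply: predictable_sub plam => t t01; exact: (sub_enlarged (uF th)).
(* The place where the null hypothesis [lm] enters: [lam] compensates [N] in the large filtration
   too, so its clipped version [L] is an intensity there. *)
have [L [bL LE lamL]] := bounded_intensityP fGF cN mN C0 pbl ibl mbl (blamC th) plamG il lm lamM.
(* Yet [L] is a function of [lam], hence predictable for the small filtration; this makes the
   residual orthogonal to the intensity error. *)
have pL : pred_fun (F th) L.
  rewrite (_ : L = fun x => Num.max 0 (Num.min C (uncurry01 (lam th) x))); last exact/funext.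
  apply: measurable_maxr; first exact: measurable_cst.
  by apply: measurable_minr; [exact: measurable_cst|exact: (predictable_pred_fun fF plam)].
split; first exact: (measurable_T_hat (uF th) (cNF th) (iidZ th) (sl th n) (sG th n) C0 C'0 (lhC th n) (GhC th n)).
move=> f bf.
have vd : v0 <= delta1 - 2 * C' * C * kappa2.
  rewrite /kappa2 [X in _ - X]mulrC divfK ?gt_eqF// /v0 lerBrDr -splitr; exact: lexx.
have := single_law_limit (uF th) (cNF th) (mX th) (rG th) (iidZ th) (sl th n) (sG th n) C0 C'0
  (GC th) (lhC th n) (GhC th n) bL pL FX lamL mlam a0 b0 (ltW e20) k0 k20 na nb (dV th) vd (hn2 n nn2) bf (bm_sup_measurable bm).
move=> /le_trans; apply.
rewrite [leRHS](_ : e = e / 2 + e / 2); last by field.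
rewrite lerD2l; exact: (rate_total a0 b0 k0 k20 ae be eta1 abe etaK).
Qed.

Theorem theorem5p1 (R : realType) (Theta : Type)
  (* the filtered probability space, processes and intensities, for each th *)
  (d : measure_display) (Om : Theta -> measurableType d)
  (P : forall th, probability (Om th) R)
  (F : forall th, R -> set (set (Om th)))
  (N : forall th, R -> Om th -> nat)
  (X lam blam G : forall th, R -> Om th -> R)
  (* the replications *)
  (d' : measure_display) (Sm : Theta -> measurableType d')
  (Q : forall th, probability (Sm th) R)
  (Z : forall th, nat -> Sm th -> Om th)
  (* the sample split and the estimators *)
  (J : forall n, {set 'I_n})
  (lamhat Ghat : forall th n, n.-tuple (Om th) -> R -> Om th -> R)
  (* a Brownian motion, and S distributed as the supremum of its modulus *)
  (dB : measure_display) (OB : measurableType dB) (PB : probability OB R)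
  (B : R -> OB -> R)
  (dS : measure_display) (OS : measurableType dS) (PS : probability OS R)
  (S : {RV PS >-> R})
  (C C' delta1 : R) :
  let GF th := enlarged_filtration (P th) (F th) (X th) in
  let Theta0 :=
    [set th | local_martingale (P th) (GF th) (compensated (N th) (lam th))] in
  let T th n w := T_hat (N th) (Z th) (J n) (lamhat th n) (Ghat th n) w in
  let g th n := norm2 (Q th) (fun s w =>
    G th s (Z th 0%N w) - Ghat th n (sample n (Z th) w) s (Z th 0%N w)) in
  let h th n := norm2 (Q th) (fun s w =>
    lam th s (Z th 0%N w) - lamhat th n (sample n (Z th) w) s (Z th 0%N w)) in
  (* setting *)
  (forall th, usual_filtration (P th) (F th)) ->
  (forall th, counting_process (F th) (N th)) ->
  (forall th, caglad (X th)) ->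
  (forall th t, 0 <= t <= 1 -> measurable_fun setT (X th t)) ->
  (forall th, is_intensity (P th) (F th) (N th) (lam th)) ->
  (forall th, is_intensity (P th) (GF th) (N th) (blam th)) ->
  (forall th, residual_process (P th) (F th) (X th) (G th)) ->
  (forall th, iid_replications (P th) (Q th) (Z th)) ->
  (forall th n, sample_split_estimator (F th) (J n) (lamhat th n)) ->
  (forall th n, sample_split_estimator (GF th) (J n) (Ghat th n)) ->
  brownian_motion PB B ->
  same_law PS PB S (fun w => sup_abs (B ^~ w)) ->
  (* boundedness *)
  0 < C -> 0 < C' ->
  (forall th, caglad (blam th)) ->
  (forall th, \forall w \ae P th, forall t, 0 <= t <= 1 -> blam th t w <= C) ->
  (forall th, \forall w \ae P th, forall t, 0 <= t <= 1 -> `|G th t w| <= C') ->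
  (forall th n, \forall w \ae Q th, forall t, 0 <= t <= 1 ->
     `|lamhat th n (sample n (Z th) w) t (Z th 0%N w)| <= C) ->
  (forall th n, \forall w \ae Q th, forall t, 0 <= t <= 1 ->
     `|Ghat th n (sample n (Z th) w) t (Z th 0%N w)| <= C') ->
  (* rates *)
  #|J n| @[n --> \oo] --> \oo ->
  (fun n => ereal_sup [set maxe (maxe (g th n) (h th n))
                            ((Num.sqrt #|J n|%:R)%:E * g th n * h th n)%E
                      | th in [set: Theta]]) @ \oo --> 0%E ->
  (* variance *)
  0 < delta1 ->
  (forall th, (delta1%:E <= variance_function (P th) (N th) (G th) 1)%E) ->
  cvg_dist_unif Theta0 Q T PS S /\
  forall alpha, 0 < alpha < 1 ->
    (limn_esup (fun n => ereal_sup
       [set Q th [set w | lct (quantile S (1 - alpha)) (T th n w) = 1%N]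
       | th in Theta0]) <= alpha%:E)%E.
Proof.
move=> GF Theta0 T g h uF cNF _ mX ilam iblam rG iidZ sl sG bm lawS C0 C'0 _ blamC GC lhC GhC Jn rates d0 dV.
(* The uniform limit with [S] in place of the Brownian supremum. The threshold [n0] precedes [th]
   and [f], which gives both suprema at once. *)
have US e : 0 < e -> exists n0, forall n, (n0 <= n)%N -> forall th, Theta0 th ->
    measurable_fun setT (T th n) /\
    forall f : R -> R, bounded_lipschitz1 f ->
    `|\int[Q th]_w f (T th n w) - \int[PS]_w f (S w)| <= e.
  move=> e0; have [n0 hn0] := uniform_limit uF cNF mX ilam iblam rG iidZ sl sG bm C0 C'0
    blamC GC lhC GhC Jn rates d0 dV e0.
  exists n0 => n nn th lm; have [mT hT] := hn0 n nn th lm; split => // f bf.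
  have -> : \int[PS]_w f (S w) = \int[PB]_z f (sup_abs (B ^~ z)).
    apply: (Rint_law (u1 := S) (u2 := fun z => sup_abs (B ^~ z))).
    - exact: measurable_funP.
    - exact: bm_sup_measurable bm.
    - exact: lawS.
    - exact: lipschitz1_measurable bf.2.
  exact: hT.
split.
  apply/cvgrPdist_le => e e0; have [n0 hn0] := US e e0; exists n0 => // n nn.
  rewrite sub0r normrN; set s := sup _.
  suff /andP[s0 se] : 0 <= s <= e by rewrite ger0_norm.
  apply: sup_le_bounds (ltW e0) _ => _ [th lm <-].
  apply: sup_le_bounds (ltW e0) _ => _ [f bf <-].
  by rewrite normr_ge0 (hn0 n nn th lm).2.
move=> alpha alpha01; apply/lee_addgt0Pr => e e0.
have e20 : 0 < e / 2 by rewrite divr_gt0.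
have [delta d01 hS] := quantile_approx bm lawS alpha01 e20.
have de : 0 < delta * (e / 2) by case/andP: d01 => d1 _; rewrite mulr_gt0.
have [n0 hn0] := US _ de.
(* The upper limit is an infimum over tails, bounded here by the tail starting at [n0]. *)
rewrite /limn_esup limf_esupE; apply: le_trans.
  by apply: ereal_inf_lbound; exists [set n | (n0 <= n)%N]; [exists n0|reflexivity].
apply: ub_ereal_sup => _ [n nn <-]; apply: ub_ereal_sup => _ [th lm <-].
have [mT hT] := hn0 n nn th lm.
have := level_from_limit mT d01 e20 hS hT.
by rewrite -addrA -splitr EFinD.
Qed.
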